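(* Let $(M,g)$ be an $n$-dimensional model manifold with scaling function $\sigma$, let $\rho:M\to(0,\infty)$ and $V:M\to[0,\infty)$ be smooth and radially symmetric, and let $\mu=\mathrm{vol}_g$. The following assertions are equivalent. (i) The Dirichlet form $Q_{\rho,V}$ on $L^2(M,\rho\,\mathrm{vol}_g)$ is conservative in the generalized sense. (ii) There exists $a>0$ such that $$\int_a^\infty\frac{v_{\rho+V}(r)}{s(r)}\,dr=\int_a^\infty\frac{v_\rho(r)}{s(r)}\,dr+\int_a^\infty\frac{\int_0^rs(\xi)V(\xi)\,d\xi}{s(r)}\,dr=\infty.$$
   Context: Model manifolds: Let $E=((0,\infty)\times\mathbb{S}^{n-1})\cup\{0\}$ carry the topology making the map $\mathbb{R}^n\to E$, $x\mapsto(|x|,|x|^{-1}x)$ for $x\ne0$, $0\mapsto0$, a homeomorphism. A (smooth, connected) Riemannian manifold $(M,g)$ is called an $n$-dimensional model manifold (of infinite radius) if $M=E$ and for each $(r,\theta)\in(0,\infty)\times\mathbb{S}^{n-1}$, on $T_{(r,\theta)}M=T_r(0,\infty)\oplus T_\theta\mathbb{S}^{n-1}$, the metric is $g=(dr)^2+\sigma(r)^2(d\theta)^2$, where $\sigma:(0,\infty)\to(0,\infty)$ is smooth (the scaling function) and $(dr)^2,(d\theta)^2$ are the standard metrics on $(0,\infty)$ and $\mathbb{S}^{n-1}$. Let $d$ be the geodesic distance. A function $f:M\to\mathbb{R}$ is radially symmetric if $f(x)=f(y)$ whenever $d(x,0)=d(y,0)$; one then writes $f(r)$ for the common value at points with $d(x,0)=r$.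 For radially symmetric $\rho$ put $v_\rho(r)=\int_{B_r(0)}\rho\,d\mathrm{vol}_g$, where $B_r(0)$ is the $d$-ball of radius $r$ around $0$ (similarly $v_{\rho+V}$), and $s(r)=\omega_n\sigma^{n-1}(r)$, where $\omega_n$ is the surface area of $\mathbb{S}^{n-1}$. Forms (here with $\mu=\mathrm{vol}_g$): For a smooth $w:M\to(0,\infty)$ let $W^1(M,w)=\{f\in L^2(M,w\mu): |\nabla f|\in L^2(M,\mu)\}$ (distributional gradient) with norm $\|f\|_{W^1}=(\int_M|\nabla f|^2d\mu+\int_M f^2 w\,d\mu)^{1/2}$, and let $W^1_0(M,w)$ be the closure of $C_c^\infty(M)$ in it. The quadratic form $Q_{\rho,V}$ with domain $W_0^1(M,\rho+V)$, $Q_{\rho,V}(f,h)=\int_M\langle\nabla f,\nabla h\rangle d\mu+\int_M fhV\,d\mu$, is a Dirichlet form on $L^2(M,\rho\mu)$. Let $L_{\rho,V}$ be the associated nonpositive self-adjoint operator on $L^2(M,\rho\mu)$ and $T^{\rho,V}_t=e^{tL_{\rho,V}}$, $t>0$, the associated positivity preserving Markovian semigroup. $L^+(M)$ denotes the cone of $[0,\infty]$-valued, $\mu$-a.e. defined measurable functions. Any positivity preserving linear operator $T$ on $L^2(M,\rho\mu)$ is extended to $L^+(M)$ by $Tf=\lim_{n\to\infty}Tf_n$, where $(f_n)$ is any increasing sequence of nonnegative functions in $L^2(M,\rho\mu)$ with $f_n\to f$ $\mu$-a.e. (this is well defined). $Q_{\rho,V}$ is called conservative in the generalized sense if $$T_t^{\rho,V}1+\int_0^tT_s^{\rho,V}(V/\rho)\,ds=1\quad\text{for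 all }t>0,$$ where the integral denotes the $L^+(M)$-extension of the positivity preserving operator $f\mapsto\int_0^tT_s^{\rho,V}f\,ds$ on $L^2(M,\rho\mu)$, applied to $V/\rho$. *)

(* Defs.v *)
From HB Require Import structures.
From mathcomp Require Import all_boot all_order all_algebra.
From mathcomp Require Import all_classical all_reals all_analysis.

Set Implicit Arguments.
Unset Strict Implicit.
Unset Printing Implicit Defensive.

Import Order.TTheory GRing.Theory Num.Theory.
Import numFieldNormedType.Exports.

Local Open Scope classical_set_scope.
Local Open Scope ring_scope.

(** * Borel sigma-algebra and Lebesgue measure on R^n *)

Definition rV_display : measure_display.
Proof. exact. Qed.

Section measurable_rV.
Context (R : realType) (n : nat).

Let coord (i : 'I_n) (x : 'rV[R]_n) : measurableTypeR R := x 0 i.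

Let rV_set0 : g_sigma_preimage coord set0.
Proof. exact: sigma_algebra0. Qed.

Let rV_setC A : g_sigma_preimage coord A -> g_sigma_preimage coord (~` A).
Proof. exact: sigma_algebraC. Qed.

Let rV_bigcup (F : (set 'rV[R]_n)^nat) :
  (forall i, g_sigma_preimage coord (F i)) ->
  g_sigma_preimage coord (\bigcup_i (F i)).
Proof. exact: sigma_algebra_bigcup. Qed.

HB.instance Definition _ := @isMeasurable.Build rV_display 'rV[R]_n
  (g_sigma_preimage coord) rV_set0 rV_setC rV_bigcup.

End measurable_rV.

Fixpoint lebesgue_rV (R : realType) (n : nat) : set 'rV[R]_n -> \bar R :=
  match n with
  | 0%N => \d_(0 : 'rV[R]_0)
  | n'.+1 => pushforward (lebesgue_measure \x @lebesgue_rV R n')%E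
      (fun p : measurableTypeR R * 'rV[R]_n' =>
         row_mx (p.1 : R)%:M p.2 : 'rV[R]_(1 + n'))
  end.

(** * Smooth functions *)

Section smooth.
Context (R : realType) (n : nat).
Implicit Types (f : 'rV[R]_n -> R) (Y : 'rV[R]_n -> 'rV[R]_n).

Definition partial (i : 'I_n) f : 'rV[R]_n -> R :=
  fun x => 'D_(delta_mx 0 i) f x.

Definition smooth f := forall s : seq 'I_n,
  let h := foldr partial f s in
  continuous h /\ forall (i : 'I_n) x, derivable h x (delta_mx 0 i).

Definition compactly_supported (W : zmodType) (f : 'rV[R]_n -> W) :=
  compact (closure [set x | f x != 0]).

Definition test_function f := smooth f /\ compactly_supported f.

Definition test_field Y :=
  (forall i : 'I_n, smooth (fun x => Y x 0 i)) /\ compactly_supported Y.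

End smooth.

Definition smooth_pos (R : realType) (sigma : R -> R) :=
  forall (k : nat) (r : R), 0 < r -> derivable (derive1n k sigma) r 1.

(** * Euclidean space and polar coordinates *)

Section euclidean.
Context (R : realType) (n : nat).
Implicit Types u v x : 'rV[R]_n.

Definition dot u v : R := (u *m v^T) 0 0.

(* The norm that the library puts on 'rV[R]_n is the sup norm. *)
Definition enorm x : R := Num.sqrt (dot x x).

Definition angle x : 'rV[R]_n := (enorm x)^-1 *: x.

Definition sphere : set 'rV[R]_n := [set x | enorm x = 1].

(* The surface measure of A is n times the volume of the cone over A. *)
Definition sphere_measure (A : set 'rV[R]_n) : R :=
  n%:R * fine (lebesgue_rV
    [set x | exists t theta, [/\ 0 < t <= 1, A theta & x = t *: theta]]).

Definition sphere_area : R := sphere_measure sphere.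

End euclidean.
Arguments sphere_area : clear implicits.

(** * Riemannian metrics on R^n *)

Section riemannian.
Context (R : realType) (n : nat).
Variable g : 'rV[R]_n -> 'M[R]_n.
Implicit Types (x y u v : 'rV[R]_n) (f : 'rV[R]_n -> R).

Definition inner x u v : R := (u *m g x *m v^T) 0 0.

Record riemannian_metric : Prop := RiemannianMetric {
  metric_smooth : forall i j : 'I_n, smooth (fun x => g x i j) ;
  metric_sym : forall x, (g x)^T = g x ;
  metric_pos : forall x v, v != 0 -> 0 < inner x v v }.

Definition vol_density x : R := Num.sqrt (\det (g x)).

Definition vol : set 'rV[R]_n -> \bar R :=
  fun A => (\int[@lebesgue_rV R n]_(x in A) (vol_density x)%:E)%E.

Definition C1_curve (c : R -> 'rV[R]_n) :=
  (forall t, derivable c t 1) /\ continuous (derive1 c).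

Definition length (c : R -> 'rV[R]_n) : \bar R :=
  (\int[lebesgue_measure]_(t in `[0%R, 1%R])
     (Num.sqrt (inner (c t) (derive1 c t) (derive1 c t)))%:E)%E.

(* A piecewise C^1 curve is a sequence of C^1 curves on [0, 1], each one
   starting where the previous one ends. *)
Fixpoint joins x y (s : seq (R -> 'rV[R]_n)) : Prop :=
  match s with
  | [::] => x = y
  | c :: s' => [/\ C1_curve c, c 0 = x & joins (c 1) y s']
  end.

Definition dist x y : \bar R :=
  ereal_inf [set (\sum_(c <- s) length c)%E | s in joins x y].

Definition geo_ball x (r : R) : set 'rV[R]_n :=
  [set y | (dist x y < r%:E)%E].

Definition radially_symmetric f :=
  forall x y, dist x 0 = dist y 0 -> f x = f y.

Definition radial_value f (r : R) : R :=
  xget 0 [set c | exists2 x, dist x 0 = r%:E & f x = c].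

Definition ball_integral f (r : R) : \bar R :=
  (\int[vol]_(x in geo_ball 0 r) (f x)%:E)%E.

Definition divergence (Y : 'rV[R]_n -> 'rV[R]_n) x : R :=
  (vol_density x)^-1 *
  \sum_(i < n) partial i (fun y => vol_density y * Y y 0 i) x.

End riemannian.

(* x |-> (enorm x, angle x) identifies R^n \ {0} with (0, oo) x S^(n-1); the
   metric below is the pullback of dr^2 + sigma(r)^2 dtheta^2. *)
Record model_manifold (R : realType) (n : nat) (sigma : R -> R)
    (g : 'rV[R]_n -> 'M[R]_n) : Prop := ModelManifold {
  scaling_pos : forall r, 0 < r -> 0 < sigma r ;
  scaling_smooth : smooth_pos sigma ;
  model_metric : riemannian_metric g ;
  model_polar : forall x u v : 'rV[R]_n, x != 0 ->
    inner g x u v =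
      'D_u (@enorm R n) x * 'D_v (@enorm R n) x +
      sigma (enorm x) ^+ 2 * dot ('D_u (@angle R n) x) ('D_v (@angle R n) x) }.

Definition sphere_vol (R : realType) (n : nat) (sigma : R -> R) (r : R) : R :=
  sphere_area R n * sigma r ^+ n.-1.

(** * Weighted L^2 and Sobolev spaces, the form and its semigroup *)

Section forms.
Context (R : realType) (n : nat).
Variable g : 'rV[R]_n -> 'M[R]_n.
Implicit Types (w rho V f h u : 'rV[R]_n -> R).
Implicit Types (X Y : 'rV[R]_n -> 'rV[R]_n).
Implicit Types (A : ('rV[R]_n -> R) -> 'rV[R]_n -> R).
Implicit Types (T : R -> ('rV[R]_n -> R) -> 'rV[R]_n -> R).

Local Notation mu := (vol g).

Definition normL2_sq w f : \bar R := (\int[mu]_x (f x ^+ 2 * w x)%:E)%E.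

Definition L2 w f := measurable_fun setT f /\ (normL2_sq w f < +oo)%E.

Definition dotL2 w f h : R := fine (\int[mu]_x (f x * h x * w x)%:E)%E.

Definition energy X : \bar R := (\int[mu]_x (inner g x (X x) (X x))%:E)%E.

(* X is the distributional gradient of f and |X| is in L^2(mu). *)
Definition is_gradient f X :=
  [/\ measurable_fun setT X, (energy X < +oo)%E &
      forall Y, test_field Y ->
        (\int[mu]_x (inner g x (X x) (Y x))%:E =
         - \int[mu]_x (f x * divergence g Y x)%:E)%E].

Definition grad f : 'rV[R]_n -> 'rV[R]_n :=
  xget (fun=> 0) [set X | is_gradient f X].

Definition W1 w f := L2 w f /\ exists X, is_gradient f X.

Definition normW1_sq w f : \bar R := (energy (grad f) + normL2_sq w f)%E.

Definition W10 w f := W1 w f /\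
  exists2 phi : nat -> 'rV[R]_n -> R, (forall k, test_function (phi k)) &
    normW1_sq w (f \- phi k) @[k --> \oo] --> 0%E.

Definition form V f h : R :=
  fine (\int[mu]_x (inner g x (grad f x) (grad h x))%:E)%E +
  fine (\int[mu]_x (f x * h x * V x)%:E)%E.

(* The graph of the nonpositive self-adjoint operator on L^2(rho mu)
   associated with the form of domain W10 (rho + V). *)
Definition form_operator rho V f u :=
  [/\ W10 (rho \+ V) f, L2 rho u &
      forall h, W10 (rho \+ V) h -> form V f h = - dotL2 rho u h].

(* e^(tL): the strongly continuous semigroup on L^2(rho mu) whose generator
   is L. Operators on L^2 act on representatives. *)
Record form_semigroup rho V T : Prop := FormSemigroup {
  sg_L2 : forall t f, 0 <= t -> L2 rho f -> L2 rho (T t f) ;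
  sg_ae : forall t f h, 0 <= t -> L2 rho f -> L2 rho h ->
    (\forall x \ae mu, f x = h x) -> \forall x \ae mu, T t f x = T t h x ;
  sg_linear : forall t (a : R) f h, 0 <= t -> L2 rho f -> L2 rho h ->
    \forall x \ae mu, T t (fun y => a * f y + h y) x = a * T t f x + T t h x ;
  sg_bounded : forall t, 0 <= t -> exists C : R, forall f, L2 rho f ->
    (normL2_sq rho (T t f) <= C%:E * normL2_sq rho f)%E ;
  sg_0 : forall f, L2 rho f -> \forall x \ae mu, T 0 f x = f x ;
  sg_add : forall s t f, 0 <= s -> 0 <= t -> L2 rho f ->
    \forall x \ae mu, T (s + t) f x = T s (T t f) x ;
  sg_continuous : forall f, L2 rho f ->
    normL2_sq rho (T t f \- f) @[t --> 0^'+] --> 0%E ;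
  sg_generator : forall f u, L2 rho f -> L2 rho u ->
    form_operator rho V f u <->
    normL2_sq rho (fun x => t^-1 * (T t f x - f x) - u x)
      @[t --> 0^'+] --> 0%E }.

(** ** Extension to L^+ and generalized conservativeness *)

Definition Lplus_approx rho (f : 'rV[R]_n -> \bar R)
    (F : nat -> 'rV[R]_n -> R) :=
  (forall k, L2 rho (F k)) /\
  \forall x \ae mu, [/\ forall k, 0 <= F k x,
    forall k, F k x <= F k.+1 x &
    ((F k x)%:E @[k --> \oo] --> f x)%E].

(* For positivity preserving A the limit does not depend, almost everywhere,
   on the chosen sequence. *)
Definition Lplus_ext rho A (f : 'rV[R]_n -> \bar R) : 'rV[R]_n -> \bar R :=
  let F := xget (fun _ => cst 0) [set F | Lplus_approx rho f F] in
  fun x => limn (fun k => (A (F k) x)%:E).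

(* The L^2-valued integral of s |-> T s f over [0, t], in the weak sense. *)
Definition time_integral rho T (t : R) f : 'rV[R]_n -> R :=
  xget (cst 0) [set u | L2 rho u /\ forall h, L2 rho h ->
    dotL2 rho u h =
    \int[lebesgue_measure]_(s in `[0, t]) dotL2 rho (T s f) h].

Definition conservative rho V T := forall t, 0 < t -> \forall x \ae mu,
  (Lplus_ext rho (T t) (cst 1) x +
   Lplus_ext rho (time_integral rho T t) (fun y => (V y / rho y)%:E) x = 1)%E.

End forms.

(* Main.v *)
(** Let B be a primitive of v_{rho+V}/s, switched on smoothly away from the
origin.  Then (s B')' = s (rho + V), i.e. the Laplacian of B is rho + V, outside
a compact set, and (ii) says that B is unbounded.

Generalized conservativeness is dual to the conservation, for nonnegative f in
L^1 and L^2, of the mass [int T_t f rho + int_0^t int V T_s f], which never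
increases.  If B is bounded, composing B - b with a smooth convex function that
vanishes on the negative axis gives a nonzero u with 0 <= u <= 1 and
Delta u >= (rho + V) u.  Differentiating [int (1 - u) q(c T_t f) / c rho] for
convex q approximating the positive part, and letting c tend to infinity, bounds
the mass at time t by its initial value minus
[int u f rho + int_0^t int u T_s f rho - int u T_t f rho].  Conservation for all
t would thus make [int u T_t f rho] unbounded in t, although it is at most
[int f rho].

If B is unbounded, then u = C + B is proper and Delta u <= (rho + V) u.  The
test functions zeta_j = ent (1 - u/j) increase to the constant ent 1 and satisfy
L zeta_j >= - ent 1 V/rho - b_j with 0 <= b_j <= 1 and b_j -> 0; inserting them
into Duhamel's formula yields conservation of mass. *)

Require Import Defs.
From HB Require Import structures.
From mathcomp Require Import all_boot all_order all_algebra.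
From mathcomp Require Import all_classical all_reals all_analysis.
From mathcomp Require Import measurable_realfun.
From mathcomp Require Import ring lra.

Set Implicit Arguments.
Unset Strict Implicit.
Unset Printing Implicit Defensive.

Import Order.TTheory GRing.Theory Num.Theory.
Import numFieldNormedType.Exports.

Local Open Scope classical_set_scope.
Local Open Scope ring_scope.

(** * Integrals of real functions *)

(** The hypotheses on [T] only describe a strongly continuous semigroup of bounded operators
    generated by the form operator. Contractivity, symmetry, positivity and the bound on mass are
    all derived, from the symmetry, dissipativity and dense domain of the operator and from one
    weighted convexity inequality, [core]. The form is tested with test functions only, so elements
    of the domain must be approximated; the weight [1 - u] then brings in the gradient of [u], of
    which no energy bound is known, and a Caccioppoli estimate supplies a local one.

    One convex function, [ent x = x exp(-1/x)] for positive [x] and 0 otherwise, serves throughout: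
    as the entropy [q], to turn the potential into [u] when [B] is bounded, and to build the cutoffs
    when it is not. It is smooth, has slope in [0, 1] and second derivative in [0, 6], vanishes
    exactly on the nonpositive axis, and differs from the positive part by at most 1.

    The first equality in (ii) is additivity of integrals of nonnegative functions and holds for
    every positive [a]. *)

Lemma cvgEFin (R : realType) (I : Type) (F : set_system I) {FF : Filter F}
    (u : I -> R) (l : R) :
  u i @[i --> F] --> l -> (u i)%:E @[i --> F] --> l%:E.
Proof. by move=> ul; apply: cvg_EFin => //; exact: nearW. Qed.

Lemma cvg_minc (R : realType) (I : Type) (F : set_system I) {FF : Filter F}
    (u : I -> R) (l c : R) :
  u i @[i --> F] --> l -> Num.min (u i) c @[i --> F] --> Num.min l c.
Proof.
move=> ul; rewrite (_ : (fun i => _) = (fun i => (u i + c - `|u i - c|) / 2)).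
  rewrite minr_absE; apply: cvgM; last exact: cvg_cst.
  apply: cvgB; first by apply: cvgD => //; exact: cvg_cst.
  by apply: cvg_norm; apply: cvgB => //; exact: cvg_cst.
by apply/funext => i; rewrite minr_absE.
Qed.

Lemma cvg_maxc (R : realType) (I : Type) (F : set_system I) {FF : Filter F}
    (u : I -> R) (l c : R) :
  u i @[i --> F] --> l -> Num.max c (u i) @[i --> F] --> Num.max c l.
Proof.
move=> ul; rewrite (_ : (fun i => _) = (fun i => (c + u i + `|c - u i|) / 2)).
  rewrite maxr_absE; apply: cvgM; last exact: cvg_cst.
  apply: cvgD; first by apply: cvgD => //; exact: cvg_cst.
  by apply: cvg_norm; apply: cvgB => //; exact: cvg_cst.
by apply/funext => i; rewrite maxr_absE.
Qed.

Lemma cvgnP (R : realType) (u : nat -> R) (l : R) :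
  u n @[n --> \oo] --> l <->
  forall e, 0 < e -> exists N, forall n, (N <= n)%N -> `|u n - l| <= e.
Proof.
split=> [/cvgrPdist_le H e e0|H].
  by have [N _ HN] := H e e0; exists N => n /HN; rewrite distrC.
apply/cvgrPdist_le => e e0; have [N HN] := H e e0.
by exists N => // n /HN; rewrite distrC.
Qed.

Lemma cvgn_le_cst (R : realType) (u : nat -> R) (l c : R) N :
  u n @[n --> \oo] --> l -> (forall n, (N <= n)%N -> u n <= c) -> l <= c.
Proof.
move=> /cvgnP ul uc; apply/ler_addgt0Pr => e /ul[M HM].
have := HM _ (leq_maxr N M); have := uc _ (leq_maxl N M).
by rewrite ler_norml => ? /andP[]; lra.
Qed.

Lemma cvgn_ge_cst (R : realType) (u : nat -> R) (l c : R) N :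
  u n @[n --> \oo] --> l -> (forall n, (N <= n)%N -> c <= u n) -> c <= l.
Proof.
move=> /cvgN ul uc; rewrite -lerN2.
by apply: (cvgn_le_cst (N := N) ul) => n Nn /=; rewrite lerN2 uc.
Qed.

Section real_integral.
Context d (T : measurableType d) (R : realType) (mu : {measure set T -> \bar R}).
Implicit Types (f h : T -> R) (c : R).

Definition igr f := mu.-integrable setT (EFin \o f).

Lemma igr_meas f : igr f -> measurable_fun setT f.
Proof. by move=> /measurable_int/measurable_EFinP. Qed.

Lemma igrP f : measurable_fun setT f ->
  ((\int[mu]_x `|f x|%:E)%E < +oo)%E -> igr f.
Proof.
by move=> mf fi; apply/integrableP; split; first exact/measurable_EFinP.
Qed.

Lemma igr_lt f : igr f -> ((\int[mu]_x `|f x|%:E)%E < +oo)%E.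
Proof. by move=> /integrableP[]. Qed.

Lemma igr_le f h : measurable_fun setT f -> (forall x, `|f x| <= h x) ->
  igr h -> igr f.
Proof.
move=> mf fh; apply: le_integrable => //; first exact/measurable_EFinP.
by move=> x _ /=; rewrite lee_fin (le_trans (fh x))// ler_norm.
Qed.

Lemma igrD f h : igr f -> igr h -> igr (fun x => f x + h x).
Proof. by move=> fi hi; exact: (integrableD measurableT fi hi). Qed.

Lemma igrZ c f : igr f -> igr (fun x => c * f x).
Proof. by move=> fi; exact: (integrableZl measurableT c fi). Qed.

Lemma igrN f : igr f -> igr (fun x => - f x).
Proof. exact: integrableN. Qed.

Lemma igrB f h : igr f -> igr h -> igr (fun x => f x - h x).
Proof. by move=> fi hi; exact: igrD fi (igrN hi). Qed.

Lemma igr0 : igr (fun=> 0).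
Proof. exact: integrable0. Qed.

Lemma eq_igr f h : (forall x, f x = h x) -> igr f -> igr h.
Proof. by move=> /funext ->. Qed.

Lemma igr_abs f : igr f -> igr (fun x => `|f x|).
Proof.
by move=> fi; apply/igrP; [apply: measurableT_comp => //; exact: igr_meas|
  under eq_integral do rewrite normr_id; exact: igr_lt].
Qed.

Lemma igr_bM M f h : igr f -> measurable_fun setT h ->
  (forall x, `|h x| <= M) -> igr (fun x => h x * f x).
Proof.
move=> fi mh hM; apply: (@igr_le _ (fun x => M * `|f x|)).
- by apply: measurable_funM => //; exact: igr_meas.
- by move=> x; rewrite normrM ler_wpM2r.
- exact/igrZ/igr_abs.
Qed.

Lemma igr_fin f : igr f -> (\int[mu]_x (f x)%:E = (\int[mu]_x f x)%:E)%E.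
Proof. by move=> fi; rewrite fineK//; exact: integrable_fin_num. Qed.

Lemma rintD f h : igr f -> igr h ->
  \int[mu]_x (f x + h x) = \int[mu]_x f x + \int[mu]_x h x.
Proof. exact: RintegralD. Qed.

Lemma rintB f h : igr f -> igr h ->
  \int[mu]_x (f x - h x) = \int[mu]_x f x - \int[mu]_x h x.
Proof. exact: RintegralB. Qed.

Lemma rintZ c f : igr f -> \int[mu]_x (c * f x) = c * \int[mu]_x f x.
Proof. exact: RintegralZl. Qed.

Lemma rintN f : igr f -> \int[mu]_x (- f x) = - \int[mu]_x f x.
Proof.
move=> fi; rewrite -mulN1r -rintZ//.
by apply: eq_Rintegral => x _; rewrite mulN1r.
Qed.

Lemma rint_le f h : igr f -> igr h -> (forall x, f x <= h x) ->
  \int[mu]_x f x <= \int[mu]_x h x.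
Proof. by move=> fi hi fh; exact: le_Rintegral. Qed.

Lemma rint_ge0 f : (forall x, 0 <= f x) -> 0 <= \int[mu]_x f x.
Proof. by move=> f0; exact: Rintegral_ge0. Qed.

Lemma eq_rint f h : (forall x, f x = h x) -> \int[mu]_x f x = \int[mu]_x h x.
Proof. by move=> /funext ->. Qed.

Lemma rint_abs f : igr f -> `|\int[mu]_x f x| <= \int[mu]_x `|f x|.
Proof. exact: le_normr_Rintegral. Qed.

Lemma rint_ae_eq f h : measurable_fun setT f -> measurable_fun setT h ->
  (\forall x \ae mu, f x = h x) -> \int[mu]_x f x = \int[mu]_x h x.
Proof.
move=> mf mh fh; congr fine; apply: ae_eq_integral => //.
- exact/measurable_EFinP.
- exact/measurable_EFinP.
- by apply: filterS fh => x /= -> _.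
Qed.

Lemma rint_ae_le f h : igr f -> igr h -> (\forall x \ae mu, f x <= h x) ->
  \int[mu]_x f x <= \int[mu]_x h x.
Proof.
move=> fi hi fh; rewrite -subr_ge0 -rintB//.
rewrite (@rint_ae_eq _ (fun x => `|h x - f x|)).
- exact: rint_ge0.
- exact: igr_meas (igrB hi fi).
- exact: igr_meas (igr_abs (igrB hi fi)).
- by apply: filterS fh => x fhx; rewrite ger0_norm// subr_ge0.
Qed.

Lemma igr_ae_eq f h : measurable_fun setT h ->
  (\forall x \ae mu, f x = h x) -> igr f -> igr h.
Proof.
move=> mh fh fi; apply: igrP => //.
rewrite (_ : (\int[mu]_x `|h x|%:E = \int[mu]_x `|f x|%:E)%E).
  exact: igr_lt.
apply: ae_eq_integral => //.
- by apply/measurable_EFinP; exact: measurableT_comp.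
- by apply/measurable_EFinP; apply: measurableT_comp => //; exact: igr_meas.
- by apply: filterS fh => x /= -> _.
Qed.

Lemma rint_eq0_ae f : igr f -> (forall x, 0 <= f x) -> \int[mu]_x f x = 0 ->
  \forall x \ae mu, f x = 0.
Proof.
move=> fi f0 int0.
have [+ _] := ae_eq_integral_abs mu measurableT (measurable_int _ fi).
move=> H; have := H _; rewrite (_ : (\int[mu]_x _ = 0)%E); last first.
  under eq_integral do rewrite /= ger0_norm//.
  by rewrite igr_fin// int0.
by move=> /(_ erefl); apply: filterS => x /(_ I) /= [].
Qed.

Lemma igr_sum (I : Type) (s : seq I) (F : I -> T -> R) :
  (forall i, igr (F i)) -> igr (fun x => \sum_(i <- s) F i x).
Proof.
move=> Fi; elim: s => [|i s IH].
  by apply: eq_igr igr0 => x; rewrite big_nil.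
by apply: eq_igr (igrD (Fi i) IH) => x; rewrite big_cons.
Qed.

Lemma rint_sum (I : Type) (s : seq I) (F : I -> T -> R) :
  (forall i, igr (F i)) ->
  \int[mu]_x (\sum_(i <- s) F i x) = \sum_(i <- s) \int[mu]_x F i x.
Proof.
move=> Fi; elim: s => [|i s IH].
  rewrite big_nil; under eq_rint do rewrite big_nil.
  by rewrite /Rintegral integral0.
rewrite big_cons -IH -rintD//; last exact: igr_sum.
by apply: eq_rint => x; rewrite big_cons.
Qed.

Lemma rint_dct (F : nat -> T -> R) f h : (forall k, measurable_fun setT (F k)) ->
  measurable_fun setT f -> (\forall x \ae mu, F k x @[k --> \oo] --> f x) ->
  igr h -> (\forall x \ae mu, forall k, `|F k x| <= h x) ->
  igr f /\ \int[mu]_x F k x @[k --> \oo] --> \int[mu]_x f x.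
Proof.
move=> mF mf Ff hi Fh.
have [] := @dominated_convergence _ _ _ mu setT measurableT
  (fun k => EFin \o F k) (EFin \o f) (EFin \o h).
- by move=> k; exact/measurable_EFinP.
- exact/measurable_EFinP.
- by apply: filterS Ff => x Fx _; exact: cvgEFin.
- exact: hi.
- by apply: filterS Fh => x Fx k _ /=; rewrite lee_fin.
move=> fi _ H; split=> //.
by apply: fine_cvg; move: H; rewrite /= igr_fin.
Qed.

(** Serves where integrability of the limit is not known beforehand, as for the semigroup applied to
    an integrable function. *)
Lemma rint_fatou (F : nat -> T -> R) f C : (forall k, igr (F k)) ->
  (forall k x, 0 <= F k x) -> measurable_fun setT f ->
  (forall x, F k x @[k --> \oo] --> f x) ->
  (forall k, \int[mu]_x F k x <= C) -> igr f /\ \int[mu]_x f x <= C.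
Proof.
move=> Fi F0 mf Ff FC.
have f0 x : 0 <= f x by apply: (cvgn_ge_cst (N := 0%N) (Ff x)).
have le_int : (\int[mu]_x (f x)%:E <= C%:E)%E.
  have mF k : measurable_fun setT (EFin \o F k) by case/integrableP: (Fi k).
  have := @fatou _ _ _ mu _ measurableT _ mF (fun k x _ => F0 k x).
  rewrite (eq_integral (EFin \o f)); last first.
    by move=> x _; apply: (cvg_limn_einf_sup _).1; exact: cvgEFin.
  move=> /le_trans; apply; rewrite limn_einf_lim.
  apply: lime_le; first exact: is_cvg_einfs.
  apply: nearW => n; apply: ereal_inf_le; eexists; first by exists n => /=.
  by rewrite /= igr_fin// lee_fin.
have fi : igr f.
  apply: igrP => //; under eq_integral do rewrite ger0_norm//.
  exact: le_lt_trans le_int (ltry _).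
by split=> //; move: le_int; rewrite igr_fin.
Qed.

End real_integral.

(** * Weighted L^2 spaces *)

Section weighted_L2.
Context d (T : measurableType d) (R : realType) (mu : {measure set T -> \bar R}).
Variable w : T -> R.
Hypotheses (mw : measurable_fun setT w) (w0 : forall x, 0 <= w x).
Implicit Types (f h k : T -> R) (c : R).

(** For the Riemannian volume these are convertible with [normL2_sq], [L2] and [dotL2] of the
    statement; here the measure and the weight are abstract. *)
Definition sqn f : \bar R := (\int[mu]_x (f x ^+ 2 * w x)%:E)%E.
Definition isL2 f := measurable_fun setT f /\ (sqn f < +oo)%E.
Definition dt f h : R := fine (\int[mu]_x (f x * h x * w x)%:E)%E.
Definition nm f : R := Num.sqrt (dt f f).

Lemma L2_meas f : isL2 f -> measurable_fun setT f. Proof. by case. Qed.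

Lemma meas_prod3 f h : measurable_fun setT f -> measurable_fun setT h ->
  measurable_fun setT (fun x => f x * h x * w x).
Proof. by move=> mf mh; do ! apply: measurable_funM. Qed.

Let sqn_norm f : (\int[mu]_x `|f x ^+ 2 * w x|%:E)%E = sqn f.
Proof. by apply: eq_integral => x _; rewrite ger0_norm// mulr_ge0 ?sqr_ge0. Qed.

Lemma L2_igr f : isL2 f -> igr mu (fun x => f x ^+ 2 * w x).
Proof.
move=> [mf fi]; apply: igrP.
  by apply: measurable_funM => //; exact: measurable_funX.
by rewrite sqn_norm.
Qed.

Lemma igr_L2 f : measurable_fun setT f -> igr mu (fun x => f x ^+ 2 * w x) ->
  isL2 f.
Proof.
by move=> mf /igr_lt; rewrite sqn_norm.
Qed.

Lemma L2_prod f h : isL2 f -> isL2 h -> igr mu (fun x => f x * h x * w x).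
Proof.
move=> fi hi; apply: (@igr_le _ _ _ mu _
  (fun x => 2^-1 * (f x ^+ 2 * w x + h x ^+ 2 * w x))).
- by apply: meas_prod3; [case: fi|case: hi].
- move=> x; rewrite normrM (ger0_norm (w0 x)) -mulrDl mulrA ler_wpM2r//.
  have := sqr_ge0 (`|f x| - `|h x|); have := real_normK (num_real (f x)).
  by have := real_normK (num_real (h x)); rewrite normrM; nra.
- by apply/igrZ/igrD; exact: L2_igr.
Qed.

Lemma L2_le f h : measurable_fun setT f -> (forall x, `|f x| <= `|h x|) ->
  isL2 h -> isL2 f.
Proof.
move=> mf fh hi; apply: igr_L2 => //; apply: igr_le (L2_igr hi).
  by apply: measurable_funM => //; exact: measurable_funX.
move=> x; rewrite normrM (ger0_norm (w0 x)) ler_wpM2r//.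
rewrite normrX -[leRHS]real_normK ?num_real//.
by rewrite lerXn2r ?nnegrE// normr_ge0.
Qed.

Lemma L2D f h : isL2 f -> isL2 h -> isL2 (fun x => f x + h x).
Proof.
move=> fi hi; have [mf mh] := (L2_meas fi, L2_meas hi).
apply: igr_L2; first exact: measurable_funD.
have := igrD (igrD (L2_igr fi) (igrZ 2 (L2_prod fi hi))) (L2_igr hi).
by apply: eq_igr => x; ring.
Qed.

Lemma L2Z c f : isL2 f -> isL2 (fun x => c * f x).
Proof.
move=> fi; have mf := L2_meas fi.
apply: igr_L2; first exact: measurable_funM.
by have := igrZ (c ^+ 2) (L2_igr fi); apply: eq_igr => x; ring.
Qed.

Lemma L20 : isL2 (fun=> 0).
Proof using mw w0.
apply: igr_L2 => //; apply: eq_igr (@igr0 _ _ _ mu) => x.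
by rewrite expr0n mul0r.
Qed.

Lemma L2N f : isL2 f -> isL2 (fun x => - f x).
Proof. by move=> /(L2Z (-1)); under eq_fun do rewrite mulN1r. Qed.

Lemma L2B f h : isL2 f -> isL2 h -> isL2 (fun x => f x - h x).
Proof. by move=> fi /L2N; exact: L2D. Qed.

Lemma L2_bM M f h : measurable_fun setT h -> (forall x, `|h x| <= M) ->
  isL2 f -> isL2 (fun x => h x * f x).
Proof.
move=> mh hM fi; apply: (@L2_le _ (fun x => M * f x)); last exact: L2Z.
  by apply: measurable_funM => //; exact: L2_meas.
move=> x; rewrite !normrM ler_wpM2r//.
by rewrite (le_trans (hM x))// ler_norm.
Qed.

Lemma L2_abs f : isL2 f -> isL2 (fun x => `|f x|).
Proof.
move=> fi; apply: (@L2_le _ f) => // [|x]; last by rewrite normr_id.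
by apply: measurableT_comp => //; exact: L2_meas.
Qed.

Lemma L2_sum (I : Type) (s : seq I) (F : I -> T -> R) :
  (forall i, isL2 (F i)) -> isL2 (fun x => \sum_(i <- s) F i x).
Proof.
move=> Fi; elim: s => [|i s IH].
  by under eq_fun do rewrite big_nil; exact: L20.
by under eq_fun do rewrite big_cons; exact: L2D.
Qed.

Lemma dtE f h : dt f h = \int[mu]_x (f x * h x * w x). Proof. by []. Qed.

Lemma dtC f h : dt f h = dt h f.
Proof. by rewrite !dtE; apply: eq_rint => x; rewrite (mulrC (f x)). Qed.

Lemma dtDl f h k : isL2 f -> isL2 h -> isL2 k ->
  dt (fun x => f x + h x) k = dt f k + dt h k.
Proof.
move=> fi hi ki; rewrite !dtE -rintD; [|exact: L2_prod..].
by apply: eq_rint => x; ring.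
Qed.

Lemma dtZl c f k : isL2 f -> isL2 k -> dt (fun x => c * f x) k = c * dt f k.
Proof.
move=> fi ki; rewrite !dtE -rintZ; last exact: L2_prod.
by apply: eq_rint => x; ring.
Qed.

Lemma dtBl f h k : isL2 f -> isL2 h -> isL2 k ->
  dt (fun x => f x - h x) k = dt f k - dt h k.
Proof.
move=> fi hi ki; rewrite !dtE -rintB; [|exact: L2_prod..].
by apply: eq_rint => x; ring.
Qed.

Lemma dtDr f h k : isL2 f -> isL2 h -> isL2 k ->
  dt k (fun x => f x + h x) = dt k f + dt k h.
Proof. by move=> *; rewrite dtC dtDl// !(dtC k). Qed.

Lemma dtZr c f k : isL2 f -> isL2 k -> dt k (fun x => c * f x) = c * dt k f.
Proof. by move=> *; rewrite dtC dtZl// !(dtC k). Qed.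

Lemma dtBr f h k : isL2 f -> isL2 h -> isL2 k ->
  dt k (fun x => f x - h x) = dt k f - dt k h.
Proof. by move=> *; rewrite dtC dtBl// !(dtC k). Qed.

Lemma dt_suml (I : Type) (s : seq I) (F : I -> T -> R) k :
  (forall i, isL2 (F i)) -> isL2 k ->
  dt (fun x => \sum_(i <- s) F i x) k = \sum_(i <- s) dt (F i) k.
Proof.
move=> Fi ki; elim: s => [|i s IH].
  under eq_fun do rewrite big_nil.
  rewrite big_nil dtE; under eq_rint do rewrite !mul0r.
  by rewrite /Rintegral integral0.
by under eq_fun do rewrite big_cons; rewrite big_cons dtDl ?IH//; exact: L2_sum.
Qed.

Lemma dt_ae f h k : measurable_fun setT f -> measurable_fun setT h ->
  measurable_fun setT k -> (\forall x \ae mu, f x = h x) -> dt f k = dt h k.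
Proof.
move=> mf mh mk fh; rewrite !dtE; apply: rint_ae_eq.
- exact: meas_prod3.
- exact: meas_prod3.
- by apply: filterS fh => x ->.
Qed.

Lemma dt_ge0 f h : (forall x, 0 <= f x) -> (forall x, 0 <= h x) -> 0 <= dt f h.
Proof. by move=> f0 h0; apply: rint_ge0 => x; rewrite !mulr_ge0. Qed.

Lemma dt_le f h k : isL2 f -> isL2 h -> isL2 k -> (forall x, 0 <= k x) ->
  (forall x, f x <= h x) -> dt f k <= dt h k.
Proof.
move=> fi hi ki k0 fh; rewrite !dtE; apply: rint_le; [exact: L2_prod..|].
by move=> x; rewrite !ler_wpM2r.
Qed.

Lemma dtff_ge0 f : 0 <= dt f f.
Proof. by apply: rint_ge0 => x; rewrite mulr_ge0// -expr2 sqr_ge0. Qed.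

Lemma nm_ge0 f : 0 <= nm f. Proof. exact: sqrtr_ge0. Qed.

Lemma nm2 f : nm f ^+ 2 = dt f f. Proof. exact: sqr_sqrtr (dtff_ge0 f). Qed.

Lemma sqnE f : isL2 f -> sqn f = (nm f ^+ 2)%:E.
Proof.
move=> fi; rewrite nm2 dtE -igr_fin; last exact: L2_prod.
by apply: eq_integral => x _; rewrite expr2.
Qed.

Lemma dt_CS f h : isL2 f -> isL2 h -> `|dt f h| <= nm f * nm h.
Proof.
move=> fi hi; rewrite -(@ler_pXn2r _ 2)// ?nnegrE ?mulr_ge0 ?nm_ge0//.
rewrite real_normK ?num_real// exprMn !nm2.
have H c : 0 <= dt f f - 2 * c * dt f h + c ^+ 2 * dt h h.
  have := dtff_ge0 (fun x => f x - c * h x).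
  rewrite dtBl ?dtBr ?dtZl ?dtZr ?(dtC h f)//; try exact: L2Z; last first.
    by apply: L2B => //; exact: L2Z.
  by move=> /le_trans; apply; lra.
have ff := dtff_ge0 f; have := dtff_ge0 h.
rewrite le_eqVlt => /predU1P[hh|hh].
  rewrite -hh mulr0; have [->|n0] := eqVneq (dt f h) 0; first by rewrite expr0n.
  (* If [h] has norm zero but a nonzero pairing with [f], this [c] would give the nonnegative
     expression in [H] the value -1. *)
  have := H ((dt f f + 1) / (2 * dt f h)).
  rewrite -hh mulr0 addr0.
  rewrite (_ : 2 * ((dt f f + 1) / (2 * dt f h)) * dt f h = dt f f + 1).
    by rewrite opprD addrA subrr add0r ler0N1.
  by field.
have := mulr_ge0 (H (dt f h / dt h h)) (ltW hh).
rewrite (_ : (_ + _) * _ = dt f f * dt h h - dt f h ^+ 2) ?subr_ge0//.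
by field; rewrite gt_eqF.
Qed.

Lemma nmZ c f : isL2 f -> nm (fun x => c * f x) = `|c| * nm f.
Proof.
move=> fi; rewrite /nm dtZl ?dtZr//; last exact: L2Z.
by rewrite mulrA -expr2 sqrtrM ?sqr_ge0// sqrtr_sqr.
Qed.

Lemma nm0 : nm (fun=> 0) = 0.
Proof.
rewrite /nm dtE; under eq_rint do rewrite !mul0r.
by rewrite /Rintegral integral0 sqrtr0.
Qed.

Lemma nmN f : isL2 f -> nm (fun x => - f x) = nm f.
Proof.
move=> fi; rewrite -[RHS]mul1r -normr1 -normrN -nmZ//.
by under [in RHS]eq_fun do rewrite mulN1r.
Qed.

Lemma nmD f h : isL2 f -> isL2 h -> nm (fun x => f x + h x) <= nm f + nm h.
Proof.
move=> fi hi; have fh := L2D fi hi.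
rewrite -(@ler_pXn2r _ 2)// ?nnegrE ?addr_ge0 ?nm_ge0//.
rewrite nm2 dtDl ?dtDr// sqrrD !nm2 (dtC h f).
by have := le_trans (ler_norm _) (dt_CS fi hi); lra.
Qed.

Lemma nmB f h : isL2 f -> isL2 h -> nm (fun x => f x - h x) <= nm f + nm h.
Proof. by move=> fi hi; rewrite -(nmN hi); apply: nmD => //; exact: L2N. Qed.

Lemma nm_dist f h k : isL2 f -> isL2 h -> isL2 k ->
  nm (fun x => f x - k x) <= nm (fun x => f x - h x) + nm (fun x => h x - k x).
Proof.
move=> fi hi ki; rewrite (_ : (fun x => f x - k x) =
  (fun x => (f x - h x) + (h x - k x))); first by apply: nmD; exact: L2B.
by apply/funext => x; ring.
Qed.

Lemma nm_distC f h : nm (fun x => f x - h x) = nm (fun x => h x - f x).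
Proof.
by rewrite /nm; congr Num.sqrt; rewrite !dtE; apply: eq_rint => x; ring.
Qed.

Lemma nm_le f h : isL2 f -> isL2 h -> (forall x, `|f x| <= `|h x|) ->
  nm f <= nm h.
Proof.
move=> fi hi fh; rewrite ler_wsqrtr// !dtE; apply: rint_le; [exact: L2_prod..|].
move=> x; rewrite ler_wpM2r// -!expr2 -real_normK ?num_real//.
by rewrite -[leRHS]real_normK ?num_real// lerXn2r ?nnegrE.
Qed.

Lemma nm_ae f h : measurable_fun setT f -> measurable_fun setT h ->
  (\forall x \ae mu, f x = h x) -> nm f = nm h.
Proof.
move=> mf mh fh; rewrite /nm; congr Num.sqrt.
by rewrite (dt_ae mf mh mf fh) dtC (dt_ae mf mh mh fh).
Qed.

Lemma nm0_ae f : (forall x, 0 < w x) -> isL2 f -> nm f = 0 ->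
  \forall x \ae mu, f x = 0.
Proof.
move=> wp fi f0; have : dt f f = 0 by rewrite -nm2 f0 expr0n.
rewrite dtE => /(rint_eq0_ae (L2_prod fi fi)) H.
have {H} := H (fun x => mulr_ge0 (sqr_ge0 (f x)) (w0 x)).
apply: filterS => x /eqP; rewrite mulf_eq0 (gt_eqF (wp x)) orbF.
by rewrite mulf_eq0 orbb => /eqP.
Qed.

Lemma L2_dct (F : nat -> T -> R) f G : (forall j, measurable_fun setT (F j)) ->
  measurable_fun setT f -> (\forall x \ae mu, F j x @[j --> \oo] --> f x) ->
  isL2 G -> (\forall x \ae mu, forall j : nat, `|F j x - f x| <= G x) ->
  nm (fun x => F j x - f x) @[j --> \oo] --> 0.
Proof.
move=> mF mf Ff Gi FG.
have mFf j : measurable_fun setT (fun x => F j x - f x) by exact: measurable_funB.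
have [|||_ H] := @rint_dct _ _ _ mu
    (fun j x => (F j x - f x) * (F j x - f x) * w x) (fun=> 0)
    (fun x => G x ^+ 2 * w x) (fun j => meas_prod3 (mFf j) (mFf j))
    (measurable_cst _).
- apply: filterS Ff => x Ff; rewrite -[X in _ --> X](mul0r (w x)).
  apply: cvgM; last exact: cvg_cst.
  by rewrite -[X in _ --> X](mul0r 0); apply: cvgM;
    rewrite -(subrr (f x)); apply: cvgB; (exact: cvg_cst || exact: Ff).
- exact: L2_igr.
- apply: filterS FG => x FG n.
  rewrite normrM (ger0_norm (w0 x)) ler_wpM2r// -expr2 normrX.
  by rewrite lerXn2r ?nnegrE// (le_trans _ (FG n)).
rewrite -sqrtr0; move: H.
rewrite (_ : \int[mu]_(x in setT) 0 = 0); last by rewrite /Rintegral integral0.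
by move=> H; exact: (cvg_comp _ _ H (@sqrt_continuous R 0)).
Qed.

Hypothesis wp : forall x, 0 < w x.

Let half := 2^-1 : R.

(** The Riesz-Fischer argument: the sum of the absolute increments has finite norm by monotone
    convergence, hence is finite on a set [A] of full measure; there the sequence is Cauchy, and the
    sum dominates its distance to the limit. *)
Lemma L2_complete_fast (a : nat -> T -> R) : (forall j, isL2 (a j)) ->
  (forall j, nm (fun x => a j.+1 x - a j x) <= half ^+ j) ->
  exists2 f, isL2 f & nm (fun x => a j x - f x) @[j --> \oo] --> 0.
Proof.
move=> ai aD; pose D j x := `|a j.+1 x - a j x|.
have Di j : isL2 (D j) by apply: L2_abs; exact: L2B.
pose g n x := \sum_(j < n) D j x.
have gi n : isL2 (g n) by exact: L2_sum.
(* The right-hand side is the sum of [half ^+ j] over [j < n]. *)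
have g_nm n : nm (g n) <= 2 - 2 * half ^+ n.
  elim: n => [|n IH].
    rewrite expr0 mulr1 subrr /g; under eq_fun do rewrite big_ord0.
    rewrite /nm dtE; under eq_rint do rewrite !mul0r.
    by rewrite /Rintegral integral0 sqrtr0.
  have -> : g n.+1 = fun x => g n x + D n x.
    by apply/funext => x; rewrite /g big_ord_recr.
  apply: le_trans (nmD (gi n) (Di n)) _; rewrite exprS.
  have : nm (D n) <= half ^+ n.
    apply: le_trans (aD n); apply: nm_le => //; first exact: L2B.
    by move=> x; rewrite normr_id.
  by move: IH; rewrite /half; lra.
have g0 n x : 0 <= g n x by apply: sumr_ge0 => i _; exact: normr_ge0.
have g_nd x : {homo g ^~ x : n m / (n <= m)%N >-> n <= m}.
  apply/nondecreasing_seqP => n; rewrite {2}/g big_ord_recr /= lerDl.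
  exact: normr_ge0.
pose h n x := (g n x ^+ 2 * w x)%:E.
have mh n : measurable_fun setT (h n).
  exact/measurable_EFinP/igr_meas/(L2_igr (gi n)).
have h_nd x : {homo h ^~ x : n m / (n <= m)%N >-> (n <= m)%E}.
  move=> n m nm_; rewrite lee_fin ler_wpM2r// lerXn2r ?nnegrE//.
  exact: g_nd.
have h_cvg x : h n x @[n --> \oo] --> limn (h ^~ x).
  exact/ereal_nondecreasing_is_cvgn/h_nd.
pose H x := limn (h ^~ x).
have mH : measurable_fun setT H.
  by apply: (emeasurable_fun_cvg _ _ mh) => x _; exact: h_cvg.
have h0 n x : (0 <= h n x)%E by rewrite lee_fin mulr_ge0// sqr_ge0.
have H0 x : (0 <= H x)%E.
  by apply: lime_ge; [exact: h_cvg|exact: nearW].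
have H4 : (\int[mu]_x H x <= 4%:E)%E.
  have Hc := @cvg_monotone_convergence _ _ _ mu _ measurableT h mh
    (fun n x _ => h0 n x) (fun x _ => h_nd x).
  rewrite -(cvg_lim _ Hc)//; apply: lime_le; first by apply/cvg_ex; eexists; exact: Hc.
  apply: nearW => n; rewrite -/(sqn _) sqnE// lee_fin.
  have := g_nm n; have := nm_ge0 (g n).
  have : 0 <= half ^+ n by rewrite exprn_ge0// invr_ge0.
  by nra.
have Hint : mu.-integrable setT H.
  apply/integrableP; split=> //.
  under eq_integral do rewrite gee0_abs//.
  by rewrite (le_lt_trans H4)// ltry.
have [N [mN N0 HN]] := integrable_ae measurableT Hint.
pose A := ~` N; have mA : measurable A by exact: measurableC.
have HA x : A x -> H x \is a fin_num.
  by move=> Ax; apply: contrapT => Hx; apply: Ax; apply: HN => /= /(_ I).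
have AE : \forall x \ae mu, A x.
  by exists N; split=> // x /= nAx; apply: contrapT.
have gc x : A x -> exists2 l, g n x @[n --> \oo] --> l & forall n, g n x <= l.
  move=> Ax; suff : cvgn (g ^~ x).
    move=> c; exists (limn (g ^~ x)) => // n.
    exact: nondecreasing_cvgn_le (g_nd x) c n.
  apply: nondecreasing_is_cvgn; first exact: g_nd.
  (* Only the square of [g n x] is controlled by [H]; the bound follows from [g <= 1 + g ^+ 2]. *)
  exists (1 + fine (H x) / w x) => _ [n _ <-].
  have : (h n x <= H x)%E.
    apply: lime_ge; first exact: h_cvg.
    by exists n => // m /= nm_; exact: h_nd.
 
  rewrite -(fineK (HA x Ax)) lee_fin -ler_pdivlMr// => gH.
  apply: le_trans (_ : 1 + g n x ^+ 2 <= _); last by rewrite lerD2l.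
  by have := sqr_ge0 (g n x - 1); have := g0 n x; nra.
have a_dist m n x : (m <= n)%N -> `|a n x - a m x| <= g n x - g m x.
  elim: n => [|n IH].
    by rewrite leqn0 => /eqP ->; rewrite !subrr normr0.
  rewrite leq_eqVlt => /predU1P[->|]; first by rewrite !subrr normr0.
  rewrite ltnS => /IH {}IH.
  rewrite (_ : a n.+1 x - a m x = (a n.+1 x - a n x) + (a n x - a m x)); last by ring.
  rewrite (le_trans (ler_normD _ _))//.
  have -> : g n.+1 x = g n x + D n x by rewrite /g big_ord_recr.
  by rewrite -/(D n x); move: IH; lra.
(* The value 0 off [A] makes this an everywhere limit of the measurable functions [\1_A * g n],
   hence measurable. *)
pose GG x := if x \in A then limn (g ^~ x) else 0.
have GGc x : (\1_A x * g n x) @[n --> \oo] --> GG x.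
  rewrite /GG indicE; case: ifPn => [|_].
    rewrite inE => /gc[l gl _]; under eq_cvg do rewrite mul1r.
    by rewrite (cvg_lim _ gl).
  by under eq_cvg do rewrite mul0r; exact: cvg_cst.
have mG n : measurable_fun setT (fun x => \1_A x * g n x).
  by apply: measurable_funM; [exact: measurable_indic|exact: L2_meas].
have mGG : measurable_fun setT GG.
  by apply: (measurable_fun_cvg mG) => x _; exact: GGc.
have GGn n x : A x -> g n x <= GG x.
  move=> Ax; rewrite /GG mem_set//; have [l gl gln] := gc _ Ax.
  by rewrite (cvg_lim _ gl).
have GG0 x : 0 <= GG x.
  have [Ax|Ax] := pselect (A x); first exact: le_trans (g0 0%N x) (GGn _ _ Ax).
  by rewrite /GG memNset.
have GG2 x : ((GG x ^+ 2 * w x)%:E <= H x)%E.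
  have [Ax|Ax] := pselect (A x); last first.
    by rewrite /GG memNset// expr0n mul0r.
  rewrite /GG mem_set//; have [l gl _] := gc _ Ax; rewrite (cvg_lim _ gl)//.
  rewrite (_ : H x = (l ^+ 2 * w x)%:E)//; apply: cvg_lim => //.
  apply: cvgEFin; apply: cvgM; last exact: cvg_cst.
  exact: (cvg_comp _ _ gl (@exprn_continuous _ 2 l)).
have GGi : isL2 GG.
  split=> //; apply: le_lt_trans (ltry 4); apply: le_trans H4.
  apply: ge0_le_integral => //.
  - by move=> x _; rewrite lee_fin mulr_ge0// sqr_ge0.
  - by apply/measurable_EFinP; apply: measurable_funM => //; exact: measurable_funX.
pose b n x := \1_A x * a n x.
have mb n : measurable_fun setT (b n).
  by apply: measurable_funM; [exact: measurable_indic|exact: L2_meas].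
have bi n : isL2 (b n).
  apply: (@L2_le _ (a n)) => // x; rewrite /b indicE.
  by case: (x \in A); rewrite ?mul1r ?mul0r ?normr0.
have ac x : A x -> cvgn (a ^~ x).
  move=> Ax; have [l gl gln] := gc _ Ax.
  apply/cauchy_cvgP/cauchy_exP => e e0.
  have [N0' HN'] := (cvgnP _ _).1 gl (e / 2) (divr_gt0 e0 (ltr0Sn _ _)).
  exists (a N0' x), N0' => // n /= Nn; rewrite /ball /= distrC.
  apply: le_lt_trans (a_dist _ _ _ Nn) _.
  have := HN' _ (leqnn _); have := gln n; have := gln N0'.
  by rewrite distrC ler_norml => _ ? /andP[_]; lra.
pose f x := if x \in A then limn (a ^~ x) else 0.
have bc x : b n x @[n --> \oo] --> f x.
  rewrite /f /b indicE; case: ifPn => [|_].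
    by rewrite inE => /ac al; under eq_cvg do rewrite mul1r.
  by under eq_cvg do rewrite mul0r; exact: cvg_cst.
have mf : measurable_fun setT f.
  by apply: (measurable_fun_cvg mb) => x _; exact: bc.
have b_dist m n x : (m <= n)%N -> `|b n x - b m x| <= GG x.
  move=> mn; rewrite -mulrBr indicE.
  case: (boolP (x \in A)) => [|_]; last by rewrite mul0r normr0.
  rewrite inE mul1r => Ax; apply: le_trans (a_dist _ _ _ mn) _.
  by have := GGn n _ Ax; have := g0 m x; lra.
have bf_dist n x : `|b n x - f x| <= GG x.
  apply: (@cvgn_le_cst _ (fun m => `|b n x - b m x|) _ _ n).
    by apply: cvg_norm; apply: cvgB; [exact: cvg_cst|exact: bc].
  by move=> m nm_; rewrite distrC b_dist.
have fi : isL2 f.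
  rewrite (_ : f = fun x => b 0%N x - (b 0%N x - f x)); last first.
    by apply/funext => x; ring.
  apply: L2B => //; apply: (L2_le _ _ GGi); first exact: measurable_funB.
  by move=> x; rewrite (ger0_norm (GG0 x)).
exists f => //.
rewrite (_ : (fun j => _) = (fun j => nm (fun x => b j x - f x))); last first.
  apply/funext => j; apply: nm_ae.
  - by apply: measurable_funB => //; exact: L2_meas.
  - exact: measurable_funB.
  - by apply: filterS AE => x Ax; rewrite /b indicE mem_set// mul1r.
by apply: (L2_dct _ _ _ GGi) => //; exact: aeW.
Qed.

Lemma L2_complete (a : nat -> T -> R) : (forall j, isL2 (a j)) ->
  (forall e, 0 < e -> exists N, forall m n, (N <= m)%N -> (N <= n)%N ->
    nm (fun x => a m x - a n x) <= e) ->
  exists2 f, isL2 f & nm (fun x => a j x - f x) @[j --> \oo] --> 0.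
Proof.
move=> ai ac.
have hp j : 0 < half ^+ j by rewrite exprn_gt0// invr_gt0.
have /choice[N HN] : forall j, exists N, forall m n, (N <= m)%N -> (N <= n)%N ->
    nm (fun x => a m x - a n x) <= half ^+ j by move=> j; exact: ac.
(* Adding up all earlier thresholds makes [M] monotone, at least [N j], and at least [j], so that
   the subsequence is rapidly Cauchy and goes to infinity. *)
pose M j := (j + \sum_(i < j.+1) N i)%N.
have NM j : (N j <= M j)%N by rewrite /M big_ord_recr addnA leq_addl.
have MM j : (M j <= M j.+1)%N.
  by rewrite /M (big_ord_recr j.+1)/= leq_add// leq_addr.
have [||f fi Hf] := @L2_complete_fast (a \o M).
- by move=> j; exact: ai.
- by move=> j; apply: HN => //; apply: leq_trans (NM j) _.
exists f => //; apply/cvgnP => e e0.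
have e2 : 0 < e / 2 by rewrite divr_gt0.
have [K HK] := (cvgnP _ _).1 Hf _ e2; have [L HL] := ac _ e2.
pose j := maxn K L.
have Lj : (L <= M j)%N.
  by apply: leq_trans (leq_maxr K L) _; rewrite /M leq_addr.
exists L => n Ln; rewrite subr0 ger0_norm ?nm_ge0//.
apply: le_trans (nm_dist (ai n) (ai (M j)) fi) _.
have := HL _ _ Ln Lj; have := HK j (leq_maxl _ _).
by rewrite subr0 ger0_norm ?nm_ge0//=; lra.
Qed.

End weighted_L2.

(** * Lebesgue measure on R^n *)

Lemma igr_indic d (T : measurableType d) (R : realType)
    (mu : {measure set T -> \bar R}) A : measurable A -> (mu A < +oo)%E ->
  igr mu (\1_A : T -> R).
Proof.
move=> mA A1; apply: igrP; first exact: measurable_indic.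
under eq_integral => x _.
  rewrite ger0_norm; last by rewrite indicE.
  over.
by rewrite integral_indic// setIT.
Qed.

Section measurable_rV.
Context (R : realType).

Lemma measurable_coord n (i : 'I_n) :
  measurable_fun setT (fun x : 'rV[R]_n => x 0 i).
Proof.
move=> _ Y mY; rewrite setTI; apply: sub_sigma_algebra => /=.
rewrite -bigcup_seq/=; exists i => /=; first by rewrite mem_index_enum.
by exists Y => //; rewrite setTI.
Qed.

Lemma measurable_fun_rVP d (T : measurableType d) n (f : T -> 'rV[R]_n) :
  measurable_fun setT f <->
  forall i, measurable_fun setT (fun x => f x 0 i).
Proof.
split=> [mf i|mf].
  exact: measurableT_comp (measurable_coord i) mf.
pose coord (i : 'I_n) (x : 'rV[R]_n) : measurableTypeR R := x 0 i.
pose G := \big[setU/set0]_(i < n) preimage_set_system setT (coord i) measurable.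
apply: (@measurability _ _ T 'rV[R]_n setT f G) => // _ [B GB <-].
move: GB; rewrite /G -bigcup_seq => -[i _ [Y mY <-]].
by rewrite !setTI; have := mf i measurableT Y mY; rewrite setTI.
Qed.

(** Half-open boxes are stable under intersection, generate the sigma-algebra, and split off the
    first coordinate as a product with an interval of the same kind, which suits the recursion of
    [lebesgue_rV]. *)
Definition box n (a b : 'rV[R]_n) : set 'rV[R]_n :=
  [set x | forall i, a 0 i < x 0 i <= b 0 i].

Definition box_vol n (a b : 'rV[R]_n) : R :=
  \prod_(i < n) Num.max 0 (b 0 i - a 0 i).

Lemma measurable_box n (a b : 'rV[R]_n) : measurable (box a b).
Proof.
rewrite (_ : box a b = \bigcap_(i in [set: 'I_n])
    ((fun x : 'rV[R]_n => x 0 i) @^-1` `]a 0 i, b 0 i]%classic)); last first.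
  by apply/seteqP; split=> x h i; move: (h i); rewrite /= in_itv//=; apply.
apply: fin_bigcap_measurable => // i _.
by rewrite -[X in measurable X]setTI; apply: (measurable_coord i) => //; exact: measurable_itv.
Qed.

Lemma box_volE n (a b : 'rV[R]_n.+1) : (box_vol a b)%:E =
  (lebesgue_measure `](a 0 0)%R, (b 0 0)%R]%classic *
   (box_vol (rsubmx (a : 'rV[R]_(1 + n))) (rsubmx (b : 'rV[R]_(1 + n))))%:E)%E.
Proof.
rewrite /box_vol big_ord_recl lebesgue_measure_itv/= lte_fin EFinM; congr (_ * _)%E.
  case: ltP => h; rewrite -?EFinB; first by rewrite max_r// subr_ge0 ltW.
  by rewrite max_l// subr_le0.
by congr EFin; apply: eq_bigr => i _; rewrite !mxE; congr (Num.max 0 (b _ _ - a _ _));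
   apply/val_inj.
Qed.

Lemma measurable_row_mx n : measurable_fun setT
  (fun p : measurableTypeR R * 'rV[R]_n =>
     row_mx (p.1 : R)%:M p.2 : 'rV[R]_(1 + n)).
Proof.
apply/measurable_fun_rVP => i; case: (split_ordP i) => j ->.
- rewrite [X in measurable_fun _ X](_ : _ = fst); last first.
    by apply/funext => p; rewrite row_mxEl mxE ord1 eqxx.
  exact: measurable_fst.
- rewrite [X in measurable_fun _ X](_ : _ = (fun x : 'rV[R]_n => x 0 j) \o snd).
    exact: measurableT_comp (measurable_coord j) (@measurable_snd _ _ _ _).
  by apply/funext => p; rewrite row_mxEr.
Qed.

Lemma preimage_box n (a b : 'rV[R]_(1 + n)) :
  (fun p : measurableTypeR R * 'rV[R]_n => row_mx (p.1 : R)%:M p.2) @^-1` (box a b) =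
  `]a 0 0, b 0 0]%classic `*` box (rsubmx a) (rsubmx b).
Proof.
have e0 : (lshift n ord0 : 'I_(1 + n)) = 0 by apply/val_inj.
apply/seteqP; split => [[x y]|[x y] []]/= h.
  split; last by move=> i; have := h (rshift 1 i); rewrite row_mxEr !mxE.
  by have := h (lshift n ord0); rewrite row_mxEl mxE eqxx e0 in_itv.
move=> h2 i; case: (split_ordP i) => j ->; last by have := h2 j; rewrite row_mxEr !mxE.
by rewrite row_mxEl ord1 mxE eqxx e0; move: h; rewrite in_itv.
Qed.

Lemma cover_box n : \bigcup_k box (const_mx (- k%:R) : 'rV[R]_n) (const_mx k%:R) = setT.
Proof.
apply/seteqP; split => // x _.
pose M := \sum_(i < n) `|x 0 i|.
have [k /= kM] : exists k : nat, M < k%:R.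
  by exists (Num.bound M); apply: archi_boundP; exact: sumr_ge0.
exists k => // i; rewrite !mxE.
have : `|x 0 i| < k%:R.
  apply: le_lt_trans kM; rewrite /M (bigD1 i)//= lerDl; exact: sumr_ge0.
by rewrite ltr_norml => /andP[-> /ltW ->].
Qed.

Let lebesgue_rV_spec n (m : {sigma_finite_measure set 'rV[R]_n -> \bar R}) :=
  (m : set _ -> _) = @lebesgue_rV R n /\
  forall a b, m (box a b) = (box_vol a b)%:E.

(** [lebesgue_rV] is a bare set function, while each step of its recursion is a product with a
    sigma-finite measure. The bundled measure is therefore built by induction together with its
    values on boxes, which in turn give sigma-finiteness for the next step. *)
Lemma lebesgue_rV_ex n : exists m : {sigma_finite_measure set 'rV[R]_n -> \bar R},
  lebesgue_rV_spec m.
Proof.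
elim: n => [|n [m [mE mbox]]].
  exists [the {sigma_finite_measure set _ -> \bar R} of \d_(0 : 'rV[R]_0)].
  split => // a b; rewrite /box_vol big_ord0/= /dirac indicE mem_set//.
  by case.
have mrow := @measurable_row_mx n.
pose M : {measure set 'rV[R]_n.+1 -> \bar R} :=
  measure_function_pushforward__canonical__measure_function_Measure
    [the {measure set _ -> \bar R} of (lebesgue_measure \x m)%E] mrow.
have ME : (M : set _ -> _) = lebesgue_rV (n := n.+1) by rewrite /= -mE.
have Mbox a b : M (box a b) = (box_vol a b)%:E.
  rewrite box_volE -mbox -product_measure1E//; last exact: measurable_box.
  by rewrite -preimage_box.
have Mfin : sigma_finite [set: 'rV[R]_n.+1] M.
  exists (fun k => box (const_mx (- k%:R)) (const_mx k%:R)); first by rewrite cover_box.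
  by move=> k; split; [exact: measurable_box|rewrite Mbox ltry].
pose sM := Measure_isSigmaFinite.Build _ _ _ M Mfin.
pose N : {sigma_finite_measure set 'rV[R]_n.+1 -> \bar R} := HB.pack (M : set _ -> _) M sM.
by exists N; split.
Qed.

Lemma lebesgue_rV_box n (a b : 'rV[R]_n) : lebesgue_rV (box a b) = (box_vol a b)%:E.
Proof. by have [m [<- ->]] := lebesgue_rV_ex n. Qed.

Section lebesgue_rV_measure.
Variable n : nat.

Let lebesgue_rV0 : @lebesgue_rV R n set0 = 0%E.
Proof. by have [m [<- _]] := lebesgue_rV_ex n; rewrite measure0. Qed.

Let lebesgue_rV_ge0 A : (0 <= @lebesgue_rV R n A)%E.
Proof. by have [m [<- _]] := lebesgue_rV_ex n; rewrite measure_ge0. Qed.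

Let lebesgue_rV_sigma_additive : semi_sigma_additive (@lebesgue_rV R n).
Proof.
by have [m [<- _]] := lebesgue_rV_ex n; exact: measure_semi_sigma_additive.
Qed.

HB.instance Definition _ := isMeasure.Build _ _ _ (@lebesgue_rV R n)
  lebesgue_rV0 lebesgue_rV_ge0 lebesgue_rV_sigma_additive.

Let lebesgue_rV_sigma_finite : sigma_finite setT (@lebesgue_rV R n).
Proof. by have [m [<- _]] := lebesgue_rV_ex n; exact: sigma_finiteT. Qed.

HB.instance Definition _ := Measure_isSigmaFinite.Build _ _ _ (@lebesgue_rV R n)
  lebesgue_rV_sigma_finite.

End lebesgue_rV_measure.

Definition boxes n : set (set 'rV[R]_n) := [set A | exists a b, A = box a b].

Lemma boxes_setI n : setI_closed (@boxes n).
Proof.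
move=> _ _ [a [b ->]] [c [e ->]].
exists (\row_i Num.max (a 0 i) (c 0 i)), (\row_i Num.min (b 0 i) (e 0 i)).
apply/seteqP; split=> x /=.
  move=> [h1 h2] i; rewrite !mxE gt_max le_min.
  by case/andP: (h1 i) => -> ->; case/andP: (h2 i) => -> ->.
move=> h; split=> i; have := h i; rewrite !mxE gt_max le_min.
  by move=> /andP[/andP[-> _] /andP[-> _]].
by move=> /andP[/andP[_ ->] /andP[_ ->]].
Qed.

Lemma measurable_boxes n : @measurable _ 'rV[R]_n = <<s @boxes n >>.
Proof.
apply/seteqP; split; last first.
  apply: smallest_sub; first exact: sigma_algebra_measurable.
  by move=> _ [a [b ->]]; exact: measurable_box.
pose coord (i : 'I_n) (x : 'rV[R]_n) : measurableTypeR R := x 0 i.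
pose B := g_sigma_algebraType (@boxes n).
have mc i : measurable_fun setT (coord i : B -> measurableTypeR R).
  apply: (@measurability _ _ B (measurableTypeR R) setT _ (@ocitv R)) => //.
  move=> _ [_ [[a b] _ <-] <-]; rewrite setTI/=.
  (* A slab in one coordinate is the union of the boxes whose other sides run from [-k] to [k]. *)
  rewrite (_ : _ @^-1` _ = \bigcup_k box
     (\row_j if j == i then a else - k%:R) (\row_j if j == i then b else k%:R)); last first.
    apply/seteqP; split=> x.
      move=> xi; have : [set: 'rV[R]_n] x by [].
      rewrite -(cover_box n) => -[k _ xk]; exists k => // j; rewrite !mxE.
      by case: eqVneq => [->|_]; [move: xi; rewrite /= in_itv|have := xk j; rewrite !mxE].
    by move=> [k _ /(_ i)]; rewrite !mxE eqxx /= in_itv.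
  by apply: bigcup_measurable => k _; apply: sub_sigma_algebra; eexists; eexists.
apply: smallest_sub; first exact: smallest_sigma_algebra.
by rewrite -bigcup_seq => _ [i _ [Y mY <-]]; have := mc i measurableT Y mY.
Qed.

Lemma rV_measure_unique n (m1 m2 : {measure set 'rV[R]_n -> \bar R}) :
  (forall a b, m1 (box a b) = m2 (box a b)) ->
  (forall a b, m1 (box a b) < +oo)%E ->
  forall A, measurable A -> m1 A = m2 A.
Proof.
move=> h fin A mA.
apply: (measure_unique (@boxes n) (fun k => box (const_mx (- k%:R)) (const_mx k%:R))) => //.
- exact: measurable_boxes.
- exact: boxes_setI.
- by move=> k; eexists; eexists.
- exact: cover_box.
- by move=> _ [a [b ->]].
Qed.

Lemma lebesgue_rV_shift n (v : 'rV[R]_n) A : measurable A ->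
  lebesgue_rV ((fun x => x + v) @^-1` A) = lebesgue_rV A.
Proof.
move=> mA.
have ms : measurable_fun setT (fun x : 'rV[R]_n => x + v).
  apply/measurable_fun_rVP => i.
  rewrite [X in measurable_fun _ X](_ : _ = (fun x : 'rV[R]_n => x 0 i + v 0 i)); last first.
    by apply/funext => x; rewrite mxE.
  by apply: measurable_funD => //; exact: measurable_coord.
pose M : {measure set 'rV[R]_n -> \bar R} :=
  measure_function_pushforward__canonical__measure_function_Measure
    [the {measure set _ -> \bar R} of @lebesgue_rV R n] ms.
have Mbox a b : M (box a b) = lebesgue_rV (box a b).
  rewrite /M/= /pushforward.
  rewrite (_ : _ @^-1` _ = box (a - v) (b - v)); last first.
    apply/seteqP; split=> x /= h i; have := h i; rewrite !mxE;
      by rewrite ltrBlDr lerBrDr.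
  rewrite !lebesgue_rV_box; congr EFin; apply: eq_bigr => i _; rewrite !mxE.
  by congr Num.max; ring.
by apply: (rV_measure_unique Mbox) => // a b; rewrite Mbox lebesgue_rV_box ltry.
Qed.

Lemma lebesgue_rV_scale n (t : R) A : 0 < t -> measurable A ->
  lebesgue_rV ((fun x : 'rV[R]_n => t *: x) @^-1` A) =
  ((t^-1 ^+ n)%:E * lebesgue_rV A)%E.
Proof.
move=> t0 mA.
have ms : measurable_fun setT (fun x : 'rV[R]_n => t *: x).
  apply/measurable_fun_rVP => i.
  rewrite [X in measurable_fun _ X](_ : _ = (fun x : 'rV[R]_n => t * x 0 i)); last first.
    by apply/funext => x; rewrite mxE.
  by apply: measurable_funM => //; exact: measurable_coord.
pose M : {measure set 'rV[R]_n -> \bar R} :=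
  measure_function_pushforward__canonical__measure_function_Measure
    [the {measure set _ -> \bar R} of @lebesgue_rV R n] ms.
have tn0 : 0 <= t^-1 ^+ n by rewrite exprn_ge0// invr_ge0 ltW.
pose N : {measure set 'rV[R]_n -> \bar R} :=
  mscale (NngNum tn0) [the {measure set _ -> \bar R} of @lebesgue_rV R n].
have Mbox a b : M (box a b) = N (box a b).
  rewrite /M/= /pushforward.
  rewrite (_ : _ @^-1` _ = box (t^-1 *: a) (t^-1 *: b)); last first.
    apply/seteqP; split=> x /= h i; have := h i; rewrite !mxE;
      by rewrite ![t^-1 * _]mulrC ltr_pdivrMr// ler_pdivlMr// ![x _ _ * t]mulrC.
  rewrite /N/= /mscale/= !lebesgue_rV_box -EFinM; congr EFin.
  rewrite -[X in t^-1 ^+ X]card_ord -prodr_const -big_split/=; apply: eq_bigr => i _.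
  by rewrite !mxE -mulrBr maxr_pMr ?invr_ge0 ?ltW// mulr0.
by apply: (rV_measure_unique Mbox) => // a b; rewrite Mbox /N/= /mscale/= lebesgue_rV_box ltry.
Qed.

Lemma coord_norm n (x : 'rV[R]_n) i : `|x 0 i| <= `|x|.
Proof.
rewrite [leRHS]/Num.Def.normr/= mx_normrE.
by apply/bigmax_geP; right => /=; exists (0, i).
Qed.

Lemma norm_le_coord n (x : 'rV[R]_n) M : 0 <= M -> (forall i, `|x 0 i| <= M) -> `|x| <= M.
Proof.
move=> M0 h; rewrite [leLHS]/Num.Def.normr/= mx_normrE.
by apply/bigmax_leP; split => // -[i j] _ /=; rewrite ord1.
Qed.

Lemma norm_lt_coord n (x : 'rV[R]_n) M : 0 < M -> (forall i, `|x 0 i| < M) -> `|x| < M.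
Proof.
move=> M0 h; rewrite [ltLHS]/Num.Def.normr/= mx_normrE.
by apply/bigmax_ltP; split => // -[i j] _ /=; rewrite ord1.
Qed.

Lemma open_measurable_rV n (U : set 'rV[R]_n) : open U -> measurable U.
Proof.
move=> oU.
(* An open set is the countable union of the boxes with rational corners that it contains; the other
   indices contribute the empty set. *)
pose F (p : 'rV[rat]_n * 'rV[rat]_n) : set 'rV[R]_n :=
  let B := box (map_mx ratr p.1) (map_mx ratr p.2) in if `[<B `<=` U>] then B else set0.
rewrite (_ : U = \bigcup_p F p).
  apply: countable_bigcupT_measurable; first exact: countableP.
  by move=> p; rewrite /F; case: ifP => _ //; exact: measurable_box.
apply/seteqP; split=> x; last by move=> [p _]; rewrite /F; case: asboolP => // h /h.
move=> Ux; have /nbhs_ballP[e /= e0 eU] := oU x Ux.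
have hp i : exists q : rat, x 0 i - e < ratr q < x 0 i.
  by have [|q] := @rat_in_itvoo R (x 0 i - e) (x 0 i); rewrite ?in_itv/=;
     [rewrite ltrBlDr ltrDl|exists q].
have hq i : exists q : rat, x 0 i < ratr q < x 0 i + e.
  by have [|q] := @rat_in_itvoo R (x 0 i) (x 0 i + e); rewrite ?in_itv/=;
     [rewrite ltrDl|exists q].
pose p i := projT1 (cid (hp i)); have pP i : x 0 i - e < ratr (p i) < x 0 i.
  by rewrite /p; case: cid.
pose q i := projT1 (cid (hq i)); have qP i : x 0 i < ratr (q i) < x 0 i + e.
  by rewrite /q; case: cid.
exists (\row_i p i, \row_i q i) => //; rewrite /F ifT; last first.
  apply/asboolP => y yb; apply: eU; rewrite -ball_normE/=.
  apply: norm_lt_coord => // i; have := yb i; rewrite !mxE/=.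
  have /andP[a1 _] := pP i; have /andP[_ a2] := qP i => /andP[a3 a4].
  by rewrite distrC ltr_norml ltrBlDr ltrBrDr; apply/andP; split; lra.
move=> i; rewrite !mxE/=.
by have /andP[_ ->] := pP i; have /andP[/ltW -> _] := qP i.
Qed.

Lemma continuous_measurable_rV n (f : 'rV[R]_n -> R) :
  continuous f -> measurable_fun setT f.
Proof.
move=> /continuousP cf; apply: (measurability _ (RGenOpens.measurableE R)).
move=> _ [_ [a [b ->] <-]]; rewrite setTI; apply: open_measurable_rV.
exact/cf/interval_open.
Qed.

End measurable_rV.

(** * Compact supports and bounds on balls *)

Section bounded_support.
Context (R : realType).

(** Compact support in a form that passes to sums, products and derivatives without any topology. *)
Definition bounded_support n (W : zmodType) (f : 'rV[R]_n -> W) :=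
  exists2 M : R, 0 < M & forall x, M <= `|x| -> f x = 0.

Lemma closed_norm_le n (M : R) : closed [set x : 'rV[R]_n | `|x| <= M].
Proof.
apply: (@closed_comp _ _ (fun y : 'rV[R]_n => `|y|) [set r | r <= M]); last exact: closed_le.
by move=> ? _; exact: norm_continuous.
Qed.

Lemma compactly_supportedP n (W : zmodType) (f : 'rV[R]_n -> W) :
  compactly_supported f <-> bounded_support f.
Proof.
split=> [cf|[M M0 h]].
  have [M [Mr Mb]] := compact_bounded cf.
  exists (`|M| + 2); first by rewrite ltr_wpDl.
  move=> x xM; apply: contrapT => fx.
  have : `|x| <= `|M| + 1.
    apply: (Mb (`|M| + 1)); first by rewrite (le_lt_trans (ler_norm _))// ltrDl.
    by apply: subset_closure => /=; apply/eqP.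
  by rewrite leNgt => /negP; apply; apply: lt_le_trans xM; rewrite ltrD2l ltr1n.
apply: bounded_closed_compact; last exact: closed_closure.
exists M; split; first exact: num_real.
move=> N MN x xc.
have : closure [set y | f y != 0] `<=` [set y : 'rV[R]_n | `|y| <= M].
  rewrite closureE => z; apply; split; first exact: closed_norm_le.
  by move=> y /=; apply: contraNT => Hy; apply/eqP/h/ltW; rewrite ltNge.
by move=> /(_ x xc)/= h1; exact: le_trans h1 (ltW MN).
Qed.

Lemma continuous_bounded n (f : 'rV[R]_n -> R) (M : R) : continuous f ->
  exists2 C, 0 < C & forall x, `|x| <= M -> `|f x| <= C.
Proof.
move=> cf.
have cM : compact [set x : 'rV[R]_n | `|x| <= M].
  apply: bounded_closed_compact.
    exists M; split; first exact: num_real.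
    by move=> N MN x /= xM; exact: le_trans xM (ltW MN).
  exact: closed_norm_le.
have := continuous_compact (continuous_subspaceT cf) cM.
move=> /compact_bounded[C [Cr Cb]].
exists (`|C| + 1); first by rewrite ltr_wpDl.
move=> x xM; apply: (Cb (`|C| + 1)).
  by rewrite (le_lt_trans (ler_norm _))// ltrDl.
by exists x.
Qed.

Lemma bounded_support_bounded n (f : 'rV[R]_n -> R) : continuous f ->
  bounded_support f -> exists2 C, 0 < C & forall x, `|f x| <= C.
Proof.
move=> cf [M M0 h]; have [C C0 hC] := continuous_bounded M cf.
exists C => // x; have [/hC//|/ltW /h ->] := leP `|x| M.
by rewrite normr0 ltW.
Qed.

Lemma measurable_norm_le n M : measurable [set x : 'rV[R]_n | `|x| <= M].
Proof.
rewrite -[X in measurable X]setCK; apply: measurableC; apply: open_measurable_rV.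
by rewrite openC; exact: closed_norm_le.
Qed.

Variables (n : nat) (mu : {measure set 'rV[R]_n -> \bar R}).
Hypothesis mu_fin : forall M : R, (mu [set x : 'rV[R]_n | (`|x| <= M)%R] < +oo)%E.

Lemma bounded_support_igr (f : 'rV[R]_n -> R) : measurable_fun setT f ->
  bounded_support f -> (exists C, forall x, `|f x| <= C) -> igr mu f.
Proof.
move=> mf [M M0 h] [C hC].
have C0 : 0 <= C by exact: le_trans (normr_ge0 _) (hC 0).
apply: (@igr_le _ _ _ _ _ (fun x => C * \1_[set x : 'rV[R]_n | `|x| <= M] x)) => //.
  move=> x; rewrite indicE; case: (leP `|x| M) => xM.
    by rewrite mem_set//= mulr1.
  by rewrite (h _ (ltW xM)) normr0 mulr_ge0.
by apply: igrZ; apply: igr_indic => //; exact: measurable_norm_le.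
Qed.

Lemma continuous_igr (f : 'rV[R]_n -> R) : continuous f ->
  bounded_support f -> igr mu f.
Proof.
move=> cf sf; apply: bounded_support_igr => //; first exact: continuous_measurable_rV.
by have [C _ hC] := bounded_support_bounded cf sf; exists C.
Qed.

End bounded_support.

(** * Translation invariance and integrals of derivatives *)

Section divergence.
Context (R : realType).

Lemma lebesgue_rV_fin n (M : R) : (lebesgue_rV [set x : 'rV[R]_n | (`|x| <= M)%R] < +oo)%E.
Proof.
apply: (@le_lt_trans _ _ (lebesgue_rV (box (const_mx (- M - 1) : 'rV[R]_n) (const_mx M)))).
  apply: le_measure; rewrite ?inE; [exact: measurable_norm_le|exact: measurable_box|].
  move=> x /= xM i; rewrite !mxE.
  have := le_trans (coord_norm x i) xM; rewrite ler_norml => /andP[a ->].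
  by rewrite andbT; apply: lt_le_trans a; rewrite gtrBl.
by rewrite lebesgue_rV_box ltry.
Qed.

Lemma rint_shift n (v : 'rV[R]_n) (F : 'rV[R]_n -> R) : igr (@lebesgue_rV R n) F ->
  igr (@lebesgue_rV R n) (fun x => F (x + v)) /\
  \int[@lebesgue_rV R n]_x F (x + v) = \int[@lebesgue_rV R n]_x F x.
Proof.
move=> iF.
have ms : measurable_fun setT (fun x : 'rV[R]_n => x + v).
  apply/measurable_fun_rVP => i.
  rewrite [X in measurable_fun _ X](_ : _ = (fun x : 'rV[R]_n => x 0 i + v 0 i)); last first.
    by apply/funext => x; rewrite mxE.
  by apply: measurable_funD => //; exact: measurable_coord.
pose M : {measure set 'rV[R]_n -> \bar R} :=
  measure_function_pushforward__canonical__measure_function_Measure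
    [the {measure set _ -> \bar R} of @lebesgue_rV R n] ms.
have ME A : measurable A -> M A = lebesgue_rV A by exact: lebesgue_rV_shift.
have E h : measurable_fun setT h -> (forall x, 0 <= h x)%E ->
    (\int[@lebesgue_rV R n]_x h (x + v)%R = \int[@lebesgue_rV R n]_x h x)%E.
  move=> mh h0; have := @ge0_integral_pushforward _ _ _ _ _ _ ms
    [the {measure set _ -> \bar R} of @lebesgue_rV R n] setT h measurableT mh (fun x _ => h0 x).
  rewrite preimage_setT => <-; apply: eq_measure_integral => A mA _; exact: ME.
have mF := igr_meas iF.
have i1 : igr (@lebesgue_rV R n) (fun x => F (x + v)).
  apply: igrP; first exact: measurableT_comp mF ms.
  rewrite (E (fun x => `|F x|%:E)); [exact: igr_lt|by apply/measurable_EFinP; exact: measurableT_comp|].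
  by move=> x; rewrite lee_fin.
split => //.
rewrite /Rintegral; congr fine.
rewrite integralE [RHS]integralE; congr (_ - _)%E.
  rewrite -[RHS]E//; last exact/measurable_funepos/measurable_EFinP.
  by apply: eq_integral => x _; rewrite !funeposE.
rewrite -[RHS]E//; last exact/measurable_funeneg/measurable_EFinP.
by apply: eq_integral => x _; rewrite !funenegE.
Qed.

Lemma derive_line n (F : 'rV[R]_n -> R) x v (t : R) : derivable F (x + t *: v) v ->
  is_derive t 1 (fun s : R => F (x + s *: v)) ('D_v F (x + t *: v)).
Proof.
move=> dF.
have E : (fun h : R => h^-1 *: (((fun s : R => F (x + s *: v)) \o shift t) (h *: 1) - F (x + t *: v)))
  = (fun h => h^-1 *: ((F \o shift (x + t *: v)) (h *: v) - F (x + t *: v))).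
  apply/funext => h /=; congr (_ *: (F _ - _)).
  have -> : h%:A = h by exact: mulr1.
  by rewrite scalerDl addrCA.
by apply: DeriveDef; rewrite /derivable /derive E.
Qed.

Lemma mvt_line n (F : 'rV[R]_n -> R) x v (t : R) : 0 < t ->
  (forall y, derivable F y v) ->
  exists2 s, 0 < s < t & F (x + t *: v) - F x = t * 'D_v F (x + s *: v).
Proof.
move=> t0 dF.
have dl (s : R) : is_derive s 1 (fun s : R => F (x + s *: v)) ('D_v F (x + s *: v)).
  exact: derive_line.
have cl : {within `[0, t], continuous (fun s : R => F (x + s *: v))}.
  by apply: derivable_within_continuous => s _; have [] := dl s.
have [s st] := MVT t0 (fun s _ => dl s) cl.
rewrite scale0r addr0 subr0 => E; exists s; first by move: st; rewrite in_itv.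
by rewrite E mulrC.
Qed.

(** By translation invariance every difference quotient has integral zero. Increments of length at
    most 1 keep the supports in the ball of radius [M + 1], where the mean value theorem bounds the
    quotients by the maximum of the derivative, so dominated convergence applies. *)
Lemma rint_partial0 n (i : 'I_n) (F : 'rV[R]_n -> R) : continuous F ->
  (forall x, derivable F x (delta_mx 0 i)) -> continuous (partial i F) ->
  bounded_support F ->
  igr (@lebesgue_rV R n) (partial i F) /\ \int[@lebesgue_rV R n]_x partial i F x = 0.
Proof.
move=> cF dF cdF [M M0 sF].
pose e : 'rV[R]_n := delta_mx 0 i.
have ne (t : R) : `|t *: e| <= `|t|.
  apply: norm_le_coord => // j; rewrite !mxE eqxx/= normrM.
  by case: (j == i); rewrite ?normr1 ?normr0 ?mulr1 ?mulr0.
pose h (k : nat) : R := k.+1%:R^-1.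
have h0 k : 0 < h k by rewrite invr_gt0.
have h1 k : h k <= 1 by rewrite invf_le1// ler1n.
pose Q k x := (h k)^-1 * (F (x + h k *: e) - F x).
have iF : igr (@lebesgue_rV R n) F.
  by apply: continuous_igr => //; [exact: lebesgue_rV_fin|exists M].
have Qint k : igr (@lebesgue_rV R n) (Q k) /\ \int[@lebesgue_rV R n]_x Q k x = 0.
  have [i1 E] := rint_shift (h k *: e) iF.
  have i2 := igrB i1 iF.
  by split; [exact: igrZ|rewrite rintZ// rintB// E subrr mulr0].
have Qlim x : Q k x @[k --> \oo] --> partial i F x.
  have H := (cvgr_dnbhsP (fun t => t^-1 *: ((F \o shift x) (t *: e) - F x)) 0 _).1 (dF x) h.
  rewrite (_ : (fun k => Q k x) = fun k => (h k)^-1 *: ((F \o shift x) (h k *: e) - F x)).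
    by apply: H; split=> [k|]; [rewrite gt_eqF|exact: cvg_harmonic].
  by apply/funext => k; rewrite /Q/= [x + _]addrC.
have sd : bounded_support (partial i F).
  exists (M + 1); first by rewrite addr_gt0.
  move=> x xM; rewrite -(cvg_lim _ (Qlim x))//; apply: cvg_lim => //.
  rewrite (_ : (fun k => Q k x) = fun=> 0); first exact: cvg_cst.
  apply/funext => k; rewrite /Q !sF ?subrr ?mulr0//.
    by apply: le_trans xM; rewrite lerDl.
  have := lerB_normD x (h k *: e); apply: le_trans; rewrite lerBrDr.
  apply: le_trans xM; rewrite lerD2l; apply: le_trans (ne _) _.
  by rewrite gtr0_norm.
have idF := continuous_igr (@lebesgue_rV_fin n) cdF sd.
split => //.
have [C C0 hC] := bounded_support_bounded cdF sd.
have lim : \int[@lebesgue_rV R n]_x Q k x @[k --> \oo] --> \int[@lebesgue_rV R n]_x partial i F x.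
  have [] // := @rint_dct _ _ _ (@lebesgue_rV R n) Q (partial i F)
      (fun x => C * \1_[set x : 'rV[R]_n | `|x| <= M + 1] x).
  - by move=> k; exact: igr_meas (Qint k).1.
  - exact: igr_meas idF.
  - by apply: aeW => x; exact: Qlim.
  - apply: igrZ; apply: igr_indic; [exact: measurable_norm_le|exact: lebesgue_rV_fin].
  - apply: aeW => x k; rewrite indicE; case: (leP `|x| (M + 1)) => xM.
      rewrite mem_set//= mulr1 /Q.
      have [s _ ->] := mvt_line x (h0 k) dF.
      by rewrite mulKf ?gt_eqF//; exact: hC.
    rewrite memNset/=; last by rewrite leNgt xM.
    rewrite mulr0 /Q !sF ?subrr ?mulr0 ?normr0//.
      by apply: le_trans (ltW xM); rewrite lerDl.
    have := lerB_normD x (h k *: e); apply: le_trans; rewrite lerBrDr.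
    apply: le_trans (ltW xM); rewrite lerD2l; apply: le_trans (ne _) _.
    by rewrite gtr0_norm.
rewrite -(cvg_lim _ lim)//; apply: cvg_lim => //.
rewrite (_ : (fun k => _) = fun=> 0); first exact: cvg_cst.
by apply/funext => k; case: (Qint k).
Qed.

End divergence.

(** * Mass of symmetric semigroups *)

Section time.
Variable R : realType.
Implicit Types (F p q : R -> R) (r s t e c : R).

(** An argument by continuous induction: the bound [F s <= F 0 + e * s] persists up to the supremum
    [r] of the times up to which it holds, by continuity, and beyond [r] by the bound on the right
    derivative, so [r = t]. A right-sided hypothesis is what a semigroup provides. *)
Lemma dini_le F t : 0 <= t ->
  (forall r e, 0 <= r <= t -> 0 < e -> exists2 d, 0 < d &
    forall s, 0 <= s <= t -> `|s - r| <= d -> `|F s - F r| <= e) ->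
  (forall r e, 0 <= r < t -> 0 < e -> exists2 d, 0 < d &
    forall h, 0 < h <= d -> r + h <= t -> F (r + h) <= F r + e * h) ->
  F t <= F 0.
Proof.
move=> t0 Fc Fd; apply/ler_addgt0Pr => e0 e0p.
pose e := e0 / (t + 1); have ep : 0 < e by rewrite divr_gt0// ltr_wpDl.
suff : F t <= F 0 + e * t.
  move=> /le_trans; apply; rewrite lerD2l /e mulrAC ler_pdivrMr ?ltr_wpDl//.
  by rewrite ler_pM2l// lerDl.
pose A := [set r | 0 <= r <= t /\ forall s, 0 <= s <= r -> F s <= F 0 + e * s].
have A0 : A 0.
  split; first by rewrite lexx.
  by move=> s /le_anti <-; rewrite mulr0 addr0.
have At : ubound A t by move=> r [/andP[]].
have supA : has_sup A by split; [exists 0|exists t].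
pose r := sup A.
have r0 : 0 <= r by apply: sup_ubound => //; case: supA.
have rt : r <= t by apply: ge_sup => //; exists 0.
have below s : 0 <= s < r -> F s <= F 0 + e * s.
  move=> /andP[s0 sr]; have [|a [ax aA] sa] := sup_adherent (eps := r - s) _ supA.
    by rewrite subr_gt0.
  apply: aA; rewrite s0/= ltW//; move: sa; rewrite -/r; lra.
have Ar : A r.
  split; first by rewrite r0.
  move=> s /andP[s0]; rewrite le_eqVlt => /predU1P[->|sr]; last first.
    by apply: below; rewrite s0.
  have [->|rn0] := eqVneq r 0; first by rewrite mulr0 addr0.
  apply/ler_addgt0Pr => eta eta0.
  have [||d d0 Hd] := Fc r eta => //; first by rewrite r0.
  have rp : 0 < r by rewrite lt_neqAle eq_sym rn0.
  pose s' := Num.max 0 (r - d).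
  have s'0 : 0 <= s' by rewrite le_max lexx.
  have s'r : s' < r by rewrite gt_max rp/=; lra.
  have := Hd s'; rewrite s'0 (ltW (lt_le_trans s'r rt)) => /(_ isT).
  have -> : `|s' - r| <= d.
    rewrite ltr0_norm ?subr_lt0// opprB lerBlDr -lerBlDl.
    by rewrite le_max lexx orbT.
  move=> /(_ isT); rewrite ler_norml => /andP[H1 _].
  have := below s'; rewrite s'0 s'r => /(_ isT) H2.
  have : e * s' <= e * r by rewrite ler_pM2l// ltW.
  by lra.
move: (rt); rewrite le_eqVlt => /predU1P[<-|rltt].
  by apply: Ar.2; rewrite r0 lexx.
have [||d d0 Hd] := Fd r e => //; first by rewrite r0.
pose d' := Num.min d (t - r).
have d'0 : 0 < d' by rewrite lt_min d0 subr_gt0.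
have : A (r + d').
  have rd't : r + d' <= t by rewrite -lerBrDl ge_min lexx orbT.
  split; first by rewrite rd't addr_ge0// ltW.
  move=> s /andP[s0 srd]; have [sr|rs] := leP s r; first by apply: Ar.2; rewrite s0.
  have := Hd (s - r); rewrite subr_gt0 rs/= subrKC => H.
  apply: le_trans (H _ _) _.
  - by rewrite lerBlDl (le_trans srd)// lerD2l ge_min lexx.
  - exact: le_trans rd't.
  - by have := Ar.2 r; rewrite r0 lexx => /(_ isT); lra.
move=> /(sup_ubound supA.2); rewrite -/r; lra.
Qed.

Local Notation leb := (@lebesgue_measure R).

Definition tint p t : R := \int[leb]_(s in `[0, t]) p s.

Lemma cont_integrable p a b : continuous p -> leb.-integrable `[a, b] (EFin \o p).
Proof.
move=> pc; apply: continuous_compact_integrable; first exact: segment_compact.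
exact: continuous_subspaceT.
Qed.

Lemma tint_step p c r s : continuous p -> 0 <= r -> r <= s ->
  (forall x, r <= x <= s -> p x <= c) -> tint p s - tint p r <= c * (s - r).
Proof.
move=> pc r0 rs px; have pi : leb.-integrable `]r, s] (EFin \o p).
  apply: integrableS (cont_integrable r s pc) => //.
  exact: subset_itv_oc_cc.
rewrite /tint Rintegral_itvB//; [|exact: cont_integrable|by rewrite bnd_simp..].
apply: le_trans (le_Rintegral (f2 := fun=> c) _ _ _ _) _ => //.
- have cc : continuous (fun _ : R => c) by move=> ?; exact: cvg_cst.
  by apply: integrableS (cont_integrable r s cc) => //; exact: subset_itv_oc_cc.
- by move=> x /=; rewrite in_itv/= => /andP[rx xs]; apply: px; rewrite xs ltW.
rewrite Rintegral_cst//= lebesgue_measure_itv/= lte_fin; case: ltP => //= sr.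
by rewrite (_ : s = r) ?subrr//; apply/eqP; rewrite eq_le sr.
Qed.

Lemma tintN p t : continuous p -> tint (fun s => - p s) t = - tint p t.
Proof.
move=> pc; rewrite /tint -mulN1r -RintegralZl//; last exact: cont_integrable.
by apply: eq_Rintegral => s _; rewrite mulN1r.
Qed.

Lemma contN p : continuous p -> continuous (fun s => - p s).
Proof. by move=> pc x; apply: cvgN; exact: pc. Qed.

Lemma tint_step_ge p c r s : continuous p -> 0 <= r -> r <= s ->
  (forall x, r <= x <= s -> c <= p x) -> c * (s - r) <= tint p s - tint p r.
Proof.
move=> pc r0 rs px; have H := @tint_step _ (- c) r s (contN pc) r0 rs.
suff : - (tint p s - tint p r) <= - c * (s - r) by rewrite mulNr lerN2.
rewrite (_ : - _ = tint (fun s => - p s) s - tint (fun s => - p s) r).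
  by apply: H => x /px; rewrite lerN2.
by rewrite !tintN//; ring.
Qed.

Lemma tint0 p : tint p 0 = 0.
Proof. by rewrite /tint set_itv1 Rintegral_set1. Qed.

Lemma tint_dist p r s M : continuous p -> 0 <= r -> r <= s ->
  (forall x, r <= x <= s -> `|p x| <= M) -> `|tint p s - tint p r| <= M * (s - r).
Proof.
move=> pc r0 rs pM; rewrite ler_norml -mulNr; apply/andP; split.
  by apply: tint_step_ge => // x /pM; rewrite ler_norml => /andP[].
by apply: tint_step => // x /pM; rewrite ler_norml => /andP[].
Qed.

Lemma tint_ge0 p t : (forall s, 0 <= s <= t -> 0 <= p s) -> 0 <= tint p t.
Proof. by move=> p0; apply: Rintegral_ge0 => s /=; rewrite in_itv; exact: p0. Qed.

Lemma tint_le p q t : continuous p -> continuous q ->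
  (forall s, 0 <= s <= t -> p s <= q s) -> tint p t <= tint q t.
Proof.
move=> pc qc pq; apply: le_Rintegral => //; exact: cont_integrable.
Qed.

Lemma tintB p q t : continuous p -> continuous q ->
  tint (fun s => p s - q s) t = tint p t - tint q t.
Proof. by move=> pc qc; apply: RintegralB => //; exact: cont_integrable. Qed.

(* Local continuity of p on [0, t] through e-d, as in dini_le. *)
Lemma cont_near p r e : continuous p -> 0 < e ->
  exists2 d, 0 < d & forall s, `|s - r| <= d -> `|p s - p r| <= e.
Proof.
move=> pc e0; have /cvgrPdist_le/(_ _ e0) := pc r.
move=> /nbhs_ballP[d /= d0 H]; exists (d / 2); first by rewrite divr_gt0.
move=> s sr; rewrite distrC; apply: H => /=; rewrite /ball /= distrC.
by apply: le_lt_trans sr _; rewrite ltr_pdivrMr// ltr_pMr// ltr1n.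
Qed.

Lemma cont_eps p : (forall r e, 0 < e ->
  exists2 d, 0 < d & forall s, `|s - r| <= d -> `|p s - p r| <= e) -> continuous p.
Proof.
move=> H r; apply/cvgrPdist_le => e e0; have [d d0 Hd] := H r e e0.
apply/nbhs_ballP; exists d => // s; rewrite /ball /= distrC => /ltW /Hd.
by rewrite distrC.
Qed.

Lemma tint_dct (P : nat -> R -> R) p t M : (forall k, continuous (P k)) ->
  continuous p -> (forall s, 0 <= s <= t -> P k s @[k --> \oo] --> p s) ->
  (forall k s, 0 <= s <= t -> `|P k s| <= M) ->
  tint (P k) t @[k --> \oo] --> tint p t.
Proof.
move=> Pc pc Pp PM.
have mc (f : R -> R) : continuous f -> measurable_fun (`[0, t] : set R) (EFin \o f).
  move=> fc; apply/measurable_EFinP; apply: measurable_funTS.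
  exact: continuous_measurable_fun.
have [||||| _ _] := @dominated_convergence _ _ _ leb `[0, t]%classic
  (measurable_itv _) (fun k => EFin \o P k) (EFin \o p) (EFin \o cst M).
- by move=> k; exact: mc.
- exact: mc.
- by apply: aeW => s; rewrite /= in_itv/= => st; apply: cvgEFin; exact: Pp.
- by apply: cont_integrable => ?; exact: cvg_cst.
- by apply: aeW => s k; rewrite /= in_itv/= lee_fin => st; exact: PM.
move=> H; apply: fine_cvg; move: H; rewrite /tint /Rintegral fineK//.
exact: integrable_fin_num (cont_integrable _ _ pc).
Qed.

(* N + int p is nonincreasing as soon as the right derivative of N is at most
   - p. *)
Lemma dini_tint (N p : R -> R) t : 0 <= t -> continuous N -> continuous p ->
  (forall r e, 0 <= r < t -> 0 < e -> exists2 d, 0 < d &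
    forall h, 0 < h <= d -> r + h <= t -> N (r + h) <= N r + (e - p r) * h) ->
  N t + tint p t <= N 0.
Proof.
move=> t0 Nc pc Nd.
have -> : N 0 = N 0 + tint p 0 by rewrite tint0 addr0.
apply: (@dini_le (fun s => N s + tint p s) t) => //.
- move=> r e /andP[r0 rt] e0; have e2 : 0 < e / 2 by rewrite divr_gt0.
  have [d1 d10 H1] := @cont_near N r _ Nc e2.
  have [d2 d20 H2] := @cont_near p r 1 pc ltr01.
  pose M := `|p r| + 1; have M0 : 0 < M by rewrite ltr_wpDl.
  exists (Num.min d1 (Num.min d2 (e / 2 / M))).
    by rewrite !lt_min d10 d20 divr_gt0.
  move=> s /andP[s0 st]; rewrite !le_min => /andP[s1 /andP[s2 s3]].
  have pM x : `|x - r| <= d2 -> `|p x| <= M.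
    move=> /H2 px; rewrite /M -(subrK (p r) (p x)) (le_trans (ler_normD _ _))//.
    by rewrite addrC lerD2l.
  have : `|tint p s - tint p r| <= M * `|s - r|.
    case: (leP r s) => [rs|/ltW sr].
      rewrite [`|s - r|]ger0_norm ?subr_ge0//; apply: tint_dist => // x /andP[rx xs].
      apply: pM; rewrite ger0_norm ?subr_ge0//.
      by apply: le_trans s2; rewrite ger0_norm ?subr_ge0// lerD2r.
    rewrite distrC [`|s - r|]distrC [`|r - s|]ger0_norm ?subr_ge0//.
    apply: tint_dist => // x /andP[sx xr].
    apply: pM; rewrite distrC ger0_norm ?subr_ge0//.
    by apply: le_trans s2; rewrite distrC ger0_norm ?subr_ge0// lerD2l lerN2.
  have : M * `|s - r| <= e / 2 by rewrite mulrC -ler_pdivlMr.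
  have := H1 _ s1; rewrite !ler_norml => /andP[? ?] ? /andP[? ?].
  by apply/andP; split; lra.
- move=> r e rt e0; have e2 : 0 < e / 2 by rewrite divr_gt0.
  have [d1 d10 H1] := Nd r _ rt e2.
  have [d2 d20 H2] := @cont_near p r _ pc e2.
  exists (Num.min d1 d2); first by rewrite lt_min d10.
  move=> h /andP[h0]; rewrite le_min => /andP[h1 h2] rh.
  have /andP[r0 _] := rt.
  have := @tint_step p (p r + e / 2) r (r + h) pc r0 _ _.
  rewrite lerDl (ltW h0) addrAC subrr add0r => /(_ isT) H3.
  have {}H3 : tint p (r + h) - tint p r <= (p r + e / 2) * h.
    apply: H3 => x /andP[rx xh]; have := H2 x; rewrite ger0_norm ?subr_ge0//.
    rewrite lerBlDl (le_trans xh) ?lerD2l// => /(_ isT).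
    by rewrite ler_norml => /andP[_]; lra.
  by have := H1 h; rewrite h0 h1 => /(_ isT rh); lra.
Qed.

End time.

(** Used at the end of [conserved_of_cutoffs]: [Z] is the initial pairing with the cutoff, [L], [C]
    and [B] are the time integrals for [l], [c] and [b], [I] is the mass at time [t] and [M] the
    initial mass. *)
Lemma cutoff_arith1 (R : realType) (Z L C B I M k e : R) : Z + L <= k * I ->
  - (k * C) - B <= L -> B <= k * e -> - (k * e) <= Z - k * M ->
  k * (M - 2 * e) <= k * (I + C).
Proof. by lra. Qed.

Lemma cutoff_arith2 (R : realType) (D I C H m M e : R) : 0 < e ->
  - (e / 5) <= D - I -> - (e / 5) <= m - C -> m <= H -> M - 2 * (e / 5) <= I + C ->
  D + H <= M -> `|D + H - M| <= e.
Proof. by rewrite ler_norml => *; apply/andP; split; lra. Qed.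

(** What is needed of a convex approximation [q] of the positive part with derivative [dq]. The
    quadratic bounds make the integral of [q (f x)] finite and continuous on L2, the Taylor bound
    stands for a second derivative at most 6, and the last field recovers the positive part by
    rescaling. *)
Record entropy_fun (R : realType) (q dq : R -> R) : Prop := EntropyFun {
  entropy_meas : measurable_fun setT q ;
  entropy_dmeas : measurable_fun setT dq ;
  entropy_ge0 : forall x, 0 <= q x ;
  entropy_neg : forall x, x <= 0 -> q x = 0 ;
  entropy_pos : forall x, 0 < x -> 0 < q x ;
  entropy_sq : forall x, q x <= 3 * x ^+ 2 ;
  entropy_dlin : forall x, `|dq x| <= 6 * `|x| ;
  entropy_lip : forall x y, `|q x - q y| <= `|x - y| ;
  entropy_lip2 : forall x y, `|q x - q y| <= 6 * (`|x| + `|y|) * `|x - y| ;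
  entropy_taylor : forall x y, q (x + y) <= q x + dq x * y + 3 * y ^+ 2 ;
  entropy_lim : forall x N, 0 < N -> `|q (N * x) / N - Num.max x 0| <= N^-1 }.

(** * Contractivity, symmetry and time integrals of the semigroup *)

Section semigroup.
Context d (T : measurableType d) (R : realType) (mu : {measure set T -> \bar R}).
Variable w : T -> R.
Hypotheses (mw : measurable_fun setT w) (wp : forall x, 0 < w x).
Let w0 x : 0 <= w x. Proof. exact: ltW. Qed.

Local Notation sqn := (sqn mu w).
Local Notation isL2 := (isL2 mu w).
Local Notation dt := (dt mu w).
Local Notation nm := (nm mu w).
Implicit Types (f h k u : T -> R) (s t : R).

Let L20 := @L20 _ _ _ mu w mw w0.
Let L2_igr := @L2_igr _ _ _ mu w mw w0.
Let L2_prod := @L2_prod _ _ _ mu w mw w0.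
Let L2_le := @L2_le _ _ _ mu w mw w0.
Let L2D := @L2D _ _ _ mu w mw w0.
Let L2Z := @L2Z _ _ _ mu w mw w0.
Let L2N := @L2N _ _ _ mu w mw w0.
Let L2B := @L2B _ _ _ mu w mw w0.
Let L2_bM := @L2_bM _ _ _ mu w mw w0.
Let L2_abs := @L2_abs _ _ _ mu w mw w0.
Let L2_sum := @L2_sum _ _ _ mu w mw w0.
Let dtDl := @dtDl _ _ _ mu w mw w0.
Let dtZl := @dtZl _ _ _ mu w mw w0.
Let dtBl := @dtBl _ _ _ mu w mw w0.
Let dtDr := @dtDr _ _ _ mu w mw w0.
Let dtZr := @dtZr _ _ _ mu w mw w0.
Let dtBr := @dtBr _ _ _ mu w mw w0.
Let dt_suml := @dt_suml _ _ _ mu w mw w0.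
Let dt_le := @dt_le _ _ _ mu w mw w0.
Let dt_CS := @dt_CS _ _ _ mu w mw w0.
Let nmZ := @nmZ _ _ _ mu w mw w0.
Let nmN := @nmN _ _ _ mu w mw w0.
Let nmD := @nmD _ _ _ mu w mw w0.
Let nmB := @nmB _ _ _ mu w mw w0.
Let nm_dist := @nm_dist _ _ _ mu w mw w0.
Let sqnE := @sqnE _ _ _ mu w mw w0.
Let nm_le := @nm_le _ _ _ mu w mw w0.
Let L2_dct := @L2_dct _ _ _ mu w mw w0.
Let nm2 := @nm2 _ _ _ mu w w0.
Let nm0_ae f := @nm0_ae _ _ _ mu w mw w0 f wp.
Let L2_complete := @L2_complete _ _ _ mu w mw w0 wp.

Let nm_tri f h : isL2 f -> isL2 h -> nm f <= nm (fun x => f x - h x) + nm h.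
Proof.
move=> fi hi; apply: le_trans (nmD (L2B fi hi) hi).
by under [X in _ <= nm X]eq_fun do rewrite subrK.
Qed.

Lemma sqn_cvg0P (F : R -> T -> R) : (forall t, 0 < t -> isL2 (F t)) ->
  sqn (F t) @[t --> 0^'+] --> 0%E <->
  forall e, 0 < e -> exists2 d, 0 < d & forall t, 0 < t <= d -> nm (F t) <= e.
Proof.
move=> Fi; have FE t : 0 < t -> sqn (F t) = (nm (F t) ^+ 2)%:E.
  by move=> t0; apply: sqnE => //; exact: Fi.
split=> [/fine_cvg/cvgrPdist_le H e e0|H].
  have /H/nbhs_ballP[d0 /= d00 Hd] : 0 < e ^+ 2 by rewrite exprn_gt0.
  exists (d0 / 2); first by rewrite divr_gt0.
  move=> t /andP[t0 td]; rewrite -(@ler_pXn2r _ 2) ?nnegrE ?nm_ge0 ?(ltW e0)//.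
  have := Hd t; rewrite /ball/= !sub0r !normrN gtr0_norm// FE//=.
  rewrite ger0_norm ?sqr_ge0//; apply=> //.
  by apply: le_lt_trans td _; rewrite ltr_pdivrMr// ltr_pMr// ltr1n.
apply: (@cvg_trans _ ((nm (F t) ^+ 2)%:E @[t --> 0^'+])).
  apply: near_eq_cvg; near=> t.
  by rewrite FE//; near: t; exact: nbhs_right_gt.
suff Fc : nm (F t) @[t --> 0^'+] --> 0.
  have F2 : nm (F t) * nm (F t) @[t --> 0^'+] --> (0 * 0 : R) := cvgM Fc Fc.
  by rewrite mulr0 in F2; apply: cvgEFin; exact: F2.
apply/cvgrPdist_le => e e0; have [d0 d00 Hd] := H e e0.
near=> t; rewrite sub0r normrN ger0_norm ?nm_ge0//; apply: Hd.
apply/andP; split; near: t; first exact: nbhs_right_gt.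
by apply: nbhs_right_le.
Unshelve. all: by end_near. Qed.

Variables (S : R -> (T -> R) -> T -> R) (op : (T -> R) -> (T -> R) -> Prop).
Hypotheses
  (SL2 : forall t f, 0 <= t -> isL2 f -> isL2 (S t f))
  (Slin : forall t (a : R) f h, 0 <= t -> isL2 f -> isL2 h ->
    \forall x \ae mu, S t (fun y => a * f y + h y) x = a * S t f x + S t h x)
  (Sbd : forall t, 0 <= t -> exists C : R, forall f, isL2 f ->
    (sqn (S t f) <= C%:E * sqn f)%E)
  (S0 : forall f, isL2 f -> \forall x \ae mu, S 0 f x = f x)
  (Sadd : forall s t f, 0 <= s -> 0 <= t -> isL2 f ->
    \forall x \ae mu, S (s + t) f x = S s (S t f) x)
  (Scont : forall f, isL2 f -> sqn (S t f \- f) @[t --> 0^'+] --> 0%E)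
  (Sgen : forall f u, isL2 f -> isL2 u -> op f u <->
    sqn (fun x => t^-1 * (S t f x - f x) - u x) @[t --> 0^'+] --> 0%E)
  (op_L2 : forall f u, op f u -> isL2 f /\ isL2 u)
  (op_sym : forall f u h k, op f u -> op h k -> dt u h = dt f k)
  (op_diss : forall f u, op f u -> dt u f <= 0)
  (op_dense : forall f e, isL2 f -> 0 < e -> exists phi u,
    op phi u /\ nm (fun x => f x - phi x) <= e).

Let nmE f h : isL2 f -> isL2 h -> (\forall x \ae mu, f x = h x) -> nm f = nm h.
Proof. by move=> [mf _] [mh _]; exact: nm_ae. Qed.

Let dtE1 f h k : isL2 f -> isL2 h -> isL2 k -> (\forall x \ae mu, f x = h x) ->
  dt f k = dt h k.
Proof. by move=> [mf _] [mh _] [mk _]; exact: dt_ae. Qed.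

Lemma S_0 t : 0 <= t -> \forall x \ae mu, S t (fun=> 0) x = 0.
Proof.
move=> t0; have z := L20; have := Slin (-1) t0 z z.
rewrite (_ : (fun y : T => -1 * 0 + 0) = (fun=> 0)); last by apply/funext => y; ring.
by apply: filterS => x ->; ring.
Qed.

Lemma SZ t a f : 0 <= t -> isL2 f ->
  \forall x \ae mu, S t (fun y => a * f y) x = a * S t f x.
Proof.
move=> t0 fi; have := Slin a t0 fi (L20).
rewrite (_ : (fun y : T => a * f y + 0) = (fun y => a * f y)); last first.
  by apply/funext => y; ring.
by apply: filterS2 (S_0 t0) => x -> ->; rewrite addr0.
Qed.

Lemma SD t f h : 0 <= t -> isL2 f -> isL2 h ->
  \forall x \ae mu, S t (fun y => f y + h y) x = S t f x + S t h x.
Proof.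
move=> t0 fi hi; have := Slin 1 t0 fi hi.
rewrite (_ : (fun y : T => 1 * f y + h y) = (fun y => f y + h y)); last first.
  by apply/funext => y; ring.
by apply: filterS => x ->; rewrite mul1r.
Qed.

Lemma SB t f h : 0 <= t -> isL2 f -> isL2 h ->
  \forall x \ae mu, S t (fun y => f y - h y) x = S t f x - S t h x.
Proof.
move=> t0 fi hi; have := Slin (-1) t0 hi fi.
rewrite (_ : (fun y : T => -1 * h y + f y) = (fun y => f y - h y)); last first.
  by apply/funext => y; ring.
by apply: filterS => x ->; ring.
Qed.

Lemma S_bound t : 0 <= t -> exists2 C, 0 <= C & forall f, isL2 f ->
  nm (S t f) <= C * nm f.
Proof.
move=> t0; have [C HC] := Sbd t0; exists (Num.sqrt `|C|) => [|f fi].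
  exact: sqrtr_ge0.
have := HC f fi; rewrite !sqnE//; last exact: SL2.
rewrite -EFinM lee_fin => H.
rewrite -(@ler_pXn2r _ 2) ?nnegrE ?nm_ge0 ?mulr_ge0 ?sqrtr_ge0 ?nm_ge0//.
rewrite exprMn (sqr_sqrtr (normr_ge0 C)) (le_trans H)//.
by rewrite ler_wpM2r ?sqr_ge0// ler_norm.
Qed.

Lemma S_right f : isL2 f -> forall e, 0 < e -> exists2 d, 0 < d &
  forall t, 0 < t <= d -> nm (fun x => S t f x - f x) <= e.
Proof.
move=> fi; apply/sqn_cvg0P; last exact: Scont.
by move=> t /ltW t0; apply: L2B => //; exact: SL2.
Qed.

(* Uniform boundedness by a gliding hump: if the operators S (t n), with
   t n -> 0, had norms C n >= 4 ^ n, then an almost optimal choice of signs in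
   x = sum +- 3 ^ - n y n would make S (t n) x unbounded. *)
Lemma S_locally_bounded : exists d M, [/\ 0 < d, 0 <= M &
  forall t f, 0 <= t <= d -> isL2 f -> nm (S t f) <= M * nm f].
Proof.
apply: contrapT => NB.
have key n : exists tyC : R * (T -> R) * R, let: (t, y, C) := tyC in
  [/\ 0 < t <= n.+1%:R^-1, isL2 y /\ nm y <= 1,
      forall f, isL2 f -> nm (S t f) <= C * nm f, 4 ^+ n <= C &
      2 / 3 * C <= nm (S t y)].
  have [[t f]] : exists tf : R * (T -> R), [/\ 0 <= tf.1 <= n.+1%:R^-1, isL2 tf.2 &
      4 ^+ n * nm tf.2 < nm (S tf.1 tf.2)].
    apply: contrapT => H; apply: NB; exists n.+1%:R^-1, (4 ^+ n).
    split; [by rewrite invr_gt0|exact: exprn_ge0|move=> t f tn fi].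
    by rewrite leNgt; apply/negP => Hlt; apply: H; exists (t, f).
  move=> [/= /andP[t0 tn] fi Hf].
  have f0 : 0 < nm f.
    rewrite lt_neqAle nm_ge0 andbT eq_sym; apply/eqP => f0.
    have [C C0 /(_ _ fi)] := S_bound t0.
    by rewrite f0 mulr0 leNgt (le_lt_trans _ Hf)// f0 mulr0.
  have tp : 0 < t.
    rewrite lt_neqAle t0 andbT eq_sym; apply/eqP => tE; move: Hf; rewrite tE.
    rewrite (nmE _ _ (S0 fi))//; last exact: SL2.
    by rewrite ltNge ler_peMl ?nm_ge0// exprn_ege1// ler1n.
  (* The supremum of [A] is the operator norm of [S t]; it serves as [C], and [y] attains it up to a
     third. *)
  pose A := [set c | exists y, [/\ isL2 y, nm y <= 1 & c = nm (S t y)]].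
  have ub : has_sup A.
    split; first by exists (nm (S t (fun=> 0))), (fun=> 0); split=> //;
      rewrite nm0.
    have [C C0 HC] := S_bound t0; exists C => _ [y [yi y1 ->]].
    by apply: le_trans (HC y yi) _; rewrite ler_piMr.
  have fA h : isL2 h -> 0 < nm h -> nm (S t h) / nm h <= sup A.
    move=> hi h0; apply: sup_ubound; first by case: ub.
    exists (fun x => (nm h)^-1 * h x); split; first exact: L2Z.
      by rewrite nmZ// ger0_norm ?invr_ge0 ?nm_ge0// mulVf// gt_eqF.
    rewrite (nmE _ _ (SZ _ t0 hi)); [|by apply: SL2 => //; exact: L2Z|].
      by rewrite (nmZ _ (SL2 t0 hi)) ger0_norm ?invr_ge0 ?nm_ge0// mulrC.
    by apply: L2Z; exact: SL2.
  have A4 : 4 ^+ n < sup A.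
    by apply: lt_le_trans (fA f fi f0); rewrite ltr_pdivlMr.
  have A0 : 0 < sup A by apply: lt_trans A4; rewrite exprn_gt0.
  have [|_ [y [yi y1 ->]] Hy] := sup_adherent (eps := sup A / 3) _ ub.
    by rewrite divr_gt0.
  exists (t, y, sup A); split=> //; [by rewrite tp| |exact: ltW|]; last by lra.
  move=> h hi; have := nm_ge0 mu w h; rewrite le_eqVlt => /predU1P[h0|h0].
    have [C C0 /(_ _ hi)] := S_bound t0.
    by rewrite -h0 !mulr0.
  by rewrite -ler_pdivrMr//; exact: fA.
have {key} /choice[F HF] := key.
pose tt n := (F n).1.1; pose y n := (F n).1.2; pose C n := (F n).2.
have {HF} HF n : [/\ 0 < tt n <= n.+1%:R^-1, isL2 (y n) /\ nm (y n) <= 1,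
      forall f, isL2 f -> nm (S (tt n) f) <= C n * nm f, 4 ^+ n <= C n &
      2 / 3 * C n <= nm (S (tt n) (y n))].
  by have := HF n; rewrite /tt /y /C; case: (F n) => [[? ?] ?].
pose a n : R := 3^-1 ^+ n.
have a0 n : 0 < a n by rewrite exprn_gt0// invr_gt0.
pose plus n x := fun z => x z + a n * y n z.
pose minus n x := fun z : T => x z - a n * y n z.
(* The difference of the two candidates is [2 * a n * y n], so at least one of their images has norm
   [a n * nm (S (tt n) (y n))] or more; the sign is chosen accordingly. *)
pose step n x := if a n * nm (S (tt n) (y n)) <= nm (S (tt n) (plus n x))
  then plus n x else minus n x.
pose fix X n : T -> R := if n is m.+1 then step m (X m) else (fun=> 0).
have yi n : isL2 (y n) by have [_ []] := HF n.
have Xi n : isL2 (X n).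
  elim: n => [|n IH]; first exact: L20.
  by rewrite /= /step; case: ifP => _; [apply: L2D|apply: L2B] => //; exact: L2Z.
have tt0 n : 0 <= tt n by have [/andP[/ltW]] := HF n.
have big n : a n * nm (S (tt n) (y n)) <= nm (S (tt n) (X n.+1)).
  rewrite /= /step; case: ifP => // /negbT; rewrite -ltNge => lt1.
  have yn := L2Z (a n) (yi n).
  have Sy : isL2 (fun z => a n * S (tt n) (y n) z) by apply: L2Z => //; exact: SL2.
  have SX := SL2 (tt0 n) (Xi n).
  have E1 : nm (S (tt n) (plus n (X n))) =
      nm (fun z => S (tt n) (X n) z + a n * S (tt n) (y n) z).
    apply: nmE; [by apply: SL2 => //; exact: L2D|exact: L2D|].
    apply: filterS2 (SD (tt0 n) (Xi n) yn) (SZ (a n) (tt0 n) (yi n)) => z.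
    by move=> -> ->.
  have E2 : nm (S (tt n) (minus n (X n))) =
      nm (fun z => S (tt n) (X n) z - a n * S (tt n) (y n) z).
    apply: nmE; [by apply: SL2 => //; exact: L2B|exact: L2B|].
    apply: filterS2 (SB (tt0 n) (Xi n) yn) (SZ (a n) (tt0 n) (yi n)) => z.
    by move=> -> ->.
  have : nm (fun z => 2 * (a n * S (tt n) (y n) z)) <=
      nm (S (tt n) (plus n (X n))) + nm (S (tt n) (minus n (X n))).
    rewrite E1 E2; apply: le_trans (nmB (L2D SX Sy) (L2B SX Sy)).
    by rewrite le_eqVlt; apply/orP; left; apply/eqP; congr nm; apply/funext => z; ring.
  rewrite (nmZ _ Sy) (nmZ _ (SL2 (tt0 n) (yi n))) ger0_norm// gtr0_norm//.
  by move: lt1; rewrite E1; lra.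
have aS n : a n.+1 = a n / 3 by rewrite /a exprS mulrC.
have dX n : nm (fun z => X n.+1 z - X n z) <= a n.
  have [_ [_ y1] _ _ _] := HF n.
  have : nm (fun z => a n * y n z) <= a n.
    by rewrite nmZ// gtr0_norm// ger_pMr.
  rewrite /= /step; case: ifP => _; [move=> H|rewrite -(nmN) => [H|]; last exact: L2Z];
    by apply: le_trans H; rewrite le_eqVlt; apply/orP; left; apply/eqP;
    congr nm; apply/funext => z; rewrite /plus /minus; ring.
have dXm m n : (m <= n)%N -> nm (fun z => X n z - X m z) <= 3 / 2 * (a m - a n).
  elim: n => [|n IH].
    rewrite leqn0 => /eqP ->; rewrite subrr mulr0.
    by under eq_fun do rewrite subrr; rewrite nm0.
  rewrite leq_eqVlt => /predU1P[->|].
    by under eq_fun do rewrite subrr; rewrite nm0 subrr mulr0.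
  rewrite ltnS => /IH {}IH; apply: le_trans (nm_dist (Xi n.+1) (Xi n) (Xi m)) _.
  by have := dX n; rewrite aS; lra.
have a_cvg : a n @[n --> \oo] --> 0.
  by apply: cvg_expr; rewrite ger0_norm ?invr_ge0// invf_lt1// ltr1n.
have [|x xi Xx] := L2_complete Xi.
  move=> e e0; have [|N HN] := (cvgnP _ _).1 a_cvg (e / 3); first by rewrite divr_gt0.
  exists N => m n Nm Nn.
  wlog mn : m n Nm Nn / (n <= m)%N.
    move=> H; have [/H|/ltnW/H] := leqP n m; first exact.
    by rewrite nm_distC; apply.
  apply: le_trans (dXm _ _ mn) _; have := HN n Nn; have := a0 m.
  by rewrite subr0 (gtr0_norm (a0 n)); lra.
have xX n : nm (fun z => x z - X n z) <= 3 / 2 * a n.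
  apply/ler_addgt0Pr => e e0; have [N HN] := (cvgnP _ _).1 Xx e e0.
  have := HN (maxn N n) (leq_maxl _ _); rewrite subr0 ger0_norm ?nm_ge0// => H1.
  have := dXm n (maxn N n) (leq_maxr _ _); have := a0 (maxn N n).
  rewrite nm_distC in H1.
  have := nm_dist xi (Xi (maxn N n)) (Xi n).
  by lra.
(* The [n]-th term contributes at least [2/3 * a n * C n] and the later ones take away at most
   [3/2 * a n.+1 * C n = 1/2 * a n * C n]. The rest is [1/6 * a n * C n], where [a n = 3 ^- n] and
   [C n >= 4 ^+ n]. *)
have Sx n : 6^-1 * (4 / 3) ^+ n <= nm (S (tt n) x).
  have [_ _ HC C4 Cy] := HF n.
  have Cp : 0 < C n by apply: lt_le_trans C4; rewrite exprn_gt0.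
  have h1 : nm (S (tt n) (X n.+1)) <= nm (S (tt n) x) + C n * (3 / 2 * a n.+1).
    have := nm_tri (SL2 (tt0 n) (Xi n.+1)) (SL2 (tt0 n) xi).
    rewrite addrC => /le_trans; apply; rewrite lerD2l.
    rewrite nm_distC -(nmE _ _ (SB (tt0 n) xi (Xi n.+1))); first last.
    - by apply: L2B => //; exact: SL2.
    - by apply: SL2 => //; exact: L2B.
    by apply: le_trans (HC _ _) _; [exact: L2B|rewrite ler_pM2l].
  have h2 := big n.
  have h3 : a n * (2 / 3 * C n) <= a n * nm (S (tt n) (y n)) by rewrite ler_pM2l.
  have h4 : 6^-1 * (a n * C n) <= nm (S (tt n) x) by rewrite aS in h1; lra.
  apply: le_trans h4; rewrite ler_pM2l ?invr_gt0// exprMn -/(a n) mulrC.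
  by rewrite ler_pM2l.
have [d0 d00 Hd0] := S_right xi ltr01.
have bern n : 1 + n%:R / 3 <= (4 / 3) ^+ n :> R.
  elim: n => [|n IH]; first by rewrite mul0r addr0 expr0.
  rewrite exprS -natr1; have : 0 <= n%:R :> R by [].
  by lra.
(* The first entry puts [tt n.+1] below [d0], so that strong continuity bounds the image of [x] by
   [nm x + 1]; the second makes the lower bound [Sx], through Bernoulli's inequality, larger than
   that. *)
pose c := Num.max d0^-1 (18 * (nm x + 1)).
pose n := Num.truncn c.
have cn : c < n.+1%:R.
  by rewrite truncnS_gt// le_max invr_ge0 ltW.
have tn : tt n.+1 <= d0.
  have [/andP[_ tn] _ _ _ _] := HF n.+1; apply: le_trans tn _.
  rewrite invf_ple ?posrE//.
  have hc : d0^-1 <= c by rewrite le_max lexx.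
  by apply: (le_trans hc); apply: (le_trans (ltW cn)); rewrite ler_nat.
have [/andP[tp _] _ _ _ _] := HF n.+1.
have := Hd0 (tt n.+1); rewrite tp tn => /(_ isT) H1.
have H2 : nm (S (tt n.+1) x) <= 1 + nm x.
  have := nm_tri (SL2 (tt0 n.+1) xi) xi.
  by move: H1; lra.
have H3 : 18 * (nm x + 1) < n.+1%:R.
  by apply: le_lt_trans cn; rewrite le_max lexx orbT.
move: (Sx n.+1) (bern n.+1) H2 H3.
by move: ((4 / 3) ^+ n.+1) (nm (S (tt n.+1) x)) (nm x) (n.+1%:R : R) => *; lra.
Qed.

Let qd s f u := fun x => s^-1 * (S s f x - f x) - u x.

Let qd_L2 s f u : 0 <= s -> isL2 f -> isL2 u -> isL2 (qd s f u).
Proof. by move=> s0 fi ui; apply: L2B => //; apply: L2Z; apply: L2B => //; exact: SL2. Qed.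

Let op_qd f u : isL2 f -> isL2 u -> op f u <->
  forall e, 0 < e -> exists2 d, 0 < d & forall s, 0 < s <= d -> nm (qd s f u) <= e.
Proof.
move=> fi ui; rewrite (Sgen fi ui); apply: sqn_cvg0P => s s0.
by apply: qd_L2 => //; exact: ltW.
Qed.

Let S_qd t s f u : 0 <= t -> 0 < s -> isL2 f -> isL2 u ->
  nm (fun x => s^-1 * (S (t + s) f x - S t f x) - S t u x) = nm (S t (qd s f u)).
Proof.
move=> t0 /ltW s0 fi ui.
have Sf := SL2 s0 fi; have Df := L2B Sf fi.
apply: nmE.
- by apply: L2B; [apply: L2Z; apply: L2B|]; apply: SL2 => //; exact: addr_ge0.
- by apply: SL2 => //; exact: qd_L2.
- have H1 := SB t0 (L2Z s^-1 Df) ui; have H2 := SZ s^-1 t0 Df; have H3 := SB t0 Sf fi.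
  have H4 := Sadd t0 s0 fi.
  apply: filterS3 H1 H2 (filterI H3 H4) => x E1 E2 [E3 E4].
  by rewrite E4 /qd E1 E2 E3.
Qed.

(** [S t] is bounded and commutes with difference quotients, so it preserves the domain and commutes
    with the generator. *)
Lemma op_S t f u : 0 <= t -> op f u -> op (S t f) (S t u).
Proof.
move=> t0 fu; have [fi ui] := op_L2 fu; have [C C0 HC] := S_bound t0.
apply/(op_qd (SL2 t0 fi) (SL2 t0 ui)) => e e0.
have C1 : 0 < C + 1 by rewrite ltr_wpDl.
have [d0 d00 Hd] := (op_qd fi ui).1 fu (e / (C + 1)) (divr_gt0 e0 C1).
exists d0 => // s sd; have /andP[s0 _] := sd; have s0' := ltW s0.
have -> : nm (qd s (S t f) (S t u)) = nm (S t (qd s f u)).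
  rewrite -S_qd//; apply: nmE; first by apply: qd_L2 => //; exact: SL2.
    by apply: L2B; [apply: L2Z; apply: L2B|]; apply: SL2 => //; exact: addr_ge0.
  have := Sadd s0' t0 fi; rewrite addrC; apply: filterS => x E.
  by rewrite /qd E.
apply: le_trans (HC _ (qd_L2 s0' fi ui)) _.
apply: le_trans (_ : C * (e / (C + 1)) <= _); first by rewrite ler_wpM2l// Hd.
rewrite mulrCA ler_piMr// ?(ltW e0)// ler_pdivrMr// mul1r lerDl.
exact: ler01.
Qed.

Let S_diff M d0 r s f : 0 <= r -> r <= s -> s <= d0 -> 0 <= M ->
  (forall t f, 0 <= t <= d0 -> isL2 f -> nm (S t f) <= M * nm f) -> isL2 f ->
  nm (fun x => S s f x - S r f x) <= M * nm (fun x => S (s - r) f x - f x).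
Proof.
move=> r0 rs sd M0 HM fi; have sr : 0 <= s - r by rewrite subr_ge0.
have Sf := SL2 sr fi; have Df := L2B Sf fi.
have s0 := le_trans r0 rs.
rewrite (nmE (h := S r (fun x => S (s - r) f x - f x))).
- by apply: HM => //; rewrite r0 (le_trans rs).
- by apply: L2B; exact: SL2.
- exact: SL2.
- have := Sadd r0 sr fi; rewrite subrKC => H1.
  by apply: filterS2 H1 (SB r0 Sf fi) => x -> ->.
Qed.

Let sqr_diff (a b c : R) : 0 <= a -> 0 <= b -> `|a - b| <= c ->
  `|a ^+ 2 - b ^+ 2| <= c * (a + b).
Proof.
by move=> a0 b0 ab; rewrite subr_sqr normrM [`|a + b|]ger0_norm ?addr_ge0// ler_wpM2r// addr_ge0.
Qed.

Let nm_diff f h : isL2 f -> isL2 h -> `|nm f - nm h| <= nm (fun x => f x - h x).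
Proof.
move=> fi hi; rewrite ler_norml; apply/andP; split.
  by rewrite lerNl opprB lerBlDr nm_distC; exact: nm_tri.
by rewrite lerBlDr; exact: nm_tri.
Qed.

Let nm_expand c f h : isL2 f -> isL2 h ->
  nm (fun x => f x + c * h x) ^+ 2 = nm f ^+ 2 + 2 * c * dt h f + c ^+ 2 * nm h ^+ 2.
Proof.
move=> fi hi; have ci := L2Z c hi; rewrite !nm2 (dtDl fi ci (L2D fi ci)) (dtDr fi ci fi) (dtDr fi ci ci).
rewrite (dtZr c hi fi) (dtZl c hi fi) (dtZl c hi ci) (dtZr c hi hi).
by rewrite (dtC _ _ f h); ring.
Qed.

(** On the domain the squared norm of [S t f] has derivative [2 * dt (S t u) (S t f)], which
    dissipativity makes nonpositive. The uniform bound on [[0, d]] gives the continuity that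
    [dini_le] asks for and extends the estimate by density. *)
Lemma S_contr_local : exists2 d, 0 < d & forall t f, 0 <= t <= d -> isL2 f ->
  nm (S t f) <= nm f.
Proof.
have [d0 [M [d00 M0 HM]]] := S_locally_bounded; exists d0 => // t f.
have opc r g u : 0 <= r <= d0 -> op g u -> nm (S r g) <= nm g.
  move=> {t f} /andP[t0 td] gu; move: r t0 td => t t0 td; have [fi ui] := op_L2 gu.
  have HM' s : 0 <= s <= t -> nm (S s g) <= M * nm g.
    by move=> /andP[s0 st]; apply: HM => //; rewrite s0 (le_trans st).
  have HMu s : 0 <= s <= t -> nm (S s u) <= M * nm u.
    by move=> /andP[s0 st]; apply: HM => //; rewrite s0 (le_trans st).
  rewrite -(@ler_pXn2r _ 2) ?nnegrE ?nm_ge0//.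
  have -> : nm g ^+ 2 = nm (S 0 g) ^+ 2.
    by congr (_ ^+ 2); apply: nmE => //; [exact: SL2|apply: filterS (S0 fi) => x ->].
  apply: (@dini_le _ (fun s => nm (S s g) ^+ 2)) => //.
  - move=> r e /andP[r0 rt] e0.
    pose K := M * (2 * (M * nm g)) + 1.
    have K0 : 0 < K by rewrite ltr_wpDl// !mulr_ge0// nm_ge0.
    have [d1 d10 Hd1] := S_right fi (divr_gt0 e0 K0).
    exists d1 => // s /andP[s0 st] sr.
    wlog rs : r s r0 rt s0 st sr / r < s.
      move=> H; have [rs|sr'|->] := ltgtP r s; first exact: H.
        by rewrite distrC; apply: H => //; rewrite distrC.
      by rewrite subrr normr0 ltW.
    apply: le_trans (sqr_diff (nm_ge0 _ _ _) (nm_ge0 _ _ _)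
      (le_trans (nm_diff (SL2 s0 fi) (SL2 r0 fi))
      (S_diff r0 (ltW rs) (le_trans st td) M0 HM fi))) _.
    have h1 : nm (S s g) + nm (S r g) <= 2 * (M * nm g).
      by rewrite mulr2n mulrDl !mul1r lerD// HM' ?s0 ?r0.
    have h2 : nm (fun x => S (s - r) g x - g x) <= e / K.
      apply: Hd1; rewrite subr_gt0 rs/=.
      by move: sr; rewrite gtr0_norm// subr_gt0.
    apply: le_trans (ler_pM _ _ (ler_wpM2l M0 h2) h1) _.
    - by rewrite mulr_ge0// nm_ge0.
    - by rewrite addr_ge0// nm_ge0.
    rewrite (_ : M * (e / K) * _ = e / K * (K - 1)); last by rewrite /K; ring.
    by rewrite mulrAC ler_pdivrMr// ler_pM2l// lerBlDr lerDl ler01.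
  - move=> r e /andP[r0 rt] e0; have rd := le_trans (ltW rt) td.
    (* Chosen so that the error in the linear term and the whole quadratic term, each of size
       [s * (e / K)] times a summand of [K], add up to at most [e * s]. *)
    pose K := 2 * (M * nm g) + (M * nm u + M) ^+ 2 + 1.
    have K0 : 0 < K by rewrite ltr_wpDl// addr_ge0 ?sqr_ge0// !mulr_ge0// nm_ge0.
    have eK0 : 0 < Num.min 1 (e / K / (M + 1)) by rewrite lt_min ltr01 !divr_gt0// ltr_wpDl.
    have [d1 d10 Hd1] := (op_qd fi ui).1 gu _ eK0.
    pose d2 := Num.min d1 (e / K); exists d2; first by rewrite lt_min d10 divr_gt0.
    move=> s /andP[s0]; rewrite le_min => /andP[sd1 sd2] rst.
    have rs0 : 0 <= r + s by rewrite addr_ge0// ltW.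
    have [ai ui'] := (SL2 r0 fi, SL2 r0 ui).
    pose v := fun x => s^-1 * (S (r + s) g x - S r g x).
    have vi : isL2 v by apply: L2Z; apply: L2B => //; exact: SL2.
    have -> : S (r + s) g = fun x => S r g x + s * v x.
      by apply/funext => x; rewrite /v mulrA divff ?gt_eqF// mul1r subrKC.
    rewrite nm_expand//.
    have rr : 0 <= r <= t by rewrite r0 ltW.
    have hD : nm (fun x => v x - S r u x) <= M * Num.min 1 (e / K / (M + 1)).
      rewrite S_qd//; apply: le_trans (HM _ _ _ _) _.
      + by rewrite r0.
      + by apply: qd_L2 => //; exact: ltW.
      + by apply: ler_wpM2l => //; apply: Hd1; rewrite s0.
    have hD1 : nm (fun x => v x - S r u x) <= M.
      by apply: le_trans hD _; rewrite ler_piMr// ge_min lexx.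
    have hD2 : nm (fun x => v x - S r u x) <= e / K.
      apply: le_trans hD _; apply: le_trans (_ : M * (e / K / (M + 1)) <= _).
        by rewrite ler_wpM2l// ge_min lexx orbT.
      rewrite mulrCA ler_piMr ?divr_ge0 ?(ltW e0) ?(ltW K0)//.
      by rewrite ler_pdivrMr ?ltr_wpDl// mul1r lerDl.
    have hv : nm v <= M * nm u + M.
      apply: le_trans (nm_tri vi ui') _.
      by have := HMu _ rr; lra.
    have hdt : dt v (S r g) <= e / K * (M * nm g).
      have := op_diss (op_S r0 gu).
      have := dtBl vi ui' ai; have := dt_CS (L2B vi ui') ai.
      rewrite ler_norml => /andP[_ h1] h2 h3.
      have : nm (fun x => v x - S r u x) * nm (S r g) <= e / K * (M * nm g).
        by apply: ler_pM => //; [exact: nm_ge0|exact: nm_ge0|exact: HM'].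
      by move: h1; rewrite h2; lra.
    have hv2 : nm v ^+ 2 <= (M * nm u + M) ^+ 2.
      by rewrite lerXn2r ?nnegrE ?nm_ge0// addr_ge0// mulr_ge0// nm_ge0.
    rewrite -addrA lerD2l.
    have b1 : 2 * s * dt v (S r g) <= 2 * s * (e / K * (M * nm g)).
      by rewrite ler_pM2l// mulr_gt0.
    have b2 : s ^+ 2 * nm v ^+ 2 <= s * (e / K) * (M * nm u + M) ^+ 2.
      apply: ler_pM => //; first exact: sqr_ge0.
        exact: sqr_ge0.
      by rewrite expr2 ler_pM2l.
    apply: le_trans (lerD b1 b2) _.
    have -> : 2 * s * (e / K * (M * nm g)) + s * (e / K) * (M * nm u + M) ^+ 2 =
      s * (e / K) * (K - 1) by rewrite /K; ring.
    rewrite [leRHS]mulrC -mulrA ler_pM2l// mulrAC ler_pdivrMr//.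
    by rewrite ler_pM2l// lerBlDr lerDl ler01.
move=> tt fi.
apply/ler_addgt0Pr => e e0.
have M1 : 0 < M + 1 by rewrite ltr_wpDl.
have [phi [u [pu fp]]] := op_dense fi (divr_gt0 e0 M1).
have [pi ui] := op_L2 pu; have /andP[t0 _] := tt.
have h1 := nm_tri (SL2 t0 fi) (SL2 t0 pi).
have h2 : nm (fun x => S t f x - S t phi x) <= M * (e / (M + 1)).
  rewrite -(nmE _ _ (SB t0 fi pi)).
  - by apply: le_trans (HM _ _ tt (L2B fi pi)) _; rewrite ler_wpM2l.
  - by apply: SL2 => //; exact: L2B.
  - by apply: L2B; exact: SL2.
have h3 := opc _ _ _ tt pu.
have h4 : nm phi <= e / (M + 1) + nm f.
  by apply: le_trans (nm_tri pi fi) _; rewrite lerD2r nm_distC.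
have h5 : M * (e / (M + 1)) + e / (M + 1) = e.
  by rewrite -[X in _ + X]mul1r -mulrDl mulrC divfK// gt_eqF.
by lra.
Qed.

Lemma S_contr t f : 0 <= t -> isL2 f -> nm (S t f) <= nm f.
Proof.
have [d0 d00 H] := S_contr_local.
suff main n s h : 0 <= s <= n%:R * d0 -> isL2 h -> nm (S s h) <= nm h.
  move=> t0 fi; apply: (main (Num.truncn (t / d0)).+1) => //.
  by rewrite t0/= -ler_pdivrMr// ltW// truncnS_gt// divr_ge0// ltW.
elim: n s h => [|n IH] s h /andP[s0 sn] hi.
  by apply: H => //; rewrite s0 (le_trans sn)// mul0r ltW.
have [sd|ds] := leP s d0; first by apply: H => //; rewrite s0.
have sd0 : 0 <= s - d0 by rewrite subr_ge0 ltW.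
have Sdi := SL2 (ltW d00) hi.
rewrite (nmE (h := S (s - d0) (S d0 h))); [|exact: SL2|exact: SL2|].
  apply: le_trans (IH _ _ _ Sdi) _; last by apply: H => //; rewrite lexx ltW.
  rewrite sd0/= lerBlDr; apply: (le_trans sn); rewrite -natr1.
  by rewrite mulrDl mul1r.
by have := Sadd sd0 (ltW d00) hi; rewrite subrK.
Qed.

Lemma S_dist r s f : 0 <= r -> 0 <= s -> isL2 f ->
  nm (fun x => S s f x - S r f x) <= nm (fun x => S `|s - r| f x - f x).
Proof.
move=> r0 s0 fi; wlog rs : r s r0 s0 / r <= s.
  move=> H; have [/H|/ltW/H] := leP r s; first exact.
  by rewrite nm_distC distrC; apply.
rewrite ger0_norm ?subr_ge0// -[leRHS]mul1r.
apply: (@S_diff 1 s) => // t h /andP[t0 _] hi.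
by rewrite mul1r; exact: S_contr.
Qed.

Lemma S_cont f e : isL2 f -> 0 < e -> exists2 d, 0 < d & forall r s, 0 <= r ->
  0 <= s -> `|s - r| <= d -> nm (fun x => S s f x - S r f x) <= e.
Proof.
move=> fi e0; have [d0 d00 H] := S_right fi e0; exists d0 => // r s r0 s0 rs.
apply: le_trans (S_dist r0 s0 fi) _; have [E|n0] := eqVneq `|s - r| 0.
  rewrite E; have -> : nm (fun x => S 0 f x - f x) = nm (fun=> 0).
    apply: nmE => //; first by apply: L2B => //; exact: SL2.
    by apply: filterS (S0 fi) => x ->; rewrite subrr.
  by rewrite nm0 ltW.
by apply: H; rewrite rs andbT lt_neqAle eq_sym n0 /=.
Qed.

Lemma S_der f u e : op f u -> 0 < e -> exists2 d, 0 < d & forall t s, 0 <= t ->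
  0 < s <= d -> nm (fun x => S (t + s) f x - S t f x - s * S t u x) <= e * s.
Proof.
move=> fu e0; have [fi ui] := op_L2 fu.
have [d0 d00 H] := (op_qd fi ui).1 fu e e0; exists d0 => // t s t0 sd.
have /andP[s0 _] := sd.
have Si : isL2 (fun x => s^-1 * (S (t + s) f x - S t f x) - S t u x).
  apply: L2B; last exact: SL2.
  by apply/L2Z/L2B; apply: SL2 => //; rewrite addr_ge0// ltW.
have -> : (fun x => S (t + s) f x - S t f x - s * S t u x) =
    (fun x => s * (s^-1 * (S (t + s) f x - S t f x) - S t u x)).
  by apply/funext => x; field; rewrite gt_eqF.
rewrite nmZ// gtr0_norm// mulrC ler_pM2r// S_qd//.
apply: le_trans (S_contr t0 _) (H _ sd).
by apply: qd_L2 => //; exact: ltW.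
Qed.

(** The function [G s = dt (S s f) (S (t - s) h)] has derivative zero because the operator is
    symmetric; its two end values are the two sides. *)
Lemma S_sym_op f u h k t : op f u -> op h k -> 0 <= t -> dt (S t f) h = dt f (S t h).
Proof.
move=> fu hk t0; have [fi ui] := op_L2 fu; have [hi ki] := op_L2 hk.
pose G s := dt (S s f) (S (t - s) h).
have G_Lip e : 0 < e -> exists2 d, 0 < d & forall r s, 0 <= r -> r + s <= t ->
    0 < s <= d -> `|G (r + s) - G r| <= e * s.
  move=> e0; pose K := nm f + nm h + nm u + nm k + 1.
  have [nf nh nu nk] := And4 (nm_ge0 mu w f) (nm_ge0 mu w h) (nm_ge0 mu w u) (nm_ge0 mu w k).
  have K0 : 0 < K by rewrite /K; lra.
  have eK : 0 < e / K by rewrite divr_gt0.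
  have [d1 d10 H1] := S_der fu eK; have [d2 d20 H2] := S_der hk eK.
  exists (Num.min d1 d2); first by rewrite lt_min d10.
  move=> r s r0 rst /andP[s0]; rewrite le_min => /andP[sd1 sd2].
  pose q := t - (r + s); have q0 : 0 <= q by rewrite subr_ge0.
  have qs : q + s = t - r by rewrite /q; ring.
  have [rs0 q0'] : 0 <= r + s /\ 0 <= q + s by split; apply: addr_ge0 => //; exact: ltW.
  pose a := S r f; pose b := S q h.
  have [ai bi] : isL2 a /\ isL2 b by split; exact: SL2.
  pose a' := S r u; pose b' := S q k.
  have [a'i b'i] : isL2 a' /\ isL2 b' by split; exact: SL2.
  (* The first-order terms cancel by [op_sym], and only the two Taylor remainders are left. *)
  have EG : G (r + s) - G r =
      dt (fun x => S (r + s) f x - S r f x - s * a' x) b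
      - dt a (fun x => S (q + s) h x - S q h x - s * b' x).
    have [x1 x2] : isL2 (S (r + s) f) /\ isL2 (S (q + s) h) by split; exact: SL2.
    have [y1 y2] := (L2Z s a'i, L2Z s b'i).
    rewrite /G -/q -qs (dtBl (L2B x1 ai) y1 bi) (dtBl x1 ai bi) (dtZl s a'i bi).
    rewrite (dtBr (L2B x2 bi) y2 ai) (dtBr x2 bi ai) (dtZr s b'i ai).
    by rewrite (op_sym (op_S r0 fu) (op_S q0 hk)); ring.
  have na : nm a <= nm f by exact: S_contr.
  have nb : nm b <= nm h by exact: S_contr.
  rewrite EG; apply: le_trans (ler_normB _ _) _.
  have ss : 0 < s <= d1 by rewrite s0. have ss2 : 0 < s <= d2 by rewrite s0.
  have c1 := H1 r s r0 ss; have c2 := H2 q s q0 ss2.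
  have D1 : isL2 (fun x => S (r + s) f x - S r f x - s * a' x).
    by apply: L2B; [apply: L2B => //; exact: SL2|exact: L2Z].
  have D2 : isL2 (fun x => S (q + s) h x - S q h x - s * b' x).
    by apply: L2B; [apply: L2B => //; exact: SL2|exact: L2Z].
  apply: le_trans (lerD (dt_CS D1 bi) (dt_CS ai D2)) _.
  have p1 := ler_pM (nm_ge0 _ _ _) (nm_ge0 _ _ _) c1 nb.
  have p2 := ler_pM (nm_ge0 _ _ _) (nm_ge0 _ _ _) na c2.
  apply: le_trans (lerD p1 p2) _.
  rewrite (_ : _ + _ = e / K * (nm f + nm h) * s); last by ring.
  rewrite ler_pM2r// mulrAC ler_pdivrMr// ler_pM2l// /K; lra.
have Gc r e : 0 <= r <= t -> 0 < e -> exists2 d, 0 < d &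
    forall s, 0 <= s <= t -> `|s - r| <= d -> `|G s - G r| <= e.
  move=> /andP[r0 rt] e0; have [d0 d00 H] := G_Lip 1 ltr01.
  exists (Num.min d0 e); first by rewrite lt_min d00.
  move=> s /andP[s0 st]; rewrite le_min => /andP[sd se].
  wlog rs : r s r0 rt s0 st sd se / r < s.
    move=> W; have [rs|sr|->] := ltgtP r s; first exact: W.
      by rewrite distrC; apply: W => //; rewrite distrC.
    by rewrite subrr normr0 ltW.
  have := H r (s - r) r0; rewrite subrKC subr_gt0 rs/= mul1r.
  rewrite gtr0_norm ?subr_gt0// in sd se.
  by move=> /(_ st sd) /le_trans; apply.
have G0t : G t = G 0.
  apply/le_anti/andP; split.
    apply: dini_le => // r e /andP[r0 rt] e0; have [d0 d00 H] := G_Lip e e0.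
    exists d0 => // s sd rs; have := H r s r0 rs sd.
    by rewrite ler_norml lerBlDl => /andP[].
  rewrite -lerN2; apply: (@dini_le _ (fun s => - G s)) => //.
    move=> r e r0 e0; have [d0 d00 H] := Gc r e r0 e0; exists d0 => // s s0 sr.
    by rewrite opprK addrC distrC; exact: H.
  move=> r e /andP[r0 rt] e0; have [d0 d00 H] := G_Lip e e0.
  exists d0 => // s sd rs; have := H r s r0 rs sd.
  by rewrite ler_norml => /andP[]; lra.
move: G0t; rewrite /G subrr subr0.
have St := SL2 t0 fi; have St' := SL2 t0 hi.
rewrite dtC (dtE1 (SL2 (lexx 0) hi) hi St (S0 hi)) dtC => ->.
by rewrite (dtE1 (SL2 (lexx 0) fi) fi St' (S0 fi)).
Qed.

Lemma S_sym f h t : isL2 f -> isL2 h -> 0 <= t -> dt (S t f) h = dt f (S t h).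
Proof.
move=> fi hi t0; apply/eqP; rewrite -subr_eq0 -normr_le0.
apply/ler_addgt0Pr => e e0; rewrite add0r.
pose K := 2 * (nm f + nm h + 1); have nf := nm_ge0 mu w f; have nh := nm_ge0 mu w h.
have K0 : 0 < K by rewrite /K; lra.
pose e' := Num.min 1 (e / K).
have e'0 : 0 < e' by rewrite lt_min ltr01 divr_gt0.
have [p [u [pu fp]]] := op_dense fi e'0; have [pi ui] := op_L2 pu.
have [q [k [qk hq]]] := op_dense hi e'0; have [qi ki] := op_L2 qk.
have Df := L2B fi pi; have Dh := L2B hi qi.
have E : dt (S t f) h - dt f (S t h) =
    (dt (S t (fun x => f x - p x)) h + dt (S t p) (fun x => h x - q x)) -
    (dt f (S t (fun x => h x - q x)) + dt (fun x => f x - p x) (S t q)).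
  rewrite (dtE1 (SL2 t0 Df) (L2B (SL2 t0 fi) (SL2 t0 pi)) hi (SB t0 fi pi)).
  rewrite (dtC _ _ f (S t (fun x => h x - q x))) (dtE1 (SL2 t0 Dh) (L2B (SL2 t0 hi) (SL2 t0 qi)) fi (SB t0 hi qi)).
  rewrite (dtBl (SL2 t0 fi) (SL2 t0 pi) hi) (dtBr hi qi (SL2 t0 pi)).
  rewrite (dtBl (SL2 t0 hi) (SL2 t0 qi) fi) (dtBl fi pi (SL2 t0 qi)).
  by rewrite (S_sym_op pu qk t0) (dtC _ _ (S t h) f) (dtC _ _ (S t q) f); ring.
rewrite E; apply: le_trans (ler_normB _ _) _.
apply: le_trans (lerD (ler_normD _ _) (ler_normD _ _)) _.
have np : nm p <= nm f + 1.
  apply: le_trans (nm_tri pi fi) _; rewrite addrC lerD2l nm_distC.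
  by apply: le_trans fp _; rewrite ge_min lexx.
have nq : nm q <= nm h + 1.
  apply: le_trans (nm_tri qi hi) _; rewrite addrC lerD2l nm_distC.
  by apply: le_trans hq _; rewrite ge_min lexx.
have CS a b A B : isL2 a -> isL2 b -> nm a <= A -> nm b <= B -> `|dt a b| <= A * B.
  move=> ai bi aA bB; apply: le_trans (dt_CS ai bi) _.
  by apply: ler_pM => //; exact: nm_ge0.
have b1 := CS _ _ e' (nm h) (SL2 t0 Df) hi (le_trans (S_contr t0 Df) fp) (lexx _).
have b2 := CS _ _ (nm f + 1) e' (SL2 t0 pi) Dh (le_trans (S_contr t0 pi) np) hq.
have b3 := CS _ _ (nm f) e' fi (SL2 t0 Dh) (lexx _) (le_trans (S_contr t0 Dh) hq).
have b4 := CS _ _ e' (nm h + 1) Df (SL2 t0 qi) fp (le_trans (S_contr t0 qi) nq).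
apply: le_trans (lerD (lerD b1 b2) (lerD b3 b4)) _.
rewrite (_ : _ + _ = e' * K); last by rewrite /K; ring.
by rewrite -ler_pdivlMr// ge_min lexx orbT.
Qed.

Implicit Types (G : T -> R).

(** Composition with [pos] extends functions of time to negative times by their value at 0, so that
    they are continuous on the whole line; on [[0, t]] nothing changes. *)
Let pos s := Num.max s 0 : R.
Let pos0 s : 0 <= pos s. Proof. by rewrite /pos le_max lexx orbT. Qed.
Let posE s : 0 <= s -> pos s = s. Proof. by move=> s0; exact/max_idPl. Qed.

Let pos_lip r s : `|pos s - pos r| <= `|s - r|.
Proof.
wlog rs : r s / r <= s.
  by move=> H; have [/H|/ltW/H] := leP r s => //; rewrite distrC (distrC s).
rewrite (ger0_norm (_ : 0 <= s - r)) ?subr_ge0//.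
rewrite /pos; case: (leP s 0) => s0; case: (leP r 0) => r0.
- by rewrite subrr normr0 subr_ge0.
- by lra.
- by rewrite subr0 gtr0_norm//; lra.
- by rewrite ger0_norm ?subr_ge0.
Qed.

(** A Lipschitz bound on the ball of radius [nm f] is enough, since contractivity keeps the orbit of
    [f] inside it. *)
Lemma S_lip_cont (Psi : (T -> R) -> R) f K : 0 <= K -> isL2 f ->
  (forall g h, isL2 g -> isL2 h -> nm g <= nm f -> nm h <= nm f ->
    `|Psi g - Psi h| <= K * nm (fun x => g x - h x)) ->
  continuous (fun s => Psi (S (pos s) f)).
Proof.
move=> K0 fi HP; apply: cont_eps => r e e0.
have K1 : 0 < K + 1 by rewrite ltr_wpDl.
have [d0 d00 H] := S_cont fi (divr_gt0 e0 K1); exists d0 => // s sr.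
apply: le_trans (HP _ _ (SL2 (pos0 s) fi) (SL2 (pos0 r) fi) _ _) _.
- exact: S_contr.
- exact: S_contr.
apply: le_trans (_ : (K + 1) * (e / (K + 1)) <= _); last first.
  by rewrite mulrC divfK// gt_eqF.
apply: ler_pM => //; last by apply: H => //; exact: le_trans (pos_lip r s) sr.
- exact: nm_ge0.
- by rewrite lerDl.
Qed.

Lemma dt_S_cont f h : isL2 f -> isL2 h -> continuous (fun s => dt h (S (pos s) f)).
Proof.
move=> fi hi; apply: (S_lip_cont (nm_ge0 mu w h) fi) => g k gi ki _ _.
rewrite -(dtBr gi ki hi); exact: dt_CS hi (L2B gi ki).
Qed.

(** The predicate from which [time_integral] makes its choice. *)
Definition is_time_integral t f u := isL2 u /\ forall h, isL2 h ->
  dt u h = \int[@lebesgue_measure R]_(s in `[0, t]) dt (S s f) h.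

Lemma time_integralE t f h : isL2 f -> isL2 h ->
  \int[@lebesgue_measure R]_(s in `[0, t]) dt (S s f) h =
  tint (fun s => dt f (S (pos s) h)) t.
Proof.
move=> fi hi; apply: eq_Rintegral => s; rewrite inE/= in_itv/= => /andP[s0 _].
by rewrite posE// S_sym.
Qed.

(** The error is proportional to [nm h] and otherwise independent of [h]; this turns weak
    convergence of the Riemann sums into convergence in norm. *)
Lemma riemann_bound f h t n e : 0 <= t -> isL2 f -> isL2 h -> 0 <= e ->
  (forall r s, 0 <= r -> 0 <= s -> `|s - r| <= t / n.+1%:R ->
    nm (fun x => S s f x - S r f x) <= e) ->
  `|dt (fun x => \sum_(i < n.+1) t / n.+1%:R * S (i%:R * (t / n.+1%:R)) f x) h
    - tint (fun s => dt h (S (pos s) f)) t| <= t * (e * nm h).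
Proof.
move=> t0 fi hi e0 He; set tau := t / n.+1%:R in He *.
have tau0 : 0 <= tau by rewrite divr_ge0.
have tauE : n.+1%:R * tau = t by rewrite mulrC divfK.
have ti i : 0 <= i%:R * tau by rewrite mulr_ge0.
rewrite dt_suml//; last by move=> i; apply/L2Z/SL2.
pose p s := dt h (S (pos s) f); have pc : continuous p by exact: dt_S_cont.
suff main (k : nat) : `|(\sum_(i < k) tau * p (i%:R * tau)) - tint p (k%:R * tau)|
    <= (k%:R * tau) * (e * nm h).
  have := main n.+1; rewrite tauE; congr (`|_ - _| <= _).
  apply: eq_bigr => i _; rewrite dtZl//; last exact: SL2.
  by rewrite /p posE// dtC.
elim: k => [|k IH]; first by rewrite big_ord0 mul0r tint0 subrr normr0 mul0r.
rewrite big_ord_recr /=; set c := p (k%:R * tau).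
have kk : k%:R * tau <= k.+1%:R * tau by rewrite ler_wpM2r// ler_nat.
have pb x : k%:R * tau <= x <= k.+1%:R * tau -> `|p x - c| <= e * nm h.
  move=> /andP[kx xk]; have x0 : 0 <= x by exact: le_trans kx.
  rewrite /p /c /p -(dtBr (SL2 (pos0 _) fi) (SL2 (pos0 _) fi) hi).
  apply: le_trans (dt_CS hi (L2B (SL2 (pos0 _) fi) (SL2 (pos0 _) fi))) _.
  rewrite mulrC ler_wpM2r ?nm_ge0// !posE//; apply: He => //.
  rewrite ger0_norm ?subr_ge0// lerBlDl; apply: le_trans xk _.
  by rewrite -natr1 mulrDl mul1r.
have ks : k.+1%:R * tau - k%:R * tau = tau by rewrite -natr1; ring.
have u1 := @tint_step _ p (c + e * nm h) _ _ pc (ti k) kk _.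
have u2 := @tint_step_ge _ p (c - e * nm h) _ _ pc (ti k) kk _.
rewrite ks in u1 u2.
have {}u1 : tint p (k.+1%:R * tau) - tint p (k%:R * tau) <= (c + e * nm h) * tau.
  by apply: u1 => x /pb; rewrite ler_norml => /andP[_]; lra.
have {}u2 : (c - e * nm h) * tau <= tint p (k.+1%:R * tau) - tint p (k%:R * tau).
  by apply: u2 => x /pb; rewrite ler_norml => /andP[]; lra.
move: IH; rewrite !ler_norml -natr1 => /andP[i1 i2].
by move: i1 i2 u1 u2; set A := \sum_(i < k) _; rewrite -natr1 => *; apply/andP; split; lra.
Qed.

(** No representation theorem is used: the Riemann sums of the orbit are Cauchy in L2, and their
    limit is the integral. *)
Lemma time_integral_ex t f : 0 <= t -> isL2 f -> exists u, is_time_integral t f u.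
Proof.
move=> t0 fi.
pose U n := fun x => \sum_(i < n.+1) t / n.+1%:R * S (i%:R * (t / n.+1%:R)) f x.
have Ui n : isL2 (U n).
  by apply: L2_sum => i; apply/L2Z/SL2 => //; rewrite !mulr_ge0// invr_ge0.
have key e : 0 < e -> exists N, forall n h, (N <= n)%N -> isL2 h ->
    `|dt (U n) h - tint (fun s => dt h (S (pos s) f)) t| <= e * nm h.
  move=> e0; have t1 : 0 < t + 1 by rewrite ltr_wpDl.
  have [d0 d00 H] := S_cont fi (divr_gt0 e0 t1).
  exists (Num.truncn (t / d0)) => n h Nn hi.
  apply: le_trans (riemann_bound (n := n) t0 fi hi (ltW (divr_gt0 e0 t1)) _) _.
    move=> r s r0 s0 rs; apply: H => //; apply: le_trans rs _.
    rewrite ler_pdivrMr// mulrC -ler_pdivrMr//.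
    apply: le_trans (ltW (truncnS_gt _)) _.
    by rewrite ler_nat.
  rewrite mulrA ler_wpM2r ?nm_ge0// mulrCA ler_piMr ?(ltW e0)//.
  by rewrite ler_pdivrMr// mul1r lerDl ler01.
have [|u ui Uu] := L2_complete Ui.
  move=> e e0; have e2 : 0 < e / 2 by rewrite divr_gt0.
  have [N HN] := key _ e2; exists N => m n Nm Nn.
  have Di := L2B (Ui m) (Ui n).
  have := HN m _ Nm Di; have := HN n _ Nn Di; rewrite !ler_norml.
  move=> /andP[a1 a2] /andP[b1 b2].
  (* Both estimates are tested with the difference of the two sums itself. *)
  have : nm (fun x => U m x - U n x) ^+ 2 <= e * nm (fun x => U m x - U n x).
    by rewrite nm2 (dtBl (Ui m) (Ui n) Di); lra.
  have := nm_ge0 mu w (fun x => U m x - U n x); rewrite le_eqVlt => /predU1P[<- _|].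
    exact: ltW.
  by move=> n0; rewrite expr2 ler_pM2r.
exists u; split=> // h hi; rewrite time_integralE//.
rewrite (_ : tint _ t = tint (fun s => dt h (S (pos s) f)) t); last first.
  apply: eq_Rintegral => s; rewrite inE/= in_itv/= => /andP[s0 _].
  by rewrite posE// -S_sym// dtC.
apply/eqP; rewrite -subr_eq0 -normr_le0; apply/ler_addgt0Pr => e e0; rewrite add0r.
have n1 : 0 < nm h + 1 by rewrite ltr_wpDl// nm_ge0.
have e2 : 0 < e / 2 / (nm h + 1) by rewrite !divr_gt0.
have [N HN] := key _ e2; have [M HM] := (cvgnP _ _).1 Uu _ e2.
pose n := maxn N M.
have := HN n h (leq_maxl _ _) hi; have := HM n (leq_maxr _ _).
rewrite subr0 ger0_norm ?nm_ge0// => h1 h2.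
have h3 := dt_CS (L2B (Ui n) ui) hi; rewrite (dtBl (Ui n) ui hi) in h3.
have h4 : nm (fun x => U n x - u x) * nm h <= e / 2.
  apply: le_trans (_ : e / 2 / (nm h + 1) * (nm h + 1) <= _); last first.
    by rewrite divfK// gt_eqF.
  by apply: ler_pM => //; rewrite ?nm_ge0// lerDl.
have h5 : e / 2 / (nm h + 1) * nm h <= e / 2.
  apply: le_trans (_ : e / 2 / (nm h + 1) * (nm h + 1) <= _); last first.
    by rewrite divfK// gt_eqF.
  by rewrite ler_pM2l// lerDl.
move: h2 h3; rewrite !ler_norml => /andP[? ?] /andP[? ?].
by apply/andP; split; lra.
Qed.

(** * Dissipation of weighted entropy along the semigroup *)

Section entropy.
Variables (q dq : R -> R).
Hypothesis qP : entropy_fun q dq.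
Let mq := entropy_meas qP.
Let mdq := entropy_dmeas qP.
Let q0 := entropy_ge0 qP.
Let q_sq := entropy_sq qP.
Let dq_lin := entropy_dlin qP.
Let q_lip := entropy_lip qP.
Let q_lip2 := entropy_lip2 qP.
Let q_taylor := entropy_taylor qP.
Variables (a : T -> R) (G : T -> R).
Hypotheses (ma : measurable_fun setT a) (a01 : forall x, 0 <= a x <= 1)
  (Gi : isL2 G)
  (core : forall f u, op f u ->
    dt u (fun x => a x * dq (f x)) <= - dt G (fun x => q (f x))).

(** [N] is the entropy with weight [a], and [P] is the lower bound that [core] gives for its rate of
    decrease. *)
Let N f := \int[mu]_x (a x * q (f x) * w x).
Let P f := dt G (fun x => q (f x)).

Let q00 : q 0 = 0. Proof. exact: (entropy_neg qP). Qed.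

Let a_abs x : `|a x| <= 1.
Proof. by have /andP[? ?] := a01 x; rewrite ger0_norm. Qed.

Let mcomp (g : R -> R) f : measurable_fun setT g -> measurable_fun setT f ->
  measurable_fun setT (fun x => g (f x)).
Proof. by move=> mg mf; exact: measurableT_comp. Qed.

Lemma q_L2 f : isL2 f -> isL2 (fun x => q (f x)).
Proof.
move=> fi; apply: (L2_le _ _ fi); first exact/mcomp/(L2_meas fi).
by move=> x; have := q_lip (f x) 0; rewrite q00 !subr0.
Qed.

Lemma dq_L2 f : isL2 f -> isL2 (fun x => dq (f x)).
Proof.
move=> fi; apply: (L2_le _ _ (L2Z 6 fi)); first exact/mcomp/(L2_meas fi).
by move=> x; rewrite normrM ger0_norm.
Qed.

Let adq_L2 f : isL2 f -> isL2 (fun x => a x * dq (f x)).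
Proof. by move=> fi; apply: (L2_bM ma a_abs); exact: dq_L2. Qed.

Lemma N_igr f : isL2 f -> igr mu (fun x => a x * q (f x) * w x).
Proof.
move=> fi; apply: (@igr_le _ _ _ mu _ (fun x => 3 * (f x ^+ 2 * w x))).
- do 2 apply: measurable_funM => //; exact/mcomp/(L2_meas fi).
- move=> x; have /andP[ax0 ax1] := a01 x.
  rewrite ger0_norm ?mulr_ge0// mulrA ler_wpM2r//.
  by apply: le_trans (q_sq _); rewrite ler_piMl.
- exact/igrZ/L2_igr.
Qed.

Let N_lip f h : isL2 f -> isL2 h ->
  `|N f - N h| <= 6 * (nm f + nm h) * nm (fun x => f x - h x).
Proof.
move=> fi hi; have Ni := N_igr fi; have Nh := N_igr hi.
rewrite /N -rintB//; apply: le_trans (rint_abs (igrB Ni Nh)) _.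
have [fa ha] := (L2_abs fi, L2_abs hi); have da := L2_abs (L2B fi hi).
apply: le_trans (_ : 6 * dt (fun x => `|f x| + `|h x|) (fun x => `|f x - h x|) <= _).
  rewrite dtE -rintZ; last by apply: L2_prod => //; exact: L2D.
  apply: rint_le; first exact/igr_abs/igrB.
    by apply/igrZ/L2_prod => //; exact: L2D.
  move=> x; rewrite -mulrBl -mulrBr normrM (ger0_norm (w0 x)) mulrA ler_wpM2r//.
  rewrite normrM; apply: le_trans (_ : 1 * `|q (f x) - q (h x)| <= _).
    by rewrite ler_wpM2r.
  by rewrite mul1r mulrA.
rewrite -mulrA ler_pM2l//; apply: le_trans (ler_norm _) _.
apply: le_trans (dt_CS (L2D fa ha) da) _.
have abs_nm g : isL2 g -> nm (fun x => `|g x|) = nm g.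
  move=> gi; apply/le_anti/andP; split; apply: nm_le => //; try exact: L2_abs;
    by move=> x; rewrite normr_id.
rewrite (abs_nm _ (L2B fi hi)) ler_wpM2r ?nm_ge0//.
by apply: le_trans (nmD fa ha) _; rewrite !abs_nm.
Qed.

Let P_lip f h : isL2 f -> isL2 h -> `|P f - P h| <= nm G * nm (fun x => f x - h x).
Proof.
move=> fi hi; have [qf qh] := (q_L2 fi, q_L2 hi).
rewrite /P -(dtBr qf qh Gi); apply: le_trans (dt_CS Gi (L2B qf qh)) _.
by rewrite ler_wpM2l ?nm_ge0//; apply: nm_le => //; exact: L2B.
Qed.

Let N_taylor f v : isL2 f -> isL2 v ->
  N (fun x => f x + v x) <= N f + dt v (fun x => a x * dq (f x)) + 3 * nm v ^+ 2.
Proof.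
move=> fi vi; have Ni := N_igr fi; have Nfv := N_igr (L2D fi vi).
have D1 := L2_prod vi (adq_L2 fi); have D2 := L2_prod vi vi.
rewrite nm2 !dtE /N -rintZ// -rintD// -rintD//; [|exact: igrD|exact: igrZ].
apply: rint_le => //; first by apply: igrD; [exact: igrD|exact: igrZ].
move=> x; have /andP[ax0 ax1] := a01 x.
have := ler_wpM2l ax0 (q_taylor (f x) (v x)).
have : a x * (3 * v x ^+ 2) <= 3 * v x ^+ 2 by rewrite ler_piMl// mulr_ge0// sqr_ge0.
move=> h1 h2.
have h3 : a x * q (f x + v x) <=
  a x * q (f x) + v x * (a x * dq (f x)) + 3 * (v x * v x).
  by move: h1 h2; rewrite expr2; lra.
by have := ler_wpM2r (w0 x) h3; lra.
Qed.

Let N_S_cont f : isL2 f -> continuous (fun s => N (S (pos s) f)).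
Proof.
move=> fi; apply: (S_lip_cont (K := 6 * (2 * nm f)) _ fi).
  by rewrite !mulr_ge0// nm_ge0.
move=> g h gi hi gf hf; apply: le_trans (N_lip gi hi) _.
by rewrite ler_wpM2r ?nm_ge0//; lra.
Qed.

Lemma P_S_cont f : isL2 f -> continuous (fun s => dt G (fun x => q (S (pos s) f x))).
Proof.
move=> fi; apply: (S_lip_cont (Psi := P) (nm_ge0 mu w G) fi) => g h gi hi _ _.
exact: P_lip.
Qed.

Let entropy_op f u t : 0 <= t -> op f u ->
  N (S (pos t) f) + tint (fun s => P (S (pos s) f)) t <= N (S (pos 0) f).
Proof.
move=> t0 fu; have [fi ui] := op_L2 fu.
apply: (dini_tint t0 (N_S_cont fi) (P_S_cont fi)) => r e /andP[r0 rt] e0.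
(* The summands absorb the error of the linear term, through [|dq x| <= 6 |x|], and the Taylor
   remainder [3 * nm v ^+ 2]. *)
pose K := 6 * nm f + 3 * (nm u + 1) ^+ 2 + 1.
have K0 : 0 < K.
  by rewrite ltr_wpDl// addr_ge0// mulr_ge0 ?nm_ge0 ?sqr_ge0.
pose e' := Num.min 1 (e / K).
have e'0 : 0 < e' by rewrite lt_min ltr01 divr_gt0.
have [d1 d10 H] := S_der fu e'0.
exists (Num.min d1 e'); first by rewrite lt_min d10.
move=> s /andP[s0]; rewrite le_min => /andP[sd se] rst.
have rs0 : 0 <= r + s by rewrite addr_ge0// ltW.
rewrite !posE//; have [ai a'i ui'] := And3 (SL2 r0 fi) (SL2 rs0 fi) (SL2 r0 ui).
pose v := fun x => S (r + s) f x - S r f x.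
have vi : isL2 v by exact: L2B.
have Dv : nm (fun x => v x - s * S r u x) <= e' * s by apply: H; rewrite // s0.
have := N_taylor ai vi.
rewrite (_ : (fun x => S r f x + v x) = S (r + s) f); last first.
  by apply/funext => x; rewrite /v subrKC.
move=> /le_trans; apply; rewrite -addrA lerD2l.
have sui := L2Z s ui'.
have qi := adq_L2 ai.
have b1 : dt v (fun x => a x * dq (S r f x)) <=
    - P (S r f) * s + e' * s * (6 * nm f).
  have := dtBl vi sui qi; rewrite (dtZl s ui' qi).
  have := dt_CS (L2B vi sui) qi; rewrite ler_norml => /andP[_].
  have : nm (fun x => v x - s * S r u x) * nm (fun x => a x * dq (S r f x)) <=
      e' * s * (6 * nm f).
    apply: ler_pM => //; try exact: nm_ge0.
    apply: le_trans (_ : nm (fun x => 6 * S r f x) <= _).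
      apply: nm_le => //; first exact: L2Z.
      move=> x; rewrite !normrM (ger0_norm (ler0n _ 6)).
      by apply: le_trans (dq_lin _); rewrite ler_piMl.
    by rewrite nmZ// ger0_norm// ler_pM2l//; exact: S_contr.
  have := ler_wpM2r (ltW s0) (core (op_S r0 fu)); rewrite -/(P _) => h1 h2 h3 h4.
  by rewrite h4 in h3; lra.
have nv : nm v <= s * (nm u + 1).
  apply: le_trans (nm_tri vi sui) _; rewrite nmZ// gtr0_norm//.
  have : s * nm (S r u) <= s * nm u by rewrite ler_pM2l//; exact: S_contr.
  have : e' * s <= s by rewrite ler_piMl ?(ltW s0)// ge_min lexx.
  by lra.
have nv2 : nm v ^+ 2 <= (s * (nm u + 1)) ^+ 2.
  by rewrite lerXn2r ?nnegrE ?nm_ge0// mulr_ge0 ?(ltW s0)// addr_ge0// nm_ge0.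
have b3 : s * (nm u + 1) * (s * (nm u + 1)) <= e' * s * (nm u + 1) ^+ 2.
  rewrite expr2 [leLHS](_ : _ = s * s * ((nm u + 1) * (nm u + 1))); last by ring.
  rewrite ler_wpM2r -?expr2 ?sqr_ge0//.
  by rewrite expr2 ler_pM2r.
have b4 : e' * s * K <= e * s.
  rewrite mulrAC ler_pM2r// -ler_pdivlMr//.
  by rewrite ge_min lexx orbT.
have es0 : 0 <= e' * s by rewrite mulr_ge0// ltW.
by rewrite expr2 in nv2; move: b4; rewrite /K -/(P (S r f)); lra.
Qed.

(** On the domain the right derivative of [N] along the orbit is [dt (S t u) (a * dq (S t f))],
    which [core] bounds by [- P]. This is integrated in [entropy_op]; here density and the
    continuity of [N] and [P] on L2 extend it. *)
Lemma entropy_le f t : 0 <= t -> isL2 f ->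
  N (S t f) + tint (fun s => P (S (pos s) f)) t <= N f.
Proof.
move=> t0 fi; apply/ler_addgt0Pr => e e0.
pose K := 12 * (2 * nm f + 1) + t * nm G + 1.
have K0 : 0 < K.
  by rewrite ltr_wpDl// addr_ge0// mulr_ge0 ?addr_ge0 ?mulr_ge0 ?nm_ge0.
pose e' := Num.min 1 (e / K).
have e'0 : 0 < e' by rewrite lt_min ltr01 divr_gt0.
have e'1 : e' <= 1 by rewrite ge_min lexx.
have [p [u [pu fp]]] := op_dense fi e'0; have [pi ui] := op_L2 pu.
have E := entropy_op t0 pu; rewrite posE// posE// in E.
have N0 : N (S 0 p) = N p.
  apply: rint_ae_eq; [exact: igr_meas (N_igr (SL2 _ pi))|exact: igr_meas (N_igr pi)|].
  by apply: filterS (S0 pi) => x ->.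
rewrite N0 in E.
have np : nm p <= nm f + 1.
  by apply: le_trans (nm_tri pi fi) _; rewrite addrC lerD2l nm_distC (le_trans fp).
have Sfp s : 0 <= s -> nm (fun x => S s f x - S s p x) <= e'.
  move=> s0; rewrite -(nmE (SL2 s0 (L2B fi pi)) (L2B (SL2 s0 fi) (SL2 s0 pi)) (SB s0 fi pi)).
  exact: le_trans (S_contr s0 (L2B fi pi)) fp.
have Nb g h : isL2 g -> isL2 h -> nm g <= nm f -> nm h <= nm f + 1 ->
    nm (fun x => g x - h x) <= e' -> `|N g - N h| <= 6 * (2 * nm f + 1) * e'.
  move=> gi hi gf hf gh; apply: le_trans (N_lip gi hi) _.
  apply: ler_pM => //; rewrite ?nm_ge0 ?mulr_ge0 ?addr_ge0 ?nm_ge0//.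
  by lra.
have b1 := Nb _ _ fi pi (lexx _) np fp.
have b2 := Nb _ _ (SL2 t0 fi) (SL2 t0 pi) (S_contr t0 fi)
  (le_trans (S_contr t0 pi) np) (Sfp t t0).
have b3 : tint (fun s => P (S (pos s) f)) t <= tint (fun s => P (S (pos s) p)) t
    + t * (nm G * e').
  rewrite -lerBlDl -tintB; [|exact: P_S_cont|exact: P_S_cont].
  have pc : continuous (fun s => P (S (pos s) f) - P (S (pos s) p)).
    by move=> s; apply: cvgB; exact: P_S_cont.
  have pb s : 0 <= s <= t -> P (S (pos s) f) - P (S (pos s) p) <= nm G * e'.
    move=> _; apply: le_trans (ler_norm _) _.
    apply: le_trans (P_lip (SL2 (pos0 s) fi) (SL2 (pos0 s) pi)) _.
    by rewrite ler_wpM2l ?nm_ge0//; exact: Sfp.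
  by have := tint_step pc (lexx 0) t0 pb; rewrite tint0 !subr0 mulrC.
have b4 : e' * K <= e by rewrite -ler_pdivlMr// ge_min lexx orbT.
move: b1 b2; rewrite !ler_norml => /andP[? ?] /andP[? ?].
by move: b4; rewrite /K; lra.
Qed.

End entropy.

(** * Positivity and bounds on mass *)

Section mass.
Variables (q dq : R -> R) (V : T -> R) (U : (T -> R) -> Prop).
Hypotheses (qP : entropy_fun q dq) (V0 : forall x, 0 <= V x) (U0 : U (fun=> 0))
  (UP : forall u, U u -> measurable_fun setT u /\ forall x, 0 <= u x <= 1)
  (core : forall u G f l, U u -> isL2 G ->
    (\forall x \ae mu, 0 <= G x * w x <= u x * w x + V x) -> op f l ->
    dt l (fun x => (1 - u x) * dq (f x)) <= - dt G (fun x => q (f x))).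

Let q00 : q 0 = 0. Proof. exact: (entropy_neg qP). Qed.

Let u_01 u : U u -> measurable_fun setT (fun x => 1 - u x) /\
  forall x, 0 <= 1 - u x <= 1.
Proof.
move=> /UP[mu_ u01]; split; first exact: measurable_funB.
by move=> x; have /andP[? ?] := u01 x; apply/andP; split; lra.
Qed.

(** This is [entropy_le] for [c * f] with weight [1 - u], divided by [c]; as [c] grows,
    [q (c * x) / c] tends to the positive part. In the application [U] consists of functions [u]
    with Laplacian at least [(w + V) * u], and [G] is an L2 function below [u + V / w]. *)
Lemma mass_entropy u G f t c : U u -> isL2 G ->
  (\forall x \ae mu, 0 <= G x * w x <= u x * w x + V x) -> 0 < c ->
  0 <= t -> isL2 f ->
  \int[mu]_x ((1 - u x) * (q (c * S t f x) / c) * w x) +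
  tint (fun s => dt G (fun x => q (c * S (pos s) f x) / c)) t <=
  \int[mu]_x ((1 - u x) * (q (c * f x) / c) * w x).
Proof.
move=> Uu Gi GV c0 t0 fi; have [ma a01] := u_01 Uu.
have cfi := L2Z c fi; have c0' := ltW c0.
have E := entropy_le qP ma a01 Gi (fun f l => @core u G f l Uu Gi GV) t0 cfi.
have mS s : 0 <= s -> measurable_fun setT (fun x => q (S s (fun x => c * f x) x)).
  by move=> s0; apply: measurableT_comp (entropy_meas qP) (L2_meas (SL2 s0 cfi)).
have mS' s : 0 <= s -> measurable_fun setT (fun x => q (c * S s f x)).
  by move=> s0; apply: measurableT_comp (entropy_meas qP) (L2_meas (L2Z c (SL2 s0 fi))).
have qi s : 0 <= s -> isL2 (fun x => q (c * S s f x)).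
  by move=> s0; apply: (q_L2 qP); apply: L2Z; exact: SL2.
have Ni h : isL2 h -> igr mu (fun x => (1 - u x) * q (h x) * w x).
  by exact: (N_igr qP ma a01).
have EN h : isL2 h -> \int[mu]_x ((1 - u x) * (q (h x) / c) * w x) =
    c^-1 * \int[mu]_x ((1 - u x) * q (h x) * w x).
  by move=> hi; rewrite -rintZ; [apply: eq_rint => x; ring|exact: Ni].
rewrite !EN//; last by apply: L2Z; exact: SL2.
have -> : tint (fun s => dt G (fun x => q (c * S (pos s) f x) / c)) t =
    c^-1 * tint (fun s => dt G (fun x => q (S (pos s) (fun x => c * f x) x))) t.
  rewrite /tint -RintegralZl//; last first.
    exact: (cont_integrable 0 t (P_S_cont qP Gi cfi)).
  apply: eq_Rintegral => s _.
  under eq_fun do rewrite mulrC.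
  rewrite (dtZr _ (qi _ (pos0 s)) Gi); congr (_ * _).
  rewrite !(dtC _ _ G); apply: dt_ae => //; [exact: mS'|exact: mS|exact: L2_meas Gi|].
  by apply: filterS (SZ c (pos0 s) fi) => x ->.
rewrite -mulrDr ler_pM2l ?invr_gt0//; apply: le_trans E.
rewrite lerD2r le_eqVlt; apply/orP; left; apply/eqP.
apply: rint_ae_eq; [| |by apply: filterS (SZ c t0 fi) => x ->].
- exact: igr_meas (Ni _ (L2Z c (SL2 t0 fi))).
- exact: igr_meas (Ni _ (SL2 t0 cfi)).
Qed.

Let zero_adm : \forall x \ae mu,
  0 <= (fun=> 0 : R) x * w x <= (fun=> 0 : R) x * w x + V x.
Proof. by apply: aeW => x; rewrite mul0r add0r lexx V0. Qed.

(** With [u = 0] and [G = 0] the entropy starts at zero and cannot grow; a vanishing entropy forces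
    [S t f] to be nonpositive, since [q] is positive on the positive axis. *)
Lemma S_le0 f t : 0 <= t -> isL2 f -> (forall x, f x <= 0) ->
  \forall x \ae mu, S t f x <= 0.
Proof.
move=> t0 fi f0.
have := mass_entropy U0 L20 zero_adm ltr01 t0 fi.
have -> : tint (fun s => dt (fun=> 0) (fun x => q (1 * S (pos s) f x) / 1)) t = 0.
  rewrite (_ : (fun s => _) = (fun=> 0)); last first.
    apply/funext => s; rewrite dtE; under eq_rint do rewrite mul0r mul0r.
    by rewrite /Rintegral integral0.
  by rewrite /tint /Rintegral integral0.
have -> : \int[mu]_x ((1 - 0) * (q (1 * f x) / 1) * w x) = 0.
  under eq_rint => x do rewrite (entropy_neg qP) ?mul1r ?f0// !mul0r mulr0 mul0r.
  by rewrite /Rintegral integral0.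
rewrite addr0 => H.
have St := SL2 t0 fi.
have mf : measurable_fun setT (fun x => q (S t f x)).
  by apply: measurableT_comp (entropy_meas qP) (L2_meas St).
have fx x : 0 <= q (S t f x) * w x by rewrite mulr_ge0// (entropy_ge0 qP).
have HE : \int[mu]_x (q (S t f x) * w x) = 0.
  apply/le_anti/andP; split; last exact: rint_ge0.
  apply: le_trans H; rewrite le_eqVlt; apply/orP; left; apply/eqP.
  by apply: eq_rint => x; rewrite subr0 !mul1r divr1.
have ig : igr mu (fun x => q (S t f x) * w x).
  have [ma a01] := u_01 U0; have := N_igr qP ma a01 St; apply: eq_igr => x.
  by rewrite subr0 mul1r.
apply: filterS (rint_eq0_ae ig fx HE) => x /eqP.
rewrite mulf_eq0 (gt_eqF (wp x)) orbF => /eqP qx.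
by rewrite leNgt; apply/negP => /(entropy_pos qP); rewrite qx ltxx.
Qed.

(** [S_le0] asks for a sign everywhere. The function [- |f|] has one and equals [- f] almost
    everywhere, and contractivity carries this equality through [S t]. *)
Lemma S_ge0 f t : 0 <= t -> isL2 f -> (\forall x \ae mu, 0 <= f x) ->
  \forall x \ae mu, 0 <= S t f x.
Proof.
move=> t0 fi f0; pose h x := - `|f x|.
have hi : isL2 h by apply/L2N/L2_abs.
have := S_le0 t0 hi (fun x => _).
have fh : \forall x \ae mu, (-1) * h x = f x.
  by apply: filterS f0 => x fx; rewrite /h mulrN mulN1r opprK ger0_norm.
have E : \forall x \ae mu, S t f x - S t (fun x => -1 * h x) x = 0.
  apply: nm0_ae; first by apply: L2B; apply: SL2 => //; exact: L2Z.
  have Di := L2B fi (L2Z (-1) hi).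
  apply/le_anti; rewrite nm_ge0 andbT.
  rewrite -(nmE (SL2 t0 Di) (L2B (SL2 t0 fi) (SL2 t0 (L2Z (-1) hi))) (SB t0 fi (L2Z (-1) hi))).
  apply: le_trans (S_contr t0 Di) _; rewrite (nmE Di L20) ?nm0//.
  by apply: filterS fh => x ->; rewrite subrr.
move=> H; have {}H := H (fun x => _).
apply: filterS3 E (SZ (-1) t0 hi) (H _) => [x /subr0_eq -> -> Sx|x].
  by rewrite mulN1r oppr_ge0.
by rewrite /h oppr_le0.
Qed.

Lemma tint_cont_q c f G : isL2 f -> isL2 G -> 0 < c ->
  continuous (fun s => dt G (fun x => q (c * S (pos s) f x) / c)).
Proof.
move=> fi Gi c0; have qc g : isL2 g -> isL2 (fun x => q (c * g x) / c).
  move=> gi; under eq_fun do rewrite mulrC.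
  by apply: L2Z; apply: (q_L2 qP); exact: L2Z.
apply: (S_lip_cont (Psi := fun g => dt G (fun x => q (c * g x) / c)) (nm_ge0 mu w G) fi).
move=> g h gi hi _ _; rewrite -(dtBr (qc _ gi) (qc _ hi) Gi).
apply: le_trans (dt_CS Gi (L2B (qc _ gi) (qc _ hi))) _.
rewrite ler_wpM2l ?nm_ge0//; apply: nm_le; [exact: L2B (qc _ gi) (qc _ hi)|exact: L2B|].
move=> x; rewrite -mulrBl normrM [`|c^-1|]gtr0_norm ?invr_gt0//.
rewrite ler_pdivrMr//; apply: le_trans (entropy_lip qP _ _) _.
by rewrite -mulrBr normrM gtr0_norm// mulrC.
Qed.

Lemma q_scale_le c x : 0 < c -> 0 <= q (c * x) / c <= `|x|.
Proof.
move=> c0; rewrite divr_ge0 ?(entropy_ge0 qP) ?(ltW c0)//=.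
have := entropy_lip qP (c * x) 0; rewrite q00 !subr0 ger0_norm ?(entropy_ge0 qP)//.
by rewrite normrM (gtr0_norm c0) ler_pdivrMr// [leRHS]mulrC.
Qed.

Lemma q_scale_cvg x : q (n.+1%:R * x) / n.+1%:R @[n --> \oo] --> Num.max x 0.
Proof.
apply/cvgnP => e e0; exists (Num.truncn e^-1) => n Nn.
apply: le_trans (entropy_lim qP _ _) _; first by rewrite ltr0n.
rewrite invf_ple ?posrE// ?ltr0n//; apply: le_trans (ltW (truncnS_gt _)) _.
by rewrite ler_nat.
Qed.

Lemma S_dt_ge0 G f t : 0 <= t -> isL2 f -> isL2 G -> (\forall x \ae mu, 0 <= f x) ->
  (\forall x \ae mu, 0 <= G x) -> 0 <= dt G (S t f).
Proof.
move=> t0 fi Gi f0 G0; have Si := SL2 t0 fi.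
have GE : \forall x \ae mu, G x = `|G x|.
  by apply: filterS G0 => x /ger0_norm ->.
have SE : \forall x \ae mu, S t f x = `|S t f x|.
  by apply: filterS (S_ge0 t0 fi f0) => x /ger0_norm ->.
rewrite (dtE1 Gi (L2_abs Gi) Si GE) dtC (dtE1 Si (L2_abs Si) (L2_abs Gi) SE).
by apply: dt_ge0.
Qed.

(** The limit of [mass_entropy] as [c] tends to infinity. Fatou's lemma with [u = 0] and [G = 0]
    first shows that [S t f] is integrable; dominated convergence then treats the given [u] and
    [G]. *)
Lemma mass_le u G f t : U u -> isL2 G ->
  (\forall x \ae mu, 0 <= G x * w x <= u x * w x + V x) ->
  0 <= t -> isL2 f -> (forall x, 0 <= f x) -> igr mu (fun x => f x * w x) ->
  igr mu (fun x => S t f x * w x) /\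
  \int[mu]_x ((1 - u x) * S t f x * w x) +
  tint (fun s => dt G (S (pos s) f)) t <= \int[mu]_x ((1 - u x) * f x * w x).
Proof.
move=> Uu Gi GV t0 fi f0 fw.
have Si := SL2 t0 fi; have Sp := S_ge0 t0 fi (aeW _ f0).
pose e x := Num.max (S t f x) 0.
have me : measurable_fun setT e.
  by apply: measurable_maxr => //; exact: L2_meas Si.
have eS : \forall x \ae mu, e x = S t f x.
  by apply: filterS Sp => x Sx; rewrite /e; exact/max_idPl.
have c0 n : 0 < n.+1%:R :> R by rewrite ltr0n.
have mq' n : measurable_fun setT (fun x => q (n.+1%:R * S t f x) / n.+1%:R).
  under eq_fun do rewrite mulrC.
  apply: measurable_funM => //.
  exact: measurableT_comp (entropy_meas qP) (L2_meas (L2Z _ Si)).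
(* Stated for any admissible pair because it is applied both to the zero pair and to [u] and [G]. *)
have L1 (u' : T -> R) (Uu' : U u') n (G' : T -> R) (G'i : isL2 G')
    (GV' : \forall x \ae mu, 0 <= G' x * w x <= u' x * w x + V x) :
    igr mu (fun x => (1 - u' x) * (q (n.+1%:R * S t f x) / n.+1%:R) * w x) /\
    \int[mu]_x ((1 - u' x) * (q (n.+1%:R * S t f x) / n.+1%:R) * w x) +
    tint (fun s => dt G' (fun x => q (n.+1%:R * S (pos s) f x) / n.+1%:R)) t <=
    \int[mu]_x ((1 - u' x) * f x * w x).
  have [ma a01] := u_01 Uu'.
  have igN g : isL2 g ->
      igr mu (fun x => (1 - u' x) * (q (n.+1%:R * g x) / n.+1%:R) * w x).
    move=> gi; apply: eq_igr (igrZ n.+1%:R^-1 (N_igr qP ma a01 (L2Z n.+1%:R gi))) => x.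
    by ring.
  split; first exact: igN.
  apply: le_trans (mass_entropy Uu' G'i GV' (c0 n) t0 fi) _.
  apply: rint_le; [exact: igN|by apply: eq_igr (igr_bM (M := 1) fw ma _) => x;
    [rewrite mulrA|have /andP[? ?] := a01 x; rewrite ger0_norm]|].
  move=> x; have /andP[u0 _] := a01 x; rewrite ler_wpM2r// ler_wpM2l//.
  by have /andP[_] := q_scale_le (f x) (c0 n); rewrite [`|f x|]ger0_norm.
have e_igr : igr mu (fun x => e x * w x).
  have [] := @rint_fatou _ _ _ mu
    (fun n x => (1 - 0) * (q (n.+1%:R * S t f x) / n.+1%:R) * w x)
    (fun x => e x * w x) (\int[mu]_x ((1 - 0) * f x * w x)) => //.
  - by move=> n; have [] := L1 _ U0 n _ L20 zero_adm.
  - move=> n x; rewrite subr0 mul1r mulr_ge0//.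
    by have /andP[] := q_scale_le (S t f x) (c0 n).
  - exact: measurable_funM.
  - move=> x; apply: cvgM; last exact: cvg_cst.
    by under eq_cvg do rewrite subr0 mul1r; exact: q_scale_cvg.
  - move=> n; have [_ H] := L1 _ U0 n _ L20 zero_adm; apply: le_trans H.
    rewrite lerDl; apply: tint_ge0 => s _; rewrite dtE.
    by apply: rint_ge0 => x; rewrite !mul0r.
have Si_igr : igr mu (fun x => S t f x * w x).
  apply: igr_ae_eq e_igr.
    by apply: measurable_funM => //; exact: L2_meas Si.
  by apply: filterS eS => x ->.
split=> //.
have [ma a01] := u_01 Uu.
have abs_u x : `|1 - u x| <= 1 by have /andP[? ?] := a01 x; rewrite ger0_norm.
have [|||||_ HN] := @rint_dct _ _ _ mu
    (fun n x => (1 - u x) * (q (n.+1%:R * S t f x) / n.+1%:R) * w x)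
    (fun x => (1 - u x) * S t f x * w x) (fun x => `|S t f x * w x|).
- by move=> n; do 2 apply: measurable_funM => //.
- by do 2 apply: measurable_funM => //; exact: L2_meas Si.
- apply: filterS eS => x ex; apply: cvgM; last exact: cvg_cst.
  have qc := @q_scale_cvg (S t f x); rewrite -/(e x) ex in qc.
  by apply: cvgM; [exact: cvg_cst|exact: qc].
- exact: igr_abs.
- apply: aeW => x n; rewrite 2!normrM [leRHS]normrM ler_wpM2r//.
  have /andP[q1 q2] := q_scale_le (S t f x) (c0 n).
  by rewrite (ger0_norm q1) (le_trans _ q2)// ler_piMl.
have HT : tint (fun s => dt G (fun x => q (n.+1%:R * S (pos s) f x) / n.+1%:R)) t
    @[n --> \oo] --> tint (fun s => dt G (S (pos s) f)) t.
  apply: (@tint_dct _ _ _ _ (nm G * nm f)).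
  - by move=> n; exact: tint_cont_q.
  - exact: dt_S_cont.
  - move=> s /andP[s0 _]; rewrite posE//.
    have Ss := SL2 s0 fi; have Ssp := S_ge0 s0 fi (aeW _ f0).
    have qs n : isL2 (fun x => q (n.+1%:R * S s f x) / n.+1%:R).
      by under eq_fun do rewrite mulrC; apply/L2Z/(q_L2 qP)/L2Z.
    have H : nm (fun x => q (n.+1%:R * S s f x) / n.+1%:R - S s f x) @[n --> \oo] --> 0.
      apply: (L2_dct (G := fun x => 2 * `|S s f x|)).
      + by move=> n; exact: L2_meas (qs n).
      + exact: L2_meas Ss.
      + apply: filterS Ssp => x /max_idPl xE.
        by have := @q_scale_cvg (S s f x); rewrite xE.
      + exact/L2Z/L2_abs.
      + apply: aeW => x n; apply: le_trans (ler_normB _ _) _.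
        have /andP[q1 q2] := q_scale_le (S s f x) (c0 n).
        by rewrite (ger0_norm q1) mulr2n mulrDl mul1r lerD2r.
    apply/cvgnP => eps eps0; have G1 : 0 < nm G + 1 by rewrite ltr_wpDl// nm_ge0.
    have [M HM] := (cvgnP _ _).1 H _ (divr_gt0 eps0 G1); exists M => n Mn.
    rewrite -(dtBr (qs n) Ss Gi); apply: le_trans (dt_CS Gi (L2B (qs n) Ss)) _.
    have := HM n Mn; rewrite subr0 ger0_norm ?nm_ge0// => h1.
    apply: le_trans (_ : (nm G + 1) * (eps / (nm G + 1)) <= _).
      by apply: ler_pM; rewrite ?nm_ge0// lerDl.
    by rewrite mulrC divfK// gt_eqF.
  - move=> n s /andP[s0 _]; rewrite posE//.
    have qs : isL2 (fun x => q (n.+1%:R * S s f x) / n.+1%:R).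
      by under eq_fun do rewrite mulrC; apply/L2Z/(q_L2 qP)/L2Z/SL2.
    apply: le_trans (dt_CS Gi qs) _; rewrite ler_wpM2l ?nm_ge0//.
    apply: le_trans (S_contr s0 fi); apply: nm_le => //; first exact: SL2.
    by move=> x; have /andP[q1 q2] := q_scale_le (S s f x) (c0 n); rewrite ger0_norm.
apply: (cvgn_le_cst (N := 0%N) (cvgD HN HT)) => n _.
by have [_] := L1 _ Uu n _ Gi GV.
Qed.

Lemma total_mass_le f t : 0 <= t -> isL2 f -> (forall x, 0 <= f x) ->
  igr mu (fun x => f x * w x) ->
  \int[mu]_x (S t f x * w x) <= \int[mu]_x (f x * w x).
Proof.
move=> t0 fi f0 fw; have [_] := mass_le U0 L20 zero_adm t0 fi f0 fw.
under eq_rint do rewrite subr0 mul1r.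
under [in X in _ <= X -> _]eq_rint do rewrite subr0 mul1r.
apply: le_trans; rewrite lerDl; apply: tint_ge0 => s _; rewrite dtE.
by apply: rint_ge0 => x; rewrite !mul0r.
Qed.

(** [Lplus_approx] for an abstract measure; for the Riemannian volume the two are convertible. *)
Definition Lp_approx (f : T -> \bar R) (F : nat -> T -> R) :=
  (forall j : nat, isL2 (F j)) /\ \forall x \ae mu, [/\ forall j, 0 <= F j x,
    forall j, F j x <= F j.+1 x & ((F j x)%:E @[j --> \oo] --> f x)%E].

Lemma tint_S_mono (H1 H2 f : T -> R) t : isL2 H1 -> isL2 H2 ->
  (\forall x \ae mu, H1 x <= H2 x) -> isL2 f -> (forall x, 0 <= f x) ->
  tint (fun s => dt H1 (S (pos s) f)) t <= tint (fun s => dt H2 (S (pos s) f)) t.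
Proof.
move=> H1i H2i H12 fi f0; apply: tint_le; try exact: dt_S_cont.
move=> s /andP[s0 _]; rewrite -subr_ge0 -(dtBl H2i H1i (SL2 (pos0 s) fi)).
apply: S_dt_ge0 => //; [exact: L2B|exact: aeW|].
by apply: filterS H12 => x; rewrite subr_ge0.
Qed.

(** Test with the negative part of [f]: the pairing is minus its squared norm. *)
Lemma dt_pos_ae f : isL2 f ->
  (forall h, isL2 h -> (forall x, 0 <= h x) -> 0 <= dt f h) ->
  \forall x \ae mu, 0 <= f x.
Proof.
move=> fi Hf; pose h x := Num.max (- f x) 0.
have mh : measurable_fun setT h.
  by apply: measurable_maxr => //; apply: measurableT_comp => //; exact: L2_meas fi.
have h0 x : 0 <= h x by rewrite /h le_max lexx orbT.
have hi : isL2 h.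
  apply: (L2_le mh _ fi) => x; rewrite ger0_norm// /h ge_max normr_ge0 andbT.
  by rewrite -normrN ler_norm.
have fh x : f x * h x = - (h x * h x).
  rewrite /h; case: (leP (- f x) 0) => _; first by rewrite !mulr0 oppr0.
  by ring.
have E : nm h = 0.
  apply/eqP; rewrite -sqrf_eq0 nm2; apply/eqP/le_anti/andP; split; last first.
    exact: dt_ge0.
  have := Hf h hi h0; rewrite !dtE.
  under eq_rint do rewrite fh mulNr.
  by rewrite rintN ?oppr_ge0//; exact: L2_prod.
apply: filterS (nm0_ae hi E) => x hx.
by have : - f x <= h x by [rewrite /h le_max lexx]; rewrite hx oppr_le0.
Qed.

(** * Duality between generalized conservativeness and conservation of mass *)

Section conservation.
Variables (F H : nat -> T -> R) (A : (T -> R) -> T -> R) (t : R).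
Hypotheses (t0 : 0 <= t) (FP : Lp_approx (fun=> 1%E) F)
  (HP : Lp_approx (fun x => (V x / w x)%:E) H)
  (AP : forall h, isL2 h -> is_time_integral t h (A h)).

Let Fi j : isL2 (F j). Proof. by case: FP. Qed.
Let Hi j : isL2 (H j). Proof. by case: HP. Qed.
Let Ai j : isL2 (A (H j)). Proof. by have [] := AP (Hi j). Qed.
(** The [j]-th approximation of the left-hand side of conservativeness. By symmetry its pairing with
    [f] is [mass_at f j], the mass at time [t] plus the mass killed before. *)
Let e (j : nat) x := S t (F j) x + A (H j) x.
Let ei j : isL2 (e j). Proof. by apply: L2D => //; exact: SL2. Qed.
Let mass_at f (j : nat) := dt (F j) (S t f) + tint (fun s => dt (H j) (S (pos s) f)) t.

Let pairing f j : isL2 f -> dt (e j) f = mass_at f j.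
Proof.
move=> fi; rewrite (dtDl (SL2 t0 (Fi j)) (Ai j) fi) S_sym//; congr (_ + _).
by have [_ /(_ f fi) ->] := AP (Hi j); exact: time_integralE.
Qed.

Lemma F01 : \forall x \ae mu, forall j : nat, 0 <= F j x <= 1.
Proof.
have [_] := FP; apply: filterS => x [F0 Fnd Fc] j; rewrite F0/= -lee_fin.
rewrite -(cvg_lim _ Fc)//; apply: lime_ge; first by apply/cvg_ex; exists 1%E.
exists j => // m /= km; rewrite lee_fin.
by have /nondecreasing_seqP := Fnd; apply.
Qed.

Lemma Hb : \forall x \ae mu, forall j : nat, 0 <= H j x * w x <= V x.
Proof.
have [_] := HP; apply: filterS => x [H0 Hnd Hc] j; rewrite mulr_ge0//=.
rewrite -ler_pdivlMr// -lee_fin.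
rewrite -(cvg_lim _ Hc)//; apply: lime_ge; first by apply/cvg_ex; eexists; exact: Hc.
exists j => // m /= km; rewrite lee_fin.
by have /nondecreasing_seqP := Hnd; apply.
Qed.

Lemma H_ge0 j : \forall x \ae mu, 0 <= H j x.
Proof. by have [_] := HP; apply: filterS => x [H0 _ _]. Qed.

Let Hadm j : \forall x \ae mu, 0 <= H j x * w x <= (fun=> 0 : R) x * w x + V x.
Proof. by apply: filterS Hb => x Hx; rewrite mul0r add0r. Qed.

Lemma mass_at_le f j : isL2 f -> (forall x, 0 <= f x) -> igr mu (fun x => f x * w x) ->
  dt (F j) (S t f) + tint (fun s => dt (H j) (S (pos s) f)) t <= \int[mu]_x (f x * w x).
Proof.
move=> fi f0 fw; have [Sw] := mass_le U0 (Hi j) (Hadm j) t0 fi f0 fw.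
under eq_rint do rewrite subr0 mul1r.
under [in X in _ <= X -> _]eq_rint do rewrite subr0 mul1r.
apply: le_trans; rewrite lerD2r dtE.
have Sp := S_ge0 t0 fi (aeW _ f0).
apply: rint_ae_le => //; first by apply: L2_prod => //; exact: SL2.
apply: filterS2 F01 Sp => x /(_ j)/andP[F0 F1] S0x.
by rewrite ler_wpM2r// ler_piMl.
Qed.

(** [mass_at_le] is tested with the excess [h], the positive part of [e j - 1], which is integrable
    because [h <= e j ^+ 2]. It says that the integral of [h * (e j - 1) * w = h ^+ 2 * w] is at
    most zero. *)
Let e_le1 j : \forall x \ae mu, e j x <= 1.
Proof.
pose h x := Num.max (e j x - 1) 0.
have me := L2_meas (ei j).
have mh : measurable_fun setT h by apply: measurable_maxr => //; exact: measurable_funB.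
have h0 x : 0 <= h x by rewrite /h le_max lexx orbT.
have he x : h x <= `|e j x|.
  by rewrite /h ge_max normr_ge0 andbT lerBlDr (le_trans (ler_norm _))// lerDl.
have he2 x : h x <= e j x ^+ 2.
  rewrite /h ge_max sqr_ge0 andbT; have := sqr_ge0 (e j x - 1).
  by have := sqr_ge0 (e j x); nra.
have hi : isL2 h by apply: (L2_le mh _ (ei j)) => x; rewrite ger0_norm.
have hw : igr mu (fun x => h x * w x).
  apply: igr_le (L2_igr (ei j)); first exact: measurable_funM.
  by move=> x; rewrite ger0_norm ?mulr_ge0// ler_wpM2r.
have := mass_at_le j hi h0 hw; rewrite -/(mass_at h j) -pairing// -subr_le0 dtE -rintB//; last exact: L2_prod.
rewrite (@eq_rint _ _ _ mu _ (fun x => h x * h x * w x)); last first.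
  move=> x; rewrite /h; case: (leP (e j x - 1) 0) => _; by ring.
rewrite -dtE -nm2 => hh; have nh : nm h = 0.
  by apply/eqP; rewrite -sqrf_eq0; apply/eqP/le_anti; rewrite hh sqr_ge0.
apply: filterS (nm0_ae hi nh) => x hx.
by have : e j x - 1 <= h x by [rewrite /h le_max lexx]; rewrite hx subr_le0.
Qed.

Let SF_ge0 j : \forall x \ae mu, 0 <= S t (F j) x.
Proof. by apply: S_ge0 => //; apply: filterS F01 => x /(_ j)/andP[]. Qed.

Let SF_mono j : \forall x \ae mu, S t (F j) x <= S t (F j.+1) x.
Proof.
have [_ Fnd] := FP.
have : \forall x \ae mu, 0 <= S t (fun x => F j.+1 x - F j x) x.
  apply: S_ge0 => //; first exact: L2B.
  by apply: filterS Fnd => x [_ + _] => /(_ j); rewrite subr_ge0.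
by apply: filterS2 (SB t0 (Fi j.+1) (Fi j)) => x ->; rewrite subr_ge0.
Qed.

Let AHE j h : isL2 h -> dt (A (H j)) h = tint (fun s => dt (H j) (S (pos s) h)) t.
Proof.
by move=> hi; have [_ /(_ h hi) ->] := AP (Hi j); exact: time_integralE.
Qed.

Let AH_ge0 j : \forall x \ae mu, 0 <= A (H j) x.
Proof.
apply: dt_pos_ae => // h hi h0; rewrite AHE//.
apply: tint_ge0 => s /andP[s0 _].
by apply: S_dt_ge0 => //; [exact: aeW|exact: H_ge0].
Qed.

Let AH_mono j : \forall x \ae mu, A (H j) x <= A (H j.+1) x.
Proof.
have : \forall x \ae mu, 0 <= A (H j.+1) x - A (H j) x.
  apply: dt_pos_ae => [|h hi h0]; first exact: L2B.
  rewrite dtBl// !AHE// subr_ge0; apply: tint_S_mono => //.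
  by have [_] := HP; apply: filterS => x [_ + _]; exact.
by apply: filterS => x; rewrite subr_ge0.
Qed.

(** Both parts of [e j] are nonnegative, increase with [j] and have sum at most 1, so their limits
    are finite and may be added as reals. *)
Let e_lim : \forall x \ae mu, exists r, [/\ e j x @[j --> \oo] --> r,
  forall j, 0 <= e j x <= 1 &
  (limn (fun j => (S t (F j) x)%:E) + limn (fun j => (A (H j) x)%:E) = r%:E)%E].
Proof.
have h1 : \forall x \ae mu, forall j, 0 <= S t (F j) x by apply: ae_foralln.
have h2 : \forall x \ae mu, forall j, S t (F j) x <= S t (F j.+1) x by apply: ae_foralln.
have h3 : \forall x \ae mu, forall j, 0 <= A (H j) x by apply: ae_foralln.
have h4 : \forall x \ae mu, forall j, A (H j) x <= A (H j.+1) x by apply: ae_foralln.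
have h5 : \forall x \ae mu, forall j, e j x <= 1 by apply: ae_foralln.
apply: filterS3 h1 h2 (filterI h3 (filterI h4 h5)) => x S0x Snd [A0 [And e1]].
have nd (u : nat -> R) : (forall j, u j <= u j.+1) -> (forall j, u j <= 1) ->
    u j @[j --> \oo] --> limn u.
  move=> und u1; apply: nondecreasing_is_cvgn; first exact/nondecreasing_seqP.
  by exists 1 => _ [j _ <-].
have c1 : S t (F j) x @[j --> \oo] --> limn (fun j => S t (F j) x).
  by apply: nd => // j; have := e1 j; rewrite /e; have := A0 j; lra.
have c2 : A (H j) x @[j --> \oo] --> limn (fun j => A (H j) x).
  by apply: nd => // j; have := e1 j; rewrite /e; have := S0x j; lra.
exists (limn (fun j => S t (F j) x) + limn (fun j => A (H j) x)); split.
- exact: cvgD.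
- by move=> j; rewrite e1 andbT addr_ge0.
- by rewrite (cvg_lim _ (cvgEFin c1))// (cvg_lim _ (cvgEFin c2)).
Qed.

Lemma conservative_mass : (\forall x \ae mu,
    limn (fun j => (S t (F j) x)%:E) + limn (fun j => (A (H j) x)%:E) = 1)%E ->
  forall f, isL2 f -> (forall x, 0 <= f x) -> igr mu (fun x => f x * w x) ->
  dt (F j) (S t f) + tint (fun s => dt (H j) (S (pos s) f)) t @[j --> \oo]
    --> \int[mu]_x (f x * w x).
Proof.
move=> lim1 f fi f0 fw; under eq_cvg do rewrite -/(mass_at f _) -pairing//.
have [|||||_] := @rint_dct _ _ _ mu (fun j x => e j x * f x * w x)
  (fun x => f x * w x) (fun x => f x * w x) => //.
- by move=> j; apply: meas_prod3 => //; [exact: L2_meas (ei j)|exact: L2_meas fi].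
- exact: igr_meas fw.
- apply: filterS2 lim1 e_lim => x E [r [er _]]; rewrite E => -[rE].
  rewrite -[X in _ --> X]mul1r rE; under eq_cvg do rewrite -mulrA.
  by apply: cvgM => //; exact: cvg_cst.
- apply: filterS e_lim => x [r [_ e01 _]] j; have /andP[e0 e1] := e01 j.
  by rewrite -mulrA normrM !ger0_norm ?mulr_ge0// ler_piMl ?mulr_ge0.
Qed.

(** The limit [r] of [e j] is at most 1. Conservation of mass for the indicator of [B n] makes the
    integral of [(1 - r) * w] over [B n] vanish, and the sets [B n] cover the space. *)
Lemma mass_conservative (B : nat -> set T) : (forall n, measurable (B n)) ->
  (forall x, exists n, B n x) -> (forall n, isL2 (\1_(B n))) ->
  (forall f, isL2 f -> (forall x, 0 <= f x) -> igr mu (fun x => f x * w x) ->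
  dt (F j) (S t f) + tint (fun s => dt (H j) (S (pos s) f)) t @[j --> \oo]
    --> \int[mu]_x (f x * w x)) ->
  (\forall x \ae mu,
    limn (fun j => (S t (F j) x)%:E) + limn (fun j => (A (H j) x)%:E) = 1)%E.
Proof.
move=> mB covB Bi Hm.
(* The upper limit exists everywhere and is measurable; it is the limit almost everywhere. *)
pose r x := fine (limn_esup (fun j => (e j x)%:E)).
have mr : measurable_fun setT r.
  apply: measurableT_comp; first exact: fine_measurable.
  by apply: measurable_fun_limn_esup => j; apply/measurable_EFinP; exact: L2_meas (ei j).
have rP : \forall x \ae mu, [/\ e j x @[j --> \oo] --> r x, 0 <= r x <= 1,
    forall j, 0 <= e j x <= 1 &
    (limn (fun j => (S t (F j) x)%:E) + limn (fun j => (A (H j) x)%:E) = (r x)%:E)%E].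
  apply: filterS e_lim => x [l [el e01 lE]].
  have -> : r x = l by rewrite /r (cvg_limn_einf_sup (cvgEFin el)).2.
  split=> //; apply/andP; split.
    by apply: (cvgn_ge_cst (N := 0%N) el) => j _; have /andP[] := e01 j.
  by apply: (cvgn_le_cst (N := 0%N) el) => j _; have /andP[] := e01 j.
have key n : \forall x \ae mu, `|1 - r x| * \1_(B n) x * w x = 0.
  have b0 x : 0 <= \1_(B n) x :> R by rewrite indicE.
  have b2 x : (\1_(B n) x : R) ^+ 2 = \1_(B n) x.
    by rewrite indicE; case: (_ \in _); rewrite ?expr1n ?expr0n.
  have bw : igr mu (fun x => \1_(B n) x * w x).
    by apply: eq_igr (L2_igr (Bi n)) => x; rewrite b2.
  have mb : measurable_fun setT (\1_(B n) : T -> R) by exact: measurable_indic.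
  have mrb : measurable_fun setT (fun x => `|1 - r x| * \1_(B n) x * w x).
    apply: meas_prod3 => //; apply: measurableT_comp => //.
    exact: measurable_funB.
  have c1 := Hm _ (Bi n) b0 bw.
  have [|||||ri c2] := @rint_dct _ _ _ mu (fun j x => e j x * \1_(B n) x * w x)
    (fun x => r x * \1_(B n) x * w x) (fun x => \1_(B n) x * w x) => //.
  - by move=> j; apply: meas_prod3 => //; exact: L2_meas (ei j).
  - exact: meas_prod3.
  - apply: filterS rP => x [er _ _ _]; under eq_cvg do rewrite -mulrA.
    by rewrite -mulrA; apply: cvgM => //; exact: cvg_cst.
  - apply: filterS rP => x [_ _ e01 _] j; have /andP[e0 e1] := e01 j.
    by rewrite -mulrA normrM !ger0_norm ?mulr_ge0// ler_piMl ?mulr_ge0.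
  have E : \int[mu]_x (r x * \1_(B n) x * w x) = \int[mu]_x (\1_(B n) x * w x).
    have Ej : (fun j => \int[mu]_x (e j x * \1_(B n) x * w x)) = mass_at (\1_(B n)).
      by apply/funext => j; rewrite -pairing.
    by rewrite -(cvg_lim _ c2)// Ej (cvg_lim _ c1).
  apply: rint_eq0_ae.
  - apply: igr_ae_eq (igrB bw ri) => //.
    apply: filterS rP => x [_ /andP[_ r1] _ _]; rewrite ger0_norm ?subr_ge0//; ring.
  - by move=> x; rewrite !mulr_ge0.
  - rewrite -[RHS](subrr (\int[mu]_x (\1_(B n) x * w x))) -{2}E -rintB//.
    apply: rint_ae_eq => //; first exact: igr_meas (igrB bw ri).
    apply: filterS rP => x [_ /andP[_ r1] _ _]; rewrite ger0_norm ?subr_ge0//; ring.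
have := ae_foralln key; apply: filterS2 rP => x [_ _ _ ->] /= H0.
have [n Bn] := covB x; have /eqP := H0 n.
rewrite indicE mem_set// mulr1 mulf_eq0 (gt_eqF (wp x)) orbF normr_eq0 subr_eq0.
by move=> /eqP <-.
Qed.

End conservation.

(** Moving [S s] onto [f] by symmetry, [dt f (S s h)] has right derivative [dt u (S s h)];
    [dini_tint] for this function and for its negative gives both inequalities. *)
Lemma S_duhamel f u h t : 0 <= t -> op f u -> isL2 h ->
  dt f (S t h) = dt f h + tint (fun s => dt u (S (pos s) h)) t.
Proof.
move=> t0 fu hi; have [fi ui] := op_L2 fu.
pose N s := dt f (S (pos s) h); pose p s := dt u (S (pos s) h).
have Nc : continuous N by exact: dt_S_cont.
have pc : continuous p by exact: dt_S_cont.
have Nr r e : 0 <= r < t -> 0 < e -> exists2 d, 0 < d & forall s, 0 < s <= d ->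
    r + s <= t -> `|N (r + s) - N r - p r * s| <= e * s.
  move=> /andP[r0 _] e0; have n1 : 0 < nm h + 1 by rewrite ltr_wpDl// nm_ge0.
  have [d0 d00 H] := S_der fu (divr_gt0 e0 n1); exists d0 => // s sd _.
  have /andP[s0 _] := sd; have rs0 : 0 <= r + s by rewrite addr_ge0// ltW.
  have [x1 x2 x3] := And3 (SL2 rs0 fi) (SL2 r0 fi) (SL2 r0 ui).
  rewrite /N /p !posE// -!(S_sym fi hi)// -(S_sym ui hi)//.
  have sx := L2Z s x3.
  rewrite [_ * s]mulrC -(dtZl s x3 hi) -(dtBl x1 x2 hi) -(dtBl (L2B x1 x2) sx hi).
  apply: le_trans (dt_CS (L2B (L2B x1 x2) sx) hi) _.
  apply: le_trans (_ : e / (nm h + 1) * s * (nm h + 1) <= _); last first.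
    by rewrite mulrAC divfK// gt_eqF.
  by apply: ler_pM; rewrite ?nm_ge0//; [exact: H|rewrite lerDl].
have E0 : N 0 = dt f h.
  rewrite /N posE// dtC (dtE1 (SL2 (lexx 0) hi) hi fi (S0 hi)).
  by rewrite dtC.
have Et : N t = dt f (S t h) by rewrite /N posE.
have pNc := contN pc; have NNc := contN Nc.
have u1 := dini_tint (p := fun s => - p s) t0 Nc pNc.
have u2 := dini_tint t0 NNc pc.
rewrite -Et -E0; apply/le_anti/andP; split.
  rewrite -lerBlDr -(tintN _ pc); apply: u1 => r e rt e0.
  have [d0 d00 H] := Nr r e rt e0; exists d0 => // s sd rst.
  by have := H s sd rst; rewrite ler_norml => /andP[_]; lra.
suff : - N t + tint p t <= - N 0 by rewrite -/p; lra.
apply: u2 => r e rt e0; have [d0 d00 H] := Nr r e rt e0; exists d0 => // s sd rst.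
by have := H s sd rst; rewrite ler_norml => /andP[]; lra.
Qed.

(** * The two criteria: subsolutions prevent conservation, cutoffs imply it *)

Section both_directions.
Variables (F H : nat -> T -> R) (A : R -> (T -> R) -> T -> R) (B : nat -> set T).
Hypotheses (FP : Lp_approx (fun=> 1%E) F)
  (HP : Lp_approx (fun x => (V x / w x)%:E) H)
  (AP : forall t h, 0 < t -> isL2 h -> is_time_integral t h (A t h))
  (mB : forall n, measurable (B n)) (B_nd : forall n, B n `<=` B n.+1)
  (covB : forall x, exists n, B n x) (Bi : forall n, isL2 (\1_(B n))).

Let conserved t := (\forall x \ae mu,
  limn (fun j => (S t (F j) x)%:E) + limn (fun j => (A t (H j) x)%:E) = 1)%E.

Let Fi j : isL2 (F j). Proof. by case: FP. Qed.
Let Hi j : isL2 (H j). Proof. by case: HP. Qed.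

Let mF_lim f : isL2 f -> igr mu (fun x => f x * w x) ->
  dt (F j) f @[j --> \oo] --> \int[mu]_x (f x * w x).
Proof.
move=> fi fw; have [|||||_] := @rint_dct _ _ _ mu (fun j x => F j x * f x * w x)
  (fun x => f x * w x) (fun x => `|f x * w x|) => //.
- by move=> j; apply: meas_prod3 => //; [exact: L2_meas (Fi j)|exact: L2_meas fi].
- exact: igr_meas fw.
- have [_] := FP; apply: filterS => x [_ _ /fine_cvg Fx].
  rewrite -[X in _ --> X]mul1r; under eq_cvg do rewrite -mulrA.
  by apply: cvgM => //; exact: cvg_cst.
- exact: igr_abs.
- apply: filterS (F01 FP) => x F01x j; have /andP[F0 F1] := F01x j.
  by rewrite -mulrA normrM ler_piMl// ger0_norm.
Qed.

(** The estimate [mass_le] is used with [G = un n + H j]: letting [j] grow accounts for the mass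
    killed by [V], and the truncations [un n] account for the extra loss. Both are needed because
    [u] and [V / w] need not lie in L2. *)
Lemma not_conserved u f : U u -> isL2 f -> (forall x, 0 <= f x) ->
  igr mu (fun x => f x * w x) -> 0 < \int[mu]_x (u x * f x * w x) ->
  ~ forall t, 0 < t -> conserved t.
Proof.
move=> Uu fi f0 fw; set p0 := \int[mu]_x _ => p00 Hc.
have [mu_ u01] := UP Uu.
have u_abs x : `|u x| <= 1 by have /andP[? ?] := u01 x; rewrite ger0_norm.
pose M := \int[mu]_x (f x * w x).
have igu g : igr mu (fun x => g x * w x) -> igr mu (fun x => u x * g x * w x).
  by move=> gw; apply: eq_igr (igr_bM gw mu_ u_abs) => x; rewrite mulrA.
have ig1u g : igr mu (fun x => g x * w x) -> igr mu (fun x => (1 - u x) * g x * w x).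
  by move=> gw; apply: eq_igr (igrB gw (igu g gw)) => x; ring.
have E1u g : igr mu (fun x => g x * w x) -> \int[mu]_x ((1 - u x) * g x * w x) =
    \int[mu]_x (g x * w x) - \int[mu]_x (u x * g x * w x).
  by move=> gw; rewrite -rintB; [apply: eq_rint => x; ring|exact: gw|exact: igu].
pose un n x := u x * \1_(B n) x.
have b01 n x : 0 <= (\1_(B n) x : R) <= 1 by rewrite indicE ler0n lern1 leq_b1.
have uni n : isL2 (un n) by exact: L2_bM mu_ u_abs (Bi n).
have un01 n x : 0 <= un n x <= u x.
  have /andP[? ?] := u01 x; have /andP[? ?] := b01 n x.
  by rewrite /un mulr_ge0// ler_piMr.
have Swi t : 0 <= t -> igr mu (fun x => S t f x * w x).
  move=> t0; by have [] := mass_le U0 L20 zero_adm t0 fi f0 fw.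
have key t n : 0 < t -> p0 + tint (fun s => dt (un n) (S (pos s) f)) t <=
    \int[mu]_x (u x * S t f x * w x) /\ \int[mu]_x (u x * S t f x * w x) <= M.
  move=> tp; have t0 := ltW tp; have Sw := Swi t t0.
  have Sp := S_ge0 t0 fi (aeW _ f0).
  have c1 := conservative_mass t0 FP HP (fun h => AP tp) (Hc t tp) fi f0 fw.
  have c2 := mF_lim (SL2 t0 fi) Sw.
  (* The mass killed up to time [t] is what conservation leaves: the initial mass minus the present
     one. *)
  have c3 : tint (fun s => dt (H j) (S (pos s) f)) t @[j --> \oo]
      --> M - \int[mu]_x (S t f x * w x).
    rewrite (_ : (fun j => tint _ t) = (fun j =>
      (dt (F j) (S t f) + tint (fun s => dt (H j) (S (pos s) f)) t) - dt (F j) (S t f))).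
      exact: cvgB.
    by apply/funext => j; rewrite addrAC subrr add0r.
  have unc : continuous (fun s => dt (un n) (S (pos s) f)) by exact: dt_S_cont.
  have ub j : \int[mu]_x ((1 - u x) * S t f x * w x) +
      tint (fun s => dt (un n) (S (pos s) f)) t +
      tint (fun s => dt (H j) (S (pos s) f)) t <= \int[mu]_x ((1 - u x) * f x * w x).
    have GV : \forall x \ae mu, 0 <= (un n x + H j x) * w x <= u x * w x + V x.
      apply: filterS (Hb HP) => x /(_ j)/andP[H0 HV].
      have /andP[n0 n1] := un01 n x.
      rewrite mulrDl addr_ge0 ?(mulr_ge0 n0 (w0 x))//=.
      by apply: lerD => //; rewrite ler_wpM2r.
    have [_] := mass_le Uu (L2D (uni n) (Hi j)) GV t0 fi f0 fw.
    rewrite (_ : tint _ t = tint (fun s => dt (un n) (S (pos s) f)) t +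
      tint (fun s => dt (H j) (S (pos s) f)) t).
      by rewrite addrA.
    rewrite -[X in _ + X]opprK -tintN; last exact: dt_S_cont.
    rewrite -tintB//; last by apply: contN; exact: dt_S_cont.
    congr tint; apply/funext => s; rewrite opprK.
    by rewrite (dtDl (uni n) (Hi j) (SL2 (pos0 s) fi)).
  have : \int[mu]_x ((1 - u x) * S t f x * w x) +
      tint (fun s => dt (un n) (S (pos s) f)) t + (M - \int[mu]_x (S t f x * w x))
      <= \int[mu]_x ((1 - u x) * f x * w x).
    by apply: (cvgn_le_cst (N := 0%N) (cvgD (cvg_cst _) c3)) => j _; exact: ub.
  rewrite !E1u// -/M -/p0 => h1; split; first by lra.
  have m1 : \int[mu]_x (u x * S t f x * w x) <= \int[mu]_x (S t f x * w x).
    apply: rint_ae_le => //; first exact: igu.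
    apply: filterS Sp => x Sx; rewrite ler_wpM2r// ler_piMl//.
    by have /andP[] := u01 x.
  exact: le_trans m1 (total_mass_le t0 fi f0 fw).
(* A time at which [p0 * tt] exceeds the initial mass [M]. *)
pose tt := (M + 1) / p0.
have M0 : 0 <= M by apply: rint_ge0 => x; rewrite mulr_ge0.
have tt0 : 0 < tt by rewrite divr_gt0// ltr_wpDl.
(* By [key] the limiting pairing with [u] is at least [p0] at every time. Capping at [p0] makes the
   limit in [n] the constant [p0], which is continuous and dominates. *)
pose g n s := Num.min (dt (un n) (S (pos s) f)) p0.
have gc n : continuous (g n).
  by move=> s; apply: cvg_minc; exact: (dt_S_cont fi (uni n)).
have glim : tint (g n) tt @[n --> \oo] --> tint (fun=> p0) tt.
  apply: (@tint_dct _ _ _ _ p0) => //; first by move=> ?; exact: cvg_cst.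
    move=> s /andP[s0 _]; rewrite /g posE//.
    have [|||||_ un_lim] := @rint_dct _ _ _ mu (fun n x => un n x * S s f x * w x)
      (fun x => u x * S s f x * w x) (fun x => `|S s f x * w x|).
    - by move=> n; apply: meas_prod3 => //; [exact: L2_meas (uni n)|exact: L2_meas (SL2 s0 fi)].
    - exact: igr_meas (igu _ (Swi s s0)).
    - apply: aeW => x; under eq_cvg do rewrite -mulrA.
      rewrite -mulrA; apply: cvgM; last exact: cvg_cst.
      have [m Bm] := covB x; apply/cvgnP => e e0; exists m => n mn.
      rewrite /un indicE mem_set ?mulr1 ?subrr ?normr0 ?(ltW e0)//.
      by rewrite -(subnKC mn); elim: (n - m)%N => [|i]; rewrite ?addn0// addnS => /B_nd.
    - exact/igr_abs/Swi.
    - apply: aeW => x n; rewrite -mulrA normrM ler_piMl//.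
      have /andP[n0 n1] := un01 n x; rewrite ger0_norm// (le_trans n1)//.
      by have /andP[] := u01 x.
    have ps : p0 <= \int[mu]_x (u x * S s f x * w x).
      move: s0; rewrite le_eqVlt => /predU1P[s0|s0].
        rewrite le_eqVlt; apply/orP; left; apply/eqP; rewrite -s0.
        apply: rint_ae_eq; last by apply: filterS (S0 fi) => x ->.
          exact: igr_meas (igu _ fw).
        exact: igr_meas (igu _ (Swi 0 (lexx 0))).
      have [h1 _] := key s 0%N s0; apply: le_trans h1; rewrite lerDl.
      apply: tint_ge0 => r /andP[r0 _].
      apply: S_dt_ge0 => //; [exact: aeW|apply: aeW => x].
      by have /andP[] := un01 0%N x.
    apply/cvgnP => e e0; have [m Hm] := (cvgnP _ _).1 un_lim e e0; exists m => n mn.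
    have := Hm n mn; rewrite -dtE ler_norml => /andP[h1 _].
    have : Num.min (dt (un n) (S s f)) p0 <= p0 by rewrite ge_min lexx orbT.
    have : p0 - e <= Num.min (dt (un n) (S s f)) p0.
      by rewrite le_min; apply/andP; split; lra.
    by move=> h2 h3; rewrite ler_norml; apply/andP; split; lra.
  move=> n s /andP[s0 _]; rewrite /g ger0_norm; first by rewrite ge_min lexx orbT.
  rewrite le_min (ltW p00) andbT posE//.
  apply: S_dt_ge0 => //; [exact: aeW|apply: aeW => x].
  by have /andP[] := un01 n x.
have : tint (fun=> p0) tt <= M.
  apply: (cvgn_le_cst (N := 0%N) glim) => n _.
  have [h1 h2] := key tt n tt0; apply: le_trans h2; apply: le_trans h1.
  apply: le_trans (_ : tint (fun s => dt (un n) (S (pos s) f)) tt <= _).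
    apply: tint_le => //; first exact: dt_S_cont.
    by move=> s _; rewrite /g ge_min lexx.
  by rewrite lerDr ltW.
have cc : continuous (fun _ : R => p0) by move=> ?; exact: cvg_cst.
have := tint_step_ge cc (lexx 0) (ltW tt0) (fun _ _ => lexx p0).
have -> : p0 * (tt - 0) = M + 1 by rewrite subr0 /tt mulrC divfK// gt_eqF.
by rewrite tint0 subr0; lra.
Qed.

(** Duhamel's formula for [zeta i] and the lower bound on [l i] show that, up to errors that vanish
    with [i], the mass at time [t] plus the time integral for [c i] is at least the initial mass.
    The reverse inequality is [mass_at_le], once [c i] has been compared with the sequence [H]. *)
Lemma conserved_of_cutoffs (kap M0 : R) (zeta l c b : nat -> T -> R) :
  0 < kap -> 0 <= M0 ->
  (forall i, op (zeta i) (l i)) -> (forall i x, 0 <= zeta i x <= kap) ->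
  (forall x, zeta i x @[i --> \oo] --> kap) ->
  (forall i, isL2 (c i)) -> (forall i x, 0 <= c i x <= V x / w x) ->
  (forall i, isL2 (b i)) -> (forall i x, 0 <= b i x <= M0) ->
  (forall x, b i x @[i --> \oo] --> 0) ->
  (forall i x, - (kap * c i x) - b i x <= l i x) ->
  forall t, 0 < t -> conserved t.
Proof.
move=> kap0 M00 zl z01 zlim ci c01 bi b01 blim lb t tp; have t0 := ltW tp.
apply: (mass_conservative t0 FP HP (fun h => AP tp) mB covB Bi) => f fi f0 fw.
have Swi s : 0 <= s -> igr mu (fun x => S s f x * w x).
  move=> s0; by have [] := mass_le U0 L20 zero_adm s0 fi f0 fw.
set M := \int[mu]_x _.
have mSM s : 0 <= s -> \int[mu]_x (S s f x * w x) <= M.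
  by move=> s0; exact: total_mass_le.
have zfM : dt (zeta i) f @[i --> \oo] --> kap * M.
  have zi i : isL2 (zeta i) by have [] := op_L2 (zl i).
  have [|||||_] := @rint_dct _ _ _ mu (fun i x => zeta i x * f x * w x)
    (fun x => kap * (f x * w x)) (fun x => kap * (f x * w x)).
  - by move=> i; apply: meas_prod3 => //; [exact: L2_meas (zi i)|exact: L2_meas fi].
  - exact: igr_meas (igrZ kap fw).
  - apply: aeW => x; under eq_cvg do rewrite -mulrA.
    by apply: cvgM; [exact: zlim|exact: cvg_cst].
  - exact: igrZ.
  - apply: aeW => x i; have /andP[z0 z1] := z01 i x.
    by rewrite -mulrA ger0_norm ?mulr_ge0// ler_wpM2r ?mulr_ge0.
  by rewrite rintZ.
have blim0 : tint (fun s => dt (b i) (S (pos s) f)) t @[i --> \oo] --> tint (fun=> 0) t.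
  apply: (@tint_dct _ _ _ _ (M0 * M)); [by move=> i; exact: dt_S_cont|by move=> ?; exact: cvg_cst| |].
    move=> s /andP[s0 _]; rewrite posE//.
    have [|||||_] := @rint_dct _ _ _ mu (fun i x => b i x * S s f x * w x)
      (fun x => 0) (fun x => M0 * `|S s f x * w x|).
    - by move=> i; apply: meas_prod3 => //; [exact: L2_meas (bi i)|exact: L2_meas (SL2 s0 fi)].
    - exact: measurable_cst.
    - apply: aeW => x; rewrite -[X in _ --> X](mul0r (S s f x * w x)).
      under eq_cvg do rewrite -mulrA.
      by apply: cvgM; [exact: blim|exact: cvg_cst].
    - exact/igrZ/igr_abs/Swi.
    - apply: aeW => x i; have /andP[b1 b2] := b01 i x.
      by rewrite -mulrA normrM (ger0_norm b1) ler_wpM2r.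
    by rewrite (_ : \int[mu]_(x in setT) 0 = 0)// /Rintegral integral0.
  move=> i s /andP[s0 _]; rewrite posE//.
  have Sp := S_ge0 s0 fi (aeW _ f0).
  have Sw := Swi s s0.
  rewrite ger0_norm; last first.
    apply: S_dt_ge0 => //; [exact: aeW|apply: aeW => x].
    by have /andP[] := b01 i x.
  apply: le_trans (_ : M0 * \int[mu]_x (S s f x * w x) <= _); last first.
    by rewrite ler_wpM2l// mSM.
  rewrite dtE -rintZ//; apply: rint_ae_le; [by apply: L2_prod => //; exact: SL2|exact: igrZ|].
  apply: filterS Sp => x Sx; have /andP[b1 b2] := b01 i x.
  by rewrite -mulrA ler_wpM2r// mulr_ge0.
have tint00 : tint (fun=> 0 : R) t = 0 by rewrite /tint /Rintegral integral0.
rewrite tint00 in blim0.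
(* Below [H j] almost everywhere and tending to [c i] as [j] grows, since [c i <= V / w]. This links
   the given [c i] with the approximating sequence [H], over which there is no control. The maximum
   with 0 makes the sign hold everywhere. *)
pose m i j x := Num.max 0 (Num.min (H j x) (c i x)).
have m01 i j x : 0 <= m i j x <= c i x.
  have /andP[c0 _] := c01 i x.
  by rewrite le_max lexx/= ge_max c0 ge_min lexx orbT.
have mm i j : measurable_fun setT (m i j).
  apply: measurable_maxr => //.
  by apply: measurable_minr; [exact: L2_meas (Hi j)|exact: L2_meas (ci i)].
have mi i j : isL2 (m i j).
  apply: (L2_le (mm i j) _ (ci i)) => x; have /andP[m0 m1] := m01 i j x.
  by rewrite !ger0_norm// (le_trans m0).
have mH i j : \forall x \ae mu, m i j x <= H j x.
  apply: filterS (H_ge0 HP j) => x Hx.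
  by rewrite /m ge_max Hx ge_min lexx.
have climit i : tint (fun s => dt (m i j) (S (pos s) f)) t
    @[j --> \oo] --> tint (fun s => dt (c i) (S (pos s) f)) t.
  apply: (@tint_dct _ _ _ _ (nm (c i) * nm f)).
  - by move=> j; exact: dt_S_cont.
  - exact: dt_S_cont.
  - move=> s /andP[s0 _]; rewrite posE//; have Ss := SL2 s0 fi.
    have H_ : nm (fun x => m i j x - c i x) @[j --> \oo] --> 0.
      apply: (L2_dct (mm i) (L2_meas (ci i)) _ (ci i)).
      + have [_] := HP; apply: filterS => x [_ _ /fine_cvg Hx].
        have /andP[c0 c1] := c01 i x.
        have -> : c i x = Num.max 0 (Num.min (V x / w x) (c i x)).
          by rewrite (min_idPr c1) (max_idPr c0).
        by apply: cvg_maxc; apply: cvg_minc.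
      + apply: aeW => x j; have /andP[m0 m1] := m01 i j x.
        by rewrite ler0_norm ?subr_le0// opprB lerBlDl lerDr.
    apply/cvgnP => e e0; have n1 : 0 < nm (S s f) + 1 by rewrite ltr_wpDl// nm_ge0.
    have [K HK] := (cvgnP _ _).1 H_ _ (divr_gt0 e0 n1); exists K => j Kj.
    rewrite -(dtBl (mi i j) (ci i) Ss); apply: le_trans (dt_CS (L2B (mi i j) (ci i)) Ss) _.
    have := HK j Kj; rewrite subr0 ger0_norm ?nm_ge0// => h1.
    apply: le_trans (_ : e / (nm (S s f) + 1) * (nm (S s f) + 1) <= _).
      by apply: ler_pM; rewrite ?nm_ge0// lerDl.
    by rewrite divfK// gt_eqF.
  - move=> j s /andP[s0 _]; rewrite posE//; have Ss := SL2 s0 fi.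
    apply: le_trans (dt_CS (mi i j) Ss) _; apply: ler_pM; rewrite ?nm_ge0//; last exact: S_contr.
    apply: nm_le => // x; have /andP[m0 m1] := m01 i j x.
    by rewrite !ger0_norm// (le_trans m0).
have Sw := Swi t t0; have Si := SL2 t0 fi.
pose J j := dt (F j) (S t f) + tint (fun s => dt (H j) (S (pos s) f)) t.
have J_le j : J j <= M by apply: (mass_at_le t0 FP HP).
(* The errors used below add up to at most [4 * e1]. *)
apply/cvgnP => e e0; pose e1 := e / 5; have e10 : 0 < e1 by rewrite divr_gt0.
have ke : 0 < kap * e1 by rewrite mulr_gt0.
have [i1 Hi1] := (cvgnP _ _).1 zfM _ ke; have [i2 Hi2] := (cvgnP _ _).1 blim0 _ ke.
pose i := maxn i1 i2.
have := Hi1 i (leq_maxl _ _); have := Hi2 i (leq_maxr _ _).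
rewrite subr0 !ler_norml => /andP[_ hb] /andP[hz _].
have [[zi li] Sp] := (op_L2 (zl i), S_ge0 t0 fi (aeW _ f0)).
have k1 : dt (zeta i) (S t f) <= kap * \int[mu]_x (S t f x * w x).
  rewrite dtE -rintZ//; apply: rint_ae_le; [exact: L2_prod|exact: igrZ|].
  apply: filterS Sp => x Sx; have /andP[z0 z1] := z01 i x.
  by rewrite -mulrA ler_wpM2r// mulr_ge0.
have k2 := S_duhamel t0 (zl i) fi.
have k3 : - (kap * tint (fun s => dt (c i) (S (pos s) f)) t) -
    tint (fun s => dt (b i) (S (pos s) f)) t <= tint (fun s => dt (l i) (S (pos s) f)) t.
  have cc := dt_S_cont fi (ci i); have bc := dt_S_cont fi (bi i).
  have ckc : continuous (fun s => dt (fun x => kap * c i x) (S (pos s) f)).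
    by apply: dt_S_cont => //; exact: L2Z.
  have -> : kap * tint (fun s => dt (c i) (S (pos s) f)) t =
      tint (fun s => dt (fun x => kap * c i x) (S (pos s) f)) t.
    rewrite /tint -RintegralZl//; last exact: cont_integrable.
    apply: eq_Rintegral => s _.
    by rewrite (dtZl kap (ci i) (SL2 (pos0 s) fi)).
  rewrite -(tintN _ ckc) -tintB//; last exact: contN.
  apply: tint_le; [by move=> s; apply: cvgB; [exact: contN|exact: bc]|exact: dt_S_cont|].
  move=> s /andP[s0 _]; rewrite posE//; have Ss := SL2 s0 fi.
  have kc := L2Z kap (ci i).
  rewrite -mulN1r -(dtZl (-1) kc Ss) -(dtBl (L2Z (-1) kc) (bi i) Ss) -subr_ge0.
  rewrite -(dtBl li (L2B (L2Z (-1) kc) (bi i)) Ss).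
  apply: S_dt_ge0 => //; [exact: L2B li (L2B (L2Z (-1) kc) (bi i))|exact: aeW|].
  by apply: aeW => x; rewrite mulN1r subr_ge0.
have k4 : M - 2 * e1 <= \int[mu]_x (S t f x * w x) +
    tint (fun s => dt (c i) (S (pos s) f)) t.
  by rewrite -(ler_pM2l kap0); rewrite k2 in k1; exact: cutoff_arith1 k1 k3 hb hz.
have [j1 Hj1] := (cvgnP _ _).1 (climit i) _ e10.
have [j2 Hj2] := (cvgnP _ _).1 (mF_lim Si Sw) _ e10.
exists (maxn j1 j2) => j jj.
have := Hj1 j (leq_trans (leq_maxl _ _) jj); have := Hj2 j (leq_trans (leq_maxr _ _) jj).
rewrite !ler_norml => /andP[a1 _] /andP[a2 _]; rewrite -ler_norml.
have a3 : tint (fun s => dt (m i j) (S (pos s) f)) t <=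
    tint (fun s => dt (H j) (S (pos s) f)) t.
  exact: tint_S_mono.
exact: cutoff_arith2 e0 a1 a2 a3 k4 (J_le j).
Qed.

End both_directions.

End mass.

End semigroup.

(** * Smooth functions *)

Lemma near_open (T : topologicalType) (U : set T) (x : T) (P : T -> Prop) :
  open U -> U x -> (forall y, U y -> P y) -> \forall y \near x, P y.
Proof. by move=> oU Ux UP; apply: filterS UP _; apply: open_nbhs_nbhs. Qed.

Section smooth_calculus.
Context (R : realType) (V : normedModType R).

(** Reduces directional derivatives to one real variable, where the chain rule is available. *)
Lemma is_derive_lineP (f : V -> R) (x v : V) (a : R) :
  is_derive x v f a <-> is_derive (0 : R) 1 (fun s : R => f (x + s *: v)) a.
Proof.
have E : (fun h : R => h^-1 *: (((fun s : R => f (x + s *: v)) \o shift 0) (h *: 1) - f (x + 0 *: v)))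
  = (fun h => h^-1 *: ((f \o shift x) (h *: v) - f x)).
  apply/funext => h /=; have -> : h%:A = h by exact: mulr1.
  by rewrite scale0r !addr0 [x + _]addrC.
by split=> -[d1 d2]; apply: DeriveDef; move: d1 d2; rewrite /derivable /derive E.
Qed.

Lemma is_derive_comp_dir (F : R -> R) (f : V -> R) (x v : V) (a b : R) :
  is_derive (f x) 1 F a -> is_derive x v f b -> is_derive x v (F \o f) (a * b).
Proof.
move=> dF /is_derive_lineP df; apply/is_derive_lineP.
apply: (@is_derive1_comp _ F (fun s : R => f (x + s *: v))) => //.
by rewrite scale0r addr0.
Qed.

Lemma derivable_continuous (F : R -> R) (x : R) : derivable F x 1 -> {for x, continuous F}.
Proof. by move=> /derivable1_diffP/differentiable_continuous. Qed.

Context (I : Type) (e : I -> V).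
Implicit Types (f h : V -> R) (U : set V).

Definition gpartial (i : I) f x := 'D_(e i) f x.

(** [smooth] relative to a set and to any family of directions, so that functions on row vectors and
    functions on the line, with a single direction indexed by [unit], share one calculus. *)
Definition gsmooth U f := forall s x, U x ->
  {for x, continuous (foldr gpartial f s)} /\
  forall i, derivable (foldr gpartial f s) x (e i).

(** Coinduction: every iterated derivative of a member of [C] agrees on [U] with a member of [C].
    Agreement on the open set is enough because derivatives are local. *)
Lemma gsmooth_coind (C : (V -> R) -> Prop) U : open U ->
  (forall h, C h -> forall x, U x -> {for x, continuous h} /\
     forall i, derivable h x (e i)) ->
  (forall h i, C h -> exists2 h', C h' & forall x, U x -> gpartial i h x = h' x) ->
  forall h, C h -> gsmooth U h.
Proof.
move=> oU C1 C2 h Ch s.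
have [h' Ch' E] : exists2 h', C h' & forall x, U x -> foldr gpartial h s x = h' x.
  elim: s => [|i s [h' Ch' E]]; first by exists h.
  have [h2 Ch2 E2] := C2 h' i Ch'; exists h2 => // x Ux.
  rewrite -E2//=; apply: near_eq_derive.
  exact: near_open oU Ux E.
move=> x Ux; have [c d] := C1 _ Ch' x Ux.
have E1 : \forall y \near x, h' y = foldr gpartial h s y.
  by apply: near_open oU Ux _ => y /E.
split=> [|i]; last exact: near_eq_derivable E1 (d i).
rewrite /prop_for /continuous_at E//.
apply: cvg_trans c; apply: near_eq_cvg.
by apply: filterS E1 => y.
Qed.

Lemma gsmooth_partial U f i : gsmooth U f -> gsmooth U (gpartial i f).
Proof. by move=> sf s; have := sf (rcons s i); rewrite foldr_rcons. Qed.

Lemma gsmooth_cts U f x : gsmooth U f -> U x -> {for x, continuous f}.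
Proof. by move=> sf Ux; have [] := sf [::] x Ux. Qed.

Lemma gsmooth_derivable U f x i : gsmooth U f -> U x -> derivable f x (e i).
Proof. by move=> sf Ux; have [] := sf [::] x Ux. Qed.

Lemma gsmooth_sub U U' f : U' `<=` U -> gsmooth U f -> gsmooth U' f.
Proof. by move=> UU sf s x /UU; exact: sf. Qed.

Lemma gsmooth_eq U f h : open U -> (forall x, U x -> f x = h x) ->
  gsmooth U f -> gsmooth U h.
Proof.
move=> oU E sf.
apply: (@gsmooth_coind (fun h => exists2 f, gsmooth U f & forall x, U x -> f x = h x)) => //.
- move=> {sf E} h' [f' sf' E] x Ux.
  have E1 : \forall y \near x, f' y = h' y by exact: near_open oU Ux E.
  split=> [|i]; last by apply: (near_eq_derivable E1); exact: gsmooth_derivable sf' Ux.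
  have c := gsmooth_cts sf' Ux.
  rewrite /prop_for /continuous_at -E//; apply: cvg_trans c; apply: near_eq_cvg.
  by apply: filterS E1 => y.
- move=> {sf E} h' i [f' sf' E]; exists (gpartial i h') => //.
  exists (gpartial i f'); first exact: gsmooth_partial.
  move=> x Ux; apply: near_eq_derive.
  exact: near_open oU Ux E.
- by exists f.
Qed.

Lemma gsmooth_local f U : (forall x, U x -> exists2 W, W x & gsmooth W f) -> gsmooth U f.
Proof. by move=> h s x /h[W Wx sW]; exact: sW. Qed.

(** A derivative of a product or composite mixes all operations, so closure cannot be proved for one
    operation at a time. All expressions in smooth functions are closed under derivatives together,
    and [gsmooth_coind] applies to them. In [se_comp] the sequence [phi] carries the derivatives of
    the outer function. *)
Inductive smooth_expr U : (V -> R) -> Prop :=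
| se_base f : gsmooth U f -> smooth_expr U f
| se_cst c : smooth_expr U (fun=> c)
| se_add f h : smooth_expr U f -> smooth_expr U h -> smooth_expr U (f + h)
| se_mul f h : smooth_expr U f -> smooth_expr U h -> smooth_expr U (f * h)
| se_inv f : (forall x, U x -> f x != 0) -> smooth_expr U f ->
    smooth_expr U (fun x => (f x)^-1)
| se_comp (D : set R) (phi : nat -> R -> R) k f :
    (forall j y, D y -> is_derive y 1 (phi j) (phi j.+1 y)) ->
    (forall x, U x -> D (f x)) -> smooth_expr U f ->
    smooth_expr U (phi k \o f).

Lemma smooth_expr_derive U f : smooth_expr U f ->
  (forall x, U x -> {for x, continuous f} /\ forall i, derivable f x (e i)) /\
  (forall i, exists2 f', smooth_expr U f' & forall x, U x -> gpartial i f x = f' x).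
Proof.
elim=> {f} [f sf|c|f h sf [Hf Pf] sh [Hh Ph]|f h sf [Hf Pf] sh [Hh Ph]|f f0 sf [Hf Pf]
           |D phi k f dphi fD sf [Hf Pf]].
- split=> [x Ux|i]; first exact: (sf [::]).
  by exists (gpartial i f) => //; apply: se_base; exact: gsmooth_partial.
- split=> [x Ux|i]; first by split=> [|i]; [exact: cvg_cst|exact: derivable_cst].
  exists (fun=> 0); first exact: se_cst.
  by move=> x Ux; rewrite /gpartial derive_cst.
- split=> [x Ux|i].
    have [c1 d1] := Hf x Ux; have [c2 d2] := Hh x Ux.
    by split=> [|i]; [exact: cvgD|exact: derivableD].
  have [f' sf' E] := Pf i; have [h' sh' E'] := Ph i.
  exists (f' + h'); first exact: se_add.
  move=> x Ux; have [_ d1] := Hf x Ux; have [_ d2] := Hh x Ux.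
  by rewrite /gpartial deriveD//; congr (_ + _); [exact: E|exact: E'].
- split=> [x Ux|i].
    have [c1 d1] := Hf x Ux; have [c2 d2] := Hh x Ux.
    by split=> [|i]; [exact: cvgM|exact: derivableM].
  have [f' sf' E] := Pf i; have [h' sh' E'] := Ph i.
  exists (f * h' + h * f'); first by apply: se_add; exact: se_mul.
  move=> x Ux; have [_ d1] := Hf x Ux; have [_ d2] := Hh x Ux.
  rewrite /gpartial deriveM//; congr (_ + _).
    by rewrite -[RHS]/(f x * h' x) -(E' x Ux).
  by rewrite -[RHS]/(h x * f' x) -(E x Ux).
- split=> [x Ux|i].
    have [c1 d1] := Hf x Ux.
    by split=> [|i]; [apply: cvgV => //; exact: f0|apply: derivableV => //; exact: f0].
  have [f' sf' E] := Pf i.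
  pose fi x := (f x)^-1.
  exists ((fun=> -1) * (fi * fi) * f').
    have sfi : smooth_expr U fi by exact: se_inv.
    by apply: se_mul => //; apply: se_mul; [exact: se_cst|exact: se_mul].
  move=> x Ux; have [_ d1] := Hf x Ux.
  rewrite /gpartial deriveV//; last exact: f0.
  rewrite -[X in _ = X]/(-1 * (fi x * fi x) * f' x) -E// mulN1r.
  by rewrite /fi -invfM -expr2.
- split=> [x Ux|i].
    have [c1 d1] := Hf x Ux; have dp := dphi k _ (fD x Ux).
    split=> [|i].
      apply: continuous_comp => //; apply: derivable_continuous.
      by have [] := dp.
    by have [] := is_derive_comp_dir dp (DeriveDef (d1 i) erefl).
  have [f' sf' E] := Pf i.
  exists ((phi k.+1 \o f) * f').
    by apply: se_mul => //; exact: (@se_comp _ D phi k.+1).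
  move=> x Ux; have [_ d1] := Hf x Ux; have dp := dphi k _ (fD x Ux).
  rewrite /gpartial; have [_ ->] := is_derive_comp_dir dp (DeriveDef (d1 i) erefl).
  by rewrite -[RHS]/(phi k.+1 (f x) * f' x) -E.
Qed.

Variable U : set V.
Hypothesis oU : open U.

Lemma smooth_expr_gsmooth f : smooth_expr U f -> gsmooth U f.
Proof.
apply: gsmooth_coind => // h.
  by move=> /smooth_expr_derive[].
by move=> i /smooth_expr_derive[_ /(_ i)].
Qed.

Lemma gsmooth_cst c : gsmooth U (fun=> c).
Proof. by apply: smooth_expr_gsmooth; exact: se_cst. Qed.

Lemma gsmoothD f h : gsmooth U f -> gsmooth U h -> gsmooth U (fun x => f x + h x).
Proof. by move=> sf sh; apply: smooth_expr_gsmooth; apply: se_add; exact: se_base. Qed.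

Lemma gsmoothM f h : gsmooth U f -> gsmooth U h -> gsmooth U (fun x => f x * h x).
Proof. by move=> sf sh; apply: smooth_expr_gsmooth; apply: se_mul; exact: se_base. Qed.

Lemma gsmoothV f : (forall x, U x -> f x != 0) -> gsmooth U f -> gsmooth U (fun x => (f x)^-1).
Proof. by move=> f0 sf; apply: smooth_expr_gsmooth; apply: se_inv => //; exact: se_base. Qed.

Lemma gsmooth_comp_family (D : set R) (phi : nat -> R -> R) k f :
  (forall j y, D y -> is_derive y 1 (phi j) (phi j.+1 y)) ->
  (forall x, U x -> D (f x)) -> gsmooth U f -> gsmooth U (fun x => phi k (f x)).
Proof.
move=> dphi fD sf; apply: smooth_expr_gsmooth.
by apply: (@se_comp _ D phi k) => //; exact: se_base.
Qed.

Lemma gsmoothN f : gsmooth U f -> gsmooth U (fun x => - f x).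
Proof.
move=> sf; apply: (@gsmooth_eq _ (fun x => -1 * f x)) => //.
  by move=> x _; rewrite mulN1r.
by apply: gsmoothM => //; exact: gsmooth_cst.
Qed.

Lemma gsmoothB f h : gsmooth U f -> gsmooth U h -> gsmooth U (fun x => f x - h x).
Proof. by move=> sf sh; apply: gsmoothD sf (gsmoothN sh). Qed.

Lemma gsmooth_sum (J : Type) (r : seq J) (F : J -> V -> R) :
  (forall j, gsmooth U (F j)) -> gsmooth U (fun x => \sum_(j <- r) F j x).
Proof.
move=> sF; elim: r => [|j r IH].
  by apply: gsmooth_eq (gsmooth_cst 0) => // x _; rewrite big_nil.
by apply: gsmooth_eq (gsmoothD (sF j) IH) => // x _; rewrite big_cons.
Qed.

Lemma gsmooth_prod (J : Type) (r : seq J) (F : J -> V -> R) :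
  (forall j, gsmooth U (F j)) -> gsmooth U (fun x => \prod_(j <- r) F j x).
Proof.
move=> sF; elim: r => [|j r IH].
  by apply: gsmooth_eq (gsmooth_cst 1) => // x _; rewrite big_nil.
by apply: gsmooth_eq (gsmoothM (sF j) IH) => // x _; rewrite big_cons.
Qed.

Lemma gsmoothX f k : gsmooth U f -> gsmooth U (fun x => f x ^+ k).
Proof.
move=> sf; elim: k => [|k IH]; first exact: gsmooth_cst.
by apply: gsmooth_eq (gsmoothM sf IH) => // x _; rewrite exprS.
Qed.

Lemma gsmooth_det k (A : V -> 'M[R]_k) : (forall i j, gsmooth U (fun x => A x i j)) ->
  gsmooth U (fun x => \det (A x)).
Proof.
move=> sA; apply: gsmooth_sum => s; apply: gsmoothM; first exact: gsmooth_cst.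
by apply: gsmooth_prod => i; exact: sA.
Qed.

End smooth_calculus.

(** * Smooth functions of one real variable *)

Section smooth_real.
Context (R : realType).
Implicit Types (F : R -> R) (D : set R).

Definition smooth1 D F := gsmooth (fun _ : unit => 1 : R) D F.

Lemma smooth1_family D F : smooth1 D F -> exists phi : nat -> R -> R,
  (phi 0 =1 F) /\ forall k y, D y -> is_derive y 1 (phi k) (phi k.+1 y).
Proof.
move=> sF; exists (fun k => foldr (gpartial (fun=> 1 : R)) F (nseq k tt)); split => // k y Dy.
by have [_ /(_ tt)d] := sF (nseq k tt) y Dy; exact: DeriveDef.
Qed.

Lemma smooth1_derive D F y : smooth1 D F -> D y -> is_derive y 1 F (derive1 F y).
Proof.
move=> sF Dy; rewrite derive1E; apply: DeriveDef => //.
by have [_ /(_ tt)] := sF [::] y Dy.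
Qed.

Lemma gsmooth_comp (V : normedModType R) (I : Type) (e : I -> V) U D F f : open U ->
  smooth1 D F -> (forall x, U x -> D (f x)) -> gsmooth e U f ->
  gsmooth e U (fun x => F (f x)).
Proof.
move=> oU /smooth1_family[phi [p0 dp]] fD sf.
apply: (@gsmooth_eq _ _ _ _ _ (fun x => phi 0%N (f x))) => //.
exact: (@gsmooth_comp_family _ _ _ _ _ oU D phi 0%N f dp fD sf).
Qed.

(** The class made of [f] and the constants is closed under derivatives. *)
Lemma gsmooth_affine (V : normedModType R) (I : Type) (e : I -> V) (c : I -> R) f :
  continuous f -> (forall x i, is_derive x (e i) f (c i)) -> gsmooth e setT f.
Proof.
move=> cf df.
apply: (@gsmooth_coind _ _ _ e (fun h => h = f \/ exists a, h = fun=> a)) => //.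
- exact: openT.
- move=> h [->|[a ->]] x _; first by split=> [|i]; [exact: cf|have [] := df x i].
  by split=> [|i]; [exact: cvg_cst|exact: derivable_cst].
- move=> h i [->|[a ->]]; [exists (fun=> c i)|exists (fun=> 0)].
  + by right; exists (c i).
  + by move=> x _; rewrite /gpartial; have [_ ->] := df x i.
  + by right; exists 0.
  + by move=> x _; rewrite /gpartial derive_cst.
- by left.
Qed.

Lemma smooth1_id D : smooth1 D id.
Proof.
apply: (@gsmooth_sub _ _ _ _ setT) => //.
by apply: (gsmooth_affine (c := fun=> 1)) => // x; exact: cvg_id.
Qed.

Lemma smooth1_primitive D F G : open D -> (forall y, D y -> is_derive y 1 F (G y)) ->
  smooth1 D G -> smooth1 D F.
Proof.
move=> oD dF sG s x Dx.
case/lastP: s => [|s i].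
  by have [d _] := dF x Dx; split=> //; exact: derivable_continuous.
rewrite foldr_rcons.
suff : smooth1 D (gpartial (fun _ : unit => 1 : R) i F) by exact.
apply: (gsmooth_eq oD _ sG) => y Dy.
by rewrite /gpartial; have [_ ->] := dF y Dy.
Qed.

Lemma smooth1_expR D : smooth1 D expR.
Proof.
apply: (@gsmooth_sub _ _ _ _ setT) => //.
apply: (@gsmooth_comp_family _ _ _ _ setT openT setT (fun=> expR) 0 id) => //.
exact: smooth1_id.
Qed.

Lemma smooth1_inv : smooth1 [set x : R | x != 0] GRing.inv.
Proof.
apply: (@gsmoothV _ _ _ _ _ _ id) => //; exact: smooth1_id.
Qed.

Lemma smooth1_ln : smooth1 [set x : R | 0 < x] (@ln R).
Proof.
apply: (@smooth1_primitive _ _ GRing.inv); first exact: open_gt.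
by apply: gsmooth_sub smooth1_inv => x /= /lt0r_neq0.
Qed.

Lemma smooth1_sqrt : smooth1 [set x : R | 0 < x] Num.sqrt.
Proof.
apply: (@gsmooth_eq _ _ _ _ _ (fun x => expR (2^-1 * ln x))); first exact: open_gt.
  move=> x /= x0; apply/esym/eqP; rewrite -(@eqrXn2 _ 2)// ?expR_ge0 ?sqrtr_ge0//.
  rewrite sqr_sqrtr ?ltW// -expRM_natl mulrA mulfV// mul1r lnK//.
apply: (@gsmooth_comp _ _ _ _ setT expR) => //; first exact: smooth1_expR.
by apply: gsmoothM => //; [exact: gsmooth_cst|exact: smooth1_ln].
Qed.

(** The intermediate point is written as a convex combination, which covers both orders of [a] and
    [b] and the case of equality. *)
Lemma mean_value (F dF : R -> R) (a b : R) : (forall x : R, is_derive x 1 F (dF x)) ->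
  exists2 t, 0 <= t <= 1 & F b - F a = dF (a + t * (b - a)) * (b - a).
Proof.
move=> dFx.
have cF x y : {within `[x, y], continuous F}.
  by apply: derivable_within_continuous => z _; have [] := dFx z.
have [ab|ba|->] := ltgtP a b.
- have [c /itvP cab E] := MVT ab (fun x _ => dFx x) (cF a b).
  exists ((c - a) / (b - a)).
    by rewrite divr_ge0 ?ler_pdivrMr ?subr_gt0// ?mul1r ?lerD2r ?subr_ge0 ?cab// ltW.
  by rewrite divfK ?subr_eq0 ?gt_eqF// E; congr (dF _ * _); ring.
- have [c /itvP cab E] := MVT ba (fun x _ => dFx x) (cF b a).
  exists ((a - c) / (a - b)).
    by rewrite divr_ge0 ?ler_pdivrMr ?subr_gt0// ?mul1r ?lerD2l ?lerN2 ?subr_ge0 ?cab// ltW.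
  have ab0 : a - b != 0 by rewrite subr_eq0 gt_eqF.
  have -> : a + (a - c) / (a - b) * (b - a) = c by field.
  by rewrite -opprB E -mulrN opprB.
- by exists 0; rewrite ?lexx ?ler01// !subrr mulr0.
Qed.

End smooth_real.

(** * Flat functions, the smooth step and the entropy *)

Section flat_functions.
Context (R : realType).
Implicit Types (P : {poly R}) (x y : R).

(** The functions [P(1/x) exp(-1/x)], extended by zero, form a class closed under differentiation;
    this is why they are smooth at 0. *)
Definition flat P x : R := if 0 < x then P.[x^-1] * expR (- x^-1) else 0.

Lemma flat_neg P x : x <= 0 -> flat P x = 0.
Proof. by move=> x0; rewrite /flat ltNge x0. Qed.

Lemma flat_pos P x : 0 < x -> flat P x = P.[x^-1] * expR (- x^-1).
Proof. by move=> x0; rewrite /flat x0. Qed.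

(** The [k]-th power of the inequality [y / k <= expR (y / k)]. *)
Lemma expr_expR_le k y : 0 <= y -> y ^+ k <= k%:R ^+ k * expR y.
Proof.
move=> y0; case: k => [|k]; first by rewrite !expr0 mul1r -expR0 ler_expR.
have k0 : 0 < k.+1%:R :> R by [].
have kN0 := lt0r_neq0 k0.
have -> : y ^+ k.+1 = k.+1%:R ^+ k.+1 * (y / k.+1%:R) ^+ k.+1.
  by rewrite -exprMn mulrC divfK.
have -> : expR y = expR (y / k.+1%:R) ^+ k.+1 by rewrite -expRM_natr divfK.
rewrite ler_wpM2l ?exprn_ge0//.
rewrite lerXn2r ?nnegrE ?expR_ge0 ?divr_ge0//.
by apply: le_trans (expR_ge1Dx _); rewrite lerDr.
Qed.

Lemma horner_expR_bound P k : exists2 C : R, 0 <= C &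
  forall y, 0 <= y -> `|P.[y] * expR (- y)| * y ^+ k <= C.
Proof.
elim/poly_ind: P k => [k|P c IH k].
  by exists 0 => // y y0; rewrite horner0 !mul0r normr0 mul0r.
have [C C0 HC] := IH k.+1.
exists (C + `|c| * k%:R ^+ k); first by rewrite addr_ge0// mulr_ge0// exprn_ge0.
move=> y y0; rewrite hornerMXaddC mulrDl.
apply: (@le_trans _ _ ((`|P.[y] * y * expR (- y)| + `|c * expR (- y)|) * y ^+ k)).
  by rewrite ler_wpM2r ?exprn_ge0// ler_normD.
rewrite mulrDl lerD//.
  by rewrite mulrAC normrM (ger0_norm y0) -mulrA -exprS; exact: HC.
rewrite normrM -mulrA ler_wpM2l// ger0_norm ?expR_ge0//.
by rewrite expRN mulrC ler_pdivrMr ?expR_gt0//; exact: expr_expR_le.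
Qed.

(** At the origin [horner_expR_bound] with exponent 2 gives [|flat P h| <= C * h ^+ 2], so the
    derivative there is zero; elsewhere it is the chain rule. *)
Lemma is_derive_flat P x : is_derive x (1 : R) (flat P) (flat ('X^2 * (P - P^`())) x).
Proof.
have [x0|x0|->] := ltgtP x 0.
- rewrite flat_neg ?ltW//.
  have E : \forall y \near x, (fun=> 0) y = flat P y.
    have oL : open [set y : R | y < 0] by exact: open_lt.
    by apply: (near_open oL x0) => y /= y0; rewrite flat_neg// ltW.
  exact: near_eq_is_derive E (is_derive_cst _ _ _).
- have xN0 := lt0r_neq0 x0.
  have di : is_derive x (1 : R) (fun y : R => y^-1) (- x ^- 2).
    have := @is_deriveV R id x 1 1 xN0 (is_derive_id _ _).
    by rewrite /GRing.scale/= mulr1.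
  have dp := is_derive_comp_dir (is_derive_poly P x^-1) di.
  have dn := @is_derive_comp_dir _ _ expR (fun y : R => - y^-1) _ _ _ _ (is_derive_expR (- x^-1)) (is_deriveN di).
  have dm := is_deriveM dp dn.
  have E : \forall y \near x,
      ((horner P \o (fun y : R => y^-1)) * (expR \o (fun y : R => - y^-1))) y = flat P y.
    have oL : open [set y : R | 0 < y] by exact: open_gt.
    by apply: (near_open oL x0) => y /= y0; rewrite flat_pos.
  apply: is_derive_eq (near_eq_is_derive E dm) _.
  rewrite flat_pos// !hornerE /GRing.scale/= opprK exprVn.
  ring.
- rewrite flat_neg//.
  have [C C0 HC] := horner_expR_bound P 2.
  have fb h : `|flat P h| <= C * h ^+ 2.
    have [h0|h0] := ltP 0 h; last by rewrite flat_neg// normr0 mulr_ge0// sqr_ge0.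
    have := HC h^-1; rewrite invr_ge0 => /(_ (ltW h0)).
    by rewrite exprVn ler_pdivrMr ?exprn_gt0// flat_pos.
  have H : (h^-1 *: ((flat P \o shift 0) (h *: (1:R)) - flat P 0)) @[h --> (0:R)^'] --> (0:R).
    apply/cvgrPdist_le => /= eps eps0.
    near=> h.
    have h0 : h != 0 by near: h; exact: nbhs_dnbhs_neq.
    rewrite (flat_neg P (lexx 0)) subr0 addr0 sub0r normrN.
    have -> : h%:A = h by exact: mulr1.
    rewrite normrM normfV ler_pdivrMl ?normr_gt0//.
    apply: le_trans (fb h) _; rewrite -normr_id -[h ^+ 2]ger0_norm ?sqr_ge0//.
    rewrite normrX normr_id expr2 mulrA mulrC ler_wpM2l//.
    have : `|h| <= eps / (C + 1).
      by near: h; apply: dnbhs0_le; rewrite divr_gt0// ltr_wpDl.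
    by rewrite ler_pdivlMr ?ltr_wpDl// mulrDr; have := normr_ge0 h; nra.
  by apply: DeriveDef; [apply/cvg_ex; exists 0|exact: cvg_lim H].
Unshelve. all: by end_near. Qed.

Lemma smooth1_flat P D : smooth1 D (flat P).
Proof.
apply: (@gsmooth_sub _ _ _ _ setT) => //.
apply: (@gsmooth_coind _ _ _ _ (fun h => exists P, h = flat P)) => //.
- exact: openT.
- move=> h [Q ->] x _; have [d _] := is_derive_flat Q x.
  by split=> //; exact: derivable_continuous.
- move=> h i [Q ->]; eexists; first by eexists.
  by move=> x _; rewrite /gpartial; have [_ ->] := is_derive_flat Q x.
- by exists P.
Qed.

Lemma flat1_gt0 x : 0 < x -> 0 < flat 1 x.
Proof. by move=> x0; rewrite flat_pos// hornerC mul1r expR_gt0. Qed.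

Lemma flat1_ge0 x : 0 <= flat 1 x.
Proof. by have [/flat1_gt0/ltW//|x0] := ltP 0 x; rewrite flat_neg. Qed.

Definition step x := flat 1 x / (flat 1 x + flat 1 (1 - x)).

Lemma step_den x : 0 < flat 1 x + flat 1 (1 - x).
Proof.
have [x0|x0] := ltP 0 x; first by rewrite ltr_pwDl ?flat1_gt0 ?flat1_ge0.
by rewrite ltr_wpDl ?flat1_ge0 ?flat1_gt0// subr_gt0 (le_lt_trans x0).
Qed.

Lemma step_ge0 x : 0 <= step x.
Proof. by rewrite divr_ge0 ?flat1_ge0// ltW// step_den. Qed.

Lemma step_le1 x : step x <= 1.
Proof. by rewrite ler_pdivrMr ?step_den// mul1r lerDl flat1_ge0. Qed.

Lemma step0 x : x <= 0 -> step x = 0.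
Proof. by move=> x0; rewrite /step flat_neg// mul0r. Qed.

Lemma step1 x : 1 <= x -> step x = 1.
Proof.
move=> x1; rewrite /step (@flat_neg _ (1 - x)) ?subr_le0// addr0 divff//.
by rewrite gt_eqF// flat1_gt0// (lt_le_trans ltr01).
Qed.

Lemma smooth1_step D : smooth1 D step.
Proof.
apply: (@gsmooth_sub _ _ _ _ setT) => //.
have oT : open [set: R] by exact: openT.
have s1 : smooth1 setT (fun x : R => flat 1 (1 - x)).
  apply: (@gsmooth_comp _ _ _ _ _ setT (flat 1)) => //; first exact: smooth1_flat.
  by apply: gsmoothB => //; [exact: gsmooth_cst|exact: smooth1_id].
have s2 := gsmoothD oT (smooth1_flat 1 (D := setT)) s1.
have s3 := gsmoothV oT (fun x _ => lt0r_neq0 (step_den x)) s2.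
exact (gsmoothM oT (smooth1_flat 1 (D := setT)) s3).
Qed.

(** The function is not itself a [flat P], which would require [P = 1/X], but its first two
    derivatives are, with [P = 1 + X] and [P = X^3]. *)
Definition ent x := x * flat 1 x.
Definition dent x := flat (1 + 'X) x.

Lemma is_derive_ent x : is_derive x (1 : R) ent (dent x).
Proof.
have d1 : is_derive x (1:R) (id : R -> R) 1 by exact: is_derive_id.
have dm := is_deriveM d1 (is_derive_flat 1 x).
apply: is_derive_eq dm _; rewrite /dent.
have [x0|x0] := leP x 0; first by rewrite !flat_neg// /GRing.scale/= mulr0 mulr1 addr0.
rewrite !flat_pos// derivC !hornerE /GRing.scale/= mulr1 subr0 mulr1.
by rewrite expr2 mulrA mulrA mulfV ?gt_eqF// mul1r addrC mulrDl mul1r.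
Qed.

Lemma is_derive_dent x : is_derive x (1 : R) dent (flat 'X^3 x).
Proof.
apply: is_derive_eq (is_derive_flat _ _) _; congr flat.
by rewrite derivD derivC derivX add0r addrAC subrr add0r -exprSr.
Qed.

Lemma smooth1_ent D : smooth1 D ent.
Proof.
apply: (@gsmooth_sub _ _ _ _ setT) => //.
by apply: gsmoothM; [exact: openT|exact: smooth1_id|exact: smooth1_flat].
Qed.

Lemma smooth1_dent D : smooth1 D dent. Proof. exact: smooth1_flat. Qed.

Lemma flat_X3_ge0 x : 0 <= flat 'X^3 x.
Proof.
have [x0|x0] := leP x 0; first by rewrite flat_neg.
by rewrite flat_pos// hornerXn mulr_ge0 ?expR_ge0// exprn_ge0// invr_ge0 ltW.
Qed.

(** Put [y = 1/x]. From [e >= 2] and [exp(y/3 - 1) >= y/3] one gets [exp(y/3) >= 2y/3]; cubing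
    yields [y^3 <= 27/8 exp(y)]. *)
Lemma flat_X3_le x : flat 'X^3 x <= 6.
Proof.
have [x0|x0] := leP x 0; first by rewrite flat_neg.
rewrite flat_pos// hornerXn expRN ler_pdivrMr ?expR_gt0//.
set y := x^-1; have y0 : 0 <= y by rewrite invr_ge0 ltW.
have e1 : 2 <= expR (1 : R) by have := expR_ge1Dx (1 : R).
have e2 : y / 3 <= expR (y / 3 - 1).
  by have := expR_ge1Dx (y / 3 - 1); rewrite addrC subrK.
have e3 : 2 * (y / 3) <= expR (y / 3).
  rewrite -[X in expR X](addrNK 1) addrC expRD.
  by apply: ler_pM => //; rewrite divr_ge0.
have -> : expR y = expR (y / 3) ^+ 3.
  by rewrite -expRM_natr divfK.
have e4 : (2 * (y / 3)) ^+ 3 <= expR (y / 3) ^+ 3.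
  by rewrite lerXn2r ?nnegrE ?expR_ge0// mulr_ge0// divr_ge0.
have y3 : 0 <= y ^+ 3 by exact: exprn_ge0.
have E : (2 * (y / 3)) ^+ 3 = 8 / 27 * y ^+ 3 by field.
by move: e4; rewrite E; lra.
Qed.

Lemma dent_ge0 x : 0 <= dent x.
Proof.
rewrite /dent; have [x0|x0] := leP x 0; first by rewrite flat_neg.
by rewrite flat_pos// !hornerE mulr_ge0 ?expR_ge0// addr_ge0// invr_ge0 ltW.
Qed.

Lemma dent_le1 x : dent x <= 1.
Proof.
rewrite /dent; have [x0|x0] := leP x 0; first by rewrite flat_neg.
rewrite flat_pos// !hornerE expRN ler_pdivrMr ?expR_gt0// mul1r.
exact: expR_ge1Dx.
Qed.

Lemma dent_lip x y : `|dent x - dent y| <= 6 * `|x - y|.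
Proof.
have [t _ ->] := mean_value y x is_derive_dent.
by rewrite normrM ler_wpM2r// ger0_norm ?flat_X3_ge0// flat_X3_le.
Qed.

Lemma ent_ge0 x : 0 <= ent x.
Proof.
rewrite /ent; have [x0|x0] := leP x 0; first by rewrite flat_neg// mulr0.
by rewrite mulr_ge0 ?flat1_ge0// ltW.
Qed.

Lemma dent0 : dent 0 = 0. Proof. by rewrite /dent flat_neg. Qed.

Lemma ent0 : ent 0 = 0. Proof. by rewrite /ent mul0r. Qed.

(** The difference [F] of the two sides has a derivative of the sign opposite to [t], since [dent]
    is 6-Lipschitz; so [F] is largest at 0. *)
Lemma ent_taylor x y : ent (x + y) <= ent x + dent x * y + 3 * y ^+ 2.
Proof.
pose F t := ent (x + t) - dent x * t - 3 * t ^+ 2.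
have dF t : is_derive t (1 : R) F (dent (x + t) - dent x - 6 * t).
  have d1 : is_derive t (1 : R) (fun s : R => x + s) 1.
    have := is_deriveD (is_derive_cst x t (1 : R)) (is_derive_id t (1 : R)).
    by rewrite add0r.
  have d2 := is_derive_comp_dir (is_derive_ent (x + t)) d1.
  have d3 : is_derive t (1 : R) (fun s : R => dent x * s) (dent x).
    have := is_deriveZ (dent x) (is_derive_id t (1 : R)).
    by rewrite /GRing.scale/= mulr1.
  have d4 : is_derive t (1 : R) (fun s : R => 3 * s ^+ 2) (6 * t).
    have := is_deriveZ 3 (is_deriveX 2 (is_derive_id t (1 : R))).
    rewrite /GRing.scale/= expr1 => H; apply: is_derive_eq H _; ring.
  have := is_deriveB (is_deriveB d2 d3) d4.
  by rewrite mulr1.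
have [t /andP[t0 t1] E] := mean_value 0 y dF.
have : F y - F 0 <= 0.
  rewrite E add0r subr0.
  have := dent_lip (x + t * y) x.
  rewrite addrAC subrr add0r normrM (ger0_norm t0) => l1.
  have [y0|y0] := leP 0 y.
    rewrite ger0_norm// in l1; move: (le_trans (ler_norm _) l1) => l2.
    by rewrite mulr_le0_ge0//; lra.
  have := ler_norm (dent x - dent (x + t * y)); rewrite distrC => l2.
  rewrite ltr0_norm// in l1; have := le_trans l2 l1 => l3.
  by apply: mulr_ge0_le0; [rewrite mulrN in l3; lra|exact: ltW].
by rewrite /F addr0 mulr0 expr0n/= mulr0 !subr0; lra.
Qed.

Lemma ent_le_pos x : ent x <= Num.max x 0 <= ent x + 1.
Proof.
rewrite /ent; have [x0|x0] := leP x 0; first by rewrite flat_neg// mulr0 lexx add0r ler01.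
rewrite flat_pos// hornerC mul1r.
have e1 : expR (- x^-1) <= 1 by rewrite -expR0 ler_expR oppr_le0 invr_ge0 ltW.
have e2 := expR_ge1Dx (- x^-1).
apply/andP; split; first by rewrite ler_piMr// ltW.
have := ler_wpM2l (ltW x0) e2; rewrite mulrDr mulr1 mulrN mulfV ?gt_eqF//; lra.
Qed.

Lemma ent_pos x : 0 < x -> 0 < ent x.
Proof. by move=> x0; rewrite mulr_gt0// flat1_gt0. Qed.

Lemma dent_lin x : `|dent x| <= 6 * `|x|.
Proof. by have := dent_lip x 0; rewrite dent0 !subr0. Qed.

Lemma ent_diff x y : exists2 c, `|c| <= `|x| + `|y| & `|ent x - ent y| = dent c * `|x - y|.
Proof.
have [t /andP[t0 t1] ->] := mean_value y x is_derive_ent.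
exists (y + t * (x - y)); last by rewrite normrM (ger0_norm (dent_ge0 _)).
have -> : y + t * (x - y) = t * x + (1 - t) * y by ring.
apply: le_trans (ler_normD _ _) _; rewrite !normrM (ger0_norm t0).
have t2 : 0 <= 1 - t by rewrite subr_ge0.
by rewrite (ger0_norm t2); apply: lerD; apply: ler_piMl => //; lra.
Qed.

Lemma entropy_ent : entropy_fun ent dent.
Proof.
have cent (F : R -> R) : smooth1 setT F -> measurable_fun setT F.
  by move=> sF; apply: continuous_measurable_fun => x; exact: gsmooth_cts sF I.
split.
- by apply: cent; exact (@smooth1_ent setT).
- by apply: cent; exact (@smooth1_dent setT).
- exact: ent_ge0.
- by move=> x x0; rewrite /ent flat_neg// mulr0.
- exact: ent_pos.
- by move=> x; have := ent_taylor 0 x; rewrite add0r ent0 dent0 mul0r !add0r.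
- exact: dent_lin.
- move=> x y; have [c _ ->] := ent_diff x y.
  by rewrite ler_piMl// dent_le1.
- move=> x y; have [c cxy ->] := ent_diff x y.
  rewrite ler_wpM2r//; apply: le_trans (ler_norm _) (le_trans (dent_lin c) _).
  by rewrite ler_wpM2l.
- exact: ent_taylor.
- move=> x N N0.
  have -> : Num.max x 0 = Num.max (N * x) 0 / N.
    have <- : N * Num.max x 0 = Num.max (N * x) 0 by rewrite maxr_pMr ?mulr0// ltW.
    by rewrite mulrC mulKf// gt_eqF.
  have /andP[a b] := ent_le_pos (N * x).
  rewrite -mulrBl normrM [X in _ * X]gtr0_norm ?invr_gt0//.
  apply: ler_piMl; first by rewrite invr_ge0 ltW.
  by rewrite ler_norml; apply/andP; split; lra.
Qed.

End flat_functions.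

(** * Test functions *)

Section smooth_rV.
Context (R : realType) (n : nat).
Implicit Types (f h : 'rV[R]_n -> R) (U : set 'rV[R]_n).

Definition smooth_on U f := gsmooth (fun i : 'I_n => delta_mx 0 i : 'rV[R]_n) U f.

Lemma smoothP f : smooth f <-> smooth_on setT f.
Proof.
split=> [sf s x _|sf s]; first by have [c d] := sf s; split=> [|i]; [exact: c|exact: d].
split=> [x|i x]; first by have [] := sf s x I.
by have [_ /(_ i)] := sf s x I.
Qed.

Lemma smooth_continuous f : smooth f -> continuous f.
Proof. by move=> sf; have [] := sf [::]. Qed.

Lemma smooth_derivable f x (i : 'I_n) : smooth f -> derivable f x (delta_mx 0 i).
Proof. by move=> sf; have [_] := sf [::]; exact. Qed.

Lemma smooth_partial f i : smooth f -> smooth (partial i f).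
Proof. by move=> sf s; have := sf (rcons s i); rewrite foldr_rcons. Qed.

Lemma smooth_cst c : smooth (fun _ : 'rV[R]_n => c).
Proof. by apply/smoothP; apply: gsmooth_cst; exact: openT. Qed.

Lemma smoothD f h : smooth f -> smooth h -> smooth (fun x => f x + h x).
Proof. by move=> /smoothP sf /smoothP sh; apply/smoothP; exact (gsmoothD openT sf sh). Qed.

Lemma smoothB f h : smooth f -> smooth h -> smooth (fun x => f x - h x).
Proof. by move=> /smoothP sf /smoothP sh; apply/smoothP; exact (gsmoothB openT sf sh). Qed.

Lemma smoothM f h : smooth f -> smooth h -> smooth (fun x => f x * h x).
Proof. by move=> /smoothP sf /smoothP sh; apply/smoothP; exact (gsmoothM openT sf sh). Qed.

Lemma smoothV f : (forall x, f x != 0) -> smooth f -> smooth (fun x => (f x)^-1).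
Proof. by move=> f0 /smoothP sf; apply/smoothP; exact (gsmoothV openT (fun x _ => f0 x) sf). Qed.

Lemma smooth_sum (J : Type) (r : seq J) (F : J -> 'rV[R]_n -> R) :
  (forall j, smooth (F j)) -> smooth (fun x => \sum_(j <- r) F j x).
Proof.
move=> sF; apply/smoothP; apply: (gsmooth_sum openT) => j.
by have /smoothP := sF j.
Qed.

Lemma smooth_prod (J : Type) (r : seq J) (F : J -> 'rV[R]_n -> R) :
  (forall j, smooth (F j)) -> smooth (fun x => \prod_(j <- r) F j x).
Proof.
move=> sF; apply/smoothP; apply: (gsmooth_prod openT) => j.
by have /smoothP := sF j.
Qed.

Lemma smooth_comp D F f : smooth1 D F -> (forall x, D (f x)) -> smooth f ->
  smooth (fun x => F (f x)).
Proof.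
by move=> sF fD /smoothP sf; apply/smoothP; exact (gsmooth_comp openT sF (fun x _ => fD x) sf).
Qed.

Lemma is_derive_coord (i : 'I_n) (x v : 'rV[R]_n) : is_derive x v (fun y : 'rV[R]_n => y 0 i) (v 0 i).
Proof.
apply/is_derive_lineP.
have -> : (fun s : R => (x + s *: v) 0 i) = (fun s => x 0 i + v 0 i * s).
  by apply/funext => s; rewrite !mxE [_ * s]mulrC.
have := is_deriveD (is_derive_cst (x 0 i) (0 : R) (1 : R))
  (is_deriveZ (v 0 i) (is_derive_id (0 : R) (1 : R))).
by rewrite /GRing.scale/= add0r mulr1.
Qed.

Lemma smooth_coord (i : 'I_n) : smooth (fun x : 'rV[R]_n => x 0 i).
Proof.
apply/smoothP; apply: (gsmooth_affine (c := fun j => delta_mx 0 j 0 i)).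
  exact: coord_continuous.
by move=> x j; exact: is_derive_coord.
Qed.

Lemma test_function_bs f : test_function f <-> smooth f /\ bounded_support f.
Proof. by split=> -[sf /compactly_supportedP bf]. Qed.

Lemma bounded_supportD f h : bounded_support f -> bounded_support h ->
  bounded_support (fun x => f x + h x).
Proof.
move=> [M M0 hf] [N N0 hh]; exists (M + N); first by rewrite addr_gt0.
move=> x xMN; rewrite hf ?hh ?addr0//; apply: le_trans xMN.
  by rewrite lerDr ltW.
by rewrite lerDl ltW.
Qed.

Lemma bounded_supportM f h : bounded_support h -> bounded_support (fun x => f x * h x).
Proof. by move=> [M M0 hf]; exists M => // x /hf ->; rewrite mulr0. Qed.

Lemma bounded_support_comp (W W' : zmodType) (f : 'rV[R]_n -> W) (h : 'rV[R]_n -> W') : (forall x, f x = 0 -> h x = 0) ->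
  bounded_support f -> bounded_support h.
Proof. by move=> fh [M M0 hf]; exists M => // x /hf/fh. Qed.

Lemma test_functionD f h : test_function f -> test_function h ->
  test_function (fun x => f x + h x).
Proof.
move=> /test_function_bs[sf bf] /test_function_bs[sh bh]; apply/test_function_bs.
by split; [exact: smoothD|exact: bounded_supportD].
Qed.

Lemma test_functionM f h : smooth f -> test_function h -> test_function (fun x => f x * h x).
Proof.
move=> sf /test_function_bs[sh bh]; apply/test_function_bs.
by split; [exact: smoothM|exact: bounded_supportM].
Qed.

Lemma test_functionZ c f : test_function f -> test_function (fun x => c * f x).
Proof. by apply: test_functionM; exact: smooth_cst. Qed.

Lemma test_function0 : test_function (fun _ : 'rV[R]_n => 0 : R).
Proof. by apply/test_function_bs; split; [exact: smooth_cst|exists 1]. Qed.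

Lemma bounded_support_partial f i : smooth f -> bounded_support f -> bounded_support (partial i f).
Proof.
move=> sf [M M0 hf]; exists (M + 1); first by rewrite addr_gt0.
move=> x xM; rewrite /partial.
rewrite (@near_eq_derive _ _ _ _ (fun=> 0)) ?derive_cst//.
have oU : open [set y : 'rV[R]_n | M < `|y|].
  rewrite (_ : mkset _ = ~` [set y : 'rV[R]_n | `|y| <= M]).
    by rewrite openC; exact: closed_norm_le.
  by apply/seteqP; split=> y /=; rewrite ltNge => /negP.
apply: near_open oU _ _; first by rewrite /= (lt_le_trans _ xM)// ltrDl.
by move=> y /= /ltW/hf.
Qed.

(** As [k] grows the first factor tends to the indicator of [x 0 i > a 0 i]. The shift by 1 keeps
    the second factor equal to 1 at [x 0 i = b 0 i], so the limit is the indicator of the half-open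
    box. *)
Definition bump (a b : 'rV[R]_n) (k : R) (x : 'rV[R]_n) : R :=
  \prod_(i < n) (step (k * (x 0 i - a 0 i)) * step (k * (b 0 i - x 0 i) + 1)).

Lemma bump_ge0 a b k x : 0 <= bump a b k x.
Proof. by apply: prodr_ge0 => i _; rewrite mulr_ge0 ?step_ge0. Qed.

Lemma bump_le1 a b k x : bump a b k x <= 1.
Proof.
apply: prodr_ile1 => i _; rewrite mulr_ge0 ?step_ge0//=.
by rewrite mulr_ile1 ?step_ge0 ?step_le1.
Qed.

Lemma bump_out a b k x : 1 <= k -> bump a b k x != 0 -> forall i, a 0 i < x 0 i < b 0 i + 1.
Proof.
move=> k1 h i; apply: contraNT h; rewrite negb_and -!leNgt => h.
have k0 : 0 < k by exact: lt_le_trans k1.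
rewrite /bump (bigD1 i)//= mulf_eq0; apply/orP; left; rewrite mulf_eq0.
apply/orP; case/orP: h => h; [left|right].
  by rewrite step0// mulr_ge0_le0 ?subr_le0// ltW.
rewrite step0//; have : b 0 i - x 0 i <= -1 by lra.
by move=> /(ler_wpM2l (ltW k0)); rewrite mulrN1 => h2; lra.
Qed.

Lemma bump_test a b k : 1 <= k -> test_function (bump a b k).
Proof.
move=> k1; apply/test_function_bs; split.
  apply: smooth_prod => i; apply: smoothM.
    apply: (@smooth_comp setT (@step R)) => //; first exact (@smooth1_step R setT).
    apply: smoothM; first exact: smooth_cst.
    by apply: smoothB; [exact: smooth_coord|exact: smooth_cst].
  apply: (@smooth_comp setT (@step R)) => //; first exact (@smooth1_step R setT).
  apply: smoothD; last exact: smooth_cst.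
  apply: smoothM; first exact: smooth_cst.
  by apply: smoothB; [exact: smooth_cst|exact: smooth_coord].
exists (`|a| + `|b| + 1 + 1); first by rewrite ltr_wpDl// addr_ge0// addr_ge0.
move=> x xM; apply: contrapT => /eqP/(bump_out k1) h.
have : `|x| <= `|a| + `|b| + 1.
  apply: norm_le_coord => [|i]; first by rewrite !addr_ge0.
  have /andP[h1 h2] := h i; have := coord_norm a i; have := coord_norm b i.
  rewrite !ler_norml => /andP[b1 b2] /andP[a1 a2].
  have := normr_ge0 a; have := normr_ge0 b => *.
  by apply/andP; split; lra.
by move=> h2; have := le_trans xM h2; lra.
Qed.

Lemma bump_cvg a b x : bump a b k.+1%:R x @[k --> \oo] --> (\1_(box a b) x : R).
Proof.
have big (c : R) : 0 < c -> exists N : nat, forall k, (N <= k)%N -> 1 <= k.+1%:R * c.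
  move=> c0; exists (Num.bound c^-1) => k Nk.
  rewrite -ler_pdivrMr// div1r ltW//.
  apply: lt_le_trans (archi_boundP _) _; first by rewrite invr_ge0 ltW.
  by rewrite ler_nat leqW.
have [xb|xb] := pselect (box a b x).
  have [N HN] : exists N : nat, forall k i, (N <= k)%N -> 1 <= k.+1%:R * (x 0 i - a 0 i).
    have h i : exists N : nat, forall k, (N <= k)%N -> 1 <= k.+1%:R * (x 0 i - a 0 i).
      by apply: big; rewrite subr_gt0; case/andP: (xb i).
    have [f Hf] := choice h.
    exists (\max_(i < n) f i) => k i Nk; apply: Hf; apply: leq_trans Nk; exact: leq_bigmax.
  apply: cvg_near_cst; exists N => // k /= Nk.
  rewrite indicE mem_set// /bump big1// => i _.
  rewrite step1 ?HN// step1 ?mulr1// lerDr mulr_ge0// subr_ge0.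
  by case/andP: (xb i).
have [i xi] : exists i, ~~ (a 0 i < x 0 i <= b 0 i).
  by apply: contrapT => h; apply: xb => i; apply: contrapT => /negP hi; apply: h; exists i.
rewrite indicE memNset//.
move: xi; rewrite negb_and -leNgt -ltNge => /orP[xi|xi].
  apply: cvg_near_cst; exists 0%N => // k _.
  by rewrite /bump (bigD1 i)//= step0 ?mul0r// mulr_ge0_le0// subr_le0.
have [N HN] := big _ (eq_ind_r is_true xi (subr_gt0 (b 0 i) (x 0 i))).
apply: cvg_near_cst; exists N => // k /= /HN h.
rewrite /bump (bigD1 i)//= (@step0 _ (_ * (b 0 i - _) + 1)) ?mulr0 ?mul0r//.
by rewrite -opprB mulrN addrC subr_le0.
Qed.

End smooth_rV.

Import HBSimple HBNNSimple.

(** * Density of test functions in weighted L2 spaces *)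

Section density.
Context (R : realType) (n : nat) (mu : {measure set 'rV[R]_n -> \bar R}).
Hypothesis mu_fin : forall M : R, (mu [set x : 'rV[R]_n | (`|x| <= M)%R] < +oo)%E.
Variable w : 'rV[R]_n -> R.
Hypotheses (cw : continuous w) (w0 : forall x, 0 <= w x).
Implicit Types (f h : 'rV[R]_n -> R).

Let mw : measurable_fun setT w := continuous_measurable_rV cw.
Local Notation isL2 := (isL2 mu w).
Local Notation nm := (nm mu w).
Let L2D := @L2D _ _ _ mu w mw w0.
Let L2Z := @L2Z _ _ _ mu w mw w0.
Let L2B := @L2B _ _ _ mu w mw w0.
Let L2_le := @L2_le _ _ _ mu w mw w0.

Lemma bounded_support_L2 f : measurable_fun setT f -> bounded_support f ->
  (exists C, forall x, `|f x| <= C) -> isL2 f.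
Proof.
move=> mf [M M0 bf] [C hC]; apply: igr_L2 => //.
have [W W0 hW] := continuous_bounded M cw.
apply: bounded_support_igr => //.
- by apply: measurable_funM => //; exact: measurable_funX.
- by exists M => // x /bf ->; rewrite expr0n mul0r.
exists (C ^+ 2 * W) => x; rewrite normrM normrX.
have C0 : 0 <= C by exact: le_trans (normr_ge0 _) (hC x).
have [xM|/ltW/bf ->] := leP `|x| M; last by rewrite normr0 expr0n mul0r mulr_ge0 ?exprn_ge0// ltW.
by rewrite ler_pM ?exprn_ge0//; [rewrite lerXn2r ?nnegrE|exact: hW].
Qed.

Lemma test_L2 f : test_function f -> isL2 f.
Proof.
move=> /test_function_bs[/smooth_continuous cf bf].
apply: bounded_support_L2 => //; first exact: continuous_measurable_rV.
by have [C _ hC] := bounded_support_bounded cf bf; exists C.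
Qed.

Definition test_closure f := isL2 f /\
  forall e, 0 < e -> exists2 phi, test_function phi & nm (fun x => f x - phi x) <= e.

Lemma test_closureD f h : test_closure f -> test_closure h ->
  test_closure (fun x => f x + h x).
Proof.
move=> [f2 Hf] [h2 Hh]; split; first exact: L2D.
move=> e e0; have e20 : 0 < e / 2 by rewrite divr_gt0.
have [p tp Hp] := Hf _ e20; have [q tq Hq] := Hh _ e20.
exists (fun x => p x + q x); first exact: test_functionD.
rewrite (_ : (fun x => _) = fun x => (f x - p x) + (h x - q x)); last first.
  by apply/funext => x; rewrite opprD addrACA.
apply: le_trans (nmD mw w0 (L2B f2 (test_L2 tp)) (L2B h2 (test_L2 tq))) _.
lra.
Qed.

Lemma test_closureZ c f : test_closure f -> test_closure (fun x => c * f x).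
Proof.
move=> [f2 Hf]; split; first exact: L2Z.
move=> e e0; have d0 : 0 < `|c| + 1 by rewrite ltr_wpDl.
have [p tp Hp] := Hf _ (divr_gt0 e0 d0).
exists (fun x => c * p x); first exact: test_functionZ.
rewrite (_ : (fun x => _) = fun x => c * (f x - p x)); last first.
  by apply/funext => x; rewrite mulrBr.
rewrite (nmZ mw w0 c (L2B f2 (test_L2 tp))).
have : `|c| * nm (fun x => f x - p x) <= `|c| * (e / (`|c| + 1)) by exact: ler_wpM2l.
move=> /le_trans; apply; rewrite mulrA ler_pdivrMr// mulrC; apply: ler_wpM2l; first exact: ltW.
by rewrite lerDl.
Qed.

Lemma test_closure_lim f : isL2 f ->
  (forall e, 0 < e -> exists2 h, test_closure h & nm (fun x => f x - h x) <= e) ->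
  test_closure f.
Proof.
move=> f2 H; split=> // e e0; have e20 : 0 < e / 2 by rewrite divr_gt0.
have [h [h2 Hh] fh] := H _ e20; have [p tp Hp] := Hh _ e20.
exists p => //; apply: le_trans (nm_dist mw w0 f2 h2 (test_L2 tp)) _; lra.
Qed.

Lemma test_closure_dct (F : nat -> 'rV[R]_n -> R) f G : isL2 f -> (forall j, test_closure (F j)) ->
  (forall x, F j x @[j --> \oo] --> f x) -> isL2 G ->
  (forall x (j : nat), `|F j x - f x| <= G x) -> test_closure f.
Proof.
move=> f2 F2 Ff G2 FG; apply: test_closure_lim => // e e0.
have := L2_dct mw w0 (fun j => L2_meas (F2 j).1) (L2_meas f2) (aeW _ Ff) G2 (aeW _ FG).
move=> /cvgnP/(_ e e0)[N /(_ N (leqnn N))]; rewrite subr0 => h.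
exists (F N) => //; rewrite nm_distC; exact: le_trans (ler_norm _) h.
Qed.

Lemma test_closure_test f : test_function f -> test_closure f.
Proof.
move=> tf; split; first exact: test_L2.
move=> e e0; exists f => //; rewrite (_ : (fun x => _) = fun=> 0); last first.
  by apply/funext => x; rewrite subrr.
by rewrite nm0 ltW.
Qed.

Lemma bounded_indic_L2 A (K : R) : measurable A -> A `<=` [set x : 'rV[R]_n | `|x| <= K] ->
  isL2 (\1_A).
Proof.
move=> mA AK; apply: bounded_support_L2; first exact: measurable_indic.
  exists (`|K| + 1); first by rewrite ltr_wpDl.
  move=> x xK; rewrite indicE memNset// => /AK/= xK'.
  have := le_trans xK xK'; have := ler_norm K; lra.
by exists 1 => x; rewrite indicE; case: (_ \in _); rewrite ?normr1 ?normr0.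
Qed.

Lemma box_bounded (a b : 'rV[R]_n) : box a b `<=` [set x : 'rV[R]_n | `|x| <= `|a| + `|b| + 1].
Proof.
move=> x xb /=; apply: norm_le_coord => [|i]; first by rewrite !addr_ge0.
have /andP[h1 h2] := xb i; have := coord_norm a i; have := coord_norm b i.
rewrite !ler_norml => /andP[b1 b2] /andP[a1 a2].
have := normr_ge0 a; have := normr_ge0 b => *.
by apply/andP; split; lra.
Qed.

Lemma test_closure_box (a b : 'rV[R]_n) : test_closure (\1_(box a b)).
Proof.
have b2 : isL2 (\1_(box a b)) by exact: bounded_indic_L2 (measurable_box a b) (@box_bounded a b).
have k1 (j : nat) : 1 <= j.+1%:R :> R by rewrite ler1n.
pose K := `|a| + `|b| + 1.
pose G : 'rV[R]_n -> R := \1_[set x : 'rV[R]_n | `|x| <= K].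
have G2 : isL2 G by exact: bounded_indic_L2 (measurable_norm_le _) (@subset_refl _ _).
apply: (@test_closure_dct (fun j => bump a b j.+1%:R) _ G) => //.
- by move=> j; apply: test_closure_test; exact: bump_test.
- by move=> x; exact: bump_cvg.
move=> x j; rewrite /G [in leRHS]indicE; have [xK|xK] := leP `|x| K.
  rewrite mem_set//= indicE.
  have := bump_ge0 a b j.+1%:R x; have := bump_le1 a b j.+1%:R x.
  move: (bump a b _ x) => z h1 h2; rewrite ler_norml.
  by case: (x \in _) => /=; apply/andP; split; lra.
rewrite memNset/=; last by rewrite leNgt xK.
rewrite indicE memNset ?subr0; last by move=> /box_bounded/=; rewrite leNgt xK.
suff -> : bump a b j.+1%:R x = 0 by rewrite normr0.
apply: contrapT => /eqP/(bump_out (k1 j)) h.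
have : `|x| <= K.
  apply: norm_le_coord => [|i]; first by rewrite /K !addr_ge0.
  have /andP[h1 h2] := h i; have := coord_norm a i; have := coord_norm b i.
  rewrite /K !ler_norml => /andP[b1 b3] /andP[a1 a2].
  have := normr_ge0 a; have := normr_ge0 b => *.
  by apply/andP; split; lra.
by rewrite leNgt xK.
Qed.

Lemma test_closure_eq f h : (forall x, f x = h x) -> test_closure f -> test_closure h.
Proof. by move=> /funext ->. Qed.

(** A Dynkin-class argument starting from boxes. Intersecting with a fixed box keeps all indicators
    in L2, so that complements can be taken. *)
Lemma test_closure_indic A (c e : 'rV[R]_n) : measurable A -> test_closure (\1_(A `&` box c e)).
Proof.
have mB (F : set 'rV[R]_n) : measurable F -> measurable (F `&` box c e).
  by move=> mF; apply: measurableI => //; exact: measurable_box.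
have FB (F : set 'rV[R]_n) : F `&` box c e `<=` [set x : 'rV[R]_n | `|x| <= `|c| + `|e| + 1].
  by move=> x [_ /box_bounded].
have iE (F : set 'rV[R]_n) x : \1_(F `&` box c e) x = \1_F x * \1_(box c e) x :> R.
  by rewrite indicI.
have B2 (F : set 'rV[R]_n) : measurable F -> isL2 (\1_(F `&` box c e)).
  by move=> mF; exact: bounded_indic_L2 (mB _ mF) (FB F).
rewrite measurable_boxes.
apply: (@dynkin_induction _ _ (@boxes R n) (fun S => test_closure (\1_(S `&` box c e)))).
- exact: measurable_boxes.
- exact: boxes_setI.
- by rewrite setTI; exact: test_closure_box.
- move=> _ [a [b ->]]; have [a' [b' ->]] : boxes (box a b `&` box c e).
    by apply: boxes_setI; [exists a, b|exists c, e].
  exact: test_closure_box.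
- move=> S mS cS.
  apply: (@test_closure_eq (fun x => \1_(box c e) x + -1 * \1_(S `&` box c e) x)).
    move=> x; rewrite !iE (_ : \1_(~` S) x = 1 - \1_S x :> R); first by ring.
    by rewrite !indicE in_setC; case: (_ \in _); rewrite /= ?subrr ?subr0.
  by apply: test_closureD; [exact: test_closure_box|exact: test_closureZ].
- move=> F mF tF cF.
  have mU : measurable (\bigcup_k F k) by exact: bigcupT_measurable.
  pose S k x : R := \sum_(j < k) \1_(F j `&` box c e) x.
  have SE k x : S k x = \1_((\big[setU/set0]_(j < k) F j) `&` box c e) x.
    rewrite iE /S -(@big_mkord _ _ _ k xpredT (fun j => \1_(F j `&` box c e) x)).
    rewrite -(big_mkord xpredT F).
    elim: k => [|k IH]; first by rewrite !big_nil indic0 mul0r.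
    rewrite !big_nat_recr//= IH iE -mulrDl; congr (_ * _).
    rewrite !indicE in_setU.
    have [xU|_] := boolP (x \in \big[setU/set0]_(0 <= i < k) F i); last by rewrite add0r.
    have [xF|_] := boolP (x \in F k); last by rewrite addr0.
    move: xU xF; rewrite !inE big_mkord -bigcup_mkord => -[j /= jk Fjx] Fkx.
    have := trivIsetP.1 tF j k I I; rewrite ltn_eqF// => /(_ isT) /seteqP[FF _].
    by case: (FF x).
  apply: (@test_closure_dct S _ (\1_(box c e))) => //.
  + exact: B2.
  + elim=> [|k IH].
      apply: test_closure_eq (test_closure_test (test_function0 R n)) => x.
      by rewrite /S big_ord0.
    apply: test_closure_eq (test_closureD IH (cF k)) => x.
    by rewrite /S big_ord_recr.
  + move=> x; rewrite iE.
    rewrite (_ : (fun k => S k x) = fun k => \1_(\big[setU/set0]_(j < k) F j) x * \1_(box c e) x); last first.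
      by apply/funext => k; rewrite SE iE.
    apply: cvgM; last exact: cvg_cst.
    have [[j _ Fjx]|NF] := pselect ((\bigcup_k F k) x).
      rewrite indicE mem_set; last by exists j.
      apply: cvg_near_cst; exists j.+1 => // k /= jk.
      by rewrite indicE mem_set// -bigcup_mkord; exists j.
    rewrite indicE memNset//; apply: cvg_near_cst; exists 0%N => // k _.
    by rewrite indicE memNset// -bigcup_mkord => -[j _ Fjx]; apply: NF; exists j.
  + exact: bounded_indic_L2 (measurable_box c e) (@box_bounded c e).
  + move=> x k; rewrite SE !iE -mulrBl normrM.
    rewrite [X in _ * X]ger0_norm ?indicE// ler_piMl//.
    by do 2 case: (_ \in _) => /=;
      rewrite ?subrr ?subr0 ?sub0r ?normrN ?normr1 ?normr0.
Qed.

(** A nonnegative function is the limit of simple functions cut off on growing boxes and dominated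
    by it; a general one is split into positive and negative parts. *)
Lemma test_dense f : isL2 f -> test_closure f.
Proof.
suff pos h : isL2 h -> (forall x, 0 <= h x) -> test_closure h.
  move=> f2.
  have mf := L2_meas f2.
  have cp : test_closure (fun x => Num.max (f x) 0).
    apply: pos; last by move=> x; rewrite le_max lexx orbT.
    apply: L2_le f2; first exact: measurable_maxr.
    by move=> x; case: (leP (f x) 0) => h; rewrite ?normr0.
  have cn : test_closure (fun x => Num.max (- f x) 0).
    apply: pos; last by move=> x; rewrite le_max lexx orbT.
    apply: L2_le f2; first by apply: measurable_maxr => //; exact: measurableT_comp.
    by move=> x; case: (leP (- f x) 0) => h; rewrite ?normr0 ?normrN.
  apply: test_closure_eq (test_closureD cp (test_closureZ (-1) cn)) => x.
  by case: (leP (f x) 0); case: (leP (- f x) 0) => *; lra.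
move=> h2 h0; have mh := L2_meas h2.
have mhE : measurable_fun setT (EFin \o h) by exact/measurable_EFinP.
pose a := nnsfun_approx measurableT mhE.
pose B (k : nat) : set 'rV[R]_n := box (const_mx (- k%:R)) (const_mx k%:R).
pose F k x := a k x * \1_(B k) x.
have a_lim x : a k x @[k --> \oo] --> h x.
  have h0E y : setT y -> (0%:E <= (EFin \o h) y)%E by move=> _; rewrite lee_fin.
  exact: fine_cvg (cvg_nnsfun_approx measurableT mhE h0E (x := x) I).
have aF k x : 0 <= a k x <= h x.
  rewrite fun_ge0/=.
  have nda i j : (i <= j)%N -> a i x <= a j x.
    by move=> /(nd_nnsfun_approx measurableT mhE)/lefP.
  by apply: (cvgn_ge_cst (N := k) (a_lim x)) => j /nda.
have F_lim x : F k x @[k --> \oo] --> h x.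
  apply: cvg_trans (a_lim x); apply: near_eq_cvg.
  have : [set: 'rV[R]_n] x by [].
  rewrite -(cover_box R n) => -[N _ xN]; exists N => // k /= Nk.
  rewrite /F indicE mem_set ?mulr1// => i; have := xN i; rewrite !mxE.
  have : N%:R <= k%:R :> R by rewrite ler_nat.
  by move=> h1 /andP[h3 h4]; apply/andP; split; lra.
apply: (@test_closure_dct F _ h) => //.
- move=> k; pose r : seq R := finmap.enum_fset (fset_set (range (a k))).
  have -> : F k = fun x : 'rV[R]_n => \sum_(y <- r) y * \1_((a k @^-1` [set y]) `&` B k) x.
    apply/funext => x; rewrite /F [in LHS]fimfunE fsbig_finite//= mulr_suml.
    by apply: eq_bigr => y _; rewrite indicI mulrA.
  elim: r => [|y s IH].
    apply: test_closure_eq (test_closure_test (test_function0 R n)) => x.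
    by rewrite big_nil.
  apply: test_closure_eq (test_closureD (@test_closureZ y _ _) IH).
    by move=> x; rewrite big_cons.
  by apply: test_closure_indic; exact: measurable_sfunP.
- move=> x k; have /andP[a0 ah] := aF k x; rewrite /F indicE.
  by case: (_ \in _); rewrite ?mulr1 ?mulr0 ler_norml; apply/andP; split; lra.
Qed.

End density.

(** * The form operator *)

Import HBSimple HBNNSimple.

(** * Measures given by a density *)

Section density_measure.
Context d (T : measurableType d) (R : realType) (la : {measure set T -> \bar R}).
Variable m : T -> R.
Hypotheses (mm : measurable_fun setT m) (m0 : forall x, 0 <= m x).

(** With [vol_density g] over [lebesgue_rV] this unfolds to [vol g], so facts proved for the bundled
    measure apply to the statement as it is. *)
Definition dens (A : set T) : \bar R := (\int[la]_(x in A) (m x)%:E)%E.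

Let mmE : measurable_fun setT (EFin \o m). Proof. exact/measurable_EFinP. Qed.

Let dens0 : dens set0 = 0%E. Proof. by rewrite /dens integral_set0. Qed.

Let dens_ge0 A : (0 <= dens A)%E.
Proof. by apply: integral_ge0 => x _; rewrite lee_fin. Qed.

Let dens_sigma_additive : semi_sigma_additive dens.
Proof.
move=> F mF tF mU; rewrite /dens ge0_integral_bigcup//.
- by apply: is_cvg_ereal_nneg_natsum => k _; exact: dens_ge0.
- exact: measurable_funS mmE.
- by move=> x _; rewrite lee_fin.
Qed.

Definition dens_measure : {measure set T -> \bar R} :=
  HB.pack dens (isMeasure.Build _ _ _ dens dens0 dens_ge0 dens_sigma_additive).

Lemma ge0_integral_dens (f : T -> R) : measurable_fun setT f -> (forall x, 0 <= f x) ->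
  (\int[dens_measure]_x (f x)%:E = \int[la]_x (f x * m x)%:E)%E.
Proof.
move=> mf f0; have mfE : measurable_fun setT (EFin \o f) by exact/measurable_EFinP.
have f0E x : setT x -> (0%:E <= (EFin \o f) x)%E by move=> _; rewrite lee_fin.
pose f_ := nnsfun_approx measurableT mfE.
have flim x : (EFin \o f_ ^~ x) k @[k --> \oo] --> (f x)%:E.
  exact: (cvg_nnsfun_approx measurableT mfE f0E (x := x) I).
transitivity (limn (fun k => \int[dens_measure]_x (f_ k x)%:E)%E).
  rewrite -monotone_convergence//.
  - by apply: eq_integral => x _; apply/esym/cvg_lim => //; exact: flim.
  - by move=> k; exact/measurable_EFinP/measurable_funP.
  - by move=> k x _; rewrite lee_fin.
  - by move=> x _ i j ij; rewrite lee_fin; exact/lefP/nd_nnsfun_approx.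
rewrite [X in limn X](_ : _ = (fun k => \int[la]_x (f_ k x * m x)%:E)%E).
  rewrite -monotone_convergence//.
  - apply: eq_integral => x _; apply/cvg_lim => //.
    by apply: cvgEFin; apply: cvgM; [exact: fine_cvg (flim x)|exact: cvg_cst].
  - by move=> k; apply/measurable_EFinP; apply: measurable_funM.
  - by move=> k x _; rewrite lee_fin mulr_ge0.
  - move=> x _ i j ij; rewrite lee_fin ler_wpM2r//.
    by apply/lefP/nd_nnsfun_approx.
apply/funext => k.
rewrite integralT_nnsfun sintegralE.
have E x : (f_ k x * m x)%:E =
    (\sum_(y \in range (f_ k)) ((y * \1_(f_ k @^-1` [set y]) x) * m x)%:E)%E.
  by rewrite fsumEFin// [in LHS]fimfunE !fsbig_finite//= mulr_suml.
have yi (y : R) x : 0 <= y * \1_(f_ k @^-1` [set y]) x.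
  by have := nnfun_muleindic_ge0 (f_ k) y x; rewrite -EFinM lee_fin.
under [RHS]eq_integral do rewrite E.
rewrite ge0_integral_fsum//; last 2 first.
- move=> y; apply/measurable_EFinP; apply: measurable_funM => //.
  by apply: measurable_funM => //; apply: measurable_indic; exact: measurable_sfunP.
- by move=> y x _; rewrite lee_fin mulr_ge0.
apply: eq_fsbigr => y; rewrite inE => -[z _ yz].
have y0 : 0 <= y by rewrite -yz.
under [RHS]eq_integral do rewrite -mulrA EFinM.
rewrite ge0_integralZl//; last 2 first.
- by apply/measurable_EFinP; apply: measurable_funM.
- by move=> x _; rewrite lee_fin mulr_ge0.
congr (_ * _)%E; rewrite /= /dens integral_mkcond; apply: eq_integral => x _.
by rewrite /patch indicE; case: ifP => _; rewrite ?mul1r ?mul0r.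
Qed.

Lemma igr_dens (f : T -> R) : measurable_fun setT f ->
  igr dens_measure f <-> igr la (fun x => f x * m x).
Proof.
move=> mf.
have E : (\int[dens_measure]_x `|f x|%:E = \int[la]_x `|f x * m x|%:E)%E.
  rewrite (ge0_integral_dens (f := fun x => `|f x|))//; last exact: measurableT_comp.
  by apply: eq_integral => x _; rewrite normrM (ger0_norm (m0 x)).
split=> /igr_lt; rewrite ?E => H; apply: igrP => //; last by rewrite E.
exact: measurable_funM.
Qed.

Lemma rint_dens (f : T -> R) : igr dens_measure f ->
  \int[dens_measure]_x f x = \int[la]_x (f x * m x).
Proof.
move=> If; have mf := igr_meas If.
rewrite /Rintegral integralE [in RHS]integralE; congr (fine (_ - _)).
- rewrite (eq_integral (fun x => (Num.max (f x) 0)%:E)); last first.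
    by move=> x _; rewrite funeposE /= EFin_max.
  rewrite (ge0_integral_dens (f := fun x => Num.max (f x) 0))//; last 2 first.
  + exact: measurable_maxr.
  + by move=> x; rewrite le_max lexx orbT.
  apply: eq_integral => x _; rewrite funeposE -EFin_max.
  by rewrite maxr_pMl// mul0r.
- rewrite (eq_integral (fun x => (Num.max (- f x) 0)%:E)); last first.
    by move=> x _; rewrite funenegE /= EFin_max.
  rewrite (ge0_integral_dens (f := fun x => Num.max (- f x) 0))//; last 2 first.
  + by apply: measurable_maxr => //; exact: measurableT_comp.
  + by move=> x; rewrite le_max lexx orbT.
  apply: eq_integral => x _; rewrite funenegE -EFinN -EFin_max.
  by rewrite maxr_pMl// mul0r mulNr.
Qed.

End density_measure.

Section core_arithmetic.
Context (R : realFieldType).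

(** These lemmas carry the arithmetic of [step] below, with norms and energies abstracted to
    variables. *)
Lemma core_arith1 (p x d e : R) : p <= 2 * x + 2 * d -> d <= e -> e <= 1 -> p <= 2 * x + 2.
Proof. lra. Qed.

Lemma core_arith2 (z : R) : 0 <= z -> z <= 6 -> z * z <= 36 /\ 2 * (z * z) <= 72.
Proof. by move=> z0 z6; have := ler_pM z0 z0 z6 z6; split; lra. Qed.

Lemma core_arith3 (x p c q : R) : x <= 72 * p + 2 * c -> c <= 4 * q -> q <= 36 * p -> x <= 360 * p.
Proof. lra. Qed.

Lemma core_arith4 (N p d e : R) : p <= d + N -> d <= e -> e <= 1 -> N + p <= 2 * N + 1.
Proof. lra. Qed.

Lemma core_arith5 (B L1 L2 I1 I2 J1 J2 Dd Gg e k n1 n l : R) : B <= I1 + J1 ->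
  - L2 = Dd + Gg + J2 -> - Dd <= e * (1 + k) -> I2 <= Gg -> I1 <= I2 + 6 * n1 * e ->
  J1 <= J2 + 6 * n * e -> L1 <= L2 + 6 * l * e ->
  B + L1 <= (1 + k + 6 * n1 + 6 * n + 6 * l) * e.
Proof. lra. Qed.

End core_arithmetic.

(** * Gradient, divergence and integration by parts *)

Section riemannian.
Context (R : realType) (n : nat) (g : 'rV[R]_n -> 'M[R]_n).
Hypotheses (mg : riemannian_metric g) (det_pos : forall x, 0 < \det (g x)).
Implicit Types (f h phi eta : 'rV[R]_n -> R) (X Y Z : 'rV[R]_n -> 'rV[R]_n) (x u v : 'rV[R]_n).

Local Notation m := (vol_density g).

Lemma metric_smooth_entry (i j : 'I_n) : smooth (fun x => g x i j).
Proof. by case: mg => H _ _; exact: H. Qed.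

Lemma smooth_det k (A : 'rV[R]_n -> 'M[R]_k) : (forall i j, smooth (fun x => A x i j)) ->
  smooth (fun x => \det (A x)).
Proof.
move=> sA; apply/smoothP; apply: (gsmooth_det openT) => i j.
by have /smoothP := sA i j.
Qed.

Lemma smooth_density : smooth m.
Proof.
apply: (@smooth_comp _ _ [set x : R | 0 < x] Num.sqrt (fun x => \det (g x))) => //.
  exact (@smooth1_sqrt R).
by apply: smooth_det => i j; exact: metric_smooth_entry.
Qed.

Lemma density_gt0 x : 0 < m x. Proof. by rewrite sqrtr_gt0. Qed.

Let m0 x : 0 <= m x. Proof. exact: ltW (density_gt0 x). Qed.
Let mN0 x : m x != 0. Proof. by rewrite gt_eqF// density_gt0. Qed.
Let mm : measurable_fun setT m := continuous_measurable_rV (smooth_continuous smooth_density).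

Definition volm : {measure set 'rV[R]_n -> \bar R} := dens_measure (@lebesgue_rV R n) mm m0.

Lemma vol_fin (M : R) : (volm [set x : 'rV[R]_n | (`|x| <= M)%R] < +oo)%E.
Proof.
have [C C0 hC] := continuous_bounded M (smooth_continuous smooth_density).
have mB := @measurable_norm_le R n M.
apply: (@le_lt_trans _ _ (\int[@lebesgue_rV R n]_(x in [set x : 'rV[R]_n | (`|x| <= M)%R]) C%:E)%E).
  apply: ge0_le_integral => //.
  - by move=> x _; rewrite lee_fin.
  - by apply/measurable_EFinP; exact: measurable_funTS mm.
  - by move=> x /= /hC h; rewrite lee_fin; exact: le_trans (ler_norm _) h.
rewrite integral_cst//; apply: lte_mul_pinfty => //; first by rewrite lee_fin ltW.
exact: lebesgue_rV_fin.
Qed.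

Lemma innerE x u v : inner g x u v = \sum_i \sum_j u 0 i * g x i j * v 0 j.
Proof.
rewrite /inner mxE exchange_big/=; apply: eq_bigr => j _.
by rewrite !mxE mulr_suml.
Qed.

Lemma innerC x u v : inner g x u v = inner g x v u.
Proof.
rewrite !innerE exchange_big/=; apply: eq_bigr => i _; apply: eq_bigr => j _.
have -> : g x j i = g x i j by rewrite -[in LHS](Defs.metric_sym mg) mxE.
ring.
Qed.

Lemma innerDl x u v y : inner g x (u + v) y = inner g x u y + inner g x v y.
Proof. by rewrite /inner !mulmxDl mxE. Qed.

Lemma innerZl x (a : R) u y : inner g x (a *: u) y = a * inner g x u y.
Proof. by rewrite /inner -!scalemxAl mxE. Qed.

Lemma innerDr x u v y : inner g x y (u + v) = inner g x y u + inner g x y v.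
Proof. by rewrite innerC innerDl !(innerC x y). Qed.

Lemma innerZr x (a : R) u y : inner g x y (a *: u) = a * inner g x y u.
Proof. by rewrite innerC innerZl (innerC x y). Qed.

Lemma innerNl x u y : inner g x (- u) y = - inner g x u y.
Proof. by rewrite -scaleN1r innerZl mulN1r. Qed.

Lemma innerBl x u v y : inner g x (u - v) y = inner g x u y - inner g x v y.
Proof. by rewrite innerDl innerNl. Qed.

Lemma innerBr x u v y : inner g x y (u - v) = inner g x y u - inner g x y v.
Proof. by rewrite innerC innerBl !(innerC x y). Qed.

Lemma inner0l x v : inner g x 0 v = 0.
Proof. by rewrite /inner !mul0mx mxE. Qed.

Lemma inner_ge0 x v : 0 <= inner g x v v.
Proof.
have [->|v0] := eqVneq v 0; first by rewrite inner0l.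
by apply: ltW; exact: metric_pos mg x v v0.
Qed.

Lemma inner_add2 x u v : inner g x (u + v) (u + v) <= 2 * inner g x u u + 2 * inner g x v v.
Proof.
have := inner_ge0 x (u - v).
rewrite innerBl !innerBr innerDl !innerDr (innerC x v u); lra.
Qed.

Lemma inner_CS x u v : `|inner g x u v| <= Num.sqrt (inner g x u u) * Num.sqrt (inner g x v v).
Proof.
rewrite -sqrtrM ?inner_ge0// -sqrtr_sqr ler_wsqrtr//.
have [->|v0] := eqVneq v 0; first by rewrite innerC inner0l expr0n/= !inner0l mulr0.
have c0 : 0 < inner g x v v by exact: metric_pos mg x v v0.
have := inner_ge0 x (inner g x v v *: u - inner g x u v *: v).
rewrite innerBl !innerBr !innerZl !innerZr (innerC x v u).
set a := inner g x u u; set b := inner g x u v; set c := inner g x v v in c0 *.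
have -> : c * (c * a) - c * (b * b) - (b * (c * b) - b * (b * c)) = c * (a * c - b ^+ 2) by ring.
by rewrite pmulr_rge0// subr_ge0.
Qed.

(** The classical gradient, the differential with its index raised by the inverse metric. [grad] is
    instead a chosen distributional gradient; for test functions the two agree almost everywhere by
    [grad_test]. *)
Definition grd f x : 'rV[R]_n := (\row_i partial i f x) *m invmx (g x).

Let unit_g x : g x \in unitmx. Proof. by rewrite unitmxE unitfE gt_eqF. Qed.

Lemma inner_grd f x v : inner g x (grd f x) v = \sum_i partial i f x * v 0 i.
Proof.
rewrite /inner /grd mulmxKV// mxE; apply: eq_bigr => i _.
by rewrite !mxE.
Qed.

Lemma grdE f x k : grd f x 0 k = \sum_i partial i f x * invmx (g x) i k.
Proof. by rewrite /grd mxE; apply: eq_bigr => i _; rewrite mxE. Qed.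

Lemma smooth_invmx (i j : 'I_n) : smooth (fun x => invmx (g x) i j).
Proof.
have -> : (fun x => invmx (g x) i j) = fun x => (\det (g x))^-1 * cofactor (g x) j i.
  by apply/funext => x; rewrite /invmx unit_g !mxE.
apply: smoothM.
  apply: smoothV => [x|]; first by rewrite gt_eqF.
  by apply: smooth_det => k l; exact: metric_smooth_entry.
apply: smoothM; first exact: smooth_cst.
apply: smooth_det => k l.
have -> : (fun x => row' j (col' i (g x)) k l) = fun x => g x (lift j k) (lift i l).
  by apply/funext => x; rewrite !mxE.
exact: metric_smooth_entry.
Qed.

Lemma smooth_grd f i : smooth f -> smooth (fun x => grd f x 0 i).
Proof.
move=> sf; have -> : (fun x => grd f x 0 i) = fun x => \sum_j partial j f x * invmx (g x) j i.
  by apply/funext => x; rewrite grdE.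
by apply: smooth_sum => j; apply: smoothM; [exact: smooth_partial|exact: smooth_invmx].
Qed.

Lemma smooth_inner X Y : (forall i, smooth (fun x => X x 0 i)) ->
  (forall i, smooth (fun x => Y x 0 i)) -> smooth (fun x => inner g x (X x) (Y x)).
Proof.
move=> sX sY.
have -> : (fun x => inner g x (X x) (Y x)) =
    fun x => \sum_i \sum_j X x 0 i * g x i j * Y x 0 j.
  by apply/funext => x; rewrite innerE.
apply: smooth_sum => i; apply: smooth_sum => j.
by do 2 apply: smoothM => //; exact: metric_smooth_entry.
Qed.

Lemma bounded_support_grd f : smooth f -> bounded_support f -> bounded_support (grd f).
Proof.
move=> sf bf.
have h i : exists M : R, 0 < M /\ forall x, M <= `|x| -> partial i f x = 0.
  by have [M M0 hM] := bounded_support_partial i sf bf; exists M.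
have [M HM] := choice h.
exists (1 + \sum_i M i).
  by rewrite ltr_pwDl// sumr_ge0// => i _; case: (HM i) => /ltW.
move=> x xM; apply/rowP => k; rewrite grdE mxE big1// => i _.
have [_ ->] := HM i; first by rewrite mul0r.
apply: le_trans xM; rewrite (bigD1 i)//= addrCA lerDl addr_ge0// sumr_ge0// => j _.
by case: (HM j) => /ltW.
Qed.

Lemma smooth_divergence Y : (forall i, smooth (fun x => Y x 0 i)) -> smooth (divergence g Y).
Proof.
move=> sY; apply: smoothM; first by apply: smoothV => //; exact: smooth_density.
by apply: smooth_sum => i; apply: smooth_partial; apply: smoothM => //; exact: smooth_density.
Qed.

Lemma partialM f h x i : smooth f -> smooth h ->
  partial i (fun y => f y * h y) x = f x * partial i h x + h x * partial i f x.
Proof. by move=> sf sh; rewrite /partial deriveM//; exact: smooth_derivable. Qed.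

Lemma partial_comp (F dF : R -> R) f x i : (forall t : R, is_derive t 1 F (dF t)) -> smooth f ->
  partial i (fun y => F (f y)) x = dF (f x) * partial i f x.
Proof.
move=> dFt sf; rewrite /partial.
by have [_ ->] := is_derive_comp_dir (dFt (f x)) (DeriveDef (@smooth_derivable _ _ f x i sf) erefl).
Qed.

Lemma igr_vol f : continuous f -> bounded_support f -> igr volm f.
Proof. exact: continuous_igr vol_fin f. Qed.

Lemma igr_vol_smooth f : smooth f -> bounded_support f -> igr volm f.
Proof. by move=> /smooth_continuous; exact: igr_vol. Qed.

(** Multiplied by the density [m], the sum of the two integrands is the sum of the partial
    derivatives of [f * m * Y_i], and each of these integrates to zero over Euclidean space. *)
Lemma ibp f Y : smooth f -> (forall i, smooth (fun x => Y x 0 i)) ->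
  bounded_support f \/ bounded_support Y ->
  [/\ igr volm (fun x => inner g x (grd f x) (Y x)),
      igr volm (fun x => f x * divergence g Y x) &
      \int[volm]_x inner g x (grd f x) (Y x) = - \int[volm]_x (f x * divergence g Y x)].
Proof.
move=> sf sY bs.
have smY i : smooth (fun x => m x * Y x 0 i) := smoothM smooth_density (sY i).
have b1 : bounded_support (fun x => inner g x (grd f x) (Y x)).
  case: bs => [/(bounded_support_grd sf)|].
    by apply: bounded_support_comp => x ->; rewrite inner0l.
  by apply: bounded_support_comp => x ->; rewrite innerC inner0l.
have bY i : bounded_support f \/ bounded_support (fun x => m x * Y x 0 i).
  case: bs; first by left.
  by right; apply: bounded_support_comp b => x ->; rewrite mxE mulr0.
have b2 i : bounded_support (fun x => f x * partial i (fun y => m y * Y y 0 i) x).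
  case: (bY i) => [|b]; first by apply: bounded_support_comp => x ->; rewrite mul0r.
  by apply: bounded_supportM; exact: bounded_support_partial.
have i1 := igr_vol_smooth (smooth_inner (fun i => smooth_grd i sf) sY) b1.
have dE x : f x * divergence g Y x * m x = \sum_i f x * partial i (fun y => m y * Y y 0 i) x.
  rewrite /divergence -mulr_sumr mulrAC -mulrA; congr (_ * _).
  by rewrite mulVKf.
have i2' i : igr (@lebesgue_rV R n) (fun x => f x * partial i (fun y => m y * Y y 0 i) x).
  apply: continuous_igr => //; first exact: lebesgue_rV_fin.
  exact (smooth_continuous (smoothM sf (smooth_partial i (smY i)))).
have i2 : igr volm (fun x => f x * divergence g Y x).
  apply/igr_dens.
    by apply: continuous_measurable_rV; apply: smooth_continuous; apply: smoothM => //; exact: smooth_divergence.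
  apply: (@eq_igr _ _ _ _ (fun x => \sum_i f x * partial i (fun y => m y * Y y 0 i) x)).
    by move=> x; rewrite dE.
  exact: igr_sum.
split => //; apply/eqP; rewrite -subr_eq0 opprK -rintD//; apply/eqP.
rewrite rint_dens; last exact: igrD.
have bF i : bounded_support (fun x => f x * (m x * Y x 0 i)).
  case: (bY i) => [|b]; first by apply: bounded_support_comp => x ->; rewrite mul0r.
  exact: bounded_supportM.
have P0 i := @rint_partial0 R n i _ (smooth_continuous (smoothM sf (smY i)))
  (fun x => @smooth_derivable _ _ _ x i (smoothM sf (smY i)))
  (smooth_continuous (smooth_partial i (smoothM sf (smY i)))) (bF i).
transitivity (\int[@lebesgue_rV R n]_x \sum_i partial i (fun y => f y * (m y * Y y 0 i)) x).
  apply: eq_rint => x; rewrite mulrDl dE inner_grd mulr_suml -big_split/=.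
  apply: eq_bigr => i _; rewrite (@partialM _ _ x i sf (smY i)) addrC; congr (_ + _); ring.
rewrite rint_sum; last by move=> i; case: (P0 i).
by rewrite big1// => i _; case: (P0 i).
Qed.

Lemma rowDZ (a b : R) (A B : 'rV[R]_n) k : (a *: A + b *: B) 0 k = a * A 0 k + b * B 0 k.
Proof. by rewrite !mxE. Qed.

Lemma grdM f h x : smooth f -> smooth h ->
  grd (fun y => f y * h y) x = f x *: grd h x + h x *: grd f x.
Proof.
move=> sf sh; apply/rowP => k; rewrite rowDZ !grdE !mulr_sumr -big_split/=.
by apply: eq_bigr => i _; rewrite (@partialM _ _ x i sf sh) mulrDl !mulrA.
Qed.

Lemma grd_comp (F dF : R -> R) f x : (forall t : R, is_derive t 1 F (dF t)) -> smooth f ->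
  grd (fun y => F (f y)) x = dF (f x) *: grd f x.
Proof.
move=> dFt sf; apply/rowP => k; rewrite [RHS]mxE !grdE !mulr_sumr.
by apply: eq_bigr => i _; rewrite (@partial_comp _ _ _ x i dFt sf) mulrA.
Qed.

Lemma grdB f h x : smooth f -> smooth h ->
  grd (fun y => f y - h y) x = grd f x - grd h x.
Proof.
move=> sf sh; apply/rowP => k; rewrite [RHS]mxE [(- grd h x) 0 k]mxE !grdE -sumrB.
apply: eq_bigr => i _; rewrite -mulrBl; congr (_ * _).
by rewrite /partial deriveB//; exact: smooth_derivable.
Qed.

Lemma measurable_inner X Y : measurable_fun setT X -> measurable_fun setT Y ->
  measurable_fun setT (fun x => inner g x (X x) (Y x)).
Proof.
move=> /measurable_fun_rVP mX /measurable_fun_rVP mY.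
have -> : (fun x => inner g x (X x) (Y x)) =
    fun x => \sum_i \sum_j X x 0 i * g x i j * Y x 0 j.
  by apply/funext => x; rewrite innerE.
apply: measurable_sum => i; apply: measurable_sum => j.
do 2 apply: measurable_funM => //.
exact: continuous_measurable_rV (smooth_continuous (metric_smooth_entry i j)).
Qed.

Lemma measurable_smooth_field X : (forall i, smooth (fun x => X x 0 i)) -> measurable_fun setT X.
Proof.
by move=> sX; apply/measurable_fun_rVP => i; apply: continuous_measurable_rV; apply: smooth_continuous (sX i).
Qed.

Definition fieldL2 X := measurable_fun setT X /\ igr volm (fun x => inner g x (X x) (X x)).

Definition en X : R := \int[volm]_x inner g x (X x) (X x).

Lemma en_ge0 X : 0 <= en X. Proof. by apply: rint_ge0 => x; exact: inner_ge0. Qed.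

Lemma fieldL2P X : measurable_fun setT X -> (energy g X < +oo)%E <-> fieldL2 X.
Proof.
move=> mX; have E : (\int[volm]_x `|inner g x (X x) (X x)|%:E = energy g X)%E.
  by apply: eq_integral => x _; rewrite ger0_norm ?inner_ge0.
split=> [h|[_ /igr_lt]]; last by rewrite E.
by split=> //; apply: igrP; rewrite ?E//; exact: measurable_inner.
Qed.

Lemma energyE X : fieldL2 X -> energy g X = (en X)%:E.
Proof. by move=> [_ h]; rewrite /en -igr_fin. Qed.

Lemma fieldL2_test X : (forall i, smooth (fun x => X x 0 i)) -> bounded_support X -> fieldL2 X.
Proof.
move=> sX bX; split; first exact: measurable_smooth_field.
apply: igr_vol_smooth; first exact: smooth_inner.
by apply: bounded_support_comp bX => x ->; rewrite inner0l.
Qed.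

Lemma igr_inner X Y : fieldL2 X -> fieldL2 Y -> igr volm (fun x => inner g x (X x) (Y x)).
Proof.
move=> [mX iX] [mY iY].
apply: (@igr_le _ _ _ _ _ (fun x => inner g x (X x) (X x) + inner g x (Y x) (Y x))).
- exact: measurable_inner.
- move=> x; have := inner_ge0 x (X x + Y x); have := inner_ge0 x (X x - Y x).
  rewrite innerBl !innerBr innerDl !innerDr (innerC x (Y x) (X x)).
  by rewrite ler_norml => h1 h2; apply/andP; split; have := inner_ge0 x (X x); have := inner_ge0 x (Y x); lra.
- exact: igrD.
Qed.

Lemma fieldL2B X Y : fieldL2 X -> fieldL2 Y -> fieldL2 (fun x => X x - Y x).
Proof.
move=> fX fY; have [mX iX] := fX; have [mY iY] := fY; split.
  apply/measurable_fun_rVP => i; under eq_fun do rewrite !mxE.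
  by apply: measurable_funB; [move/measurable_fun_rVP: mX|move/measurable_fun_rVP: mY]; exact.
apply: (@eq_igr _ _ _ _ (fun x => inner g x (X x) (X x) - 2 * inner g x (X x) (Y x) + inner g x (Y x) (Y x))).
  by move=> x; rewrite innerBl !innerBr (innerC x (Y x) (X x)); ring.
by apply: igrD => //; apply: igrB => //; apply: igrZ; exact: igr_inner.
Qed.

Lemma inner_young X Y c : fieldL2 X -> fieldL2 Y -> 0 < c ->
  - (\int[volm]_x inner g x (X x) (Y x)) <= c * en X + c^-1 * en Y.
Proof.
move=> fX fY c0; have [mX iX] := fX; have [mY iY] := fY.
rewrite /en -!rintZ// -rintD; [|exact: igrZ|exact: igrZ].
rewrite -rintN; last exact: igr_inner.
apply: rint_le => [||x]; [apply: igrN; exact: igr_inner|apply: igrD; exact: igrZ|].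
have := inner_ge0 x (c *: X x + Y x).
rewrite innerDl !innerDr !innerZl !innerZr (innerC x (Y x) (X x)).
set a := inner g x (X x) (X x); set b := inner g x (X x) (Y x); set e := inner g x (Y x) (Y x).
have a0 : 0 <= a by exact: inner_ge0. have e0 : 0 <= e by exact: inner_ge0.
move=> h; have h2 : 0 <= c * a + 2 * b + c^-1 * e.
  have -> : c * a + 2 * b + c^-1 * e = c^-1 * (c * (c * a) + c * b + (c * b + e)).
    by field; rewrite gt_eqF.
  by rewrite mulr_ge0// invr_ge0 ltW.
have : 0 <= c * a by rewrite mulr_ge0// ltW.
have : 0 <= c^-1 * e by rewrite mulr_ge0// invr_ge0 ltW.
lra.
Qed.

Lemma is_gradient_igr f X : is_gradient g f X -> fieldL2 X.
Proof. by move=> [mX eX _]; apply/fieldL2P. Qed.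

Lemma is_gradient_test f : test_function f -> is_gradient g f (grd f).
Proof.
move=> /test_function_bs[sf bf].
have fg : fieldL2 (grd f).
  by apply: fieldL2_test; [move=> i; exact: smooth_grd|exact: bounded_support_grd].
split; [by case: fg|by apply/fieldL2P => //; case: fg|].
move=> Y [sY /compactly_supportedP bY].
have [i1 i2 E] := ibp sf sY (or_introl bf).
by rewrite (igr_fin i1) (igr_fin i2) E.
Qed.

Lemma is_gradient_ibp f X Y : is_gradient g f X -> test_field Y ->
  igr volm (fun x => f x * divergence g Y x) ->
  \int[volm]_x inner g x (X x) (Y x) = - \int[volm]_x (f x * divergence g Y x).
Proof.
move=> [_ _ H] tY iY; have := H Y tY.
by rewrite /Rintegral => ->; rewrite (igr_fin iY).
Qed.

Lemma inner_coord x u v : inner g x u v = \sum_j inner g x u (delta_mx 0 j) * v 0 j.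
Proof.
have E w : inner g x u w = \sum_k (u *m g x) 0 k * w 0 k.
  by rewrite /inner [LHS]mxE; apply: eq_bigr => k _; rewrite [w^T _ _]mxE.
rewrite E; apply: eq_bigr => j _; congr (_ * _); rewrite E (bigD1 j)//=.
rewrite [X in _ = _ * X + _]mxE !eqxx mulr1 big1 ?addr0// => k kj.
by rewrite [X in _ * X]mxE eqxx/= (negbTE kj) mulr0.
Qed.

(** Test fields along one coordinate reduce this to functions. With [Z i] the product of [X] with
    the [i]-th basis vector and [w i] the squared length of that vector, [Z i / w i] lies in L2 with
    weight [w i] by Cauchy-Schwarz, and is orthogonal there to the dense set of test functions. *)
Lemma field_orthogonal X : fieldL2 X ->
  (forall Y, test_field Y -> \int[volm]_x inner g x (X x) (Y x) = 0) ->
  \forall x \ae volm, X x = 0.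
Proof.
move=> fX oX; have [mX iX] := fX.
pose Z (i : 'I_n) x := inner g x (X x) (delta_mx 0 i).
pose w (i : 'I_n) x := inner g x (delta_mx 0 i) (delta_mx 0 i).
have sw i : smooth (w i) by apply: smooth_inner => j; exact: smooth_cst.
have cw i := smooth_continuous (sw i).
have mw i := continuous_measurable_rV (cw i).
have wp i x : 0 < w i x.
  apply: (metric_pos mg); apply/eqP => /rowP/(_ i).
  by rewrite !mxE !eqxx/= => /eqP; rewrite oner_eq0.
have w0 i x : 0 <= w i x by exact: ltW.
have mZ i : measurable_fun setT (Z i) by apply: measurable_inner.
have F2 i : isL2 volm (w i) (fun x => Z i x / w i x).
  have mF : measurable_fun setT (fun x => Z i x / w i x).
    apply: measurable_funM => //; apply: continuous_measurable_rV; apply: smooth_continuous.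
    by apply: smoothV => // x; rewrite gt_eqF.
  apply: igr_L2 => //.
  apply: (igr_le _ _ iX); first by apply: measurable_funM => //; exact: measurable_funX.
  move=> x; rewrite ger0_norm; last by apply: mulr_ge0 => //; exact: sqr_ge0.
  have h := inner_CS x (X x) (delta_mx 0 i).
  have {}h : Z i x ^+ 2 <= inner g x (X x) (X x) * w i x.
    rewrite -real_normK ?num_real//.
    rewrite -[leRHS]sqr_sqrtr ?mulr_ge0 ?inner_ge0// lerXn2r ?nnegrE ?sqrtr_ge0//.
    by rewrite sqrtrM ?inner_ge0.
  have -> : (Z i x / w i x) ^+ 2 * w i x = Z i x ^+ 2 / w i x by field; rewrite gt_eqF.
  by rewrite ler_pdivrMr.
have Z0 i : \forall x \ae volm, Z i x = 0.
  suff h : nm volm (w i) (fun x => Z i x / w i x) = 0.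
    apply: filterS (nm0_ae (mw i) (w0 i) (wp i) (F2 i) h) => x /eqP.
    by rewrite mulf_eq0 invr_eq0 (gt_eqF (wp i x)) orbF => /eqP.
  apply/eqP; rewrite eq_le nm_ge0 andbT; apply/ler_addgt0Pr => e e0; rewrite add0r.
  have [_ /(_ e e0)[phi tphi Hphi]] := test_dense vol_fin (cw i) (w0 i) (F2 i).
  have p2 := test_L2 vol_fin (cw i) (w0 i) tphi.
  have orth : dt volm (w i) (fun x => Z i x / w i x) phi = 0.
    have /test_function_bs[sp bp] := tphi.
    rewrite dtE -(oX (fun x => phi x *: delta_mx 0 i)).
      apply: eq_rint => x; rewrite innerZr -/(Z i x) mulrAC divfK ?gt_eqF//.
      exact: mulrC.
    split=> [j|]; last first.
      by apply/compactly_supportedP; apply: bounded_support_comp bp => x ->; rewrite scale0r.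
    have -> : (fun x => (phi x *: (delta_mx 0 i : 'rV[R]_n)) 0 j) = fun x => phi x * (delta_mx 0 i : 'rV[R]_n) 0 j.
      by apply/funext => x; rewrite mxE.
    by apply: smoothM => //; exact: smooth_cst.
  have := dt_CS (mw i) (w0 i) (F2 i) (L2B (mw i) (w0 i) (F2 i) p2).
  rewrite dtBr// orth subr0 -nm2// ger0_norm ?sqr_ge0//.
  set N := nm _ _ _; have N0 : 0 <= N by exact: nm_ge0.
  have [->|Np] := eqVneq N 0; first by move=> _; exact: ltW.
  rewrite expr2 ler_pM2l ?lt0r ?Np// => h; exact: le_trans h Hphi.
have : \forall x \ae volm, forall i, Z i x = 0 by exact: filter_forall.
apply: filterS => x Zx; apply: contrapT => /eqP X0.
have := metric_pos mg x X0; rewrite inner_coord big1 ?ltxx// => j _.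
by rewrite -/(Z j x) Zx mul0r.
Qed.

Lemma en_ae X Y : fieldL2 X -> fieldL2 Y -> (\forall x \ae volm, X x = Y x) -> en X = en Y.
Proof.
move=> [_ iX] [_ iY] XY; apply: rint_ae_eq; [exact: igr_meas iX|exact: igr_meas iY|].
by apply: filterS XY => x ->.
Qed.

Lemma rint_inner_ae X Y Y' : fieldL2 X -> fieldL2 Y -> fieldL2 Y' ->
  (\forall x \ae volm, Y x = Y' x) ->
  \int[volm]_x inner g x (X x) (Y x) = \int[volm]_x inner g x (X x) (Y' x).
Proof.
move=> fX fY fY' YY'; apply: rint_ae_eq.
- exact: igr_meas (igr_inner fX fY).
- exact: igr_meas (igr_inner fX fY').
- by apply: filterS YY' => x ->.
Qed.

(** * The form and its operator on test functions *)

Section potential.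
Variables rho V : 'rV[R]_n -> R.
Hypotheses (srho : smooth rho) (rho0 : forall x, 0 < rho x)
  (sV : smooth V) (V0 : forall x, 0 <= V x).

Let W x := rho x + V x.
Let W0 x : 0 < W x. Proof. by rewrite ltr_pwDl. Qed.
Let W0' x : 0 <= W x. Proof. exact: ltW. Qed.
Let cW : continuous W := smooth_continuous (smoothD srho sV).
Let mW : measurable_fun setT W := continuous_measurable_rV cW.
Let mr : measurable_fun setT rho := continuous_measurable_rV (smooth_continuous srho).
Let mV : measurable_fun setT V := continuous_measurable_rV (smooth_continuous sV).
Let rho0' x : 0 <= rho x. Proof. exact: ltW. Qed.

Lemma L2W_rho f : isL2 volm W f -> isL2 volm rho f.
Proof.
move=> f2; have mf := L2_meas f2; apply: igr_L2 => //.
apply: (igr_le _ _ (L2_igr mW W0' f2)).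
  by apply: measurable_funM => //; exact: measurable_funX.
move=> x; rewrite ger0_norm; last by apply: mulr_ge0; [exact: sqr_ge0|exact: rho0'].
by rewrite ler_wpM2l ?sqr_ge0// lerDl.
Qed.

Lemma nmW_rho f : isL2 volm W f -> nm volm rho f <= nm volm W f.
Proof.
move=> f2; apply: ler_wsqrtr; rewrite !dtE; apply: rint_le.
- exact (L2_prod mr rho0' (L2W_rho f2) (L2W_rho f2)).
- exact (L2_prod mW W0' f2 f2).
- by move=> x; rewrite ler_wpM2l ?lerDl// -expr2 sqr_ge0.
Qed.

(** [f * h] is [f * (h / W) * W], a product of two L2 functions with weight [W], because [h / W] is
    again a test function. *)
Lemma igr_L2_test f h : isL2 volm W f -> smooth h -> bounded_support h ->
  igr volm (fun x => f x * h x).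
Proof.
move=> f2 sh bh.
have th : test_function (fun x => h x / W x).
  apply/test_function_bs; split; last by apply: bounded_support_comp bh => x ->; rewrite mul0r.
  exact (smoothM sh (smoothV (fun x => lt0r_neq0 (W0 x)) (smoothD srho sV))).
have h2 := test_L2 vol_fin cW W0' th.
apply: eq_igr (L2_prod mW W0' f2 h2) => x.
by rewrite mulrA divfK// gt_eqF.
Qed.

Lemma smooth_div_test Y : test_field Y ->
  smooth (divergence g Y) /\ bounded_support (divergence g Y).
Proof.
move=> [sY /compactly_supportedP bY]; split; first exact: smooth_divergence.
have bi i : bounded_support (partial i (fun y => m y * Y y 0 i)).
  apply: bounded_support_partial; first exact (smoothM smooth_density (sY i)).
  by apply: bounded_support_comp bY => x ->; rewrite mxE mulr0.
have h i : exists M : R, 0 < M /\ forall x, M <= `|x| -> partial i (fun y => m y * Y y 0 i) x = 0.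
  by have [M M0 hM] := bi i; exists M.
have [M HM] := choice h.
exists (1 + \sum_i M i).
  by rewrite ltr_pwDl// sumr_ge0// => i _; case: (HM i) => /ltW.
move=> x xM; rewrite /divergence big1 ?mulr0// => i _.
have [_ ->//] := HM i.
apply: le_trans xM; rewrite (bigD1 i)//= addrCA lerDl addr_ge0// sumr_ge0// => j _.
by case: (HM j) => /ltW.
Qed.

Lemma is_gradientB f h X Y : isL2 volm W f -> isL2 volm W h ->
  is_gradient g f X -> is_gradient g h Y ->
  is_gradient g (fun x => f x - h x) (fun x => X x - Y x).
Proof.
move=> f2 h2 gX gY; have fX := is_gradient_igr gX; have fY := is_gradient_igr gY.
have fXY := fieldL2B fX fY.
split; [by case: fXY|by apply/fieldL2P => //; case: fXY|].
move=> Z tZ; have [sD bD] := smooth_div_test tZ.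
have iF := igr_L2_test f2 sD bD; have iH := igr_L2_test h2 sD bD.
have fZ : fieldL2 Z by apply: fieldL2_test; [case: tZ|apply/compactly_supportedP; case: tZ].
have iXZ := igr_inner fX fZ; have iYZ := igr_inner fY fZ.
have i1 : igr volm (fun x => (f x - h x) * divergence g Z x).
  by apply: eq_igr (igrB iF iH) => x; rewrite mulrBl.
rewrite (igr_fin (igr_inner fXY fZ)) (igr_fin i1); congr EFin.
transitivity (\int[volm]_x inner g x (X x) (Z x) - \int[volm]_x inner g x (Y x) (Z x)).
  by rewrite -rintB//; apply: eq_rint => x; rewrite innerBl.
rewrite (is_gradient_ibp gX tZ iF) (is_gradient_ibp gY tZ iH).
rewrite -opprB opprK addrC -rintB//; congr (- _); apply: eq_rint => x.
by rewrite mulrBl.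
Qed.

Lemma gradient_unique f X Y : isL2 volm W f -> is_gradient g f X -> is_gradient g f Y ->
  \forall x \ae volm, X x = Y x.
Proof.
move=> f2 gX gY; have gXY := is_gradientB f2 f2 gX gY.
have : \forall x \ae volm, X x - Y x = 0.
  apply: field_orthogonal; first exact: is_gradient_igr gXY.
  move=> Z tZ; rewrite (is_gradient_ibp gXY tZ).
    rewrite (_ : \int[volm]_x _ = \int[volm]_x 0); first by rewrite /Rintegral integral0 oppr0.
    by apply: eq_rint => x; rewrite subrr mul0r.
  by apply: (eq_igr _ (@igr0 _ _ _ volm)) => x; rewrite subrr mul0r.
by apply: filterS => x /eqP; rewrite subr_eq0 => /eqP.
Qed.

Lemma gradP f : (exists X, is_gradient g f X) -> is_gradient g f (grad g f).
Proof. by move=> [X gX]; exact: (@xgetI _ (fun=> 0) [set X | is_gradient g f X] X). Qed.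

Lemma grad_test f : test_function f -> fieldL2 (grad g f) /\ fieldL2 (grd f) /\
  \forall x \ae volm, grad g f x = grd f x.
Proof.
move=> tf; have gt := is_gradient_test tf.
have gg := gradP (ex_intro _ _ gt).
split; first exact: is_gradient_igr gg.
split; first exact: is_gradient_igr gt.
exact: gradient_unique (test_L2 vol_fin cW W0' tf) gg gt.
Qed.

Lemma normW1_testB f phi : isL2 volm W f -> (exists X, is_gradient g f X) -> test_function phi ->
  normW1_sq g (rho \+ V) (f \- phi) =
    (en (fun x => grad g f x - grd phi x) + nm volm W (fun x => f x - phi x) ^+ 2)%:E.
Proof.
move=> f2 gf tp; have p2 := test_L2 vol_fin cW W0' tp.
have fp2 := L2B mW W0' f2 p2.
have gf' := gradP gf.
have gB := is_gradientB f2 p2 gf' (is_gradient_test tp).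
have gB' := gradP (ex_intro _ _ gB).
have ae := gradient_unique fp2 gB' gB.
rewrite /normW1_sq EFinD; congr (_ + _)%E.
  rewrite (energyE (is_gradient_igr gB')); congr EFin.
  exact: en_ae (is_gradient_igr gB') (is_gradient_igr gB) ae.
by rewrite -(sqnE mW W0' fp2).
Qed.

(** The Laplacian minus [V], divided by the weight [rho]: the action of the generator on test
    functions. *)
Definition test_op phi x := (divergence g (grd phi) x - V x * phi x) / rho x.

Lemma test_field_grd phi : test_function phi -> test_field (grd phi).
Proof.
move=> /test_function_bs[sp bp]; split; first by move=> i; exact: smooth_grd.
by apply/compactly_supportedP; exact: bounded_support_grd.
Qed.

Lemma W10_test phi : test_function phi -> W10 g (rho \+ V) phi.
Proof.
move=> tp; have p2 := test_L2 vol_fin cW W0' tp.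
have gp := ex_intro _ _ (is_gradient_test tp).
split; first by split.
exists (fun=> phi) => //.
rewrite (normW1_testB p2 gp tp).
rewrite (_ : (fun x => phi x - phi x) = fun=> 0); last by apply/funext => x; rewrite subrr.
rewrite nm0 expr0n addr0.
have [f1 [f2 ae]] := grad_test tp.
rewrite (_ : en _ = 0); first exact: cvg_cst.
rewrite (@en_ae _ (fun=> 0)).
- rewrite /en (_ : \int[volm]_x _ = \int[volm]_x 0); first by rewrite /Rintegral integral0.
  by apply: eq_rint => x; rewrite inner0l.
- exact: fieldL2B.
- split; first exact: measurable_cst.
  by apply: (eq_igr _ (@igr0 _ _ _ volm)) => x; rewrite inner0l.
- by apply: filterS ae => x ->; rewrite subrr.
Qed.

Lemma W10_L2 f : W10 g (rho \+ V) f -> isL2 volm W f /\ fieldL2 (grad g f) /\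
  is_gradient g f (grad g f).
Proof.
move=> [[f2 /gradP gf] _]; split; first exact: f2.
by split => //; exact: is_gradient_igr gf.
Qed.

Lemma test_op_test phi : test_function phi -> test_function (test_op phi).
Proof.
move=> tp; have [sD bD] := smooth_div_test (test_field_grd tp).
have /test_function_bs[sp bp] := tp.
apply/test_function_bs; split.
  apply: smoothM; last by apply: smoothV => // x; rewrite gt_eqF.
  exact (smoothB sD (smoothM sV sp)).
have bs : bounded_support (fun x => divergence g (grd phi) x + (- V x) * phi x).
  by apply: bounded_supportD => //; exact: bounded_supportM.
by apply: bounded_support_comp bs => x; rewrite /test_op mulNr => ->; rewrite mul0r.
Qed.

Lemma formE f h : Defs.form g V f h =
  \int[volm]_x inner g x (grad g f x) (grad g h x) + \int[volm]_x (f x * h x * V x).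
Proof. by []. Qed.

Lemma dotL2E w f h : dotL2 g w f h = dt volm w f h. Proof. by []. Qed.

Lemma form_test f phi : W10 g (rho \+ V) f -> test_function phi ->
  Defs.form g V f phi = \int[volm]_x inner g x (grad g f x) (grd phi x) + \int[volm]_x (f x * phi x * V x).
Proof.
move=> /W10_L2[f2 [ff _]] tp; have [f1 [f3 ae]] := grad_test tp.
by rewrite formE; congr (_ + _); exact: rint_inner_ae.
Qed.

Lemma formC f h : Defs.form g V f h = Defs.form g V h f.
Proof.
have E1 : \int[volm]_x inner g x (grad g f x) (grad g h x) =
    \int[volm]_x inner g x (grad g h x) (grad g f x).
  by apply: eq_rint => x; exact: innerC.
have E2 : \int[volm]_x (f x * h x * V x) = \int[volm]_x (h x * f x * V x).
  by apply: eq_rint => x; rewrite [f x * _]mulrC.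
by rewrite (formE f h) (formE h f) E1 E2.
Qed.

Lemma op_test phi : test_function phi -> form_operator g rho V phi (test_op phi).
Proof.
move=> tp; split; first exact: W10_test.
  exact (test_L2 vol_fin (smooth_continuous srho) rho0' (test_op_test tp)).
move=> h Wh; rewrite formC (form_test Wh tp).
have [h2 [fh gh]] := W10_L2 Wh.
have tg := test_field_grd tp; have [sD bD] := smooth_div_test tg.
have i1 := igr_L2_test h2 sD bD.
rewrite (is_gradient_ibp gh tg i1).
have /test_function_bs[sp bp] := tp.
have i2 : igr volm (fun x => h x * phi x * V x).
  apply: eq_igr (igr_L2_test h2 (smoothM sV sp) (bounded_supportM _ bp)) => x; ring.
have -> : dotL2 g rho (test_op phi) h =
    \int[volm]_x (h x * divergence g (grd phi) x - h x * phi x * V x).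
  rewrite dotL2E dtE; apply: eq_rint => x.
  rewrite /test_op mulrAC divfK ?gt_eqF//; ring.
by rewrite rintB// opprB addrC.
Qed.

Lemma op_dissipative f l : form_operator g rho V f l -> dt volm rho l f <= 0.
Proof.
move=> [Wf _ /(_ f Wf) E].
suff : 0 <= Defs.form g V f f by rewrite E oppr_ge0.
rewrite formE; apply: addr_ge0; apply: rint_ge0 => x; first exact: inner_ge0.
by apply: mulr_ge0; rewrite -?expr2 ?sqr_ge0.
Qed.

Lemma op_symmetric f l h k : form_operator g rho V f l -> form_operator g rho V h k ->
  dt volm rho l h = dt volm rho f k.
Proof.
move=> [Wf _ /(_ _) Ef] [Wh _ Eh]; have := Ef h Wh; have := Eh f Wf.
rewrite formC !dotL2E => -> /oppr_inj E; rewrite -E; exact: dtC.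
Qed.

Lemma op_dense f e : isL2 volm rho f -> 0 < e -> exists phi l,
  form_operator g rho V phi l /\ nm volm rho (fun x => f x - phi x) <= e.
Proof.
move=> f2 e0; have [_ /(_ e e0)[phi tp H]] := test_dense vol_fin (smooth_continuous srho) rho0' f2.
by exists phi, (test_op phi); split => //; exact: op_test.
Qed.

Lemma dent_mul_ge (y : R) : ent y <= y * dent y.
Proof.
rewrite /ent /dent; have [y0|y0] := leP y 0; first by rewrite !flat_neg// !mulr0.
apply: ler_wpM2l; first exact: ltW.
rewrite !flat_pos// hornerD !hornerC hornerX ler_wpM2r ?expR_ge0//.
by rewrite lerDl invr_ge0 ltW.
Qed.

(** Since [u] is bounded and subharmonic, testing its Laplacian with [chi ^+ 2 * u] controls its
    gradient locally. It is used with [chi = dent (phi x)], the factor of [grd u] in the gradient of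
    [(1 - u) * dent phi]. *)
Lemma caccioppoli (u chi : 'rV[R]_n -> R) : smooth u -> (forall x, 0 <= u x <= 1) ->
  (forall x, 0 <= divergence g (grd u) x) -> test_function chi ->
  igr volm (fun x => chi x ^+ 2 * inner g x (grd u x) (grd u x)) /\
  \int[volm]_x (chi x ^+ 2 * inner g x (grd u x) (grd u x)) <= 4 * en (grd chi).
Proof.
move=> su u01 du tchi; have /test_function_bs[sc bc] := tchi.
have sg i : smooth (fun x => grd u x 0 i) by exact: smooth_grd.
have s2 := smoothM sc sc.
have sF : smooth (fun x => chi x * chi x * u x) by exact (smoothM s2 su).
have bF : bounded_support (fun x => chi x * chi x * u x).
  by apply: bounded_support_comp bc => x ->; rewrite !mul0r.
have [i1 i2 E] := ibp sF sg (or_introl bF).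
have iA : igr volm (fun x => chi x ^+ 2 * inner g x (grd u x) (grd u x)).
  apply: igr_vol_smooth.
    have -> : (fun x => chi x ^+ 2 * inner g x (grd u x) (grd u x)) =
      fun x => (chi x * chi x) * inner g x (grd u x) (grd u x) by apply/funext => x; rewrite expr2.
    exact (smoothM s2 (smooth_inner sg sg)).
  by apply: bounded_support_comp bc => x ->; rewrite expr0n mul0r.
have fc : fieldL2 (grd chi).
  by apply: fieldL2_test; [move=> i; exact: smooth_grd|exact: bounded_support_grd].
have [_ ic] := fc.
split => //.
have E0 : \int[volm]_x inner g x (grd (fun y => chi y * chi y * u y) x) (grd u x) <= 0.
  rewrite E oppr_le0; apply: rint_ge0 => x.
  by have /andP[u0 _] := u01 x; rewrite mulr_ge0// mulr_ge0// -expr2 sqr_ge0.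
have : \int[volm]_x (2^-1 * (chi x ^+ 2 * inner g x (grd u x) (grd u x)) -
    2 * inner g x (grd chi x) (grd chi x)) <= 0.
  apply: le_trans E0; apply: rint_le => [||x].
  - by apply: igrB; exact: igrZ.
  - exact: i1.
  rewrite (grdM x s2 su) (grdM x sc sc) innerDl !innerZl innerDl !innerZl.
  (* Completing the square absorbs the mixed term, at the price of half of the term in [grd u]; then
     [u ^+ 2 <= 1]. *)
  have := inner_ge0 x (chi x *: grd u x + (2 * u x) *: grd chi x).
  rewrite innerDl !innerDr !innerZl !innerZr (innerC x (grd chi x) (grd u x)).
  have := inner_ge0 x (grd chi x); have /andP[u0 u1] := u01 x.
  set a := inner g x (grd u x) (grd u x); set b := inner g x (grd u x) (grd chi x).
  set c := inner g x (grd chi x) (grd chi x) => c0.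
  have : 0 <= (1 - u x ^+ 2) * c by rewrite mulr_ge0// subr_ge0 expr_le1.
  lra.
rewrite rintB; [|exact: igrZ|exact: igrZ].
rewrite !rintZ// -/(en _); lra.
Qed.

(** * The weighted convexity inequality *)

Section core.
Variables (f l u G : 'rV[R]_n -> R).
Hypotheses (fl : form_operator g rho V f l) (su : smooth u) (u01 : forall x, 0 <= u x <= 1)
  (du : forall x, W x * u x <= divergence g (grd u) x) (G2 : isL2 volm rho G)
  (GV : \forall x \ae volm, 0 <= G x * rho x <= u x * rho x + V x).

Let mu_ : measurable_fun setT u := continuous_measurable_rV (smooth_continuous su).
Let entP := entropy_ent R.
(** The function with which the form is tested. *)
Let eta h x := (1 - u x) * dent (h x).
Let f2 : isL2 volm W f. Proof. by case: fl => /W10_L2[]. Qed.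
Let l2 : isL2 volm rho l. Proof. by case: fl. Qed.
Let fX : fieldL2 (grad g f). Proof. by case: fl => /W10_L2[_ []]. Qed.
Let u1 x : 0 <= 1 - u x <= 1.
Proof. by have /andP[? ?] := u01 x; apply/andP; split; lra. Qed.

Let ent_abs (y : R) : `|ent y| <= `|y|.
Proof. by have := entropy_lip entP y 0; rewrite ent0 !subr0. Qed.

Let L2_ent (w h : 'rV[R]_n -> R) : measurable_fun setT w -> (forall x, 0 <= w x) -> isL2 volm w h ->
  isL2 volm w (fun x => ent (h x)).
Proof.
move=> mw w0 h2; apply: (L2_le mw w0 _ _ h2) => [|x]; last exact: ent_abs.
exact: measurableT_comp (entropy_meas entP) (L2_meas h2).
Qed.

Let m_eta h : measurable_fun setT h -> measurable_fun setT (eta h).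
Proof.
move=> mh; apply: measurable_funM; first exact: measurable_funB.
exact: measurableT_comp (entropy_dmeas entP) mh.
Qed.

Let eta_abs h x : `|eta h x| <= 6 * `|h x|.
Proof.
rewrite /eta normrM; have /andP[a b] := u1 x; rewrite (ger0_norm a).
by apply: le_trans (ler_wpM2l a (dent_lin (h x))) _; rewrite ler_piMl// mulr_ge0.
Qed.

Let eta_diff h k x : `|eta h x - eta k x| <= 6 * `|h x - k x|.
Proof.
rewrite /eta -mulrBr normrM; have /andP[a b] := u1 x; rewrite (ger0_norm a).
by apply: le_trans (ler_wpM2l a (dent_lip (h x) (k x))) _; rewrite ler_piMl// mulr_ge0.
Qed.

Let L2_eta h : isL2 volm W h -> isL2 volm W (eta h).
Proof.
move=> h2; apply: (L2_le mW W0' _ _ (L2Z mW W0' 6 h2)); first exact: m_eta (L2_meas h2).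
by move=> x; rewrite [leRHS]normrM (ger0_norm (ler0n R 6)); exact: eta_abs.
Qed.

Let i_entW h : isL2 volm W h -> igr volm (fun x => ent (h x) * (u x * W x)).
Proof.
move=> h2; apply: (igr_le _ _ (igrZ 3 (L2_igr mW W0' h2))).
  apply: measurable_funM; last exact: measurable_funM.
  exact: measurableT_comp (entropy_meas entP) (L2_meas h2).
move=> x; have /andP[a b] := u01 x.
have e0 := ent_ge0 (h x); rewrite ger0_norm; last by rewrite mulr_ge0// mulr_ge0.
rewrite [leRHS]mulrA; apply: ler_pM; [exact: e0|exact: mulr_ge0|exact: (entropy_sq entP)|exact: ler_piMl].
Qed.

Let i_prodV h k : isL2 volm W h -> isL2 volm W k -> igr volm (fun x => h x * k x * V x).
Proof.
move=> h2 k2; apply: (igr_le _ _ (igr_abs (L2_prod mW W0' h2 k2))).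
  by apply: measurable_funM => //; apply: measurable_funM; [exact: L2_meas h2|exact: L2_meas k2].
by move=> x; rewrite !normrM ler_wpM2l ?mulr_ge0// !ger0_norm// lerDr ltW.
Qed.

(** Pointwise, [G * rho <= u * rho + V = u * W + (1 - u) * V], and the last term is handled by
    [ent y <= y * dent y]. *)
Let pairing_lower : dt volm rho G (fun x => ent (f x)) <=
  \int[volm]_x (ent (f x) * (u x * W x)) + \int[volm]_x (f x * eta f x * V x).
Proof.
have i1 := i_entW f2; have i2 := i_prodV f2 (L2_eta f2).
have e2 := L2_ent mr rho0' (L2W_rho f2).
rewrite dtE -rintD//; apply: rint_ae_le; [exact (L2_prod mr rho0' G2 e2)|exact: igrD|].
apply: filterS GV => x /andP[_ g1].
have e0 := ent_ge0 (f x); have h := dent_mul_ge (f x).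
have /andP[a b] := u1 x; have v0 := V0 x.
have h1 : ent (f x) * (G x * rho x) <= ent (f x) * (u x * rho x + V x) by exact: ler_wpM2l.
have h2 : ((1 - u x) * V x) * ent (f x) <= ((1 - u x) * V x) * (f x * dent (f x)).
  by apply: ler_wpM2l => //; exact: mulr_ge0.
rewrite /eta /W; lra.
Qed.

(** The form is tested with [eta phi] for a test function [phi] close to [f], because the chain rule
    is available for smooth functions only. Every replacement of [phi] by [f] costs a multiple of
    [e]; the replacement inside the gradients needs the energy of [eta phi] to be bounded. *)
Let step phi e : test_function phi -> 0 < e -> e <= 1 ->
  en (fun x => grad g f x - grd phi x) <= e ^+ 2 -> nm volm W (fun x => f x - phi x) <= e ->
  dt volm rho G (fun x => ent (f x)) + dt volm rho l (eta f) <=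
  (1 + 360 * (2 * en (grad g f) + 2) + 6 * (2 * nm volm W f + 1) + 6 * nm volm W f +
   6 * nm volm rho l) * e.
Proof.
move=> tp e0 e1 De Ne; have /test_function_bs[sp bp] := tp.
have p2 := test_L2 vol_fin cW W0' tp.
have fp2 := L2B mW W0' f2 p2.
have s1u : smooth (fun x => 1 - u x) := smoothB (@smooth_cst R n 1) su.
have tchi : test_function (fun x => dent (phi x)).
  apply/test_function_bs; split.
    by apply: (@smooth_comp _ _ setT (@dent R)) => //; exact (@smooth1_dent R setT).
  by apply: bounded_support_comp bp => x ->; exact: dent0.
have /test_function_bs[sc bc] := tchi.
have teta : test_function (eta phi) by exact: test_functionM s1u tchi.
have /test_function_bs[se be] := teta.
have tent : test_function (fun x => ent (phi x)).
  apply/test_function_bs; split.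
    by apply: (@smooth_comp _ _ setT (@ent R)) => //; exact (@smooth1_ent R setT).
  by apply: bounded_support_comp bp => x ->; exact: ent0.
have /test_function_bs[sq bq] := tent.
have sgrd h i : smooth h -> smooth (fun x => grd h x 0 i) by exact: smooth_grd.
have ftest h : test_function h -> fieldL2 (grd h).
  move=> /test_function_bs[sh bh].
  by apply: fieldL2_test; [move=> i; exact: sgrd|exact: bounded_support_grd].
pose D x := grad g f x - grd phi x.
have fD : fieldL2 D := fieldL2B fX (ftest _ tp).
have E1 : - dt volm rho l (eta phi) =
    \int[volm]_x inner g x (grad g f x) (grd (eta phi) x) + \int[volm]_x (f x * eta phi x * V x).
  case: fl => Wf _ /(_ _ (W10_test teta)); rewrite dotL2E => <-.
  exact: form_test.
have E2 : \int[volm]_x inner g x (grad g f x) (grd (eta phi) x) =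
    \int[volm]_x inner g x (D x) (grd (eta phi) x) + \int[volm]_x inner g x (grd phi x) (grd (eta phi) x).
  have i1 := igr_inner fD (ftest _ teta); have i2 := igr_inner (ftest _ tp) (ftest _ teta).
  by rewrite -rintD//; apply: eq_rint => x; rewrite -innerDl subrK.
have geta x : grd (eta phi) x = ((1 - u x) * flat 'X^3 (phi x)) *: grd phi x - dent (phi x) *: grd u x.
  rewrite (grdM x s1u sc) (grd_comp x (@is_derive_dent R) sp) scalerA; congr (_ + _).
  by rewrite (grdB x (@smooth_cst R n 1) su) scalerBr (_ : grd (fun=> 1) x = 0) ?scaler0 ?sub0r//;
     apply/rowP => k; rewrite grdE mxE big1// => i _; rewrite /partial derive_cst mul0r.
have du0 x : 0 <= divergence g (grd u) x.
  by apply: le_trans (du x); rewrite mulr_ge0//; case/andP: (u01 x).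
have [iC C] := caccioppoli su u01 du0 tchi.
have [_ ip] := ftest _ tp.
have en_p : en (grd phi) <= 2 * en (grad g f) + 2.
  have [_ iXX] := fX; have [_ iDD] := fD.
  have : en (grd phi) <= 2 * en (grad g f) + 2 * en D.
    rewrite /en -!rintZ// -rintD; [|exact: igrZ|exact: igrZ].
    apply: rint_le => [||x]; [exact: ip|by apply: igrD; exact: igrZ|].
    have Eg : grd phi x = grad g f x - D x by rewrite /D opprB addrC subrK.
    rewrite [in leLHS]Eg; apply: le_trans (inner_add2 x _ (- D x)) _.
    by rewrite innerNl innerC innerNl opprK.
  by move=> h; exact: core_arith1 h De (exprn_ile1 2 (ltW e0) e1).
have en_c : en (grd (fun x => dent (phi x))) <= 36 * en (grd phi).
  have [_ ic] := ftest _ tchi.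
  rewrite /en -rintZ//; apply: rint_le => [||x]; [exact: ic|exact: igrZ|].
  rewrite (grd_comp x (@is_derive_dent R) sp) innerZl innerZr mulrA.
  apply: ler_wpM2r; first exact: inner_ge0.
  have z0 := flat_X3_ge0 (phi x); have z6 := flat_X3_le (phi x).
  by have [] := core_arith2 z0 z6.
(* The constant is [2 * 36 + 2 * 4 * 36]: the first part comes from [flat 'X^3 <= 6], the second
   from the Caccioppoli estimate followed by [en_c]. *)
have en_e : en (grd (eta phi)) <= 360 * en (grd phi).
  have [_ ie] := ftest _ teta.
  have : en (grd (eta phi)) <= 72 * en (grd phi) +
      2 * \int[volm]_x (dent (phi x) ^+ 2 * inner g x (grd u x) (grd u x)).
    rewrite /en -!rintZ// -rintD; [|exact: igrZ|exact: igrZ].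
    apply: rint_le => [||x]; [exact: ie|by apply: igrD; exact: igrZ|].
    rewrite geta; apply: le_trans (inner_add2 _ _ _) _; apply: lerD.
      have /andP[a b] := u1 x.
      have z0 : 0 <= (1 - u x) * flat 'X^3 (phi x) by rewrite mulr_ge0// flat_X3_ge0.
      have z6 : (1 - u x) * flat 'X^3 (phi x) <= 6.
        by apply: le_trans (flat_X3_le (phi x)); apply: ler_piMl => //; exact: flat_X3_ge0.
      rewrite innerZl innerZr 2!mulrA -[2 * _ * _]mulrA; apply: ler_wpM2r; first exact: inner_ge0.
      by have [] := core_arith2 z0 z6.
    by rewrite innerNl innerC innerNl opprK innerZl innerZr expr2 !mulrA.
  by move=> h; exact: core_arith3 h C en_c.
(* Young's inequality with constant [e^-1]: the energy of [D] is at most [e ^+ 2], so both resulting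
   terms are of order [e]. *)
have P1 : - (\int[volm]_x inner g x (D x) (grd (eta phi) x)) <= e * (1 + 360 * (2 * en (grad g f) + 2)).
  have ei0 : 0 < e^-1 by rewrite invr_gt0.
  apply: le_trans (inner_young fD (ftest _ teta) ei0) _; rewrite invrK mulrDr; apply: lerD.
    apply: le_trans (ler_wpM2l (ltW ei0) De) _.
    by rewrite expr2 mulrA mulVf ?gt_eqF// mul1r mulr1.
  by apply: ler_wpM2l; [exact: ltW|apply: le_trans en_e _; apply: ler_wpM2l].
(* The term with the second derivative of [ent] is nonnegative and is dropped. The remaining one,
   minus the product of [grd u] with the gradient of [ent phi], is integrated by parts against
   [u]. *)
have P2 : \int[volm]_x (ent (phi x) * (u x * W x)) <= \int[volm]_x inner g x (grd phi x) (grd (eta phi) x).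
  have sg i : smooth (fun x => grd u x 0 i) by exact: sgrd.
  have [j1 j2 E] := ibp sq sg (or_introl bq).
  apply: (@le_trans _ _ (\int[volm]_x (ent (phi x) * divergence g (grd u) x))).
    apply: rint_le => [||x]; [exact: i_entW p2|exact: j2|].
    by apply: ler_wpM2l; [exact: ent_ge0|rewrite mulrC; exact: du].
  have -> : \int[volm]_x (ent (phi x) * divergence g (grd u) x) =
      \int[volm]_x (- inner g x (grd (fun y => ent (phi y)) x) (grd u x)).
    by rewrite rintN// E opprK.
  apply: rint_le => [||x]; [exact: igrN|exact: igr_inner (ftest _ tp) (ftest _ teta)|].
  rewrite geta (grd_comp x (@is_derive_ent R) sp) innerBr !innerZr innerZl.
  rewrite -subr_ge0 opprK subrK mulr_ge0 ?inner_ge0// mulr_ge0 ?flat_X3_ge0//.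
  by case/andP: (u1 x).
have N0 := nm_ge0 volm W f.
have afp2 := L2_abs mW W0' fp2.
have af2 := L2_abs mW W0' f2; have ap2 := L2_abs mW W0' p2.
have nabs h : nm volm W (fun x => `|h x|) = nm volm W h.
  congr Num.sqrt; rewrite !dtE; apply: eq_rint => x.
  by rewrite -normrM ger0_norm// -expr2 sqr_ge0.
have P3 : \int[volm]_x (ent (f x) * (u x * W x)) <=
    \int[volm]_x (ent (phi x) * (u x * W x)) + 6 * (2 * nm volm W f + 1) * e.
  have aS := L2D mW W0' af2 ap2.
  rewrite -lerBlDl -rintB; [|exact: i_entW|exact: i_entW].
  apply: (@le_trans _ _ (6 * dt volm W (fun x => `|f x| + `|phi x|) (fun x => `|f x - phi x|))).
    rewrite dtE -rintZ; last exact (L2_prod mW W0' aS afp2).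
    apply: rint_le => [||x]; [by apply: igrB; exact: i_entW|apply: igrZ; exact (L2_prod mW W0' aS afp2)|].
    rewrite -mulrBl !mulrA; apply: ler_wpM2r => //.
    have h := le_trans (ler_norm _) (entropy_lip2 entP (f x) (phi x)).
    have /andP[a b] := u01 x.
    by apply: le_trans (ler_wpM2r a h) _; rewrite ler_piMr// !mulr_ge0// addr_ge0.
  rewrite -mulrA; apply: ler_wpM2l => //.
  apply: le_trans (le_trans (ler_norm _) (dt_CS mW W0' aS afp2)) _.
  rewrite (nabs (fun x => f x - phi x)); apply: ler_pM; rewrite ?nm_ge0//.
  apply: le_trans (nmD mW W0' af2 ap2) _; rewrite !nabs.
  have : nm volm W phi <= nm volm W (fun x => phi x - f x) + nm volm W f.
    apply: le_trans (nmD mW W0' (L2B mW W0' p2 f2) f2).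
    by under [X in _ <= nm _ _ X]eq_fun do rewrite subrK.
  by rewrite nm_distC => h; exact: core_arith4 h Ne e1.
have P4 : \int[volm]_x (f x * eta f x * V x) <=
    \int[volm]_x (f x * eta phi x * V x) + 6 * nm volm W f * e.
  rewrite -lerBlDl -rintB; [|exact: i_prodV f2 (L2_eta f2)|exact: i_prodV f2 (L2_eta p2)].
  apply: (@le_trans _ _ (6 * dt volm W (fun x => `|f x|) (fun x => `|f x - phi x|))).
    rewrite dtE -rintZ; last exact (L2_prod mW W0' af2 afp2).
    apply: rint_le => [||x].
    - by apply: igrB; [exact: i_prodV f2 (L2_eta f2)|exact: i_prodV f2 (L2_eta p2)].
    - by apply: igrZ; exact (L2_prod mW W0' af2 afp2).
    rewrite -mulrBl -mulrBr; apply: le_trans (ler_norm _) _.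
    rewrite !normrM (ger0_norm (V0 x)) mulrA.
    apply: ler_pM; [exact: mulr_ge0|exact: V0| |by rewrite lerDr ltW].
    by apply: le_trans (ler_wpM2l (normr_ge0 (f x)) (eta_diff f phi x)) _; rewrite mulrCA.
  rewrite -mulrA; apply: ler_wpM2l => //.
  apply: le_trans (le_trans (ler_norm _) (dt_CS mW W0' af2 afp2)) _.
  by rewrite !nabs; apply: ler_wpM2l.
have P5 : dt volm rho l (eta f) <= dt volm rho l (eta phi) + 6 * nm volm rho l * e.
  have e1' := L2W_rho (L2_eta f2); have e2' := L2W_rho (L2_eta p2).
  rewrite -lerBlDl -(dtBr mr rho0' e1' e2' l2).
  apply: le_trans (le_trans (ler_norm _) (dt_CS mr rho0' l2 (L2B mr rho0' e1' e2'))) _.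
  have fpr := L2W_rho fp2.
  have key : nm volm rho (fun x => eta f x - eta phi x) <= 6 * e.
    have h1 : nm volm rho (fun x => eta f x - eta phi x) <= nm volm rho (fun x => 6 * (f x - phi x)).
      apply: (nm_le mr rho0' (L2B mr rho0' e1' e2') (L2Z mr rho0' 6 fpr)) => x.
      by rewrite [leRHS]normrM (ger0_norm (ler0n R 6)); exact: eta_diff.
    apply: le_trans h1 _; rewrite (nmZ mr rho0' 6 fpr) (ger0_norm (ler0n R 6)).
    by apply: ler_wpM2l => //; exact: le_trans (nmW_rho fp2) Ne.
  rewrite [leRHS](_ : _ = nm volm rho l * (6 * e)); last by rewrite mulrCA mulrA.
  by apply: ler_wpM2l; [exact: nm_ge0|exact: key].
rewrite E2 in E1.
exact: core_arith5 pairing_lower E1 P1 P2 P3 P4 P5.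
Qed.

(** Formally the form of [f] and [(1 - u) * dent f] is at least the integral of [ent f] against the
    Laplacian of [u] plus [(1 - u) * V], hence against [u * rho + V], hence against [G * rho]. The
    approximants come from the definition of [W10], and [e] is tuned so that the error [K * e] of
    [step] is at most [eps]. *)
Lemma core_inequality : dt volm rho l (fun x => (1 - u x) * dent (f x)) <=
  - dt volm rho G (fun x => ent (f x)).
Proof.
rewrite -subr_le0 opprK addrC.
set K := 1 + 360 * (2 * en (grad g f) + 2) + 6 * (2 * nm volm W f + 1) + 6 * nm volm W f +
   6 * nm volm rho l.
have K0 : 0 < K.
  have := en_ge0 (grad g f); have := nm_ge0 volm W f; have := nm_ge0 volm rho l.
  rewrite /K; lra.
apply/ler_addgt0Pr => eps eps0; rewrite add0r.
pose e := Num.min 1 (eps / K).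
have e0 : 0 < e by rewrite lt_min ltr01 divr_gt0.
have e1 : e <= 1 by rewrite ge_min lexx.
have Ke : K * e <= eps.
  by rewrite -ler_pdivlMl// mulrC ge_min lexx orbT.
apply: le_trans Ke.
have [[[_ gf] [phi tphi cv]] _ _] := fl; move: cv.
have E j := normW1_testB f2 gf (tphi j).
rewrite (_ : (fun k => normW1_sq g (rho \+ V) (f \- phi k)) = fun k => (
   en (fun x => grad g f x - grd (phi k) x) + nm volm W (fun x => f x - phi k x) ^+ 2)%:E); last first.
  by apply/funext => k; exact: E.
move=> /fine_cvg/cvgnP/(_ (e ^+ 2) (exprn_gt0 2 e0))[N /(_ N (leqnn N))].
rewrite subr0 => /(le_trans (ler_norm _)) h.
have en0 := en_ge0 (fun x => grad g f x - grd (phi N) x).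
have n0 := sqr_ge0 (nm volm W (fun x => f x - phi N x)).
have h' : en (fun x => grad g f x - grd (phi N) x) +
  nm volm W (fun x => f x - phi N x) ^+ 2 <= e ^+ 2 by exact: h.
apply: (step (tphi N) e0 e1); first by apply: le_trans h'; rewrite lerDl.
rewrite -(@ler_pXn2r _ 2) ?nnegrE ?nm_ge0 ?(ltW e0)//.
by apply: le_trans h'; rewrite lerDr.
Qed.

End core.

End potential.

End riemannian.

(** * Distance and volume density of model manifolds *)

Section euclidean_norm.
Context (R : realType) (n : nat).
Implicit Types (x y u v : 'rV[R]_n).

Lemma dotE u v : dot u v = \sum_i u 0 i * v 0 i.
Proof. by rewrite /dot mxE; apply: eq_bigr => i _; rewrite mxE. Qed.

Lemma dotC u v : dot u v = dot v u.
Proof. by rewrite !dotE; apply: eq_bigr => i _; rewrite mulrC. Qed.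

Lemma dotDl u v y : dot (u + v) y = dot u y + dot v y.
Proof. by rewrite !dotE -big_split; apply: eq_bigr => i _; rewrite mxE mulrDl. Qed.

Lemma dotZl a u y : dot (a *: u) y = a * dot u y.
Proof. by rewrite !dotE mulr_sumr; apply: eq_bigr => i _; rewrite mxE mulrA. Qed.

Lemma dotDr u v y : dot y (u + v) = dot y u + dot y v.
Proof. by rewrite dotC dotDl !(dotC y). Qed.

Lemma dotZr a u y : dot y (a *: u) = a * dot y u.
Proof. by rewrite dotC dotZl (dotC y). Qed.

Lemma dotBl u v y : dot (u - v) y = dot u y - dot v y.
Proof. by rewrite dotDl -scaleN1r dotZl mulN1r. Qed.

Lemma dotBr u v y : dot y (u - v) = dot y u - dot y v.
Proof. by rewrite dotC dotBl !(dotC y). Qed.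

Lemma dot_ge0 x : 0 <= dot x x.
Proof. by rewrite dotE sumr_ge0// => i _; rewrite -expr2 sqr_ge0. Qed.

Lemma dot_gt0 x : x != 0 -> 0 < dot x x.
Proof.
move=> x0; rewrite lt0r dot_ge0 andbT; apply: contraNneq x0 => h.
apply/eqP/rowP => i; rewrite mxE.
have : forall j, true -> x 0 j * x 0 j = 0.
  by apply/psumr_eq0P => [j _|]; [rewrite -expr2 sqr_ge0|rewrite -dotE].
by move=> /(_ i isT)/eqP; rewrite mulf_eq0 orbb => /eqP.
Qed.

Lemma enorm_ge0 x : 0 <= enorm x. Proof. exact: sqrtr_ge0. Qed.

Lemma enorm2 x : enorm x ^+ 2 = dot x x. Proof. exact: sqr_sqrtr (dot_ge0 x). Qed.

Lemma enorm_gt0 x : x != 0 -> 0 < enorm x.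
Proof. by move=> x0; rewrite sqrtr_gt0 dot_gt0. Qed.

Lemma enorm0 : enorm (0 : 'rV[R]_n) = 0.
Proof. by rewrite /enorm dotE big1 ?sqrtr0// => i _; rewrite mxE mul0r. Qed.

Lemma enorm_eq0 x : (enorm x == 0) = (x == 0).
Proof.
have [->|x0] := eqVneq x 0; first by rewrite enorm0 eqxx.
by rewrite gt_eqF// enorm_gt0.
Qed.

Lemma enormZ a x : enorm (a *: x) = `|a| * enorm x.
Proof. by rewrite /enorm dotZl dotZr mulrA -expr2 sqrtrM ?sqr_ge0// sqrtr_sqr. Qed.

Lemma norm_le_enorm x : `|x| <= enorm x.
Proof.
apply: norm_le_coord; first exact: enorm_ge0.
move=> i; rewrite -sqrtr_sqr ler_wsqrtr// dotE (bigD1 i)//= -expr2 lerDl sumr_ge0// => j _.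
by rewrite -expr2 sqr_ge0.
Qed.

Lemma enorm_le_norm x : enorm x <= n%:R * `|x|.
Proof.
rewrite -(@ler_pXn2r _ 2) ?nnegrE ?enorm_ge0 ?mulr_ge0// enorm2 dotE exprMn.
apply: (@le_trans _ _ (\sum_(i < n) `|x| ^+ 2)).
  apply: ler_sum => i _; rewrite -expr2 -real_normK ?num_real//.
  by rewrite lerXn2r ?nnegrE ?coord_norm.
rewrite sumr_const card_ord -[leLHS]mulr_natl; apply: ler_wpM2r; first exact: sqr_ge0.
by rewrite expr2 -natrM ler_nat; case: n => // k; rewrite leq_pmulr.
Qed.

Lemma dot_CS u v : `|dot u v| <= enorm u * enorm v.
Proof.
rewrite -sqrtrM ?dot_ge0// -sqrtr_sqr ler_wsqrtr//.
have [->|v0] := eqVneq v 0.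
  by rewrite dotC -(scale0r (0 : 'rV[R]_n)) !dotZl !mul0r expr0n mulr0.
have c0 := dot_gt0 v0.
have := dot_ge0 (dot v v *: u - dot u v *: v).
rewrite dotBl !dotBr !dotZl !dotZr (dotC v u).
set a := dot u u; set b := dot u v; set c := dot v v in c0 *.
have -> : c * (c * a) - c * (b * b) - (b * (c * b) - b * (b * c)) = c * (a * c - b ^+ 2) by ring.
by rewrite pmulr_rge0// subr_ge0.
Qed.

Lemma smooth_dot : smooth (fun x => dot x x).
Proof.
have -> : (fun x : 'rV[R]_n => dot x x) = fun x => \sum_i x 0 i * x 0 i.
  by apply/funext => x; rewrite dotE.
by apply: smooth_sum => i; apply: smoothM; exact: smooth_coord.
Qed.

Lemma is_derive_dot x v : is_derive x v (fun y => dot y y) (2 * dot x v).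
Proof.
apply/is_derive_lineP.
have -> : (fun s : R => dot (x + s *: v) (x + s *: v)) =
    fun s => dot x x + 2 * dot x v * s + dot v v * s ^+ 2.
  apply/funext => s; rewrite dotDl !dotDr !dotZl !dotZr (dotC v x); ring.
have h1 := is_derive_cst (dot x x) (0 : R) (1 : R).
have h2 := is_deriveZ (2 * dot x v) (is_derive_id (0 : R) (1 : R)).
have h3 := is_deriveZ (dot v v) (is_deriveX 2 (is_derive_id (0 : R) (1 : R))).
apply: is_derive_eq (is_deriveD (is_deriveD h1 h2) h3) _.
by rewrite /GRing.scale/= mulr1 mulr0 mul0r mulr0 addr0 add0r.
Qed.

Lemma continuous_enorm : continuous (@enorm R n).
Proof.
move=> x; apply: continuous_comp; first exact: smooth_continuous smooth_dot x.
exact: sqrt_continuous.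
Qed.

Definition rV_neq0 : set 'rV[R]_n := [set x | x != 0].

Lemma open_neq0 : open rV_neq0.
Proof.
rewrite (_ : rV_neq0 = @enorm R n @^-1` [set r | 0 < r]).
  by apply: open_comp => [x _|]; [exact: continuous_enorm|exact: open_gt].
by apply/seteqP; split=> x /=; [exact: enorm_gt0|move=> h; rewrite /rV_neq0/= -enorm_eq0 gt_eqF].
Qed.

Lemma smooth_on_enorm : smooth_on rV_neq0 (@enorm R n).
Proof.
apply: (@gsmooth_comp _ _ _ _ _ [set r : R | 0 < r] Num.sqrt) => //.
- exact: open_neq0.
- exact (@smooth1_sqrt R).
- by move=> x; exact: dot_gt0.
- by apply: (@gsmooth_sub _ _ _ _ setT) => //; apply/smoothP; exact: smooth_dot.
Qed.

Lemma is_derive_enorm x v : x != 0 -> is_derive x v (@enorm R n) (dot x v / enorm x).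
Proof.
move=> x0; have := @is_derive_comp_dir _ _ Num.sqrt (fun y : 'rV[R]_n => dot y y) _ _ _ _ (is_derive1_sqrt (dot_gt0 x0)) (is_derive_dot x v).
move=> H; apply: is_derive_eq H _; rewrite -/(enorm x).
by field; rewrite gt_eqF// enorm_gt0.
Qed.

Lemma is_derive_radial (F : R -> R) (x v : 'rV[R]_n) dF : x != 0 -> is_derive (enorm x) 1 F dF ->
  is_derive x v (fun y => F (enorm y)) (dF * (dot x v / enorm x)).
Proof. by move=> x0 dFx; exact: is_derive_comp_dir dFx (is_derive_enorm v x0). Qed.

Lemma derive_angle x v : x != 0 ->
  'D_v (@angle R n) x = (enorm x)^-1 *: v - (dot x v / enorm x ^+ 3) *: x.
Proof.
move=> x0; have r0 := enorm_gt0 x0.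
have dc i : is_derive x v (fun y : 'rV[R]_n => angle y 0 i)
    ((enorm x)^-1 * v 0 i - (dot x v / enorm x ^+ 3) * x 0 i).
  have -> : (fun y : 'rV[R]_n => angle y 0 i) = (fun y => (enorm y)^-1) * (fun y : 'rV[R]_n => y 0 i).
    by apply/funext => y; rewrite /angle mxE.
  have rN0 : enorm x != 0 by rewrite gt_eqF.
  have dV := is_derive_radial v x0 (@is_deriveV R id _ 1 1 rN0 (is_derive_id _ _)).
  apply: is_derive_eq (is_deriveM dV (is_derive_coord i x v)) _.
  by rewrite /GRing.scale/= mulr1; field.
have da : derivable (@angle R n) x v.
  apply/derivable_mxP => i j; rewrite (ord1 i).
  by have [] := dc j.
apply/rowP => i; rewrite (derive_mx da) !mxE.
by have [_ ->] := dc i.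
Qed.

End euclidean_norm.

(** One block matrix [M] is factored in two ways; comparing determinants reduces the rank-one
    perturbation to a scalar. *)
Lemma det_rank1 (F : fieldType) n (a : F) (u v : 'rV[F]_n) : (0 < n)%N -> a != 0 ->
  \det (a%:M + u^T *m v) = a ^+ n.-1 * (a + (v *m u^T) 0 0).
Proof.
case: n u v => // n u v _ a0.
pose M := block_mx (1%:M : 'M[F]_1) (- v) u^T (a%:M : 'M[F]_n.+1).
have E1 : M = block_mx 1%:M 0 u^T 1%:M *m block_mx 1%:M (- v) 0 (a%:M + u^T *m v).
  rewrite mulmx_block !mul1mx !mulmx1 ?mul0mx ?mulmx0 ?addr0 ?add0r mulmxN.
  by rewrite addrCA addNr addr0.
have E2 : M = block_mx 1%:M (- (a^-1 *: v)) 0 1%:M *m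
    block_mx (1%:M + (a^-1 *: v) *m u^T) 0 u^T a%:M.
  rewrite mulmx_block !mul1mx ?mul0mx ?mulmx0 ?add0r mulNmx addrK.
  by rewrite mulNmx -scalemxAl mul_mx_scalar scalerA mulVf// scale1r.
have D1 : \det M = \det (a%:M + u^T *m v) by rewrite E1 det_mulmx det_lblock det_ublock !det1 !mul1r.
rewrite -D1 E2 det_mulmx det_ublock det_lblock !det1 !mul1r det_scalar.
rewrite {1}[1%:M + _]mx11_scalar det_scalar1 mxE mxE eqxx -scalemxAl mxE exprS /= mulr1n.
by field.
Qed.

Lemma integral_FTC (R : realType) (F f : R -> R) (a b : R) : a < b ->
  (forall t : R, is_derive t 1 F (f t)) -> continuous f ->
  (\int[lebesgue_measure]_(t in `[a, b]) (f t)%:E = (F b - F a)%:E)%E.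
Proof.
move=> ab dF cf; rewrite (@continuous_FTC2 R f F a b)//.
- exact: continuous_subspaceT.
- have cF (x : R) : {for x, continuous F} by apply: derivable_continuous; have [] := dF x.
  split=> [x _| |]; first by have [] := dF x.
    exact: cvg_at_right_filter (cF a).
  exact: cvg_at_left_filter (cF b).
- by move=> x _; rewrite derive1E; have [_ ->] := dF x.
Qed.

(** * The metric in Cartesian coordinates and the distance to the origin *)

Section model.
Context (R : realType) (n : nat) (sigma : R -> R) (g : 'rV[R]_n -> 'M[R]_n).
Hypotheses (n_gt0 : (0 < n)%N) (model_g : model_manifold sigma g).
Implicit Types (x y u v : 'rV[R]_n).

Let mg : riemannian_metric g := model_metric model_g.
Let sigma_gt0 r : 0 < r -> 0 < sigma r := @scaling_pos _ _ _ _ model_g r.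

(** The factor by which [g] rescales the Euclidean metric orthogonally to [x]; in the radial
    direction the two metrics agree, see [model_inner]. *)
Definition conf (r : R) := (sigma r / r) ^+ 2.

Lemma conf_gt0 r : 0 < r -> 0 < conf r.
Proof. by move=> r0; rewrite exprn_gt0// divr_gt0// sigma_gt0. Qed.

Lemma model_inner x u v : x != 0 ->
  inner g x u v = conf (enorm x) * dot u v +
    (1 - conf (enorm x)) * (dot x u / enorm x) * (dot x v / enorm x).
Proof.
move=> x0; rewrite (model_polar model_g u v x0).
have [_ ->] := is_derive_enorm u x0; have [_ ->] := is_derive_enorm v x0.
rewrite !derive_angle// dotBl !dotBr !dotZl !dotZr -enorm2 (dotC u x).
have r0 : enorm x != 0 by rewrite enorm_eq0.
by rewrite /conf; field.
Qed.

Lemma inner_entry x (i j : 'I_n) : inner g x (delta_mx 0 i) (delta_mx 0 j) = g x i j.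
Proof. by rewrite /inner -rowE trmx_delta -colE !mxE. Qed.

Lemma dot_delta x (i : 'I_n) : dot x (delta_mx 0 i) = x 0 i.
Proof.
rewrite dotE (bigD1 i)//= mxE !eqxx mulr1 big1 ?addr0// => j ji.
by rewrite mxE eqxx/= (negbTE ji) mulr0.
Qed.

Definition xhat x : 'rV[R]_n := (enorm x)^-1 *: x.

Lemma model_metricE x : x != 0 ->
  g x = (conf (enorm x))%:M + ((1 - conf (enorm x)) *: xhat x)^T *m xhat x.
Proof.
move=> x0; apply/matrixP => i j; rewrite -inner_entry model_inner// !dot_delta.
rewrite !mxE big_ord_recl big_ord0 addr0 !mxE eqxx/= [j == i]eq_sym.
have r0 : enorm x != 0 by rewrite enorm_eq0.
by case: (i == j); rewrite ?mulr1n ?mulr0n /=; field.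
Qed.

Lemma dot_xhat x : x != 0 -> dot (xhat x) (xhat x) = 1.
Proof.
move=> x0; rewrite dotZl dotZr -enorm2 expr2.
have r0 : enorm x != 0 by rewrite enorm_eq0.
by field.
Qed.

Lemma det_model x : x != 0 -> \det (g x) = conf (enorm x) ^+ n.-1.
Proof.
move=> x0; have c0 := conf_gt0 (enorm_gt0 x0).
rewrite model_metricE// det_rank1 ?gt_eqF//.
by rewrite -/(dot (xhat x) _) dotZr dot_xhat// mulr1 addrC subrK mulr1.
Qed.

(** The polar formula is silent at the origin. On the ray through the [i]-th basis vector that
    vector is radial, so the entries of row [i] are those of the identity, and continuity carries
    this to 0. *)
Lemma model_metric0 : g 0 = 1%:M.
Proof.
apply/matrixP => i j; rewrite mxE.
pose e : 'rV[R]_n := delta_mx 0 i.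
have h : g (t *: e) i j @[t --> (0:R)^'+] --> g 0 i j.
  apply: cvg_at_right_filter.
  have c : {for (0:R), continuous (fun t : R => g (t *: e) i j)}.
    apply: (@continuous_comp _ _ _ (fun t : R => t *: e) (fun x => g x i j)).
      exact: scalel_continuous.
    exact: smooth_continuous (metric_smooth mg i j) _.
  by have := c; rewrite /prop_for /continuous_at scale0r.
rewrite -(cvg_lim _ h)//; apply: cvg_lim => //.
apply: cvg_near_cst; near=> t.
have t0 : 0 < t by near: t; exact: nbhs_right_gt.
have e0 : e != 0.
  by apply/eqP => /rowP/(_ i); rewrite !mxE !eqxx => /eqP; rewrite oner_eq0.
have en1 : enorm e = 1 by rewrite /enorm dot_delta mxE !eqxx sqrtr1.
have te0 : t *: e != 0 by rewrite scaler_eq0 negb_or e0 gt_eqF.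
rewrite -inner_entry model_inner// !dot_delta enormZ en1 mulr1 gtr0_norm//.
rewrite !mxE !eqxx/= mulr1 [j == i]eq_sym.
by case: (i == j); rewrite /= ?mulr0n ?mulr1n; field; rewrite gt_eqF.
Unshelve. all: by end_near. Qed.

Lemma det_pos x : 0 < \det (g x).
Proof.
have [->|x0] := eqVneq x 0; first by rewrite model_metric0 det1.
by rewrite det_model// exprn_gt0// conf_gt0// enorm_gt0.
Qed.

Lemma density_model x : x != 0 -> vol_density g x = (sigma (enorm x) / enorm x) ^+ n.-1.
Proof.
move=> x0; have r0 := enorm_gt0 x0.
rewrite /vol_density det_model// /conf exprAC sqrtr_sqr ger0_norm// exprn_ge0//.
by rewrite divr_ge0 ?ltW// sigma_gt0.
Qed.

Lemma inner_radial_le x v : (dot x v) ^+ 2 <= enorm x ^+ 2 * inner g x v v.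
Proof.
have [->|x0] := eqVneq x 0.
  by rewrite enorm0 -(scale0r (0 : 'rV[R]_n)) dotZl mul0r expr0n mul0r.
rewrite model_inner//; have r0 := enorm_gt0 x0.
have c0 := conf_gt0 r0; have cs := dot_CS x v.
have cs2 : dot x v ^+ 2 <= enorm x ^+ 2 * dot v v.
  rewrite -real_normK ?num_real// -(enorm2 v) -exprMn.
  by rewrite lerXn2r ?nnegrE ?mulr_ge0 ?enorm_ge0.
have -> : enorm x ^+ 2 * (conf (enorm x) * dot v v + (1 - conf (enorm x)) * (dot x v / enorm x) * (dot x v / enorm x)) =
  dot x v ^+ 2 + conf (enorm x) * (enorm x ^+ 2 * dot v v - dot x v ^+ 2).
  by field; rewrite gt_eqF.
by rewrite lerDl mulr_ge0 ?(ltW c0)// subr_ge0.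
Qed.

Lemma inner_along x : forall t : R, inner g (t *: x) x x = enorm x ^+ 2.
Proof.
move=> t; have [->|x0] := eqVneq x 0.
  by rewrite enorm0 expr0n /inner !mul0mx mxE.
have [->|t0] := eqVneq t 0.
  by rewrite scale0r /inner model_metric0 mulmx1 -/(dot x x) enorm2.
have tx0 : t *: x != 0 by rewrite scaler_eq0 negb_or t0.
rewrite model_inner// enormZ dotZl -enorm2.
have r0 : enorm x != 0 by rewrite enorm_eq0.
have at0 : `|t| != 0 by rewrite normr_eq0.
have t2 : t ^+ 2 = `|t| ^+ 2 by rewrite real_normK ?num_real.
transitivity (conf (`|t| * enorm x) * enorm x ^+ 2 + (1 - conf (`|t| * enorm x)) *
  (t ^+ 2 / `|t| ^+ 2 * enorm x ^+ 2)); first by field; rewrite at0 r0.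
by rewrite t2 divff ?expf_neq0//; ring.
Qed.

(** The Euclidean norm made smooth at the origin, through which curves may pass. Its derivative
    along a curve is at most the speed, by [inner_radial_le]. *)
Definition reg_norm (e : R) x := Num.sqrt (dot x x + e ^+ 2).

Lemma length_ge (c : R -> 'rV[R]_n) (e : R) : 0 < e -> C1_curve c ->
  (`|reg_norm e (c 1) - reg_norm e (c 0)|%:E <= length g c)%E.
Proof.
move=> e0 [dc cc].
have rp x : 0 < dot x x + e ^+ 2 by rewrite ltr_wpDl ?dot_ge0// exprn_gt0.
have dci i (t : R) : is_derive t 1 (fun s : R => c s 0 i) ((derive1 c t) 0 i).
  have d1 : derivable (fun s : R => c s 0 i) t 1 by have /derivable_mxP := dc t; exact.
  by apply: DeriveDef => //; rewrite derive1E (derive_mx (dc t)) mxE.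
pose c' := derive1 c.
have dN (t : R) : is_derive t 1 (fun s : R => reg_norm e (c s)) (dot (c t) (c' t) / reg_norm e (c t)).
  have d2 : is_derive t 1 (fun s : R => dot (c s) (c s) + e ^+ 2) (2 * dot (c t) (c' t)).
    have -> : (fun s : R => dot (c s) (c s) + e ^+ 2) =
        (\sum_(i < n) (fun s : R => c s 0 i) * (fun s : R => c s 0 i)) + (fun=> e ^+ 2).
      apply/funext => s; rewrite dotE; congr (_ + _).
      by elim/big_ind2: _ => // f1 f2 g1 g2 -> ->.
    have h i := is_deriveM (dci i t) (dci i t).
    have hs : is_derive t 1 (\sum_(i < n) (fun s : R => c s 0 i) * (fun s : R => c s 0 i))
       (\sum_(i < n) (c t 0 i *: c' t 0 i + c t 0 i *: c' t 0 i)) by exact: is_derive_sum.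
    apply: is_derive_eq (is_deriveD hs (is_derive_cst _ _ _)) _.
    by rewrite addr0 dotE mulr_sumr; apply: eq_bigr => i _; rewrite mulr2n mulrDl mul1r.
  have d3 : is_derive t 1 (fun s : R => reg_norm e (c s)) _ :=
    @is_derive1_comp R Num.sqrt (fun s : R => dot (c s) (c s) + e ^+ 2) t _ _ (is_derive1_sqrt (rp (c t))) d2.
  apply: is_derive_eq d3 _.
  by rewrite -/(reg_norm e (c t)); field; rewrite gt_eqF// sqrtr_gt0.
have cci i : continuous (fun t => c t 0 i).
  by move=> t; apply: derivable_continuous; have [] := dci i t.
have cci' i : continuous (fun t => c' t 0 i).
  by move=> t; apply: (@continuous_comp _ _ _ c' (fun x : 'rV[R]_n => x 0 i)); [exact: cc|exact: coord_continuous].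
have csum (r : seq 'I_n) (F : 'I_n -> R -> R) : (forall i, continuous (F i)) ->
    continuous (fun t => \sum_(i <- r) F i t).
  move=> cF; elim: r => [|i r IH].
    have -> : (fun t => \sum_(i <- [::]) F i t) = fun=> 0 by apply/funext => t; rewrite big_nil.
    by move=> t; exact: cvg_cst.
  have -> : (fun t => \sum_(j <- i :: r) F j t) = fun t => F i t + \sum_(j <- r) F j t.
    by apply/funext => t; rewrite big_cons.
  by move=> t; apply: cvgD; [exact: cF|exact: IH].
pose f (t : R) := dot (c t) (c' t) / reg_norm e (c t).
have cN : continuous (fun t => reg_norm e (c t)).
  by move=> t; apply: derivable_continuous; have [] := dN t.
have cf : continuous f.
  have -> : f = fun t => (\sum_i c t 0 i * c' t 0 i) * (reg_norm e (c t))^-1.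
    by apply/funext => t; rewrite /f dotE.
  move=> t; apply: cvgM.
    by apply: (csum _ (fun i t => c t 0 i * c' t 0 i)) => i s; apply: cvgM; [exact: cci|exact: cci'].
  by apply: cvgV; [rewrite gt_eqF// sqrtr_gt0|exact: cN].
pose q (t : R) := Num.sqrt (inner g (c t) (c' t) (c' t)).
have cont_c : continuous c by move=> t; have /derivable1_diffP/differentiable_continuous := dc t.
have cq : continuous q.
  have -> : q = Num.sqrt \o (fun t => \sum_i \sum_j c' t 0 i * g (c t) i j * c' t 0 j).
    by apply/funext => t; rewrite /q /= innerE.
  move=> t; apply: continuous_comp; last exact: sqrt_continuous.
  apply: (csum _ (fun i t => \sum_j c' t 0 i * g (c t) i j * c' t 0 j)) => i.
  apply: (csum _ (fun j t => c' t 0 i * g (c t) i j * c' t 0 j)) => j s.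
  apply: cvgM; last exact: cci'.
  apply: cvgM; first exact: cci'.
  apply: (@continuous_comp _ _ _ c (fun x => g x i j)); first exact: cont_c.
  exact: smooth_continuous (metric_smooth mg i j) _.
have fq t : `|f t| <= q t.
  have np : 0 < reg_norm e (c t) by rewrite sqrtr_gt0.
  rewrite /f normrM normfV (gtr0_norm np) ler_pdivrMr//.
  rewrite -(@ler_pXn2r _ 2) ?nnegrE ?mulr_ge0 ?sqrtr_ge0// exprMn real_normK ?num_real//.
  rewrite !sqr_sqrtr ?(ltW (rp _)) ?inner_ge0//.
  apply: le_trans (inner_radial_le _ _) _; rewrite mulrC ler_wpM2l ?inner_ge0// enorm2.
  by rewrite lerDl sqr_ge0.
have mf : measurable_fun (`[0%R, 1%R]%classic : set (measurableTypeR R)) f.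
  by apply: measurable_funTS; exact: continuous_measurable_fun.
have mq : measurable_fun (`[0%R, 1%R]%classic : set (measurableTypeR R)) q.
  by apply: measurable_funTS; exact: continuous_measurable_fun.
have := integral_FTC ltr01 dN cf => E.
apply: (@le_trans _ _ (\int[lebesgue_measure]_(t in `[0%R, 1%R]) `|(f t)%:E|)%E).
  rewrite -abse_EFin -E; apply: le_abse_integral => //; exact/measurable_EFinP.
apply: ge0_le_integral => //.
- by apply: measurableT_comp => //; exact/measurable_EFinP.
- exact/measurable_EFinP.
- by move=> t _; rewrite lee_fin; exact: fq.
Qed.

Lemma dist_ge x y (e : R) : 0 < e -> (`|reg_norm e x - reg_norm e y|%:E <= dist g x y)%E.
Proof.
move=> e0; apply: le_ereal_inf_tmp => _ [s js <-].
elim: s x js => [|c s IH] x /=; first by move=> ->; rewrite big_nil subrr normr0.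
move=> [C1 <- js]; rewrite big_cons.
apply: le_trans (leeD (length_ge e0 C1) (IH _ js)).
rewrite -EFinD lee_fin (distrC (reg_norm e (c 1))); exact: ler_distD.
Qed.

Lemma reg_norm0 e : 0 < e -> reg_norm e 0 = e.
Proof.
move=> e0; rewrite /reg_norm -enorm2 enorm0 expr0n add0r sqrtr_sqr gtr0_norm//.
Qed.

Lemma reg_norm_ge e x : enorm x <= reg_norm e x.
Proof. by rewrite ler_wsqrtr// lerDl sqr_ge0. Qed.

(** With one end at the origin the sum of the norms is the absolute value of their difference. The
    regularization costs [e], its value at 0, and [e] is arbitrary. *)
Lemma enorm_le_dist x y : x = 0 \/ y = 0 -> ((enorm x + enorm y)%:E <= dist g x y)%E.
Proof.
move=> xy; apply/lee_addgt0Pr => e e0.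
rewrite -leeBlDr// -EFinB; apply: le_trans (dist_ge x y e0); rewrite lee_fin.
case: xy => ->; rewrite enorm0 ?add0r ?addr0 reg_norm0//.
  rewrite distrC; apply: le_trans (ler_norm _).
  by rewrite lerD2r reg_norm_ge.
apply: le_trans (ler_norm _); by rewrite lerD2r reg_norm_ge.
Qed.

Lemma dist_le_line (a b : R) x : `|b| <= 1 -> (dist g (a *: x) ((a + b) *: x) <= (enorm x)%:E)%E.
Proof.
move=> b1; pose c (t : R) : 'rV[R]_n := (a + b * t) *: x.
have dci i (t : R) : is_derive t 1 (fun s : R => c s 0 i) (b * x 0 i).
  have -> : (fun s : R => c s 0 i) = fun s => a * x 0 i + (b * x 0 i) * s.
    by apply/funext => s; rewrite /c mxE; ring.
  apply: is_derive_eq (is_deriveD (is_derive_cst (a * x 0 i) t (1 : R)) (is_deriveZ (b * x 0 i) (is_derive_id t (1 : R)))) _.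
  by rewrite /GRing.scale/= add0r mulr1.
have dc (t : R) : derivable c t 1.
  by apply/derivable_mxP => i j; rewrite (ord1 i); have [] := dci j t.
have c'E (t : R) : derive1 c t = b *: x.
  rewrite derive1E; apply/rowP => i; rewrite (derive_mx (dc t)) !mxE.
  by have [_ ->] := dci i t.
have C1 : C1_curve c.
  split=> [t|t]; first exact: dc.
  have -> : derive1 c = fun=> b *: x by apply/funext; exact: c'E.
  exact: cvg_cst.
apply: ge_ereal_inf; exists (length g c).
  exists [:: c]; last by rewrite big_cons big_nil adde0.
  by split => //; rewrite /c ?mulr0 ?addr0// mulr1.
rewrite /length.
have E (t : R) : Num.sqrt (inner g (c t) (derive1 c t) (derive1 c t)) = `|b| * enorm x.
  rewrite c'E innerZl (innerZr mg) /c inner_along mulrA -expr2 -exprMn sqrtr_sqr normrM.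
  by rewrite (ger0_norm (enorm_ge0 x)).
under eq_integral do rewrite E.
rewrite integral_cst//= lebesgue_measure_itv/= lte_fin ltr01 oppr0 adde0 mule1 lee_fin.
by rewrite ler_piMl// enorm_ge0.
Qed.

Lemma dist_x0 x : dist g x 0 = (enorm x)%:E.
Proof.
apply/eqP; rewrite eq_le; apply/andP; split.
  have := @dist_le_line 1 (-1) x; rewrite normrN normr1 => /(_ (lexx _)).
  by rewrite subrr scale0r scale1r.
by have := @enorm_le_dist x 0 (or_intror erefl); rewrite enorm0 addr0.
Qed.

Lemma dist_0x x : dist g 0 x = (enorm x)%:E.
Proof.
apply/eqP; rewrite eq_le; apply/andP; split.
  have := @dist_le_line 0 1 x; rewrite normr1 => /(_ (lexx _)).
  by rewrite add0r scale0r scale1r.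
by have := @enorm_le_dist 0 x (or_introl erefl); rewrite enorm0 add0r.
Qed.

Lemma geo_ballE r : geo_ball g 0 r = [set x | enorm x < r].
Proof. by apply/seteqP; split=> x; rewrite /geo_ball/= dist_0x lte_fin. Qed.

Definition base : 'rV[R]_n := delta_mx 0 (Ordinal n_gt0).

Lemma enorm_base : enorm base = 1.
Proof. by rewrite /enorm dot_delta mxE !eqxx sqrtr1. Qed.

(** The restriction of [f] to a line through the origin, defined for negative [r] as well and as
    smooth as [f]. *)
Definition profile (f : 'rV[R]_n -> R) (r : R) : R := f (r *: base).

Lemma radial_profile f x : radially_symmetric g f -> f x = profile f (enorm x).
Proof.
move=> rf; apply: rf; rewrite !dist_x0 enormZ enorm_base mulr1.
by rewrite ger0_norm ?enorm_ge0.
Qed.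

Lemma radial_valueE f r : radially_symmetric g f -> 0 <= r -> radial_value g f r = profile f r.
Proof.
move=> rf r0; have en_r : enorm (r *: base) = r by rewrite enormZ enorm_base mulr1 ger0_norm.
apply: xget_subset1.
  by exists (r *: base) => //; rewrite dist_x0 en_r.
by move=> a b [x xr <-] [y yr <-]; apply: rf; rewrite xr yr.
Qed.

End model.

(** * Polar coordinates and radial Laplacians *)

Lemma integral_indicM d (T : measurableType d) (R : realType) (mu : {measure set T -> \bar R})
    (D P : set T) (f : T -> R) :
  (\int[mu]_(x in D) (\1_P x * f x)%:E = \int[mu]_(x in D `&` P) (f x)%:E)%E.
Proof.
rewrite integral_mkcondr; apply: eq_integral => x _; rewrite /patch indicE.
by case: (x \in P); rewrite ?mul1r ?mul0r.
Qed.

Section real_primitives.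
Context (R : realType).
Implicit Types (f h F : R -> R).
Local Notation leb := (@lebesgue_measure R).

Lemma measurable_cont h (D : set (measurableTypeR R)) : continuous h -> measurable_fun D (h : measurableTypeR R -> R).
Proof. by move=> ch; apply: measurable_funTS; exact: continuous_measurable_fun. Qed.

Lemma integral_oo_cc h (a b : R) : continuous h ->
  (\int[leb]_(t in `]a, b[) (h t)%:E = \int[leb]_(t in `[a, b]) (h t)%:E)%E.
Proof.
move=> ch; rewrite integral_itv_bndo_bndc; last by apply/measurable_EFinP; exact: measurable_cont.
by rewrite integral_itv_obnd_cbnd//; apply/measurable_EFinP; exact: measurable_cont.
Qed.

Lemma is_derive_monomial (c t : R) k :
  is_derive t 1 (fun s => c * s ^+ k) (k%:R * c * t ^+ k.-1).
Proof.
have E j : (id : R -> R) ^+ j = (fun s : R => s ^+ j).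
  by elim: j => // j IH; rewrite exprS IH; apply/funext => r; rewrite exprS.
rewrite (_ : (fun s : R => c * s ^+ k) = c *: ((id : R -> R) ^+ k)); last by rewrite E.
apply: is_derive_eq (is_deriveZ c (is_deriveX k (is_derive_id t (1 : R)))) _.
by rewrite /GRing.scale/= mulr1 mulrCA mulrA.
Qed.

Lemma continuous_monomial (c : R) k : continuous (fun s : R => c * s ^+ k).
Proof. by move=> t; apply: derivable_continuous; have [] := is_derive_monomial c t k. Qed.

Definition prim h (r : R) : R := \int[leb]_(t in `[0, r]) h t.

Lemma prim_igr h (a b : R) : continuous h -> leb.-integrable `[a, b] (EFin \o h).
Proof.
by move=> ch; apply: continuous_compact_integrable; [exact: segment_compact|exact: continuous_subspaceT].
Qed.

Lemma is_derive_prim h (r : R) : continuous h -> 0 < r -> is_derive r 1 (prim h) (h r).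
Proof.
move=> ch r0; have [| | |d E] := @continuous_FTC1_closed R h 0 r (r + 1) _ (prim_igr _ _ ch).
- by rewrite ltrDl.
- exact: r0.
- exact: ch.
by rewrite derive1E in E; exact: DeriveDef d E.
Qed.

Lemma prim_integral h (r : R) : continuous h ->
  (\int[leb]_(t in `]0%R, r[) (h t)%:E = (prim h r)%:E)%E.
Proof.
move=> ch; rewrite integral_oo_cc// /prim /Rintegral fineK//.
by apply: integrable_fin_num => //; exact: prim_igr.
Qed.

Lemma prim0 h (r : R) : (forall t, t <= r -> h t = 0) -> prim h r = 0.
Proof.
move=> h0; rewrite /prim /Rintegral (eq_integral (fun=> 0%E)) ?integral0// => t.
by rewrite inE/= in_itv/= => /andP[_ tr]; rewrite h0.
Qed.

End real_primitives.

(** * Polar integration of radial functions *)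

Section polar.
Context (R : realType) (n : nat).
Hypothesis n_gt0 : (0 < n)%N.
Local Notation la := (@lebesgue_rV R n).
Local Notation leb := (@lebesgue_measure R).

Lemma measurable_enorm : measurable_fun setT (@enorm R n : _ -> measurableTypeR R).
Proof. exact: continuous_measurable_rV (@continuous_enorm R n). Qed.

Lemma open_eball (r : R) : open [set x : 'rV[R]_n | enorm x < r].
Proof.
rewrite (_ : [set x | _] = @enorm R n @^-1` [set s | s < r])//.
by apply: open_comp => [x _|]; [exact: continuous_enorm|exact: open_lt].
Qed.

Lemma measurable_eball (r : R) : measurable [set x : 'rV[R]_n | enorm x < r].
Proof. by apply: open_measurable_rV; apply: open_eball. Qed.

Definition eball_vol : R := fine (la [set x | enorm x < 1]).

Lemma eball_fin (r : R) : (la [set x : 'rV[R]_n | (enorm x < r)%R] < +oo)%E.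
Proof.
apply: le_lt_trans (lebesgue_rV_fin n r).
apply: le_measure; rewrite ?inE; [exact: measurable_eball|exact: measurable_norm_le|].
by move=> x /ltW; exact: le_trans (norm_le_enorm x).
Qed.

Lemma eball_volE : la [set x : 'rV[R]_n | enorm x < 1] = eball_vol%:E.
Proof. by rewrite /eball_vol fineK// ge0_fin_numE ?measure_ge0// eball_fin. Qed.

Lemma eball_lebesgue (r : R) : 0 < r -> la [set x | enorm x < r] = (eball_vol * r ^+ n)%:E.
Proof.
move=> r0.
have -> : [set x : 'rV[R]_n | enorm x < r] = (fun x => r^-1 *: x) @^-1` [set x | enorm x < 1].
  by apply/seteqP; split=> x; rewrite /= enormZ ger0_norm ?invr_ge0 ?(ltW r0)// mulrC ltr_pdivrMr// mul1r.
rewrite lebesgue_rV_scale ?invr_gt0//; last exact: measurable_eball.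
by rewrite invrK eball_volE -EFinM mulrC.
Qed.

Lemma eball_vol_gt0 : 0 < eball_vol.
Proof.
have n0 : 0 < n%:R :> R by rewrite ltr0n.
pose c : R := (2 * n%:R)^-1; have c0 : 0 < c by rewrite invr_gt0 mulr_gt0.
have sub : box (const_mx (- c)) (const_mx c) `<=` [set x : 'rV[R]_n | enorm x < 1].
  move=> x bx; apply: le_lt_trans (enorm_le_norm x) _.
  have xc : `|x| <= c.
    apply: norm_le_coord (ltW c0) _ => i; have := bx i; rewrite !mxE => /andP[/ltW ? ?].
    by rewrite ler_norml; apply/andP.
  apply: (@le_lt_trans _ _ (n%:R * c)); first by rewrite ler_wpM2l.
  by rewrite /c invfM mulrCA mulfV ?gt_eqF// mulr1 invf_lt1// ltr1n.
rewrite -lte_fin -eball_volE; apply: (@lt_le_trans _ _ (la (box (const_mx (- c)) (const_mx c)))).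
  rewrite lebesgue_rV_box lte_fin prodr_gt0// => i _; rewrite !mxE opprK lt_max.
  by rewrite addr_gt0// orbT.
by apply: le_measure; rewrite ?inE; [exact: measurable_box|exact: measurable_eball|exact: sub].
Qed.

Definition radial_jac (t : R) : R := n%:R * eball_vol * t ^+ n.-1.

Lemma radial_jac_FTC (r : R) : 0 < r ->
  (\int[leb]_(t in `]0%R, r[) (radial_jac t)%:E = (eball_vol * r ^+ n)%:E)%E.
Proof.
move=> r0; rewrite integral_oo_cc; last exact: continuous_monomial.
rewrite (integral_FTC r0 (fun t => is_derive_monomial eball_vol t n)); last exact: continuous_monomial.
by rewrite expr0n gtn_eqF// mulr0 subr0.
Qed.

Definition radial_density (t : measurableTypeR R) : R := \1_(`]0, +oo[%classic) t * radial_jac t.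

Lemma measurable_radial_density : measurable_fun setT radial_density.
Proof.
apply: measurable_funM; first by apply: measurable_indic.
by apply: measurable_cont; exact: continuous_monomial.
Qed.

Lemma radial_density_ge0 t : 0 <= radial_density t.
Proof.
rewrite /radial_density indicE; have [|_] := boolP (t \in _); last by rewrite mul0r.
rewrite inE/= in_itv/= andbT mul1r => /ltW t0.
by rewrite !mulr_ge0 ?exprn_ge0// ltW// eball_vol_gt0.
Qed.

(** Polar coordinates for radial functions, without a product decomposition: both sides are measures
    on the line, and they agree on left half-lines because the volume of a ball scales like the
    [n]-th power of its radius. *)
Lemma enorm_lebesgue (A : set (measurableTypeR R)) : measurable A ->
  la (@enorm R n @^-1` A) = dens leb radial_density A.
Proof.
pose m1 : {measure set (measurableTypeR R) -> \bar R} :=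
  measure_function_pushforward__canonical__measure_function_Measure
    [the {measure set _ -> \bar R} of la] measurable_enorm.
pose m2 := dens_measure leb measurable_radial_density radial_density_ge0.
have m1E (x : R) : m1 `]-oo, x[%classic = la [set y | enorm y < x].
  by rewrite /m1/= /pushforward; congr (la _); apply/seteqP; split=> y /=; rewrite in_itv/=.
have m2E (x : R) : m2 `]-oo, x[%classic = (\int[leb]_(t in `]0%R, x[) (radial_jac t)%:E)%E.
  rewrite /m2/= /dens integral_indicM; congr integral; apply/seteqP; split=> y /=.
    by rewrite !in_itv/= andbT => -[-> ->].
  by rewrite !in_itv/= andbT => /andP[-> ->].
move=> mA; apply: (@measure_unique _ R (measurableTypeR R) (RGenInftyO.G (R:=R))
  (fun k => `]-oo, k%:R[%classic) _ _ _ _ m1 m2) => //.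
- exact: RGenInftyO.measurableE.
- move=> _ _ [x ->] [y ->]; exists (Num.min x y); apply/seteqP; split=> z /=.
    by rewrite !in_itv/= lt_min => -[-> ->].
  by rewrite !in_itv/= lt_min => /andP[-> ->].
- by move=> i; exists i%:R.
- apply/seteqP; split=> // x _; exists (Num.truncn `|x|).+1 => //=.
  by rewrite in_itv/=; apply: le_lt_trans (ler_norm x) _; exact: truncnS_gt.
- move=> _ [x ->]; rewrite m1E m2E; have [x0|x0] := ltP 0 x.
    by rewrite eball_lebesgue// radial_jac_FTC.
  rewrite set_itv_ge ?integral_set0; last by rewrite bnd_simp -leNgt.
  rewrite (_ : [set y | _] = set0) ?measure0//; apply/seteqP; split=> // y /=.
  by rewrite ltNge (le_trans x0 (enorm_ge0 y)).
- by move=> k; rewrite m1E eball_fin.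
Qed.

Lemma polar_integral (F : R -> R) (r : R) : measurable_fun setT (F : measurableTypeR R -> R) ->
  (forall t, 0 <= F t) ->
  (\int[la]_(x in [set x | (enorm x < r)%R]) (F (enorm x))%:E =
   \int[leb]_(t in `]0%R, r[) (radial_jac t * F t)%:E)%E.
Proof.
move=> mF F0.
pose m1 : {measure set (measurableTypeR R) -> \bar R} :=
  measure_function_pushforward__canonical__measure_function_Measure
    [the {measure set _ -> \bar R} of la] measurable_enorm.
pose m2 := dens_measure leb measurable_radial_density radial_density_ge0.
pose G (t : measurableTypeR R) : R := \1_(`]-oo, r[%classic) t * F t.
have mG : measurable_fun setT G by apply: measurable_funM => //; apply: measurable_indic.
have G0 t : 0 <= G t by rewrite mulr_ge0// indicE.
transitivity (\int[m1]_t (G t)%:E)%E.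
  have -> : (\int[m1]_t (G t)%:E = \int[la]_x (G (enorm x))%:E)%E.
    have := @ge0_integral_pushforward _ _ _ _ R _ measurable_enorm la setT (EFin \o G) measurableT.
    rewrite preimage_setT; apply; first exact/measurable_EFinP.
    by move=> t _; rewrite lee_fin.
  rewrite -[in LHS](setTI [set x | _]) -integral_indicM; apply: eq_integral => x _.
  rewrite /G !indicE.
  have -> // : (enorm x \in `]-oo, r[%classic) = (x \in [set x : 'rV[R]_n | enorm x < r]).
  by apply/idP/idP; rewrite !inE/= ?in_itv.
transitivity (\int[m2]_t (G t)%:E)%E.
  by apply: eq_measure_integral => A mA _; rewrite /m1/= /pushforward enorm_lebesgue.
rewrite ge0_integral_dens// -[in RHS](setTI [set` `]0, r[]) -integral_indicM; apply: eq_integral => t _.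
rewrite /G /radial_density !indicE.
have -> : (t \in `]0%R, r[%classic) = (t \in `]-oo, r[%classic) && (t \in `]0%R, +oo[%classic).
  apply/idP/andP; rewrite !inE/= !in_itv/= andbT; first by move=> /andP[].
  by move=> [-> ->].
by congr EFin; case: (t \in `]-oo, r[%classic); case: (t \in `]0, +oo[%classic); rewrite /= ?mulr1n ?mulr0n; ring.
Qed.

Lemma sphere_areaE : sphere_area R n = n%:R * eball_vol.
Proof.
rewrite /sphere_area /sphere_measure; congr (_ * _).
have -> : [set x | exists (t : R) (theta : 'rV[R]_n), [/\ 0 < t <= 1, sphere theta & x = t *: theta]] =
    @enorm R n @^-1` `]0, 1]%classic.
  apply/seteqP; split=> x /=; rewrite in_itv/=.
    by move=> [t [th [t01 th1 ->]]]; rewrite enormZ th1 mulr1 gtr0_norm//; case/andP: t01.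
  move=> /andP[x0 x1]; exists (enorm x), ((enorm x)^-1 *: x); split.
  - by rewrite x0.
  - by rewrite /sphere/= enormZ gtr0_norm ?invr_gt0// mulVf// gt_eqF.
  - by rewrite scalerA mulfV ?scale1r// gt_eqF.
rewrite enorm_lebesgue// /dens integral_indicM.
have -> : `]0, 1]%classic `&` `]0, +oo[%classic = `]0, 1]%classic :> set R.
  by apply/seteqP; split=> y /=; rewrite !in_itv/= ?andbT; [by case|by move=> h; split=> //; case/andP: h].
rewrite -integral_itv_bndo_bndc ?radial_jac_FTC// ?expr1n ?mulr1//.
by apply/measurable_EFinP; apply: measurable_cont; exact: continuous_monomial.
Qed.

End polar.

(** * Radial functions and their Laplacians *)

Section radial_functions.
Context (R : realType) (n : nat) (sigma : R -> R) (g : 'rV[R]_n -> 'M[R]_n).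
Hypotheses (n_gt0 : (0 < n)%N) (model_g : model_manifold sigma g).
Implicit Types (x y u v : 'rV[R]_n) (f : 'rV[R]_n -> R).
Local Notation leb := (@lebesgue_measure R).
Local Notation s := (sphere_vol n sigma).
Local Notation profile := (profile n_gt0).
Local Notation base := (base R n_gt0).
Let mg : riemannian_metric g := model_metric model_g.
Let dp := det_pos n_gt0 model_g.
Let sigma_gt0 (r : R) : 0 < r -> 0 < sigma r := @scaling_pos _ _ _ _ model_g r.

Lemma sphere_volE (r : R) : s r = n%:R * eball_vol R n * sigma r ^+ n.-1.
Proof. by rewrite /sphere_vol sphere_areaE. Qed.

Lemma area_gt0 : 0 < n%:R * eball_vol R n.
Proof. by rewrite mulr_gt0 ?ltr0n// eball_vol_gt0. Qed.

Lemma sphere_vol_gt0 (r : R) : 0 < r -> 0 < s r.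
Proof. by move=> r0; rewrite sphere_volE mulr_gt0 ?area_gt0// exprn_gt0// sigma_gt0. Qed.

Lemma enorm_scale_base (t : R) : 0 <= t -> enorm (t *: base) = t.
Proof. by move=> t0; rewrite enormZ enorm_base mulr1 ger0_norm. Qed.

Lemma density_radial x : vol_density g x = profile (vol_density g) (enorm x).
Proof.
rewrite /profile; have [->|x0] := eqVneq x 0; first by rewrite enorm0 scale0r.
have y0 : enorm x *: base != 0 by rewrite -enorm_eq0 enorm_scale_base ?enorm_ge0// enorm_eq0.
by rewrite !(density_model n_gt0 model_g)// enorm_scale_base ?enorm_ge0.
Qed.

Lemma profile_derive f (r : R) : smooth f ->
  is_derive r 1 (profile f) (profile (partial (Ordinal n_gt0) f) r).
Proof.
move=> sf; have := @derive_line R n f 0 base r.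
rewrite !add0r (_ : (fun t : R => f (0 + t *: base)) = profile f); last first.
  by apply/funext => t; rewrite add0r.
by apply; exact: smooth_derivable.
Qed.

Lemma smooth1_profile f (D : set R) : open D -> smooth f -> smooth1 D (profile f).
Proof.
move=> oD sf; apply: (@gsmooth_coind _ _ _ _ (fun h => exists2 f, smooth f & h = profile f) D oD); last by exists f.
  move=> _ [k sk ->] x _; have [d _] := profile_derive x sk.
  by split; [exact: derivable_continuous|].
move=> _ i [k sk ->]; exists (profile (partial (Ordinal n_gt0) k)).
  by exists (partial (Ordinal n_gt0) k) => //; exact: smooth_partial.
by move=> x _; have [_ E] := profile_derive x sk.
Qed.

Lemma smooth1_sigma : smooth1 [set r : R | 0 < r] sigma.
Proof.
have ss := scaling_smooth model_g.
have E (l : seq unit) : foldr (gpartial (fun _ : unit => 1 : R)) sigma l = derive1n (size l) sigma.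
  elim: l => [//|a l IH]; apply/funext => r; by rewrite derive1nS derive1E /= IH.
move=> l r r0; rewrite E; have d := ss (size l) r r0; split; last by [].
exact: derivable_continuous.
Qed.

Lemma smooth1_sphere_vol : smooth1 [set r : R | 0 < r] s.
Proof.
have -> : s = fun r => n%:R * eball_vol R n * sigma r ^+ n.-1.
  by apply/funext => r; rewrite sphere_volE.
apply: gsmoothM; first exact: open_gt.
  by apply: gsmooth_cst; exact: open_gt.
by apply: gsmoothX; [exact: open_gt|exact: smooth1_sigma].
Qed.

Lemma continuous_profile f : continuous f -> continuous (profile f).
Proof.
by move=> cf r; apply: (@continuous_comp _ _ _ (fun t : R => t *: base) f); [exact: scalel_continuous|exact: cf].
Qed.

(* [shell f r] is [s r * profile f r] for [r > 0], extended continuously to [r <= 0]. *)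
Definition shell f (r : R) : R := radial_jac n r * (profile f r * profile (vol_density g) r).

Lemma shellE f (r : R) : 0 < r -> shell f r = s r * profile f r.
Proof.
move=> r0; have y0 : r *: base != 0 by rewrite -enorm_eq0 enorm_scale_base ?(ltW r0)// gt_eqF.
rewrite /shell {2}/profile (density_model n_gt0 model_g)// enorm_scale_base ?(ltW r0)//.
rewrite sphere_volE /radial_jac expr_div_n; have : r ^+ n.-1 != 0 by rewrite expf_neq0// gt_eqF.
by move=> h; field.
Qed.

Lemma continuous_shell f : continuous f -> continuous (shell f).
Proof.
move=> cf r; apply: (@continuousM _ R^o); first exact: continuous_monomial.
apply: (@continuousM _ R^o); first exact: continuous_profile.
exact: continuous_profile (smooth_continuous (smooth_density mg dp)) r.
Qed.

Lemma ball_integralE f (r : R) : continuous f -> (forall x, 0 <= f x) -> radially_symmetric g f ->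
  ball_integral g f r = (prim (shell f) r)%:E.
Proof.
move=> cf f0 rf; rewrite -prim_integral; last exact: continuous_shell.
rewrite -polar_integral//; last 2 first.
- apply: measurable_cont => t; apply: (@continuousM _ R^o); first exact: continuous_profile.
  exact: continuous_profile (smooth_continuous (smooth_density mg dp)) t.
- by move=> t; rewrite mulr_ge0 ?f0// ltW// density_gt0.
rewrite /ball_integral (geo_ballE model_g).
transitivity (\int[volm mg dp]_x (\1_[set x | enorm x < r] x * f x)%:E)%E.
  by rewrite integral_indicM setTI.
rewrite ge0_integral_dens; last 2 first.
- apply: measurable_funM; last exact: continuous_measurable_rV.
  by apply: measurable_indic; exact: measurable_eball.
- by move=> x; rewrite mulr_ge0// indicE.
rewrite -[in RHS](setTI [set x | _]) -integral_indicM; apply: eq_integral => x _.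
by rewrite -mulrA -(radial_profile n_gt0 model_g)// -density_radial.
Qed.

Lemma inner_radial x v : x != 0 -> inner g x x v = dot x v.
Proof.
move=> x0; rewrite (model_inner model_g)// -enorm2.
have r0 : enorm x != 0 by rewrite enorm_eq0.
by field.
Qed.

Section laplacian.
Variables (U W W' : R -> R) (delta : R).
Hypotheses (delta0 : 0 < delta) (sU : smooth1 [set r : R | 0 < r] U)
  (dU : forall r : R, 0 < r -> is_derive r 1 U (W r / s r))
  (dW : forall r : R, 0 < r -> is_derive r 1 W (W' r))
  (U0 : forall r : R, 0 <= r -> r < delta -> U r = U 0).
Let u x := U (enorm x).

(** The norm is smooth only away from the origin; near it [U] is constant. *)
Lemma smooth_radial : smooth u.
Proof.
apply/smoothP; apply: gsmooth_local => x _; have [x1|x1] := ltP (enorm x) delta.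
  exists [set y : 'rV[R]_n | enorm y < delta] => //.
  apply: (@gsmooth_eq _ _ _ _ _ (fun=> U 0)); first exact: open_eball.
    by move=> y y1; rewrite /u [RHS]U0// enorm_ge0.
  by apply: gsmooth_cst; exact: open_eball.
exists (@rV_neq0 R n).
  by rewrite /rV_neq0/= -enorm_eq0 gt_eqF// (lt_le_trans delta0 x1).
apply: (@gsmooth_comp _ _ _ _ _ [set r : R | 0 < r] U) => //.
- exact: open_neq0.
- by move=> y; exact: enorm_gt0.
- exact: smooth_on_enorm.
Qed.

Let partial_u x (i : 'I_n) : x != 0 ->
  partial i u x = W (enorm x) / s (enorm x) * (x 0 i / enorm x).
Proof.
move=> x0; have [_ E] := is_derive_radial (delta_mx 0 i) x0 (dU (enorm_gt0 x0)).
by rewrite /partial E dot_delta.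
Qed.

(** The difference [v] of the two sides is shown to have inner product 0 with itself, which avoids
    inverting the metric. *)
Lemma grd_radial x : x != 0 -> grd g u x = (W (enorm x) / (s (enorm x) * enorm x)) *: x.
Proof.
move=> x0; apply/eqP; rewrite -subr_eq0; apply: contraT => nz; have := metric_pos mg x nz.
set v := (_ - _); have -> : inner g x v v = 0; last by rewrite ltxx.
rewrite {1}/v innerBl (inner_grd dp) innerZl inner_radial// dotE mulr_sumr -sumrB big1// => i _.
rewrite partial_u//; have r0 : enorm x != 0 by rewrite enorm_eq0.
have s0 : s (enorm x) != 0 by rewrite gt_eqF// sphere_vol_gt0// enorm_gt0.
by field; rewrite r0 s0.
Qed.

(** [vol_density g] times the gradient of [u] is [G (enorm x) *: x]: the powers of [sigma] in the
    density and in [s] cancel. *)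
Let G (r : R) := W r * (n%:R * eball_vol R n * r ^+ n)^-1.

Let dG (r : R) : 0 < r -> is_derive r 1 G
  (W' r / (n%:R * eball_vol R n * r ^+ n) - n%:R * W r / (n%:R * eball_vol R n * r ^+ n * r)).
Proof.
move=> r0; have A0 := area_gt0.
have nz : n%:R * eball_vol R n * r ^+ n != 0 by rewrite mulf_neq0 ?gt_eqF// exprn_gt0.
have h := is_deriveM (dW r0) (@is_deriveV R (fun t => n%:R * eball_vol R n * t ^+ n) r _ 1 nz (is_derive_monomial (n%:R * eball_vol R n) r n)).
apply: is_derive_eq h _; rewrite /GRing.scale/=.
have rE : r ^+ n = r * r ^+ n.-1 by rewrite -exprS prednK.
rewrite rE; have q0 : r ^+ n.-1 != 0 by rewrite expf_neq0 ?gt_eqF.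
move: (r ^+ n.-1) q0 => q q0; move: A0; rewrite pmulr_rgt0 ?ltr0n// => e0.
have n0 : n%:R != 0 :> R by rewrite pnatr_eq0 -lt0n.
by field; rewrite n0 q0 (gt_eqF e0) (gt_eqF r0).
Qed.

(** The formula [(s U')' / s] with [s U' = W]. The Euclidean divergence of [G (enorm x) *: x] is
    [r G' + n G], in which the derivative of the power of [r] cancels. *)
Lemma laplace_radial x : x != 0 ->
  divergence g (grd g u) x = W' (enorm x) / s (enorm x).
Proof.
move=> x0; have r0 := enorm_gt0 x0; set r := enorm x in r0 *.
pose dGr := W' r / (n%:R * eball_vol R n * r ^+ n) - n%:R * W r / (n%:R * eball_vol R n * r ^+ n * r).
have dpart i : partial i (fun y => vol_density g y * grd g u y 0 i) x = dGr * (x 0 i / r) * x 0 i + G r.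
  transitivity ('D_(delta_mx 0 i) (fun y : 'rV[R]_n => G (enorm y) * y 0 i) x).
    apply: near_eq_derive; apply: (near_open (@open_neq0 R n)) => // y y0.
    have ry := enorm_gt0 y0; have sy := sigma_gt0 ry.
    rewrite (density_model n_gt0 model_g)// grd_radial// mxE /G sphere_volE expr_div_n.
    have -> : enorm y ^+ n = enorm y * enorm y ^+ n.-1 by rewrite -exprS prednK.
    have q0 : enorm y ^+ n.-1 != 0 by rewrite expf_neq0 ?gt_eqF.
    have z0 : sigma (enorm y) ^+ n.-1 != 0 by rewrite expf_neq0 ?gt_eqF.
    have := area_gt0; rewrite pmulr_rgt0 ?ltr0n// => e0.
    have n0 : n%:R != 0 :> R by rewrite pnatr_eq0 -lt0n.
    move: (enorm y ^+ n.-1) (sigma (enorm y) ^+ n.-1) q0 z0 => a b a0 b0.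
    by field; rewrite n0 a0 b0 (gt_eqF e0) (gt_eqF ry).
  have h := is_deriveM (is_derive_radial (delta_mx 0 i) x0 (dG r0)) (is_derive_coord i x (delta_mx 0 i)).
  have [_ ->] := h; rewrite /GRing.scale/= mxE !eqxx mulr1 dot_delta -/r -/dGr addrC.
  by congr (_ + _); rewrite mulrC.
rewrite /divergence; under eq_bigr do rewrite dpart.
rewrite big_split/= sumr_const card_ord.
have -> : \sum_(i < n) dGr * (x 0 i / r) * x 0 i = dGr / r * r ^+ 2.
  by rewrite enorm2 dotE mulr_sumr; apply: eq_bigr => i _; ring.
rewrite (density_model n_gt0 model_g)// -/r -[G r *+ n]mulr_natl /G /dGr sphere_volE expr_div_n.
have -> : r ^+ n = r * r ^+ n.-1 by rewrite -exprS prednK.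
have q0 : r ^+ n.-1 != 0 by rewrite expf_neq0 ?gt_eqF.
have z0 : sigma r ^+ n.-1 != 0 by rewrite expf_neq0 ?gt_eqF// sigma_gt0.
have := area_gt0; rewrite pmulr_rgt0 ?ltr0n// => e0.
have n0 : n%:R != 0 :> R by rewrite pnatr_eq0 -lt0n.
move: (r ^+ n.-1) (sigma r ^+ n.-1) q0 z0 => a b a0 b0.
by field; rewrite n0 a0 b0 (gt_eqF e0) (gt_eqF r0).
Qed.

Lemma laplace_radial0 x : enorm x < delta -> divergence g (grd g u) x = 0.
Proof.
have pu y i : enorm y < delta -> partial i u y = 0.
  move=> y1; rewrite /partial; transitivity ('D_(delta_mx 0 i) (fun=> U 0) y); last by rewrite derive_cst.
  apply: near_eq_derive; apply: (near_open (@open_eball R n delta)) => // z z1.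
  by rewrite /u [LHS]U0// enorm_ge0.
move=> x1; rewrite /divergence big1 ?mulr0// => i _.
rewrite /partial; transitivity ('D_(delta_mx 0 i) (fun=> 0 : R) x); last by rewrite derive_cst.
apply: near_eq_derive; apply: (near_open (@open_eball R n delta)) => // z z1.
by rewrite grdE big1 ?mulr0// => j _; rewrite pu// mul0r.
Qed.

End laplacian.
End radial_functions.

(** * The radial potential *)

Section cutoff_step.
Context (R : realType).
Implicit Types (t r c : R).

Definition dstep t : R := 'D_1 (@step R) t.

Lemma is_derive_step t : is_derive t 1 (@step R) (dstep t).
Proof. by have := smooth1_derive (@smooth1_step R setT) (I : [set: R] t); rewrite derive1E. Qed.

Lemma continuous_dstep : continuous dstep.
Proof. move=> t; exact (gsmooth_cts (gsmooth_partial tt (@smooth1_step R setT)) (I : [set: R] t)). Qed.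

Lemma dstep0 t : t < 0 \/ 1 < t -> dstep t = 0.
Proof.
move=> h; rewrite /dstep; transitivity ('D_1 (fun=> step t) t); last by rewrite derive_cst.
apply: near_eq_derive; case: h => h.
  by apply: (near_open (@open_lt R 0)) => // y y0; rewrite !step0 ?(ltW h) ?(ltW y0).
by apply: (near_open (@open_gt R 1)) => // y y0; rewrite !step1 ?(ltW h) ?(ltW y0).
Qed.

Variable c : R.
Hypothesis c0 : 0 < c.

(** Zero up to [c^-1] and one from [2 / c] on; the theorem takes [2 / c] as the lower limit [a] of
    integration. *)
Definition cut r := step (c * r - 1).

Lemma cut_ge0 r : 0 <= cut r. Proof. exact: step_ge0. Qed.

Lemma cut_le1 r : cut r <= 1. Proof. exact: step_le1. Qed.

Lemma cut0 r : r <= c^-1 -> cut r = 0.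
Proof. by move=> rc; rewrite /cut step0// subr_le0 -ler_pdivlMl// mulr1. Qed.

Lemma cut1 r : 2 / c <= r -> cut r = 1.
Proof. by rewrite ler_pdivrMr// => rc; rewrite /cut step1// lerBrDr [c * r]mulrC. Qed.

Lemma is_derive_cut r : is_derive r 1 cut (dstep (c * r - 1) * c).
Proof.
apply: (@is_derive_comp_dir R R (@step R) (fun r => c * r - 1)); first exact: is_derive_step.
apply: is_derive_eq (is_deriveD (is_deriveZ c (is_derive_id r (1 : R))) (is_derive_cst (- 1 : R) r (1 : R))) _.
by rewrite /GRing.scale/= mulr1 addr0.
Qed.

Lemma smooth1_cut (D : set R) : open D -> smooth1 D cut.
Proof.
move=> oD; apply: (@gsmooth_comp _ _ _ _ _ setT (@step R)) => //; first exact: smooth1_step.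
apply: gsmoothB => //; last exact: gsmooth_cst.
by apply: gsmoothM => //; [exact: gsmooth_cst|exact: smooth1_id].
Qed.

End cutoff_step.

Lemma prim_ge0 (R : realType) (h : R -> R) (r : R) : (forall t, 0 <= t -> 0 <= h t) -> 0 <= prim h r.
Proof. by move=> h0; apply: Rintegral_ge0 => t /=; rewrite in_itv/= => /andP[t0 _]; exact: h0. Qed.

Lemma mvt_pos (R : realType) (F dF : R -> R) (a b : R) : 0 < a -> a < b ->
  (forall r : R, 0 < r -> is_derive r 1 F (dF r)) ->
  exists2 t, a < t & F b - F a = dF t * (b - a).
Proof.
move=> a0 ab d; have [||t] := @MVT R F dF a b ab.
- by move=> x; rewrite in_itv/= => /andP[ax _]; exact: d (lt_trans a0 ax).
- apply: continuous_in_subspaceT => x; rewrite inE/= in_itv/= => /andP[ax _].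
  by apply: derivable_continuous; have [] := d x (lt_le_trans a0 ax).
by rewrite in_itv/= => /andP[at_ _] E; exists t.
Qed.

(** * The potential, its growth and its Laplacian *)

Section radial_rate.
Context (R : realType) (n : nat) (sigma : R -> R) (g : 'rV[R]_n -> 'M[R]_n).
Hypotheses (n_gt0 : (0 < n)%N) (model_g : model_manifold sigma g).
Local Notation s := (sphere_vol n sigma).
Local Notation profile := (profile n_gt0).
Local Notation shell := (shell g n_gt0).
Implicit Types (f h : 'rV[R]_n -> R).
Let mg : riemannian_metric g := model_metric model_g.
Let dp := det_pos n_gt0 model_g.
Variable c : R.
Hypothesis c0 : 0 < c.
Let ci0 : 0 < c^-1. Proof. by rewrite invr_gt0. Qed.
Let s_gt0 (r : R) : 0 < r -> 0 < s r := @sphere_vol_gt0 R n sigma g n_gt0 model_g r.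

(** The integrand of (ii) beyond [2 / c], switched off near the origin, where [1 / s] may be
    singular. It is linear in [f], whence the additivity in (ii). *)
Definition rate (f : 'rV[R]_n -> R) (r : R) : R := cut c r * (prim (shell f) r / s r).

Lemma rate0 f (r : R) : r <= c^-1 -> rate f r = 0.
Proof. by move=> rc; rewrite /rate cut0// mul0r. Qed.

Lemma rate1 f (r : R) : 2 / c <= r -> rate f r = prim (shell f) r / s r.
Proof. by move=> rc; rewrite /rate cut1// mul1r. Qed.

Lemma continuous_rate f : continuous f -> continuous (rate f).
Proof.
move=> cf r; have [rc|rc] := ltP r c^-1.
  apply: derivable_continuous.
  have [] // := @near_eq_is_derive _ R R (fun=> 0) (rate f) r 1 0 _ (is_derive_cst _ _ _).
  by apply: (near_open (@open_lt R c^-1)) => // y y0; rewrite rate0 ?(ltW y0).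
have r0 := lt_le_trans ci0 rc.
apply: (@continuousM _ R^o).
  by apply: derivable_continuous; have [] := is_derive_cut c r.
apply: (@continuousM _ R^o).
  by apply: derivable_continuous; have [] := is_derive_prim (@continuous_shell R n sigma g n_gt0 model_g _ cf) r0.
apply: continuousV; first by rewrite gt_eqF// s_gt0.
exact (gsmooth_cts (smooth1_sphere_vol n_gt0 model_g) r0).
Qed.

Lemma shell_ge0 f (r : R) : (forall x, 0 <= f x) -> 0 <= r -> 0 <= shell f r.
Proof.
move=> f0 r0; rewrite /shell /radial_jac !mulr_ge0 ?exprn_ge0 ?f0//.
  by rewrite ltW// eball_vol_gt0.
by rewrite ltW// (density_gt0 dp).
Qed.

Lemma rate_ge0 f (r : R) : (forall x, 0 <= f x) -> 0 <= rate f r.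
Proof.
move=> f0; have [rc|rc] := ltP r c^-1; first by rewrite rate0 ?(ltW rc).
have r0 := lt_le_trans ci0 rc.
rewrite mulr_ge0 ?cut_ge0// divr_ge0 ?(ltW (s_gt0 r0))//.
by apply: prim_ge0 => t t0; exact: shell_ge0.
Qed.

Lemma shellD f h (r : R) : shell (f \+ h) r = shell f r + shell h r.
Proof. by rewrite /shell /profile /=; ring. Qed.

Lemma rateD f h (r : R) : continuous f -> continuous h -> rate (f \+ h) r = rate f r + rate h r.
Proof.
move=> cf ch; rewrite /rate -mulrDr -mulrDl; congr (_ * (_ / _)).
rewrite /prim -RintegralD//; [|by apply: prim_igr; exact: (@continuous_shell R n sigma g n_gt0 model_g)..].
by congr Rintegral; apply/funext => t; exact: shellD.
Qed.

Lemma integral_rate f : continuous f -> (forall x, 0 <= f x) -> radially_symmetric g f ->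
  (\int[lebesgue_measure]_(r in `[(2 / c)%R, +oo[) (ball_integral g f r * ((s r)^-1)%:E) =
   \int[lebesgue_measure]_(r in `[(2 / c)%R, +oo[) (rate f r)%:E)%E.
Proof.
move=> cf f0 rf; apply: eq_integral => r; rewrite inE/= in_itv/= andbT => ar.
by rewrite (@ball_integralE R n sigma g n_gt0 model_g)// -EFinM rate1.
Qed.

Lemma integral_rate_radial f : continuous f -> radially_symmetric g f ->
  (\int[lebesgue_measure]_(r in `[(2 / c)%R, +oo[)
    ((\int[lebesgue_measure]_(xi in `]0%R, r[) (s xi * radial_value g f xi)%:E) * ((s r)^-1)%:E) =
   \int[lebesgue_measure]_(r in `[(2 / c)%R, +oo[) (rate f r)%:E)%E.
Proof.
move=> cf rf; apply: eq_integral => r; rewrite inE/= in_itv/= andbT => ar.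
rewrite rate1// EFinM -prim_integral; last exact: (@continuous_shell R n sigma g n_gt0 model_g).
congr (_ * _)%E; apply: eq_integral => t; rewrite inE/= in_itv/= => /andP[t0 _].
by rewrite (@radial_valueE R n sigma g n_gt0 model_g)// ?(ltW t0)// (@shellE R n sigma g n_gt0 model_g).
Qed.

Lemma integral_rateD f h : continuous f -> continuous h -> (forall x, 0 <= f x) -> (forall x, 0 <= h x) ->
  (\int[lebesgue_measure]_(r in `[(2 / c)%R, +oo[) (rate (f \+ h) r)%:E =
   \int[lebesgue_measure]_(r in `[(2 / c)%R, +oo[) (rate f r)%:E +
   \int[lebesgue_measure]_(r in `[(2 / c)%R, +oo[) (rate h r)%:E)%E.
Proof.
move=> cf ch f0 h0; rewrite -ge0_integralD//.
- by apply: eq_integral => r _; rewrite rateD.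
- by move=> r _; rewrite lee_fin rate_ge0.
- by apply/measurable_EFinP; apply: measurable_cont; exact: continuous_rate.
- by move=> r _; rewrite lee_fin rate_ge0.
- by apply/measurable_EFinP; apply: measurable_cont; exact: continuous_rate.
Qed.

Section potential.
Variable w : 'rV[R]_n -> R.
Hypotheses (sw : smooth w) (w_gt0 : forall x, 0 < w x) (rw : radially_symmetric g w).
Let cw := smooth_continuous sw.
Let w_ge0 x : 0 <= w x. Proof. exact: ltW. Qed.
Let v := prim (shell w).
Let m := rate w.
Let pos := [set r : R | 0 < r].
Let opos : open pos. Proof. exact: open_gt. Qed.

(** The potential [B] as a function of the radius. *)
Definition rate_prim : R -> R := prim m.
Local Notation B := rate_prim.

Let dv (r : R) : 0 < r -> is_derive r 1 v (shell w r).
Proof. by move=> r0; apply: is_derive_prim => //; exact: (@continuous_shell R n sigma g n_gt0 model_g). Qed.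

Lemma rate_prim0 (r : R) : r <= c^-1 -> B r = 0.
Proof. by move=> rc; apply: prim0 => t tr; rewrite /m rate0// (le_trans tr). Qed.

Lemma is_derive_rate_prim (r : R) : is_derive r 1 B (m r).
Proof.
have [rc|rc] := ltP r c^-1; last first.
  by apply: is_derive_prim; [exact: continuous_rate|exact: lt_le_trans rc].
rewrite /m rate0 ?(ltW rc)//.
apply: (@near_eq_is_derive _ R R (fun=> 0) B r 1 0) (is_derive_cst _ _ _).
by apply: (near_open (@open_lt R c^-1)) => // y y0; rewrite rate_prim0 ?(ltW y0).
Qed.

Lemma rate_prim_nd (a b : R) : a <= b -> B a <= B b.
Proof.
move=> ab; have [t _ E] := mean_value a b is_derive_rate_prim.
by rewrite -subr_ge0 E mulr_ge0 ?rate_ge0// subr_ge0.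
Qed.

Lemma rate_prim_ge0 (r : R) : 0 <= B r.
Proof.
have [rc|rc] := leP r c^-1; first by rewrite rate_prim0.
by rewrite -(rate_prim0 (lexx c^-1)); apply/rate_prim_nd/ltW.
Qed.

Let v_gt0 (r : R) : 0 < r -> 0 < v r.
Proof.
move=> r0; have r2 : r / 2 < r by rewrite ltr_pdivrMr// ltr_pMr// ltr1n.
have [t at_ E] := mvt_pos (divr_gt0 r0 (ltr0Sn R 1)) r2 dv.
have t0 : 0 < t by apply: lt_trans at_; rewrite divr_gt0.
rewrite -(subrK (v (r / 2)) (v r)) E ltr_pwDl//; last first.
  by apply: prim_ge0 => y y0; exact: shell_ge0.
rewrite mulr_gt0 ?subr_gt0// (@shellE R n sigma g n_gt0 model_g)// mulr_gt0 ?s_gt0//.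
exact: w_gt0.
Qed.

(** Ensures that the supremum of a bounded [B] exceeds its value at [2 / c], so that the subsolution
    built from it is not zero. *)
Lemma rate_prim_lt : B (2 / c) < B (2 / c + 1).
Proof.
have [t /andP[t0 _] E] := mean_value (2 / c) (2 / c + 1) is_derive_rate_prim.
have d1 : 2 / c + 1 - 2 / c = 1 by rewrite addrAC subrr add0r.
rewrite -subr_gt0 E d1 !mulr1.
have ct : 2 / c <= 2 / c + t by rewrite lerDl.
have ct0 := lt_le_trans (divr_gt0 (ltr0Sn R 1) c0) ct.
by rewrite /m rate1// divr_gt0 ?v_gt0 ?s_gt0.
Qed.

Let smooth1_v : smooth1 pos v.
Proof.
apply: (smooth1_primitive opos dv).
apply: (@gsmooth_eq _ _ _ _ _ (fun r => s r * profile w r)) => //.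
  by move=> r r0; rewrite (@shellE R n sigma g n_gt0 model_g).
apply: gsmoothM => //; first exact: (smooth1_sphere_vol n_gt0 model_g).
exact: smooth1_profile.
Qed.

Let smooth1_B : smooth1 pos B.
Proof.
apply: (smooth1_primitive opos (fun r _ => is_derive_rate_prim r)).
apply: (gsmoothM opos); first exact: smooth1_cut.
apply: (gsmoothM opos); first exact: smooth1_v.
apply: (gsmoothV opos); last exact: (smooth1_sphere_vol n_gt0 model_g).
by move=> r r0; rewrite gt_eqF// s_gt0.
Qed.

(* [lap r] is the Laplacian of [B o enorm] at distance [r] from the origin. *)
Definition lap (r : R) : R :=
  (cut c r * shell w r + v r * (dstep (c * r - 1) * c)) / s r.

Lemma lap1 (r : R) : 2 / c < r -> lap r = profile w r.
Proof.
move=> rc; have r0 : 0 < r by apply: lt_trans rc; rewrite divr_gt0.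
rewrite /lap cut1 ?(ltW rc)// dstep0; last by right; rewrite ltrBrDr mulrC -ltr_pdivrMr.
rewrite mul0r mulr0 addr0 mul1r (@shellE R n sigma g n_gt0 model_g)// mulrAC mulfV ?mul1r//.
by rewrite gt_eqF// s_gt0.
Qed.

(** Beyond [2 / c] the Laplacian equals [w] and before [c^-1] it vanishes; on the compact interval
    between, the quotient has a maximum. With this [C] the function [C + B] satisfies the inequality
    needed for the cutoffs, since it is at least [C]. *)
Lemma lap_le : exists2 C, 1 <= C & forall r, 0 < r -> lap r <= C * profile w r.
Proof.
pose q (r : R) := v r * (dstep (c * r - 1) * c) / (s r * profile w r).
have qE (r : R) : 0 < r -> lap r = (cut c r + q r) * profile w r.
  move=> r0; rewrite /lap /q (@shellE R n sigma g n_gt0 model_g)//.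
  have s0 : s r != 0 by rewrite gt_eqF// s_gt0.
  have p0 : profile w r != 0 by rewrite gt_eqF// w_gt0.
  by field; rewrite s0 p0.
have cc : continuous (fun t : R => dstep (c * t - 1)).
  move=> t; have ca : {for t, continuous (fun r : R => c * r - 1)}.
    apply: derivable_continuous.
    by have [] := is_deriveD (is_deriveZ c (is_derive_id t (1 : R))) (is_derive_cst (- 1 : R) t (1 : R)).
  exact (@continuous_comp R R R (fun r : R => c * r - 1) (@dstep R) t ca (@continuous_dstep R (c * t - 1))).
have [||k _ hk] := @EVT_max R q c^-1 (2 / c).
- by rewrite ler_peMl ?(ltW ci0)// ler1n.
- apply: continuous_in_subspaceT => r; rewrite inE/= in_itv/= => /andP[rc _].
  have r0 := lt_le_trans ci0 rc.
  have s0 : s r * profile w r != 0 by rewrite mulf_neq0 ?gt_eqF ?s_gt0// w_gt0.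
  change (continuous_at r (fun r : R => v r * (dstep (c * r - 1) * c) * (s r * profile w r)^-1)).
  apply: cvgM.
    apply: cvgM; first by apply: derivable_continuous; have [] := dv r0.
    apply: cvgM; last exact: cvg_cst.
    exact: (cc r).
  apply: cvgV => //; apply: cvgM.
    exact (gsmooth_cts (smooth1_sphere_vol n_gt0 model_g) r0).
  exact: continuous_profile.
exists (1 + Num.max 0 (q k)); first by rewrite lerDl le_max lexx.
move=> r r0; rewrite qE// ler_wpM2r ?w_ge0// lerD ?cut_le1// le_max.
have [rc|rc] := ltP r c^-1.
  by rewrite /q dstep0 ?mul0r ?mulr0 ?mul0r ?lexx//; left; rewrite subr_lt0 -ltr_pdivlMl// mulr1.
have [rc2|rc2] := leP r (2 / c); first by rewrite hk ?orbT// in_itv/= rc.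
by rewrite /q dstep0 ?mul0r ?mulr0 ?mul0r ?lexx//; right; rewrite ltrBrDr mulrC -ltr_pdivrMr.
Qed.

Section entropy_of_potential.
Variables al be : R.
Let z (r : R) := al + be * B r.
Let U (r : R) := ent (z r).

Let dz (r : R) : is_derive r 1 z (be * m r).
Proof.
apply: is_derive_eq (is_deriveD (is_derive_cst al r (1 : R)) (is_deriveZ be (is_derive_rate_prim r))) _.
by rewrite /GRing.scale/= add0r.
Qed.

Let W (r : R) := be * (dent (z r) * (cut c r * v r)).
Let dW1 (r : R) := cut c r * shell w r + v r * (dstep (c * r - 1) * c).
Let W' (r : R) := be * (dent (z r) * dW1 r + (cut c r * v r) * (flat 'X^3 (z r) * (be * m r))).

Let sU : smooth1 pos U.
Proof.
apply: (gsmooth_comp opos (@smooth1_ent R setT)); first by move=> ? _.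
apply: (gsmoothD opos); first exact: gsmooth_cst.
by apply: (gsmoothM opos); [exact: gsmooth_cst|exact: smooth1_B].
Qed.

Let dU (r : R) : 0 < r -> is_derive r 1 U (W r / s r).
Proof.
move=> r0; apply: is_derive_eq (is_derive_comp_dir (is_derive_ent (z r)) (dz r)) _.
by rewrite /W /m /rate -/v -!mulrA mulrCA.
Qed.

Let dW (r : R) : 0 < r -> is_derive r 1 W (W' r).
Proof.
move=> r0; have h1 := is_derive_comp_dir (is_derive_dent (z r)) (dz r).
have h2 := is_deriveM (is_derive_cut c r) (dv r0).
exact: is_derive_eq (is_deriveZ be (is_deriveM h1 h2)) _.
Qed.

Let U0 (r : R) : 0 <= r -> r < c^-1 -> U r = U 0.
Proof. by move=> _ rc; rewrite /U /z !rate_prim0 ?(ltW rc) ?(ltW ci0). Qed.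

Let u (x : 'rV[R]_n) := ent (al + be * B (enorm x)).

Lemma smooth_ent_potential : smooth u.
Proof. exact: smooth_radial ci0 sU U0. Qed.

(** The chain rule: first derivative of [ent] times the Laplacian of the potential, plus second
    derivative times its squared gradient, whose radial component is [m]. *)
Lemma laplace_ent_potential x : c^-1 <= enorm x ->
  divergence g (grd g u) x = be * dent (al + be * B (enorm x)) * lap (enorm x) +
    be ^+ 2 * flat 'X^3 (al + be * B (enorm x)) * m (enorm x) ^+ 2.
Proof.
move=> xc; have r0 := lt_le_trans ci0 xc.
have x0 : x != 0 by rewrite -enorm_eq0 gt_eqF.
rewrite (laplace_radial n_gt0 model_g dU dW x0) /W' /lap -/(dW1 _) /m /rate -/v -/(z _).
have s0 : s (enorm x) != 0 by rewrite gt_eqF// s_gt0.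
by field.
Qed.

Lemma laplace_ent_potential0 x : enorm x < c^-1 -> divergence g (grd g u) x = 0.
Proof. by move=> xc; rewrite (laplace_radial0 g U0 xc). Qed.

End entropy_of_potential.

(** If the monotone [B] were bounded it would converge to its supremum and the integral would be a
    finite difference; conversely a finite integral bounds every increment of [B] beyond [2 / c]. *)
Lemma integral_rate_infty :
  (\int[lebesgue_measure]_(r in `[(2 / c)%R, +oo[) (m r)%:E = +oo)%E <->
  forall M, exists r, M < B r.
Proof.
have cm : continuous m by exact: continuous_rate.
have cB (x : R) : {for x, continuous B} by apply: derivable_continuous; have [] := is_derive_rate_prim x.
split=> [h M|h].
  apply: contrapT => /forallNP nB.
  have ub : has_ubound (range B) by exists M => _ [r _ <-]; rewrite leNgt; apply/negP; exact: nB.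
  have := @ge0_continuous_FTC2y R m B (2 / c) (sup (range B)) _ _ (nondecreasing_cvgr rate_prim_nd ub) _ _ _.
  rewrite h => /(_ (fun x _ => rate_ge0 x w_ge0)) E.
  have : (+oo = (sup (range B))%:E - (B (2 / c))%:E)%E; last by [].
  apply: E.
  - exact: continuous_subspaceT.
  - by move=> x _; have [] := is_derive_rate_prim x.
  - exact: cvg_at_right_filter (cB _).
  - by move=> x _; rewrite derive1E; have [_ ->] := is_derive_rate_prim x.
apply/eqP; rewrite eq_le leey /= leNgt; apply/negP => I_lt.
set I := (\int[_]_(_ in _) _)%E in I_lt.
have I_ge0 : (0 <= I)%E by apply: integral_ge0 => r _; rewrite lee_fin rate_ge0.
have I_fin : I \is a fin_num by rewrite ge0_fin_numE.
have [r] := h (fine I + B (2 / c)); rewrite ltNge => /negP; apply.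
have [rc|rc] := leP r (2 / c).
  by apply: (le_trans (rate_prim_nd rc)); rewrite lerDr fine_ge0.
rewrite -lerBlDr -lee_fin fineK// -(integral_FTC rc is_derive_rate_prim cm).
apply: ge0_subset_integral => //.
- by apply/measurable_EFinP; exact: measurable_cont.
- by move=> t _; rewrite lee_fin rate_ge0.
- by move=> t /=; rewrite !in_itv/= => /andP[-> _].
Qed.

End potential.
End radial_rate.

(** * Conservativeness *)

(** By convexity the tangent at [z] lies below the graph at 1. For positive [z] and [y = 1/z] the
    left-hand side collapses to [y exp(-y)], which is at most [exp(-1)]. *)
Lemma ent_tangent (R : realType) (z : R) : z <= 1 -> ent z + dent z * (1 - z) <= ent 1.
Proof.
move=> z1; have [z0|z0] := leP z 0.
  by rewrite (entropy_neg (entropy_ent R) z0) /dent flat_neg// mul0r addr0 ent_ge0.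
have e1 (x : R) : (1 : {poly R}).[x] = 1 by rewrite -polyC1 hornerC.
rewrite /ent /dent !flat_pos// hornerD hornerX !e1 invr1 !mul1r.
set y := z^-1; have zy : z * y = 1 by rewrite /y mulfV// gt_eqF.
have -> : z * expR (- y) + (1 + y) * expR (- y) * (1 - z) = (1 + y - z * y) * expR (- y) by ring.
rewrite zy addrAC subrr add0r -ler_pdivlMr ?expR_gt0// -expRN opprK -expRD addrC.
by apply: le_trans (expR_ge1Dx _); rewrite addrCA subrr addr0.
Qed.

(** Turns a bound on the Laplacian of a cutoff with value [e] into one on the generator;
    [e + d <= kap], supplied by [ent_tangent], bounds the total factor of [V]. *)
Lemma cutoff_arith (F : realFieldType) (rho V e d kap L : F) : 0 < rho -> 0 <= V ->
  e + d <= kap -> - (d * (rho + V)) <= L -> - (kap * (V / rho)) - d <= (L - V * e) / rho.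
Proof.
move=> r0 V0 ek dL; rewrite ler_pdivlMr//.
have -> : (- (kap * (V / rho)) - d) * rho = - (kap * V) - d * rho by field; rewrite gt_eqF.
have := ler_wpM2r V0 ek; lra.
Qed.

(** * The subsolution and the cutoffs *)

Section conclusion.
Context (R : realType) (n : nat) (sigma : R -> R) (g : 'rV[R]_n -> 'M[R]_n)
  (rho V : 'rV[R]_n -> R) (T : R -> ('rV[R]_n -> R) -> 'rV[R]_n -> R).
Hypotheses (n_gt0 : (0 < n)%N) (model_g : model_manifold sigma g)
  (rho_smooth : smooth rho) (rho_gt0 : forall x, 0 < rho x)
  (rho_radial : radially_symmetric g rho)
  (V_smooth : smooth V) (V_ge0 : forall x, 0 <= V x)
  (V_radial : radially_symmetric g V)
  (T_semigroup : form_semigroup g rho V T).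
Let mg : riemannian_metric g := model_metric model_g.
Let dp := det_pos n_gt0 model_g.
Local Notation mu := (volm mg dp).
Local Notation isL2 := (isL2 mu rho).
Let W := rho \+ V.
Let crho := smooth_continuous rho_smooth.
Let rho_ge0 x : 0 <= rho x. Proof. exact: ltW. Qed.
Let cV := smooth_continuous V_smooth.
Let sW : smooth W. Proof. exact: smoothD. Qed.
Let W_gt0 x : 0 < W x. Proof. by rewrite ltr_pwDl. Qed.
Let rW : radially_symmetric g W.
Proof. by move=> x y xy; rewrite /W/= (rho_radial xy) (V_radial xy). Qed.

(** Truncations to balls show that approximating sequences exist, so the choices made by [xget] in
    [Lplus_ext] are genuine. *)
Let cut_off k (r : R) (x : 'rV[R]_n) : R := \1_[set x : 'rV[R]_n | enorm x < r] x * k x.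

Let cut_off_bounded (k : 'rV[R]_n -> R) (r : R) : continuous k -> [/\ measurable_fun setT (cut_off k r),
  bounded_support (cut_off k r) & exists C, forall x, `|cut_off k r x| <= C].
Proof.
move=> ck; split.
- apply: measurable_funM; last exact: continuous_measurable_rV.
  by apply: measurable_indic; exact: measurable_eball.
- exists (Num.max r 1) => [|x]; first by rewrite lt_max ltr01 orbT.
  rewrite ge_max => /andP[rx _]; rewrite /cut_off indicE memNset ?mul0r//= => xr.
  by have := le_lt_trans (le_trans rx (norm_le_enorm x)) xr; rewrite ltxx.
- have [C C0 kC] := continuous_bounded r ck; exists C => x.
  rewrite /cut_off indicE; have [|_] := boolP (x \in _); last by rewrite mul0r normr0 ltW.
  by rewrite inE/= mul1r => xr; apply/kC/ltW/(le_lt_trans (norm_le_enorm x)).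
Qed.

Let cut_off_approx (k : 'rV[R]_n -> R) : continuous k -> (forall x, 0 <= k x) ->
  Lp_approx mu rho (fun x => (k x)%:E) (fun j => cut_off k j%:R).
Proof.
move=> ck k0; split=> [j|].
  have [h1 h2 h3] := cut_off_bounded j%:R ck.
  exact: (bounded_support_L2 (vol_fin mg dp) crho rho_ge0).
apply: aeW => x; split=> [j|j|].
- by rewrite mulr_ge0// indicE.
- rewrite ler_wpM2r// !indicE ler_nat.
  case: (boolP (x \in [set x : 'rV[R]_n | enorm x < j%:R])) => //; rewrite inE/= => xj.
  by rewrite mem_set//=; apply: (lt_trans xj); rewrite ltr_nat.
- apply: cvg_near_cst; near=> j; rewrite /cut_off indicE mem_set ?mul1r//=.
  by near: j; exact: nbhs_infty_gtr.
Unshelve. all: by end_near. Qed.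

(** [F] and [H] are literally the sequences chosen inside [Lplus_ext] for 1 and for [V / rho], which
    makes [conservative] match the abstract statement. *)
Let F := xget (fun _ : nat => cst 0 : 'rV[R]_n -> R) [set F | Lplus_approx g rho (cst 1%E) F].
Let H := xget (fun _ : nat => cst 0 : 'rV[R]_n -> R)
  [set F | Lplus_approx g rho (fun y => (V y / rho y)%:E) F].

Let FP : Lp_approx mu rho (fun=> 1%E) F.
Proof.
apply: (@xgetPex _ _ [set F | Lplus_approx g rho (cst 1%E) F]).
exists (fun j => cut_off (fun=> 1) j%:R).
by apply: (cut_off_approx (k := fun=> 1)); [exact: cst_continuous|move=> x; exact: ler01].
Qed.

Let cVr : continuous (fun x => V x / rho x).
Proof.
have rho_neq0 x : rho x != 0 by rewrite gt_eqF.
exact (smooth_continuous (smoothM V_smooth (smoothV rho_neq0 rho_smooth))).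
Qed.

Let HP : Lp_approx mu rho (fun x => (V x / rho x)%:E) H.
Proof.
apply: (@xgetPex _ _ [set F | Lplus_approx g rho (fun y => (V y / rho y)%:E) F]).
exists (fun j => cut_off (fun x => V x / rho x) j%:R).
by apply: (cut_off_approx cVr) => x; rewrite divr_ge0.
Qed.

Let op := form_operator g rho V.
Let mrho : measurable_fun setT rho := continuous_measurable_rV crho.

Let op_L2 f u : op f u -> isL2 f /\ isL2 u.
Proof.
move=> [fW u2 _]; split=> //.
have [f2 _] := @W10_L2 R n g mg dp rho V f fW.
exact (@L2W_rho R n g mg dp rho V rho_smooth rho_gt0 V_smooth V_ge0 f f2).
Qed.

Let op_sym f u h k : op f u -> op h k -> dt mu rho u h = dt mu rho f k.
Proof. exact (@op_symmetric R n g mg dp rho V f u h k). Qed.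

Let op_diss f u : op f u -> dt mu rho u f <= 0.
Proof. exact (@op_dissipative R n g mg dp rho V V_ge0 f u). Qed.

Let op_dns f (e : R) : isL2 f -> 0 < e ->
  exists phi u, op phi u /\ nm mu rho (fun x => f x - phi x) <= e.
Proof. exact (@op_dense R n g mg dp rho V rho_smooth rho_gt0 V_smooth V_ge0 f e). Qed.

Let T_L2 (t : R) f : 0 <= t -> isL2 f -> isL2 (T t f).
Proof. exact (@sg_L2 _ _ _ _ _ _ T_semigroup t f). Qed.

Let T_lin (t a : R) f h : 0 <= t -> isL2 f -> isL2 h ->
  \forall x \ae mu, T t (fun y => a * f y + h y) x = a * T t f x + T t h x.
Proof. exact (@sg_linear _ _ _ _ _ _ T_semigroup t a f h). Qed.

Let T_bd (t : R) : 0 <= t -> exists C : R, forall f, isL2 f ->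
  (sqn mu rho (T t f) <= C%:E * sqn mu rho f)%E.
Proof. exact (@sg_bounded _ _ _ _ _ _ T_semigroup t). Qed.

Let T_0 f : isL2 f -> \forall x \ae mu, T 0 f x = f x.
Proof. exact (@sg_0 _ _ _ _ _ _ T_semigroup f). Qed.

Let T_add (s t : R) f : 0 <= s -> 0 <= t -> isL2 f ->
  \forall x \ae mu, T (s + t) f x = T s (T t f) x.
Proof. exact (@sg_add _ _ _ _ _ _ T_semigroup s t f). Qed.

Let T_cts f : isL2 f -> sqn mu rho (T t f \- f) @[t --> 0^'+] --> 0%E.
Proof. exact (@sg_continuous _ _ _ _ _ _ T_semigroup f). Qed.

Let T_gen f u : isL2 f -> isL2 u -> op f u <->
  sqn mu rho (fun x => t^-1 * (T t f x - f x) - u x) @[t --> 0^'+] --> 0%E.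
Proof. exact (@sg_generator _ _ _ _ _ _ T_semigroup f u). Qed.

Let AP (t : R) h : 0 < t -> isL2 h -> is_time_integral mu rho T t h (time_integral g rho T t h).
Proof.
move=> t0 h2.
have E := @time_integral_ex _ _ _ mu rho mrho rho_gt0 T op T_L2 T_lin T_bd T_0 T_add T_cts T_gen
  op_L2 op_sym op_diss op_dns t h (ltW t0) h2.
exact (@xgetPex _ (cst 0) [set u | is_time_integral mu rho T t h u] E).
Qed.

(** The class [U] of the abstract part: subsolutions of the Laplacian minus [rho + V] with values in
    [[0, 1]]. Zero is among them and gives the plain bound on mass. *)
Let super u := [/\ smooth u, forall x, 0 <= u x <= 1 &
  forall x, (rho x + V x) * u x <= divergence g (grd g u) x].

Let super0 : super (fun=> 0).
Proof.
split=> [|x|x]; [exact: smooth_cst|by rewrite lexx ler01|].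
rewrite mulr0 /divergence big1 ?mulr0// => i _.
have -> : (fun y => vol_density g y * grd g (fun=> 0 : R) y 0 i) = fun=> 0.
  apply/funext => y; rewrite grdE big1 ?mulr0// => j _.
  by rewrite /partial derive_cst mul0r.
by rewrite /partial derive_cst.
Qed.

Let superP u : super u -> measurable_fun setT u /\ forall x, 0 <= u x <= 1.
Proof. by case=> su u01 _; split=> //; exact: continuous_measurable_rV (smooth_continuous su). Qed.

Let core u G f l : super u -> isL2 G ->
  (\forall x \ae mu, 0 <= G x * rho x <= u x * rho x + V x) -> op f l ->
  dt mu rho l (fun x => (1 - u x) * dent (f x)) <= - dt mu rho G (fun x => ent (f x)).
Proof.
move=> [su u01 du] G2 GV fl.
exact (core_inequality rho_smooth rho_gt0 V_smooth V_ge0 fl su u01 du G2 GV).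
Qed.

Let B (j : nat) : set 'rV[R]_n := [set x | enorm x < j%:R].

Let mB j : measurable (B j). Proof. exact: measurable_eball. Qed.

Let B_nd j : B j `<=` B j.+1.
Proof. by move=> x /lt_trans; apply; rewrite ltr_nat. Qed.

Let covB x : exists j, B j x.
Proof.
exists (Num.truncn (enorm x)).+1; rewrite /B/=; exact: truncnS_gt.
Qed.

Let indic_L2 (r : R) : isL2 (\1_[set x : 'rV[R]_n | enorm x < r]).
Proof.
apply: (bounded_indic_L2 (K := r) (vol_fin mg dp) crho rho_ge0); first exact: measurable_eball.
by move=> x /ltW; exact: le_trans (norm_le_enorm x).
Qed.

Variable c : R.
Hypothesis c0 : 0 < c.
Let ci0 : 0 < c^-1. Proof. by rewrite invr_gt0. Qed.
Let b := rate_prim sigma g n_gt0 c W.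
Let b0 := @rate_prim0 R n sigma g n_gt0 c c0 W.
Let b_ge0 := rate_prim_ge0 n_gt0 model_g c0 sW W_gt0.
Let b_nd := rate_prim_nd n_gt0 model_g c0 sW W_gt0.

Let profileW x : profile n_gt0 W (enorm x) = W x.
Proof. by rewrite -(@radial_profile R n sigma g n_gt0 model_g). Qed.

Lemma not_conservative : ~ (forall M, exists r, M < b r) -> ~ conservative g rho V T.
Proof.
move=> nb; have [M bM] : exists M, forall r, b r <= M.
  apply: contrapT => /forallNP h; apply: nb => M; have /existsNP[r /negP] := h M.
  by rewrite -ltNge; exists r.
have ub : has_ubound (range b) by exists M => _ [r _ <-].
have sup_b : has_sup (range b) by split=> //; exists (b 0), 0.
pose S := sup (range b).
have bS r : b r <= S by apply: ub_le_sup => //; exists r.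
(* The first entry makes [z] nonpositive up to [2 / c], where the Laplacian of the potential is not
   under control; the second makes [z] at most 1. *)
pose al := Num.max (b (2 / c)) (S - 1).
have al_lt : al < S.
  rewrite gt_max ltrBlDr ltrDl ltr01 andbT.
  exact: lt_le_trans (rate_prim_lt n_gt0 model_g c0 sW W_gt0) (bS _).
have [_ [r1 _ <-] alr1] := sup_gt sup_b.1 al_lt.
pose z (r : R) := - al + 1 * b r.
have z_le1 r : z r <= 1.
  by rewrite /z mul1r addrC lerBlDl; apply: (le_trans (bS r)); rewrite -lerBlDr le_max lexx orbT.
have z_le0 (r : R) : r <= 2 / c -> z r <= 0.
  by move=> rc; rewrite /z mul1r addrC subr_le0; apply: (le_trans (b_nd rc)); rewrite le_max lexx.
pose u (x : 'rV[R]_n) : R := ent (z (enorm x)).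
have Uu : super u.
  split=> [|x|x]; first exact: (smooth_ent_potential n_gt0 model_g c0 sW).
    rewrite ent_ge0/=; have /andP[h _] := ent_le_pos (z (enorm x)); apply: le_trans h _.
    by rewrite ge_max z_le1 ler01.
  rewrite -[rho x + V x]/(W x); have [xc|xc] := ltP (enorm x) c^-1.
    rewrite (@laplace_ent_potential0 R n sigma g n_gt0 c c0 W)// /u (entropy_neg (entropy_ent R)) ?mulr0//.
    by apply: z_le0; apply: ltW; apply: (lt_le_trans xc); rewrite ler_peMl ?(ltW ci0)// ler1n.
  rewrite (laplace_ent_potential n_gt0 model_g c0 sW)// -/b -/(z (enorm x)).
  have [xc2|xc2] := leP (enorm x) (2 / c).
    rewrite /u (entropy_neg (entropy_ent R)) ?z_le0// mulr0 /dent !flat_neg ?z_le0//.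
    by rewrite !mulr0 !mul0r addr0.
  rewrite (lap1 n_gt0 model_g c0)// profileW mul1r expr1n mul1r.
  (* Here [ent z <= z * dent z <= dent z], because [z <= 1]. *)
  apply: (@le_trans _ _ (dent (z (enorm x)) * W x)); last first.
    by rewrite lerDl mulr_ge0 ?flat_X3_ge0 ?sqr_ge0.
  rewrite mulrC ler_wpM2r ?(ltW (W_gt0 x))//.
  apply: le_trans (dent_mul_ge _) _; rewrite -[leRHS]mul1r.
  by rewrite ler_wpM2r ?dent_ge0.
have r1c : 2 / c < r1.
  rewrite ltNge; apply/negP => h; have := lt_le_trans alr1 (b_nd h).
  by rewrite ltNge le_max lexx.
have r10 : 0 < r1 by apply: lt_trans r1c; rewrite divr_gt0.
pose k (x : 'rV[R]_n) : R := u x * rho x.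
have [su u01 _] := Uu.
have ck : continuous k by apply: smooth_continuous; exact: smoothM.
have k0 x : 0 <= k x by have /andP[? _] := u01 x; rewrite mulr_ge0.
have rk : radially_symmetric g k.
  move=> x y xy; have exy : enorm x = enorm y by move: xy; rewrite !(dist_x0 model_g) => -[].
  by rewrite /k (rho_radial xy) /u exy.
have pk : 0 < prim (shell g n_gt0 k) (r1 + 1).
  have r11 : r1 < r1 + 1 by rewrite ltrDl.
  have [t rt E] := mvt_pos r10 r11 (fun r r0 => is_derive_prim (@continuous_shell R n sigma g n_gt0 model_g _ ck) r0).
  rewrite -(subrK (prim (shell g n_gt0 k) r1) (prim _ _)) E.
  have t0 := lt_trans r10 rt.
  rewrite ltr_pwDl//; last by apply: prim_ge0 => y y0; exact: (shell_ge0 n_gt0 model_g).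
  rewrite addrAC subrr add0r mulr1 (@shellE R n sigma g n_gt0 model_g)// mulr_gt0 ?(sphere_vol_gt0 n_gt0 model_g)//.
  rewrite /profile /k /u (enorm_scale_base n_gt0 (ltW t0)) mulr_gt0//.
  by apply: ent_pos; rewrite /z mul1r addrC subr_gt0; apply: (lt_le_trans alr1); exact/b_nd/ltW.
(* The ball reaches beyond [r1], where [b] exceeds [al] and [u] is positive, so the pairing of [u]
   with [f] is positive. *)
pose f : 'rV[R]_n -> R := \1_[set x : 'rV[R]_n | enorm x < r1 + 1].
move=> cons; have nc := @not_conserved _ _ _ mu rho mrho rho_gt0 T op T_L2 T_lin T_bd T_0 T_add T_cts T_gen
  op_L2 op_sym op_diss op_dns _ _ V super (entropy_ent R) V_ge0 super0 superP core F H
  (time_integral g rho T) B FP HP AP B_nd covB (fun j => indic_L2 j%:R) u f Uu (indic_L2 (r1 + 1)).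
refine (nc _ _ _ cons).
- by move=> x; rewrite /f indicE.
- by have [h1 h2 h3] := cut_off_bounded (r1 + 1) crho; exact: (bounded_support_igr (vol_fin mg dp)).
rewrite -lte_fin -(@ball_integralE R n sigma g n_gt0 model_g)// in pk.
suff -> : \int[mu]_x (u x * f x * rho x) = fine (ball_integral g k (r1 + 1)).
  by rewrite -lte_fin fineK// (@ball_integralE R n sigma g n_gt0 model_g).
rewrite /Rintegral /ball_integral (geo_ballE model_g); congr fine.
transitivity (\int[mu]_x (\1_[set x : 'rV[R]_n | enorm x < r1 + 1] x * k x)%:E)%E.
  by apply: eq_integral => x _; congr EFin; rewrite /k /f; ring.
by rewrite integral_indicM setTI.
Qed.

Lemma conservative_of_divergence : (forall M, exists r, M < b r) -> conservative g rho V T.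
Proof.
move=> ub; have [C C1 lapC] := lap_le n_gt0 model_g c0 sW W_gt0.
have C0 : 0 < C := lt_le_trans ltr01 C1.
pose k (j : nat) : R := j.+1%:R.
have k0 j : 0 < k j by [].
(* That is, [1 - (C + b) / k j], which tends to 1 at every point. *)
pose z (j : nat) (x : 'rV[R]_n) : R := 1 - C / k j + - (k j)^-1 * b (enorm x).
have zE j x : 1 - z j x = (C + b (enorm x)) / k j.
  by rewrite /z; field; rewrite gt_eqF.
have z_lt1 j x : z j x < 1 by rewrite -subr_gt0 zE divr_gt0// ltr_pwDl.
have C_le j x : C / k j <= 1 - z j x.
  by rewrite zE ler_pM2r ?invr_gt0// lerDl.
(* This is where the divergence of (ii) enters: [b] exceeds [k j] outside a ball, so the cutoffs
   have compact support. *)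
have z_out j : exists2 M, 0 < M & forall x, M <= `|x| -> z j x <= 0.
  have [r br] := ub (k j); exists (Num.max r 1) => [|x]; first by rewrite lt_max ltr01 orbT.
  rewrite ge_max => /andP[rx _]; rewrite -[leLHS](subKr 1) subr_le0 zE ler_pdivlMr// mul1r.
  apply: (le_trans (ltW br)); apply: (le_trans (b_nd (le_trans rx (norm_le_enorm x)))).
  by rewrite lerDr ltW.
have cz j : continuous (z j).
  pose phi (r : R) : R := 1 - C / k j + - (k j)^-1 * b r.
  have cphi (r : R) : {for r, continuous phi}.
    apply: derivable_continuous.
    by have [] := is_deriveD (is_derive_cst (1 - C / k j) r (1 : R))
      (is_deriveZ (- (k j)^-1) (is_derive_rate_prim n_gt0 model_g c0 sW r)).
  move=> x; exact (@continuous_comp _ _ _ (@enorm R n) phi x (@continuous_enorm R n x) (cphi _)).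
pose zeta (j : nat) (x : 'rV[R]_n) : R := ent (z j x).
have tz j : test_function (zeta j).
  apply/test_function_bs; split; first exact: (smooth_ent_potential n_gt0 model_g c0 sW).
  have [M M0 hM] := z_out j; exists M => // x Mx.
  by rewrite /zeta (entropy_neg (entropy_ent R))// hM.
pose A (j : nat) : set 'rV[R]_n := [set x | 0 < z j x].
have mA j : measurable (A j).
  apply: open_measurable_rV; rewrite (_ : A j = z j @^-1` [set r | 0 < r])//.
  by apply: open_comp => [x _|]; [exact: cz|exact: open_gt].
(* [V / rho] itself need not be in L2; it is kept only where the cutoff is positive, a bounded
   set. *)
pose q (j : nat) (x : 'rV[R]_n) : R := \1_(A j) x * (V x / rho x).
pose h (j : nat) (x : 'rV[R]_n) : R := dent (z j x) * (1 - z j x).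
have h_ge0 j x : 0 <= h j x by rewrite mulr_ge0 ?dent_ge0// subr_ge0 ltW.
have h_le1 j x : h j x <= 1.
  have [zn|zp] := leP (z j x) 0; first by rewrite /h /dent flat_neg// mul0r ler01.
  rewrite -[1]mulr1 ler_pM ?dent_ge0 ?dent_le1// ?subr_ge0 ?(ltW (z_lt1 _ _))//.
  by rewrite gerBl ltW.
have tangent j x : ent (z j x) + h j x <= ent 1 := ent_tangent (ltW (z_lt1 j x)).
have z_cvg x : z j x @[j --> \oo] --> (1 : R).
  have -> : (fun j => z j x) = (fun j => 1 - (C + b (enorm x)) * harmonic j).
    by apply/funext => j; rewrite -[LHS](subKr 1) zE.
  rewrite -[X in _ --> X]subr0 -[X in _ - X](mulr0 (C + b (enorm x))).
  apply: cvgB; first exact: cvg_cst.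
  by apply: cvgM; [exact: cvg_cst|exact: cvg_harmonic].
have c_ent : continuous (@ent R).
  by move=> t; apply: derivable_continuous; have [] := is_derive_ent t.
have c_dent : continuous (@dent R).
  by move=> t; apply: derivable_continuous; have [] := is_derive_dent t.
have cc := @conserved_of_cutoffs _ _ _ mu rho mrho rho_gt0 T op T_L2 T_lin T_bd T_0 T_add T_cts T_gen
  op_L2 op_sym op_diss op_dns _ _ V super (entropy_ent R) V_ge0 super0 superP core F H
  (time_integral g rho T) B FP HP AP mB covB (fun j => indic_L2 j%:R) (ent 1) 1 zeta
  (fun j => test_op g rho V (zeta j)) q h.
move=> t t0; refine (cc _ _ _ _ _ _ _ _ _ _ _ t t0).
- exact: ent_pos.
- exact: ler01.
- by move=> j; exact: (op_test mg dp rho_smooth rho_gt0 V_smooth V_ge0).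
- move=> j x; rewrite ent_ge0/=; apply: le_trans (tangent j x); by rewrite lerDl.
- by move=> x; apply: (cvg_comp _ _ (z_cvg x)); exact: c_ent.
- move=> j; have [M M0 hM] := z_out j.
  apply: (bounded_support_L2 (vol_fin mg dp) crho rho_ge0).
  + apply: measurable_funM; last exact: continuous_measurable_rV.
    by apply: measurable_indic; exact: mA.
  + by exists M => // x Mx; rewrite /q indicE memNset ?mul0r//= /A/= ltNge hM.
  + have [K K0 hK] := continuous_bounded M cVr; exists K => x; rewrite /q indicE.
    have [|_] := boolP (x \in A j); last by rewrite mul0r normr0 ltW.
    rewrite inE/= /A/= mul1r => zp; apply: hK; rewrite leNgt; apply/negP => /ltW/hM.
    by rewrite leNgt zp.
- move=> j x; rewrite /q indicE; have vr : 0 <= V x / rho x by rewrite divr_ge0.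
  by case: (x \in A j); rewrite ?mul1r ?mul0r ?lexx ?vr.
- move=> j; have [M M0 hM] := z_out j.
  apply: (bounded_support_L2 (vol_fin mg dp) crho rho_ge0).
  + have cpsi : continuous (fun r : R => dent r * (1 - r)).
      move=> r; apply: cvgM; first exact: c_dent.
      by apply: cvgB; [exact: cvg_cst|exact: cvg_id].
    apply: continuous_measurable_rV => x.
    exact (@continuous_comp _ _ _ (z j) (fun r : R => dent r * (1 - r)) x (cz j x) (cpsi _)).
  + by exists M => // x Mx; rewrite /h /dent flat_neg ?mul0r// hM.
  + by exists 1 => x; rewrite ger0_norm.
- by move=> j x; rewrite h_ge0 h_le1.
- move=> x; rewrite -[X in _ --> X](mulr0 (dent (1 : R))) -[X in _ * X](subrr (1 : R)).
  apply: cvgM; first by apply: (cvg_comp _ _ (z_cvg x)); exact: c_dent.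
  by apply: cvgB; [exact: cvg_cst|exact: z_cvg].
(* The second-derivative term is nonnegative. The other one is [- dent z] times the Laplacian of the
   potential over [k j], and that quotient is at most [C * W / k j <= (1 - z) * W]. *)
move=> j x; have lap_ge : - (h j x * (rho x + V x)) <= divergence g (grd g (zeta j)) x.
  have hW : 0 <= h j x * (rho x + V x) by rewrite mulr_ge0// ltW// W_gt0.
  have [xc|xc] := ltP (enorm x) c^-1.
    by rewrite (@laplace_ent_potential0 R n sigma g n_gt0 c c0 W)// oppr_le0.
  rewrite (laplace_ent_potential n_gt0 model_g c0 sW)// -/b -/(z j x).
  rewrite -[leLHS]addr0; apply: lerD; last first.
    by apply: mulr_ge0; [apply: mulr_ge0; [exact: sqr_ge0|exact: flat_X3_ge0]|exact: sqr_ge0].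
  have lx := lapC _ (lt_le_trans ci0 xc); rewrite profileW in lx.
  move: (lap sigma g n_gt0 c W (enorm x)) lx => D Dle.
  have key : D / k j <= (1 - z j x) * W x.
    apply: (@le_trans _ _ (C * W x / k j)); first by rewrite ler_pM2r ?invr_gt0.
    by rewrite mulrAC ler_wpM2r ?(ltW (W_gt0 x)).
  rewrite !mulNr lerN2 (_ : (k j)^-1 * _ * D = dent (z j x) * (D / k j)); last by ring.
  by rewrite /h -mulrA ler_wpM2l ?dent_ge0.
(* Where [z] is nonpositive the cutoff and [h] vanish, so the left-hand side is nonpositive and the
   right-hand side nonnegative. *)
have [zn|zp] := leP (z j x) 0; last first.
  rewrite /q indicE mem_set// mul1r.
  exact (@cutoff_arith R (rho x) (V x) (zeta j x) (h j x) (ent 1) _ (rho_gt0 x) (V_ge0 x)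
    (tangent j x) lap_ge).
apply: (@le_trans _ _ 0).
  rewrite -opprD oppr_le0 addr_ge0// mulr_ge0 ?ent_ge0// mulr_ge0 ?divr_ge0// indicE//.
rewrite /test_op; apply: divr_ge0; last exact: rho_ge0.
rewrite [zeta j x](entropy_neg (entropy_ent R) zn) mulr0 subr0.
by apply: le_trans lap_ge; rewrite /h /dent flat_neg// !mul0r oppr0.
Qed.

End conclusion.

Theorem theorem6p2 (R : realType) (n : nat) (sigma : R -> R)
    (g : 'rV[R]_n -> 'M[R]_n) (rho V : 'rV[R]_n -> R)
    (T : R -> ('rV[R]_n -> R) -> 'rV[R]_n -> R)
    (n_gt0 : (0 < n)%N)
    (model_g : model_manifold sigma g)
    (rho_smooth : smooth rho) (rho_gt0 : forall x, 0 < rho x)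
    (rho_radial : radially_symmetric g rho)
    (V_smooth : smooth V) (V_ge0 : forall x, 0 <= V x)
    (V_radial : radially_symmetric g V)
    (T_semigroup : form_semigroup g rho V T) :
  let s := sphere_vol n sigma in
  let I (a : R) (F : R -> \bar R) : \bar R :=
    (\int[lebesgue_measure]_(r in `[a, +oo[) (F r * ((s r)^-1)%:E))%E in
  conservative g rho V T <->
  exists a : R, [/\ 0 < a,
    I a (ball_integral g (rho \+ V)) =
      (I a (ball_integral g rho) +
       I a (fun r => \int[lebesgue_measure]_(xi in `]0%R, r[)
                       (s xi * radial_value g V xi)%:E))%E &
    I a (ball_integral g (rho \+ V)) = +oo%E].
Proof.
move=> s I.
have crho := smooth_continuous rho_smooth; have cV := smooth_continuous V_smooth.
have rho_ge0 x : 0 <= rho x := ltW (rho_gt0 x).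
have sW : smooth (rho \+ V) by exact: smoothD.
have W0 x : 0 < (rho \+ V) x by rewrite ltr_pwDl.
have W0' x : 0 <= (rho \+ V) x := ltW (W0 x).
have rW : radially_symmetric g (rho \+ V).
  by move=> x y xy /=; rewrite (rho_radial _ _ xy) (V_radial _ _ xy).
have IW (c : R) : 0 < c -> I (2 / c) (ball_integral g (rho \+ V)) =
    (\int[lebesgue_measure]_(r in `[(2 / c)%R, +oo[) (rate sigma g n_gt0 c (rho \+ V) r)%:E)%E.
  by move=> c0; exact: (integral_rate n_gt0 model_g c0 (smooth_continuous sW) W0' rW).
split=> [cons|[a [a0 _ E]]].
  (* With this cutoff parameter the exhibited lower limit [a] is [2 / 2]. *)
  have c0 : 0 < 2 :> R by [].
  exists (2 / 2); split; first by rewrite divr_gt0.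
    rewrite IW// (integral_rateD n_gt0 model_g c0 crho cV rho_ge0 V_ge0).
    rewrite /I (integral_rate n_gt0 model_g c0 crho rho_ge0 rho_radial).
    by rewrite (integral_rate_radial n_gt0 model_g c0 cV V_radial).
  rewrite IW//; apply/(integral_rate_infty n_gt0 model_g c0 sW W0); apply: contrapT => nb.
  exact: (not_conservative model_g rho_smooth rho_gt0 rho_radial V_smooth V_ge0 V_radial
    T_semigroup c0 nb cons).
have c0 : 0 < 2 / a by rewrite divr_gt0.
(* The cutoff parameter is chosen so that the potential is fully switched on exactly from the given
   [a]. *)
have aE : a = 2 / (2 / a) by rewrite invf_div mulrCA mulfV ?mulr1.
rewrite aE IW// in E.
exact: (conservative_of_divergence model_g rho_smooth rho_gt0 rho_radial V_smooth V_ge0 V_radial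
  T_semigroup c0 ((integral_rate_infty n_gt0 model_g c0 sW W0).1 E)).
Qed.
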